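(* Let $k \geq 2$ be an integer, and let $s$ be an integer satisfying \[ s \geq \begin{cases} 2^k + 1, & 2 \leq k \leq 4,\\ k^2-k+2\lfloor \sqrt{2k+2}\rfloor-\theta(k) + 1, & k \geq 5. \end{cases} \] Then there exists $\delta=\delta(k,s)>0$ such that \[ \mathrm{Root}(P_1,\ldots,P_s;N) \ll N^{-1}\prod_{j=1}^s P_j+\bigg(\prod_{j=1}^s P_j\bigg)^{1-k/s-\delta} \] uniformly in the positive integer $N$ and in the positive integers $P_1,\ldots,P_s$, where the implicit constant depends only on $k$ and $s$.
   Context: For positive integers $P_1,\ldots,P_s$ and $N$, $\mathrm{Root}(P_1,\ldots,P_s;N)$ denotes the number of integer solutions $(x_1,\ldots,x_s)$ of $x_1^k+\cdots+x_s^k=N$ with $1\leq x_j\leq P_j$ for all $j$. Here \[ \theta(k) := \begin{cases} 1, & 2k+2 \leq \lfloor \sqrt{2k+2}\rfloor^2+\lfloor \sqrt{2k+2}\rfloor,\\ 2, & 2k+2 > \lfloor \sqrt{2k+2}\rfloor^2+\lfloor \sqrt{2k+2}\rfloor. \end{cases} \] *)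

(* Defs.v *)
From Stdlib Require Import Reals Arith List.
Open Scope R_scope.

Fixpoint root_count (k : nat) (Ps : list nat) (N : nat) : nat :=
  match Ps with
  | nil => if Nat.eqb N 0 then 1%nat else 0%nat
  | P :: Ps' =>
      fold_right Nat.add 0%nat
        (map (fun x => if Nat.leb (x ^ k) N
                       then root_count k Ps' (N - x ^ k)%nat else 0%nat)
             (seq 1 P))
  end.

Definition theta (k : nat) : nat :=
  let r := Nat.sqrt (2 * k + 2) in
  if Nat.leb (2 * k + 2) (r * r + r) then 1%nat else 2%nat.

Definition s_bound (k : nat) : nat :=
  if Nat.leb k 4 then (2 ^ k + 1)%nat
  else (k * k - k + 2 * Nat.sqrt (2 * k + 2) - theta k + 1)%nat.

Definition prodP (Ps : list nat) : nat := fold_right Nat.mul 1%nat Ps.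

(* Main.v *)
From mathcomp Require all_boot all_order all_algebra complex reals normed_module exp trigo boolp.
From mathcomp Require Rstruct Rstruct_topology ring lra zify.
From Stdlib Require PeanoNat.
Require Import Defs.
From Stdlib Require Import Reals Arith List.
Open Scope R_scope.

(* Let p be a prime large compared with k and s, and let p^M be slightly larger than (2 p X)^k,
   where X = max P_j. By orthogonality the number of solutions is the mean over c modulo p^M of a
   product of Weyl sums f_j(c / p^M) twisted by a character.

   Everything starts from l^2 decoupling for the moment curve over Z / p^M: splitting a residue
   class into subclasses, translation-dilation invariance and a bilinear reduction to two distinct
   classes modulo p give a self-improving inequality, whose limit is Vinogradov's mean value theorem
   at the critical exponent k(k+1). The same argument for the exponents 0, ..., r-1, k gives
   a Hua-type bound for the Weyl sum at the exponent r(r+1), and averaging over shifts of the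
   variable turns Vinogradov's theorem into Wooley's saving P^tau on the minor arcs at the exponent
   k(k+1). Interpolating between the two with k + 1 - r close to sqrt(2k+2) saves a power of P on
   the minor arcs at the exponent s.

   Hoelder's inequality yields the second term of the bound from the minor arcs. If some P_j is
   smaller than X^(1/2), few major arcs are needed and the trivial bound suffices on them. Otherwise
   each f_j is replaced on them by its main term; the minor arc saving, applied near rational points,
   also bounds the singular series, and the remaining integral around 0 is dominated by a Fejer
   kernel, which counts the solutions of an inequality |x_1^k + ... + x_s^k - N| < H and is
   O(H N^-1 P_1 ... P_s). *)

(** The prime p is fixed and only M grows with X, so a loss p^(eps M) is a small power of X, which
    every fixed saving absorbs; the constants must therefore be uniform in M. Working in Z / p^M
    turns integrals over the circle into finite means and intervals into residue classes.

    The exponents 0, ..., r-1, k are not translation invariant, so decoupling gives the Hua-type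
    bound only for variables prime to p, and multiples of p need a recursion of their own. The
    interpolation saves a power only off the widest major arcs, those of level tau = 1. For smaller
    tau the points between two levels are few; interpolating the saving P^tau at k(k+1) with their
    number descends to any tau > 0 in finitely many steps, because 3s > 2k(k+1).

    On the major arcs the main term of f_j is useful only for P_j above X^(1/2), since its error is
    governed by the denominator and not by P_j. A shorter P_j makes the product smaller than X^s by
    a power, and the second term of the bound then has room for a trivial estimate. *)

Module Waring.
Import all_boot all_order all_algebra complex reals exp trigo boolp.
Import mathcomp.algebra_tactics.ring mathcomp.algebra_tactics.lra mathcomp.zify.zify.
Set Implicit Arguments. Unset Strict Implicit. Unset Printing Implicit Defensive.
Import Order.TTheory GRing.Theory Num.Theory.
Local Open Scope ring_scope.

(** * Inequalities *)

Section Inequalities.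
Variable R : realType.
Implicit Types (x y m : R).

Definition nthroot q x : R := x `^ q%:R^-1.

Lemma nthroot_ge0 q x : 0 <= nthroot q x. Proof. exact: powR_ge0. Qed.

Lemma nthrootK q x : 0 <= x -> (0 < q)%N -> nthroot q x ^+ q = x.
Proof.
move=> x0 d0; rewrite -powR_mulrn ?powR_ge0 // -powRrM mulVf ?powRr1 //.
by rewrite pnatr_eq0 -lt0n.
Qed.

Lemma nth_root_exists x d : 0 <= x -> (0 < d)%N -> exists2 y, 0 <= y & y ^+ d = x.
Proof. by move=> x0 d0; exists (nthroot d x); [apply: nthroot_ge0 | apply: nthrootK]. Qed.

Lemma tangent_pow x m q : 0 <= x -> 0 <= m ->
  m ^+ q.+1 + q.+1%:R * m ^+ q * (x - m) <= x ^+ q.+1.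
Proof.
move=> x0 m0; elim: q => [|q IH]; first by rewrite !expr1 expr0 !mul1r addrC subrK.
rewrite (exprS x); apply: le_trans (ler_wpM2l x0 IH).
have : 0 <= q.+1%:R * m ^+ q * (x - m) ^+ 2.
  by rewrite mulr_ge0 ?sqr_ge0 // mulr_ge0 // ?ler0n // exprn_ge0.
move=> h; rewrite -subr_ge0; apply: (le_trans h); rewrite le_eqVlt; apply/orP; left; apply/eqP.
by rewrite !exprS -!natr1; ring.
Qed.

(** The tangent to x^q at the weighted mean lies below the graph; summed with the weights, its
    linear term cancels. *)
Lemma jensen_pow (I : finType) (l a : I -> R) q :
  (forall i, 0 <= l i) -> (forall i, 0 <= a i) -> \sum_i l i = 1 -> (0 < q)%N ->
  (\sum_i l i * a i) ^+ q <= \sum_i l i * a i ^+ q.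
Proof.
case: q => // q l0 a0 l1 _; set m := \sum_i _.
have m0 : 0 <= m by apply: sumr_ge0 => i _; apply: mulr_ge0.
have h : \sum_i l i * (m ^+ q.+1 + q.+1%:R * m ^+ q * (a i - m)) <= \sum_i l i * a i ^+ q.+1.
  by apply: ler_sum => i _; apply: ler_wpM2l => //; apply: tangent_pow.
apply: le_trans h.
under eq_bigr => i _ do rewrite mulrDr [l i * (_ * _)]mulrCA mulrBr.
rewrite big_split /= -mulr_suml l1 mul1r -mulr_sumr.
by rewrite sumrB -mulr_suml l1 mul1r subrr mulr0 addr0.
Qed.

Lemma sum_pow_le (I : finType) (a : I -> R) q :
  (forall i, 0 <= a i) -> (0 < q)%N ->
  (\sum_i a i) ^+ q <= #|I|%:R ^+ q.-1 * \sum_i a i ^+ q.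
Proof.
move=> a0 q0; have [I0|I0] := posnP #|I|.
  rewrite !big_pred0 ?expr0n ?eqn0Ngt ?q0 /= ?mulr0 // => i; have := card0_eq I0 i; by rewrite !inE.
have n0 : (0 : R) < #|I|%:R by rewrite ltr0n.
have n1 : (#|I|%:R : R) != 0 by rewrite gt_eqF.
have e1 : \sum_(i : I) (#|I|%:R^-1 : R) = 1.
  by rewrite sumr_const -[LHS]mulr_natl; apply: divff.
have p0 (i : I) : (0 : R) <= #|I|%:R^-1 by rewrite invr_ge0 ler0n.
have := jensen_pow p0 a0 e1 q0; rewrite -!mulr_sumr.
rewrite exprMn exprVn -ler_pdivlMl ?invr_gt0 ?exprn_gt0 // invrK mulrA.
suff -> : #|I|%:R ^+ q / #|I|%:R = #|I|%:R ^+ q.-1 :> R by [].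
by rewrite -{1}(prednK q0) exprSr mulfK.
Qed.

Lemma sum_pow_ge (I : finType) (a : I -> R) q :
  (forall i, 0 <= a i) -> (0 < q)%N -> \sum_i a i ^+ q <= (\sum_i a i) ^+ q.
Proof.
move=> a0; case: q => // q _; rewrite exprS mulr_suml; apply: ler_sum => i _.
rewrite exprS; apply: ler_wpM2l => //; apply: lerXn2r; rewrite ?nnegrE ?sumr_ge0 //.
by rewrite (bigD1 i) //= lerDl sumr_ge0.
Qed.

(** Minkowski's inequality in weighted L^q, with upper bounds [s i] in place of the norms. With S
    the sum of the [s i], the sum of the [a i g] is the mean of S / s_i times [a i g] with weights
    s_i / S, and Jensen's inequality applies. An index with s_i = 0 contributes nothing where [W] is
    nonzero. *)
Lemma minkowski_pow (I G : finType) (W : G -> R) (a : I -> G -> R) (s : I -> R) q :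
  (0 < q)%N -> (forall g, 0 <= W g) -> (forall i g, 0 <= a i g) -> (forall i, 0 <= s i) ->
  (forall i, \sum_g W g * a i g ^+ q <= s i ^+ q) ->
  \sum_g W g * (\sum_i a i g) ^+ q <= (\sum_i s i) ^+ q.
Proof.
move=> q0 W0 a0 s0 H; set S := \sum_i s i.
have S0 : 0 <= S by apply: sumr_ge0.
have Z i g : s i = 0 -> W g != 0 -> a i g = 0.
  move=> si Wg; have := H i; rewrite si expr0n eqn0Ngt q0 /= => Hi.
  have P h (_ : xpredT h) : 0 <= W h * a i h ^+ q by rewrite mulr_ge0 // exprn_ge0.
  have := psumr_eq0P P; rewrite (le_anti (introT andP (conj Hi (sumr_ge0 _ P)))).
  move=> /(_ erefl g isT)/eqP; rewrite mulf_eq0 (negbTE Wg) /= expf_eq0 q0 /=.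
  by move/eqP.
have [S1|S1] := eqVneq S 0.
  have s1 i : s i = 0 by apply: (psumr_eq0P (fun i _ => s0 i) S1).
  rewrite big1 ?exprn_ge0 // => g _; have [->|Wg] := eqVneq (W g) 0; first by rewrite mul0r.
  by rewrite big1 ?expr0n ?eqn0Ngt ?q0 ?mulr0 // => i _; apply: Z.
have Sp : 0 < S by rewrite lt_def S1.
apply: (@le_trans _ _ (\sum_g \sum_i (s i / S * (S / s i) ^+ q) * (W g * a i g ^+ q))).
  apply: ler_sum => g _; have [->|Wg] := eqVneq (W g) 0.
    by rewrite mul0r sumr_ge0 // => i _; rewrite mul0r mulr0.
  have := @jensen_pow I (fun i => s i / S) (fun i => S / s i * a i g) q.
  rewrite -mulr_suml divff //.
  move=> /(_ (fun i => divr_ge0 (s0 i) S0) (fun i => mulr_ge0 (divr_ge0 S0 (s0 i)) (a0 i g)) erefl q0).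
  move=> /(ler_wpM2l (W0 g)).
  have -> : \sum_i s i / S * (S / s i * a i g) = \sum_i a i g.
    apply: eq_bigr => i _; have [si|si] := eqVneq (s i) 0; last by field; rewrite si.
    by rewrite (Z i g) // !mulr0.
  move=> /le_trans; apply; rewrite mulr_sumr; apply: ler_sum => i _.
  by rewrite exprMn le_eqVlt; apply/orP; left; apply/eqP; ring.
rewrite exchange_big /=.
apply: (@le_trans _ _ (\sum_i s i / S * S ^+ q)); last by rewrite -!mulr_suml divff // mul1r.
apply: ler_sum => i _; rewrite -mulr_sumr -mulrA; apply: ler_wpM2l; first exact: divr_ge0.
apply: le_trans (ler_wpM2l _ (H i)) _; first by rewrite exprn_ge0 // divr_ge0.
rewrite -exprMn; have [->|si] := eqVneq (s i) 0; last by rewrite divfK.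
by rewrite mulr0 expr0n eqn0Ngt q0 exprn_ge0.
Qed.

(** Hölder's inequality for d factors, free of roots. Each [F' j] is divided by its sum and the
    geometric mean is bounded by the arithmetic mean; if one of the sums vanishes, so does F. *)
Lemma holder_pow (T : finType) (P : pred T) (d : nat) (F : T -> R) (F' : 'I_d -> T -> R) :
  (0 < d)%N -> (forall t, 0 <= F t) -> (forall j t, 0 <= F' j t) ->
  (forall t, P t -> F t ^+ d <= \prod_j F' j t) ->
  (\sum_(t | P t) F t) ^+ d <= \prod_j \sum_(t | P t) F' j t.
Proof.
move=> d0 F0 F'0 H; set A := fun j => \sum_(t | P t) F' j t.
have A0 j : 0 <= A j by apply: sumr_ge0.
case: (boolP [exists j, A j == 0]) => [/existsP[j /eqP Aj]|].
  suff -> : \sum_(t | P t) F t = 0.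
    by rewrite expr0n eqn0Ngt d0 /=; apply: prodr_ge0 => i _; apply: A0.
  apply: big1 => t Pt.
  have Z : F' j t = 0 by apply: (psumr_eq0P (fun i _ => F'0 j i) Aj).
  have := H t Pt; rewrite (bigD1 j) //= Z mul0r => Ht.
  have /eqP : F t ^+ d = 0 by apply/le_anti; rewrite Ht exprn_ge0.
  by rewrite expf_eq0 d0 => /eqP.
rewrite negb_exists => /forallP A1.
have PA0 : 0 <= \prod_j A j by apply: prodr_ge0 => j _; apply: A0.
have [G G0 GE] := nth_root_exists PA0 d0.
rewrite -[X in _ <= X]GE; apply: lerXn2r; rewrite ?nnegrE ?sumr_ge0 //.
apply: (@le_trans _ _ (\sum_(t | P t) G * (\sum_j F' j t / A j) / d%:R)).
  apply: ler_sum => t Pt; rewrite -[_ <= _](@ler_pXn2r _ d) ?nnegrE //; last first.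
    by rewrite !mulr_ge0 ?invr_ge0 ?ler0n ?sumr_ge0 // => j _; apply: divr_ge0.
  apply: le_trans (H t Pt) _; rewrite -mulrA exprMn GE.
  have := leif_AGM (A := [set: 'I_d]) (E := fun j => F' j t / A j).
  rewrite cardsT card_ord.
  case; first by move=> j _; apply: divr_ge0.
  have e1 (V : nmodType) (f : 'I_d -> V) : \sum_(i in [set: 'I_d]) f i = \sum_i f i.
    by apply: eq_bigl => i; rewrite inE.
  rewrite e1; set s := \sum_i _ => /(ler_wpM2l PA0) + _.
  move=> /(le_trans _); apply;
  have e2 (f : 'I_d -> R) : \prod_(i in [set: 'I_d]) f i = \prod_i f i.
    by apply: eq_bigl => i; rewrite inE.
  rewrite e2 -big_split /=; apply: ler_prod => j _.
  by rewrite F'0 /= mulrCA divff ?mulr1.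
rewrite -mulr_suml -mulr_sumr exchange_big /=.
have e j : \sum_(t | P t) F' j t / A j = 1 by rewrite -mulr_suml; apply: divff; apply: A1.
rewrite (eq_bigr (fun=> 1)) // sumr_const card_ord -mulrA divff ?mulr1 //.
by rewrite pnatr_eq0 -lt0n.
Qed.

End Inequalities.

Section Normc.
Variable R : rcfType.
Local Notation nm := (@Normc.normc R).
Implicit Types z w : R[i].

Lemma normc_ge0 z : 0 <= nm z.
Proof. by case: z => a b; apply: sqrtr_ge0. Qed.

Lemma le_normc_sum (I : Type) (r : seq I) (P : pred I) (F : I -> R[i]) :
  nm (\sum_(i <- r | P i) F i) <= \sum_(i <- r | P i) nm (F i).
Proof.
elim/big_ind2: _ => [|x y z t h1 h2|i _]; rewrite ?Normc.normc0 //.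
by apply: le_trans (le_normcD _ _) _; apply: lerD.
Qed.

Lemma normcX z n : nm (z ^+ n) = nm z ^+ n.
Proof. by elim: n => [|n IH]; rewrite ?expr0 ?Normc.normc1 // !exprS Normc.normcM IH. Qed.

Lemma normc_prod (I : Type) (r : seq I) (P : pred I) (F : I -> R[i]) :
  nm (\prod_(i <- r | P i) F i) = \prod_(i <- r | P i) nm (F i).
Proof. by elim/big_ind2: _ => [|x y z t <- <-|]; rewrite ?Normc.normc1 ?Normc.normcM. Qed.

Lemma normc_conj z : nm z^*%C = nm z.
Proof. by case: z => a b /=; rewrite sqrrN. Qed.

Lemma normc_sqr z : (nm z ^+ 2)%:C%C = z * z^*%C.
Proof. by case: z => a b; rewrite /= sqr_sqrtr ?addr_ge0 ?sqr_ge0 //; simpc; rewrite [b * a]mulrC addNr -!expr2. Qed.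

Lemma normc_real (a : R) : nm a%:C%C = `|a|.
Proof. by rewrite /= expr0n /= addr0 sqrtr_sqr. Qed.

End Normc.

(** Splits an index in base b into its i low digits v, a residue class modulo b^i, and its j high
    digits u. *)
Lemma sum_digits (V : nmodType) (b i j : nat) (F : nat -> V) : (0 < b)%N ->
  \sum_(v < b ^ (i + j)) F v = \sum_(v < b ^ i) \sum_(u < b ^ j) F (v + b ^ i * u)%N.
Proof.
move=> b0; rewrite exchange_big /= expnD mulnC.
elim: (b ^ j)%N => [|m IH]; first by rewrite mul0n !big_ord0.
rewrite big_ord_recr /= mulSnr big_split_ord /= IH; congr (_ + _).
by apply: eq_bigr => v _; rewrite mulnC addnC.
Qed.

(** * Decoupling over a residue ring *)

Section Decoupling.
Variables (R : realType) (Z : comNzRingType) (p : nat).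
Local Notation C := R[i].
Local Notation nm := (@Normc.normc R).

(* [f] is locally constant up to phase on the box dual to [x + p^a Z]: shifting by [h]
   only multiplies [f] by [E h x] as soon as [E h] is constant on [x + p^a Z]. *)
Definition quasi (A : zmodType) (E : A -> Z -> C) (a : nat) (x : Z) (f : A -> C) :=
  forall h, (forall u, E h (x + p%:R ^+ a * u) = E h x) -> forall g, f (g + h) = E h x * f g.

(* l^2 decoupling of [x + p^a Z] into its [p^m] subclasses modulo [p^(a+m)], in weighted L^(2q);
   the [s v] are upper bounds for the squared norms, which avoids taking roots. *)
Definition decouples (A : finZmodType) (E : A -> Z -> C) (W : A -> R)
    (x : Z) (a m q : nat) (K : R) :=
  forall (f : nat -> A -> C) (s : nat -> R),
    (forall v, (v < p ^ m)%N -> quasi E (a + m) (x + p%:R ^+ a * v%:R) (f v)) ->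
    (forall v, (v < p ^ m)%N -> 0 <= s v) ->
    (forall v, (v < p ^ m)%N -> \sum_g W g * nm (f v g) ^+ (2 * q) <= s v ^+ q) ->
    \sum_g W g * nm (\sum_(v < p ^ m) f v g) ^+ (2 * q) <= K * (\sum_(v < p ^ m) s v) ^+ q.

(** A shift whose phase is constant on the coarse class is constant, with the same value, on each of
    its subclasses. *)
Lemma quasi_sum (A : zmodType) (E : A -> Z -> C) a m x (f : nat -> A -> C) :
  (forall v, (v < p ^ m)%N -> quasi E (a + m) (x + p%:R ^+ a * v%:R) (f v)) ->
  quasi E a x (fun g => \sum_(v < p ^ m) f v g).
Proof.
move=> H h Hh g; rewrite mulr_sumr; apply: eq_bigr => v _.
have e : E h (x + p%:R ^+ a * v%:R) = E h x by apply: Hh.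
rewrite -e; apply: (H v (ltn_ord v)) => u.
by rewrite exprD -addrA -mulrA -mulrDr !Hh.
Qed.

Section Basic.
Variables (A : finZmodType) (E : A -> Z -> C).
Implicit Types (W : A -> R) (x : Z).

Lemma decouples_le W x a m q K K' : K <= K' ->
  decouples E W x a m q K -> decouples E W x a m q K'.
Proof.
move=> KK H f s Hf s0 Hs; apply: le_trans (H f s Hf s0 Hs) _.
by apply: ler_wpM2r KK; rewrite exprn_ge0 // sumr_ge0 // => v _; apply: s0.
Qed.

(** The triangle and power mean inequalities alone. It starts the induction and serves wherever m is
    a small part of the range. *)
Lemma decouples_crude W x a m q : (forall g, 0 <= W g) -> (0 < q)%N ->
  decouples E W x a m q ((p ^ m)%:R ^+ (2 * q)).
Proof.
move=> W0 q0 f s Hf s0 Hs.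
have q20 : (0 < 2 * q)%N by rewrite muln_gt0.
apply: (@le_trans _ _ (\sum_g \sum_(v < p ^ m) (p ^ m)%:R ^+ (2 * q).-1 * (W g * nm (f v g) ^+ (2 * q)))).
  apply: ler_sum => g _; rewrite -mulr_sumr -mulr_sumr mulrCA; apply: ler_wpM2l => //.
  apply: (@le_trans _ _ ((\sum_(v < p ^ m) nm (f v g)) ^+ (2 * q))).
    by apply: lerXn2r; rewrite ?nnegrE ?normc_ge0 ?sumr_ge0 ?le_normc_sum // => *; apply: normc_ge0.
  by have := @sum_pow_le R 'I_(p ^ m) (fun v => nm (f v g)) (2 * q) (fun=> normc_ge0 _) q20; rewrite card_ord.
rewrite exchange_big /=; under eq_bigr => v _ do rewrite -mulr_sumr.
rewrite -mulr_sumr; have [pm0|pm0] := posnP (p ^ m).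
  have P0 (F : nat -> R) : \sum_(v < p ^ m) F v = 0 by rewrite pm0 big_ord0.
  rewrite (P0 (fun i => \sum_j W j * nm (f i j) ^+ (2 * q))) (P0 s).
  by rewrite expr0n [q == _]eqn0Ngt q0 !mulr0.
apply: (@le_trans _ _ ((p ^ m)%:R ^+ (2 * q).-1 * \sum_(v < p ^ m) s v ^+ q)).
  by apply: ler_wpM2l; [rewrite exprn_ge0 ?ler0n | apply: ler_sum => v _; apply: Hs].
apply: ler_pM; rewrite ?exprn_ge0 ?ler0n ?sumr_ge0 //.
- by move=> v _; rewrite exprn_ge0 ?s0.
- by apply: ler_weXn2l; rewrite ?ler1n // leq_pred.
- by apply: (@sum_pow_ge R 'I_(p ^ m) (fun v => s v)) => // v; apply: s0.
Qed.

(** Decoupling constants multiply under composition of scales: the inner constant enters the bounds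
    [s] through its q-th root, and the outer inequality applies unchanged. *)
Lemma decouples_trans W x a m m' q K K' : (0 < p)%N -> (0 < q)%N -> (forall g, 0 <= W g) ->
  0 <= K -> 0 <= K' ->
  decouples E W x a m q K ->
  (forall v, (v < p ^ m)%N -> decouples E W (x + p%:R ^+ a * v%:R) (a + m) m' q K') ->
  decouples E W x a (m + m') q (K * K').
Proof.
move=> p0 q0 W0 K0 K'0 H H' f s Hf s0 Hs.
have lt v u : (v < p ^ m)%N -> (u < p ^ m')%N -> (v + p ^ m * u < p ^ (m + m'))%N.
  move=> hv hu; apply: (@leq_trans (p ^ m + p ^ m * u)); first by rewrite ltn_add2r.
  by rewrite -mulnS expnD leq_mul2l hu orbT.
have [k k0 kE] := nth_root_exists K'0 q0.
under eq_bigr => g _ do rewrite (@sum_digits _ p m m' (fun v => f v g)) //.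
rewrite (@sum_digits _ p m m' s) //.
have S0 v : (v < p ^ m)%N -> 0 <= \sum_(u < p ^ m') s (v + p ^ m * u)%N.
  by move=> hv; rewrite sumr_ge0 // => u _; apply: s0; apply: lt.
have F v u : (v < p ^ m)%N -> (u < p ^ m')%N ->
    quasi E (a + m + m') (x + p%:R ^+ a * v%:R + p%:R ^+ (a + m) * u%:R) (f (v + p ^ m * u)%N).
  move=> hv hu; have := Hf _ (lt v u hv hu).
  by rewrite natrD natrM natrX mulrDr exprD !mulrA !addrA addnA.
apply: le_trans (H (fun v g => \sum_(u < p ^ m') f (v + p ^ m * u)%N g)
          (fun v => k * \sum_(u < p ^ m') s (v + p ^ m * u)%N) _ _ _) _ => [v hv|v hv|v hv|].
- by apply: (@quasi_sum A E (a + m) m' _ (fun u => f (v + p ^ m * u)%N)) => u hu; apply: F.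
- by rewrite mulr_ge0 // S0.
- rewrite exprMn kE; apply: (H' v hv (fun u => f (v + p ^ m * u)%N) (fun u => s (v + p ^ m * u)%N)).
  + by move=> u; apply: F.
  + by move=> u hu; apply: s0; apply: lt.
  + by move=> u hu; apply: Hs; apply: lt.
- by rewrite -mulr_sumr exprMn kE mulrA.
Qed.

(** Transference. If the shifts [phi h] act on x + p^a Z as the phases [E0] act on the variable u,
    then for every base point g the functions h |-> f v (g + phi h) satisfy the hypothesis of
    decoupling for [E0]. This is applied on each orbit, along which the weight is constant, and
    Minkowski's inequality recombines the orbits. *)
Lemma decouples_transfer (A0 : finZmodType) (E0 : A0 -> Z -> C) (phi : A0 -> A) W x a m q K :
  (0 < q)%N -> 0 <= K -> (forall g, 0 <= W g) ->
  {morph phi : h k / h + k} ->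
  (forall h u, E (phi h) (x + p%:R ^+ a * u) = E0 h u) ->
  (forall g h, W (g + phi h) = W g) ->
  decouples E0 (fun=> 1) 0 0 m q K -> decouples E W x a m q K.
Proof.
move=> q0 K0 W0 phiD EE WE H f s Hf s0 Hs.
pose n : R := #|A0|%:R.
have n0 : 0 < n by rewrite ltr0n; apply/card_gt0P; exists 0.
have shift (G : A -> R) (GW : G = (fun g => W g * nm (\sum_(v < p ^ m) f v g) ^+ (2 * q)) \/
    exists v, G = (fun g => W g * nm (f v g) ^+ (2 * q))) :
    n * \sum_g G g = \sum_g \sum_h G (g + phi h).
  rewrite exchange_big /= /n mulr_natl -sumr_const; apply: eq_bigr => h _.
  by rewrite (reindex_inj (addIr (phi h))).
rewrite -(ler_pM2l n0) mulrCA (shift (fun g => W g * nm (\sum_(v < p ^ m) f v g) ^+ (2 * q))); last by left.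
under eq_bigr => g _ do under eq_bigr => h _ do rewrite WE.
(* The squared L^(2q) norm of the piece v along the orbit of g. *)
pose S v g := nthroot q (\sum_h nm (f v (g + phi h)) ^+ (2 * q)).
have sq v g : 0 <= \sum_h nm (f v (g + phi h)) ^+ (2 * q).
  by apply: sumr_ge0 => h _; apply: exprn_ge0; apply: normc_ge0.
have step1 g : \sum_h nm (\sum_(v < p ^ m) f v (g + phi h)) ^+ (2 * q) <= K * (\sum_(v < p ^ m) S v g) ^+ q.
  have := H (fun v h => f v (g + phi h)) (fun v => S v g).
  rewrite (eq_bigr _ (fun h _ => mul1r _)); apply=> v hv.
  - move=> h; rewrite add0r expr0 mul1r => hh h'.
    rewrite phiD addrA (Hf v hv (phi h)) EE // => u.
    by rewrite exprD -addrA -mulrA -mulrDr !EE; apply: hh.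
  - exact: nthroot_ge0.
  - by rewrite nthrootK //; under eq_bigr => h _ do rewrite mul1r.
apply: (@le_trans _ _ (K * \sum_g W g * (\sum_(v < p ^ m) S v g) ^+ q)).
  rewrite mulr_sumr; apply: ler_sum => g _.
  by rewrite -mulr_sumr mulrCA; apply: ler_wpM2l.
apply: ler_wpM2l => //.
have n00 : 0 <= n := ltW n0.
rewrite -{1}(nthrootK n00 q0) -exprMn mulr_sumr.
apply: (@minkowski_pow R 'I_(p ^ m) A W (fun v => S v) (fun v => nthroot q n * s v) q q0 W0).
- by move=> v g; apply: nthroot_ge0.
- by move=> v; rewrite mulr_ge0 ?nthroot_ge0 ?s0.
- move=> v; rewrite exprMn nthrootK //.
  apply: le_trans (ler_wpM2l n00 (Hs v (ltn_ord v))).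
  rewrite (shift (fun g => W g * nm (f v g) ^+ (2 * q))); last by right; exists v.
  apply: ler_sum => g _; rewrite /S nthrootK // mulr_sumr.
  by apply: ler_sum => h _; rewrite WE.
Qed.

End Basic.
End Decoupling.

(** * Polynomial phases modulo powers of p *)

Section PolynomialPhases.
Variables (R : realType) (Z : finComUnitRingType) (p M : nat) (psi : Z -> R[i]).
Local Notation C := R[i].
Local Notation P := (p%:R : Z).
Hypothesis P_nil : P ^+ M = 0.

(** A phase of modulus p^w inside the ring modulo p^M: the factor p^(M-w) lowers the modulus, so
    that all moduli share one ring. *)
Definition phase k w (c : 'rV[Z]_k.+1) (x : Z) : C := psi (P ^+ (M - w) * (rVpoly c).[x]).

(** Newton expansion of a product of linear factors in e, by induction from e C(e,i) = i C(e,i) +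
    (i+1) C(e,i+1). Binomial coefficients are used instead of powers because they are the Taylor
    coefficients of X^e. *)
Lemma prod_binomial_basis (s : seq Z) :
  exists q : nat -> Z, (forall i, (size s < i)%N -> q i = 0) /\
  forall n e, (size s < n)%N -> \prod_(a <- s) (e%:R - a) = \sum_(i < n) q i * 'C(e, i)%:R.
Proof.
elim: s => [|a s [q [q0 IH]]].
  exists (fun i => (i == 0)%:R); split=> [[|i]//|[//|n] e _].
  rewrite big_nil big_ord_recl eqxx bin0 mul1r big1 ?addr0 // => i _.
  by rewrite mul0r.
exists (fun i => q i * (i%:R - a) + i%:R * q i.-1); split=> [[//|i] /= hi|[//|n] e /= hn].
  by rewrite !q0 ?mul0r ?mulr0 ?addr0 // ltnW.
rewrite big_cons (IH n e hn).
under [RHS]eq_bigr => i _ do rewrite mulrDl.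
rewrite [in RHS]big_split /= [X in _ = X + _]big_ord_recr /= (q0 n hn) !mul0r addr0.
rewrite [X in _ = _ + X]big_ord_recl /= !mul0r add0r -big_split mulr_sumr /=.
apply: eq_bigr => i _.
have h : e%:R * 'C(e, i)%:R = i%:R * 'C(e, i)%:R + i.+1%:R * 'C(e, i.+1)%:R :> Z.
  rewrite -!natrM -natrD mul_bin_left; congr (_ %:R).
  have [ie|ie] := leqP i e; first by rewrite -mulnDl subnKC.
  by rewrite bin_small // !muln0.
rewrite /bump /= add1n; transitivity (q i * (e%:R * 'C(e, i)%:R) - a * q i * 'C(e, i)%:R); first by ring.
by rewrite h; ring.
Qed.

Section LeftInverse.
Variables (k l : nat) (e : 'I_l -> nat) (y : Z).
Hypothesis e_inj : injective e.
Hypothesis e_bnd : forall j, (0 < e j <= k)%N.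
Hypothesis unit_le : forall n, (0 < n <= k)%N -> (n%:R : Z) \is a GRing.unit.
Hypothesis y_unit : y \is a GRing.unit.

(** Row j holds the Taylor coefficients of X^(e j) at y, without the constant one. A column of the
    inverse is, up to powers of y, the Lagrange polynomial vanishing at 0 and at all exponents but
    one, written in the binomial basis. The root 0 removes the constant term; the normalising factor
    is a unit because the exponents and their differences are at most k in absolute value. *)
Lemma binomial_matrix_inverse :
  exists G : 'M[Z]_l, G *m (\matrix_(j, i < l) ('C(e j, i.+1)%:R * y ^+ (e j - i.+1))) = 1%:M.
Proof.
set B := \matrix_(j, i) _.
have dunit j j' : j != j' -> ((e j)%:R - (e j')%:R : Z) \is a GRing.unit.
  move=> jj; have := e_bnd j; have := e_bnd j'; have : e j != e j' by apply: contra_neq jj => /e_inj.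
  case: (ltngtP (e j) (e j')) => // h _ h1 h2.
    rewrite -opprB unitrN -natrB; last exact: ltnW.
    by apply: unit_le; rewrite subn_gt0 h /=; apply: leq_trans (leq_subr _ _) _; case/andP: h1.
  rewrite -natrB; last exact: ltnW.
  by apply: unit_le; rewrite subn_gt0 h /=; apply: leq_trans (leq_subr _ _) _; case/andP: h2.
pose L j := 0 :: [seq (e j')%:R : Z | j' <- enum (predC1 j)].
have sL j : size (L j) = l.
  rewrite /= size_map -cardE.
  by have := cardC1 j; rewrite card_ord => ->; rewrite prednK // (leq_trans _ (ltn_ord j)).
have H j : exists N : 'cV[Z]_l, forall j', (row j' B *m N) 0 0 = (j == j')%:R.
  have [q [q0 Hq]] := prod_binomial_basis (L j).
  pose u : Z := (\prod_(a <- L j) ((e j)%:R - a)) * y ^+ e j.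
  have uu : u \is a GRing.unit.
    rewrite unitrM unitrX // andbT big_cons subr0 unitrM unit_le //=.
    rewrite big_map big_seq; elim/big_ind: _ => [|x z hx hz|j']; first exact: unitr1.
      by rewrite unitrM hx.
    by rewrite mem_enum inE => jj; apply: dunit; rewrite eq_sym.
  have q00 : q 0 = 0.
    have := Hq l.+1 0%N; rewrite sL ltnSn => /(_ isT).
    rewrite big_cons subrr mul0r big_ord_recl bin0 mulr1 big1 ?addr0 // => i _.
    by rewrite bin0n mulr0.
  exists (\col_i (u^-1 * (y ^+ i.+1 * q i.+1))) => j'.
  rewrite mxE.
  transitivity (u^-1 * (y ^+ e j' * \prod_(a <- L j) ((e j')%:R - a))).
    rewrite (Hq l.+1) ?sL // big_ord_recl q00 mul0r add0r !mulr_sumr.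
    apply: eq_bigr => i _; rewrite !mxE lift0.
    have [h|h] := leqP i.+1 (e j'); last by rewrite bin_small // !(mul0r, mulr0).
    have -> : y ^+ e j' = y ^+ (e j' - i.+1) * y ^+ i.+1 by rewrite -exprD subnK.
    by ring.
  have [<-|jj] := eqVneq j j'; first by rewrite [y ^+ _ * _]mulrC mulVr.
  suff -> : \prod_(a <- L j) ((e j')%:R - a) = 0 by rewrite !mulr0.
  rewrite (big_rem (e j')%:R) /= ?subrr ?mul0r //.
  rewrite in_cons; apply/orP; right; apply: (map_f (fun j' => (e j')%:R)).
  by rewrite mem_enum inE eq_sym.
have [N HN] := fin_all_exists H.
exists (\matrix_(i, j) N j i 0); apply: mulmx1C; apply/matrixP => j' j.
rewrite !mxE eq_sym -HN mxE; apply: eq_bigr => i _; by rewrite !mxE.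
Qed.
End LeftInverse.

Lemma horner_rVpoly_sum n (h : 'rV[Z]_n) u : (rVpoly h).[u] = \sum_i h 0 i * u ^+ i.
Proof. by rewrite horner_poly; apply: eq_bigr => i _; rewrite valK. Qed.

(** The factor p^(w-m) reduces the modulus of the nonconstant part from p^w to p^m. Powers centred
    at eta are highly divisible by p near eta, so that such a phase can be constant on classes
    around eta. *)
Definition section_poly k w m l (e : 'I_l -> nat) (eta : Z) (t : 'I_l -> Z) (c0 : Z) : 'rV[Z]_k.+1 :=
  poly_rV (P ^+ (w - m) *: (\sum_j t j *: ('X - eta%:P) ^+ e j) + c0%:P).

Lemma horner_section_poly k w m l (e : 'I_l -> nat) (eta : Z) (t : 'I_l -> Z) (c0 x : Z) :
  (forall j, (e j <= k)%N) ->
  (rVpoly (section_poly k w m e eta t c0)).[x] = P ^+ (w - m) * (\sum_j t j * (x - eta) ^+ e j) + c0.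
Proof.
move=> ek; rewrite poly_rV_K.
  rewrite hornerD hornerZ hornerC horner_sum; congr (_ * _ + _).
  by apply: eq_bigr => j _; rewrite hornerZ horner_exp !hornerE.
apply: leq_trans (size_polyD _ _) _; rewrite geq_max; apply/andP; split; last first.
  by apply: leq_trans (size_polyC_leq1 _) _.
apply: leq_trans (size_scale_leq _ _) _; apply: leq_trans (size_sum _ _ _) _.
apply/bigmax_leqP => j _; apply: leq_trans (size_scale_leq _ _) _.
by rewrite size_exp_XsubC ltnS.
Qed.

Lemma sum_shifted_powers l (e : 'I_l -> nat) (t : 'I_l -> Z) (y z : Z) n :
  (forall j, (e j < n)%N) ->
  \sum_j t j * (y + z) ^+ e j =
  \sum_(i < n) z ^+ i * \sum_j t j * ('C(e j, i)%:R * y ^+ (e j - i)).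
Proof.
move=> en; under [RHS]eq_bigr => i _ do rewrite mulr_sumr.
rewrite exchange_big /=; apply: eq_bigr => j _.
rewrite exprDn mulr_sumr (big_ord_widen n (fun i : nat => t j * (y ^+ (e j - i) * z ^+ i *+ 'C(e j, i)))) //.
rewrite big_mkcond /=; apply: eq_bigr => i _; rewrite -mulr_natr.
case: ifP => [_|/negbT]; first by ring.
by rewrite -leqNgt => h; rewrite bin_small // !(mul0r, mulr0).
Qed.

(* A degree-[l] polynomial phase in [u] with modulus [p^w'] is realised on [x + p^a Z] by a
   combination of the powers [(X - eta)^(e j)]: the coefficients are found by inverting
   a binomial matrix, and the terms of degree above [l] are divisible by the modulus. *)
Lemma decouples_section k l (e : 'I_l -> nat) (eta x : Z) a m w w' (W : 'rV[Z]_k.+1 -> R) q K :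
  injective e -> (forall j, (0 < e j <= k)%N) ->
  (forall n, (0 < n <= k)%N -> (n%:R : Z) \is a GRing.unit) ->
  x - eta \is a GRing.unit -> (w' + l * a <= w <= M)%N ->
  ((w' <= a)%N \/ forall j, (e j <= l)%N) ->
  (forall g, 0 <= W g) ->
  (forall g t c0, W (g + section_poly k w (w' + l * a) e eta t c0) = W g) ->
  (0 < q)%N -> 0 <= K ->
  decouples p (@phase l w') (fun=> 1) 0 0 m q K -> decouples p (@phase k w) W x a m q K.
Proof.
move=> e_inj e_bnd unit_le y_unit /andP[hw1 hw2] hwe W0 WE q0 K0.
have [G GB] := binomial_matrix_inverse e_inj e_bnd unit_le y_unit.
set y := x - eta in y_unit GB.
(* Multiplication by [G] prescribes the Taylor coefficients at x: degree i+1 receives p^((l-i-1)a)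
   h_(i+1), and the argument p^a u supplies the remaining p^((i+1)a). The constant term is corrected
   by [c0]. *)
pose T (h : 'rV[Z]_l.+1) : 'rV[Z]_l := (\row_i (P ^+ ((l - i.+1) * a) * h 0 (lift ord0 i))) *m G.
pose c0 (h : 'rV[Z]_l.+1) : Z := P ^+ (w - w') * h 0 0 -
   P ^+ (w - (w' + l * a)) * \sum_j T h 0 j * y ^+ e j.
pose phi h := section_poly k w (w' + l * a) e eta (T h 0) (c0 h).
have TD h h' : T (h + h') = T h + T h'.
  rewrite /T -mulmxDl; congr (_ *m _); apply/rowP => i; rewrite !mxE mulrDr //.
apply: (@decouples_transfer _ _ _ _ _ _ _ phi) => //.
- move=> h h'; rewrite /phi /section_poly -linearD; congr poly_rV.
  rewrite addrACA -scalerDr -big_split -polyCD; congr (_ *: _ + _%:P).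
    by apply: eq_bigr => j _; rewrite TD mxE scalerDl.
  rewrite /c0 addrACA -opprD -mulrDr -mulrDr mxE; congr (_ - _ * _).
  by rewrite -big_split; apply: eq_bigr => j _; rewrite TD mxE mulrDl.
- move=> h u; rewrite /phase; congr psi.
  have ek j : (e j <= k)%N by case/andP: (e_bnd j).
  rewrite horner_section_poly // mulrDr mulrA.
  have -> : x + P ^+ a * u - eta = y + P ^+ a * u by rewrite /y; ring.
  have en j : (e j < (l + k).+1)%N by rewrite ltnS (leq_trans _ (leq_addl _ _)) //; case/andP: (e_bnd j).
  rewrite (sum_shifted_powers _ _ _ en) big_ord_recl expr0 mul1r.
  have -> : \sum_j T h 0 j * ('C(e j, @ord0 (l + k))%:R * y ^+ (e j - @ord0 (l + k))) = \sum_j T h 0 j * y ^+ e j.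
    by apply: eq_bigr => j _; rewrite bin0 mul1r subn0.
  have eP : P ^+ (M - w) * P ^+ (w - (w' + l * a)) = P ^+ (M - (w' + l * a)) by rewrite -exprD; congr (_ ^+ _); lia.
  have eP' : P ^+ (M - w) * P ^+ (w - w') = P ^+ (M - w') by rewrite -exprD; congr (_ ^+ _); lia.
  rewrite /c0; set S := \sum_j T h 0 j * y ^+ e j.
  rewrite mulrDr mulrBr !mulrA eP eP' horner_rVpoly_sum mulr_sumr big_ord_recl expr0 mulr1.
  rewrite addrC -addrA addKr; congr (_ + _).
  rewrite big_split_ord /= mulrDr [X in _ + X](_ : _ = 0) ?addr0; last first.
    rewrite mulr_sumr big1 // => i _; rewrite /bump /= !add1n.
    case: hwe => [hwe|hwe].
      rewrite exprMn -exprM mulrA [P ^+ _ * (_ * _)]mulrA -exprD.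
      suff -> : P ^+ (M - (w' + l * a) + a * (l + i).+1) = 0 by rewrite !mul0r.
      rewrite -(subnK (_ : M <= M - (w' + l * a) + a * (l + i).+1)%N) ?exprD ?P_nil ?mulr0 //.
      by rewrite mulnS mulnDr; nia.
    rewrite [X in _ * (_ * X)]big1 ?mulr0 // => j _.
    by rewrite bin_small ?mul0r ?mulr0 // ltnS (leq_trans (hwe j)) // leq_addr.
  rewrite mulr_sumr; apply: eq_bigr => i _; rewrite /bump /= !add1n.
  have -> : \sum_j T h 0 j * ('C(e j, i.+1)%:R * y ^+ (e j - i.+1)) = P ^+ ((l - i.+1) * a) * h 0 (lift ord0 i).
    have /matrixP/(_ 0 i) : T h *m (\matrix_(j, i < l) ('C(e j, i.+1)%:R * y ^+ (e j - i.+1))) = \row_i (P ^+ ((l - i.+1) * a) * h 0 (lift ord0 i)).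
      by rewrite /T -mulmxA GB mulmx1.
    by rewrite !mxE => <-; apply: eq_bigr => j _; rewrite mxE.
  rewrite exprMn -exprM.
  have -> : P ^+ (M - w') = P ^+ (M - (w' + l * a)) * (P ^+ (a * i.+1) * P ^+ ((l - i.+1) * a)).
    rewrite -!exprD; congr (_ ^+ _); have := ltn_ord i => il.
    by rewrite [((l - _) * a)%N]mulnC -mulnDr subnKC // [(a * l)%N]mulnC; lia.
  by ring.
- by move=> g h; apply: WE.
Qed.

End PolynomialPhases.

(** Half of the critical exponent k(k+1); moments are written with exponents 2q throughout. *)
Definition tri k := 'C(k.+1, 2).

Lemma triS k : tri k.+1 = (k.+1 + tri k)%N.
Proof. by rewrite /tri binS bin1 addnC. Qed.

Lemma tri_double k : (2 * tri k = k * k.+1)%N.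
Proof. by elim: k => // k IH; rewrite triS mulnDr IH; ring. Qed.

Lemma leq_tri k l : (k <= l)%N -> (tri k <= tri l)%N.
Proof. by move=> kl; apply: leq_bin2l. Qed.

Lemma tri_gt0 k : (0 < k)%N -> (0 < tri k)%N.
Proof. by case: k => // k _; rewrite triS. Qed.

(** If all other terms are at most t/p times the largest one, the sum is at most 1 + t times the
    largest. Otherwise a second term exceeds this threshold, and the sum, at most p times the
    largest, is controlled by a product of powers of the two. *)
Lemma broad_narrow (R : realType) (p : nat) (X : 'I_p -> R) t i j : (0 < p)%N ->
  0 < t -> t <= 1 -> (forall x, 0 <= X x) ->
  (\sum_x X x) ^+ (2 * (i + j)) <= (1 + t) ^+ (2 * (i + j)) * \sum_x X x ^+ (2 * (i + j)) +
    (p%:R / t) ^+ (2 * (i + j)) * p%:R ^+ (2 * (i + j)) *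
    \sum_x \sum_(y | y != x) X x ^+ (2 * i) * X y ^+ (2 * j).
Proof.
move=> p0 t0 t1 X0; set T := (2 * (i + j))%N.
have pR : 0 < p%:R :> R by rewrite ltr0n.
pose x := [arg max_(x > Ordinal p0) X x]%O.
have xmax y : X y <= X x by rewrite /x; case: Order.TotalTheory.arg_maxP => // z _; apply.
have S0 : 0 <= \sum_x X x by apply: sumr_ge0.
have P1 : 1 <= p%:R / t by rewrite ler_pdivlMr // mul1r (le_trans t1) // ler1n.
have A0 : 0 <= (1 + t) ^+ T * \sum_x X x ^+ T.
  by rewrite mulr_ge0 ?exprn_ge0 ?sumr_ge0 // ?addr_ge0 // ?ltW // => y _; apply: exprn_ge0.
have B0 z : 0 <= \sum_(y | y != z) X z ^+ (2 * i) * X y ^+ (2 * j).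
  by apply: sumr_ge0 => y _; rewrite mulr_ge0 ?exprn_ge0.
have C0 : 0 <= (p%:R / t) ^+ T * p%:R ^+ T.
  by rewrite mulr_ge0 ?exprn_ge0 // ?ler0n // (le_trans ler01).
case: (boolP [forall y, (y != x) ==> (X y <= t / p%:R * X x)]) => [/forallP H|].
  apply: (@le_trans _ _ ((1 + t) ^+ T * \sum_x X x ^+ T)); last first.
    by rewrite lerDl mulr_ge0 // sumr_ge0.
  apply: (@le_trans _ _ ((1 + t) ^+ T * X x ^+ T)); last first.
    apply: ler_wpM2l; first by rewrite exprn_ge0 // addr_ge0 // ltW.
    by rewrite (bigD1 x) //= lerDl sumr_ge0 // => y _; apply: exprn_ge0.
  rewrite -exprMn; apply: lerXn2r; rewrite ?nnegrE ?mulr_ge0 ?addr_ge0 ?(ltW t0) //.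
  rewrite (bigD1 x) //= mulrDl mul1r lerD2l.
  apply: (@le_trans _ _ (\sum_(y < p) t / p%:R * X x)).
    rewrite big_mkcond; apply: ler_sum => y _; case: ifP => yx; first exact: (implyP (H y)).
    by rewrite !mulr_ge0 ?invr_ge0 ?(ltW t0) ?(ltW pR).
  rewrite sumr_const card_ord -[X in X <= _]mulr_natl le_eqVlt; apply/orP; left; apply/eqP.
  by field; rewrite gt_eqF.
rewrite negb_forall => /existsP[y]; rewrite negb_imply -ltNge => /andP[yx Hy].
apply: (@le_trans _ _ ((p%:R / t) ^+ T * p%:R ^+ T * \sum_x \sum_(y | y != x) X x ^+ (2 * i) * X y ^+ (2 * j))); last first.
  by rewrite lerDr.
apply: (@le_trans _ _ ((p%:R / t) ^+ T * p%:R ^+ T * (X x ^+ (2 * i) * X y ^+ (2 * j)))); last first.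
  apply: ler_wpM2l => //; rewrite (bigD1 x) //= (bigD1 y) //= -addrA lerDl addr_ge0 ?sumr_ge0 //.
  by move=> z _; rewrite mulr_ge0 ?exprn_ge0.
have Sle : \sum_x X x <= p%:R * X x.
  apply: le_trans (ler_sum _ (fun y _ => xmax y)) _.
  by rewrite sumr_const card_ord mulr_natl.
apply: (@le_trans _ _ ((p%:R * X x) ^+ T)).
  by apply: lerXn2r; rewrite ?nnegrE ?mulr_ge0 // ltW.
rewrite exprMn [X in _ <= X * _]mulrC -mulrA; apply: ler_wpM2l; first by rewrite exprn_ge0 // ltW.
rewrite {1}/T mulnDr exprD mulrCA; apply: ler_wpM2l; first exact: exprn_ge0.
apply: (@le_trans _ _ ((p%:R / t) ^+ (2 * j) * X y ^+ (2 * j))).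
  rewrite -exprMn; apply: lerXn2r; rewrite ?nnegrE ?mulr_ge0 ?invr_ge0 ?(ltW t0) ?(ltW pR) //.
  have P2 : 0 < p%:R / t by rewrite divr_gt0.
  apply: le_trans (ler_wpM2l (ltW P2) (ltW Hy)).
  by rewrite mulrA mulf_div [t * _]mulrC divff ?mul1r // mulf_neq0 // gt_eqF.
apply: ler_wpM2r; first exact: exprn_ge0.
by apply: ler_weXn2l => //; rewrite /T leq_mul2l leq_addl orbT.
Qed.

(** * Bilinear estimates for two classes at different scales *)

Section Bilinear.
Variables (R : realType) (Z : finComUnitRingType) (p M : nat) (psi : Z -> R[i]).
Local Notation C := R[i].
Local Notation nm := (@Normc.normc R).
Local Notation P := (p%:R : Z).
Hypothesis P_nil : P ^+ M = 0.
Hypothesis p_gt1 : (1 < p)%N.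
Hypothesis psiD : {morph psi : x y / x + y >-> x * y}.
Hypothesis psi_norm : forall x, nm (psi x) = 1.
Variable k : nat.
Hypothesis unit_le : forall n, (0 < n <= k)%N -> (n%:R : Z) \is a GRing.unit.
Hypothesis unit_diff : forall x y : nat, x != y %[mod p] -> (x%:R - y%:R : Z) \is a GRing.unit.

Local Notation ph := (phase p M psi).

Definition dec l n (K : R) := forall w, (l * n <= w <= M)%N ->
  decouples p (@ph l w) (fun=> 1) 0 0 n (tri l) K.

Lemma section_poly_coarser w m m' l (e : 'I_l -> nat) eta t c0 : (m' <= m <= w)%N ->
  section_poly p k w m' e eta t c0 = section_poly p k w m e eta (fun j => P ^+ (m - m') * t j) c0.
Proof.
move=> /andP[h1 h2]; rewrite /section_poly; congr (poly_rV (_ + _)).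
have -> : (w - m' = (w - m) + (m - m'))%N by lia.
rewrite exprD -scalerA; congr (_ *: _); rewrite scaler_sumr.
by apply: eq_bigr => j _; rewrite scalerA.
Qed.

Lemma unit_add_nil (u z : Z) : u \is a GRing.unit -> u + P * z \is a GRing.unit.
Proof.
move=> uu; have -> : u + P * z = u * (1 + P * (z / u)).
  by rewrite mulrDr mulr1 mulrCA [u * _]mulrC divrK.
rewrite unitrM uu /=; apply/unitrPr; set t := P * _.
exists (\sum_(i < M) (- t) ^+ i).
have := subrX1 (- t) M; rewrite -[- t - 1]opprD mulNr exprNn exprMn P_nil mul0r mulr0 sub0r.
by move=> /oppr_inj H; rewrite [1 + t]addrC -H.
Qed.

(* Each application of [decouples_section] may only enlarge the scale by the factor
   1 + 1/l, so reaching [a + m] from [a] takes [N] steps of length at most [inc]. *)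
Lemma decouples_section_iter l (e : 'I_l -> nat) eta w mtop (W : 'rV[Z]_k.+1 -> R) c eps N inc :
  (0 < l)%N -> injective e -> (forall j, (0 < e j <= k)%N) ->
  (mtop <= w <= M)%N -> (forall g, 0 <= W g) ->
  (forall g t c0, W (g + section_poly p k w mtop e eta t c0) = W g) ->
  0 <= c -> (forall n, (l * n <= M)%N -> dec l n (c * p%:R `^ (eps * n%:R))) ->
  forall a m x, x - eta \is a GRing.unit -> (0 < a)%N -> (l * inc <= a)%N -> (m <= N * inc)%N ->
  (l * (a + m) <= mtop)%N ->
  decouples p (@ph k w) W x a m (tri l) (c ^+ N * p%:R `^ (eps * m%:R)).
Proof.
move=> l0 e_inj e_bnd /andP[mw wM] W0 WE c0 Hdec.
elim: N => [|N IH] a m x ux a0 hinc hm hmt.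
  move: hm; rewrite mul0n leqn0 => /eqP->; rewrite expr0 mul1r mulr0 powRr0.
  move=> f s _ _ Hs; rewrite expn0 big_ord1 mul1r.
  by under eq_bigr => g _ do rewrite big_ord1; apply: Hs.
pose m1 := minn inc m.
have m1m : (m1 <= m)%N by rewrite geq_minr.
have m1i : (m1 <= inc)%N by rewrite geq_minl.
have -> : c ^+ N.+1 * p%:R `^ (eps * m%:R) =
    (c * p%:R `^ (eps * m1%:R)) * (c ^+ N * p%:R `^ (eps * (m - m1)%:R)).
  rewrite mulrACA -exprS; congr (_ * _); rewrite -powRD -?mulrDr -?natrD ?subnKC //.
  by apply/implyP => _; rewrite pnatr_eq0; lia.
rewrite -{1}(subnKC m1m); apply: decouples_trans => //; rewrite ?tri_gt0 ?mulr_ge0 ?exprn_ge0 ?powR_ge0 //; first lia.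
  have hl : (l * (a + m1) <= mtop)%N by apply: leq_trans hmt; rewrite leq_mul2l leq_add2l m1m orbT.
  apply: (@decouples_section _ _ _ _ _ P_nil k l e eta x a m1 w (l * m1)) => //.
  - by rewrite -mulnDr [(m1 + a)%N]addnC (leq_trans hl mw).
  - by left; apply: leq_trans hinc; rewrite leq_mul2l m1i orbT.
  - move=> g t c1; have := @section_poly_coarser w mtop (l * m1 + l * a) l e eta t c1.
    rewrite /section_poly => ->; first exact: WE.
    by rewrite -mulnDr [(m1 + a)%N]addnC hl.
  - exact: tri_gt0.
  - by rewrite mulr_ge0 ?powR_ge0.
  - apply: Hdec; last by rewrite leqnn /=; nia.
    nia.
move=> v _; apply: IH; rewrite ?addn_gt0 ?a0 //.
- rewrite addrAC -(prednK a0) exprS -mulrA; exact: unit_add_nil.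
- exact: leq_trans hinc (leq_addr _ _).
- by rewrite /m1; move: hm; rewrite mulSn; lia.
- by rewrite -addnA subnKC.
Qed.

(* The pieces of scale [a] are indexed by residues modulo [p^a]; [f] and [s] give the finest pieces. *)
Definition piece (T : nmodType) n (f : nat -> T) a x : T := \sum_(u < p ^ (n - a)) f (x + p ^ a * u)%N.

Lemma piece_split (T : nmodType) n (f : nat -> T) a m x : (a + m <= n)%N ->
  piece n f a x = \sum_(v < p ^ m) piece n f (a + m) (x + p ^ a * v).
Proof.
move=> h; rewrite /piece; have -> : (n - a = m + (n - (a + m)))%N by lia.
rewrite (@sum_digits T p m (n - (a + m)) (fun u => f (x + p ^ a * u)%N)); last lia.
apply: eq_bigr => v _; apply: eq_bigr => u _.
by rewrite mulnDr expnD !mulnA addnA.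
Qed.

Lemma piece_total (T : nmodType) n (f : nat -> T) : (0 < n)%N ->
  \sum_(v < p ^ n) f v = \sum_(x < p) piece n f 1 x.
Proof.
move=> n0; have := @piece_split T n f 0 1 0%N n0.
rewrite {1}/piece subn0 expn1; under eq_bigr => u _ do rewrite add0n expn0 mul1n.
by move=> ->; apply: eq_bigr => x _; rewrite add0n expn0 mul1n.
Qed.

Local Notation rV := 'rV[Z]_k.+1.

Definition admissible n w (f : nat -> rV -> C) (s : nat -> R) :=
  [/\ forall v, (v < p ^ n)%N -> quasi p (@ph k w) n v%:R (f v),
      forall v, (v < p ^ n)%N -> 0 <= s v &
      forall v, (v < p ^ n)%N -> \sum_g nm (f v g) ^+ (2 * tri k) <= s v ^+ tri k].

Local Notation pc n f a x g := (piece n (fun v => f v g) a x).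

Lemma piece_lt n a x u : (a <= n)%N -> (x < p ^ a)%N -> (u < p ^ (n - a))%N -> (x + p ^ a * u < p ^ n)%N.
Proof.
move=> an xa un; rewrite -(subnKC an) expnD; apply: (@leq_trans (p ^ a + p ^ a * u)).
  by rewrite ltn_add2r.
by rewrite -mulnS leq_mul2l un orbT.
Qed.

Lemma piece_quasi n w f s a x : (a <= n)%N -> (x < p ^ a)%N -> admissible n w f s ->
  quasi p (@ph k w) a x%:R (fun g => pc n f a x g).
Proof.
move=> an xa [Hf _ _]; apply: (@quasi_sum _ _ _ _ _ a (n - a) _ (fun u => f (x + p ^ a * u)%N)) => u hu.
have := Hf _ (piece_lt an xa hu).
by rewrite subnKC // natrD natrM natrX.
Qed.

Lemma piece_ge0 n w f s a x : (a <= n)%N -> (x < p ^ a)%N -> admissible n w f s -> 0 <= piece n s a x.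
Proof. by move=> an xa [_ H _]; apply: sumr_ge0 => u _; apply: H; apply: piece_lt. Qed.

(** The mixed moment of two pieces of scales a and b against their squared norms. The pieces lie in
    distinct classes modulo p, which is the transversality that lower degree decoupling exploits. *)
Definition bilinear n i j a b (K : R) :=
  forall w f s, (k * n <= w <= M)%N -> admissible n w f s ->
  forall x y, (x < p ^ a)%N -> (y < p ^ b)%N -> x != y %[mod p] ->
  \sum_g nm (pc n f a x g) ^+ (2 * i) * nm (pc n f b y g) ^+ (2 * j) <=
  K * piece n s a x ^+ i * piece n s b y ^+ j.

Lemma bilinear_le n i j a b K K' : (a <= n)%N -> (b <= n)%N -> K <= K' ->
  bilinear n i j a b K -> bilinear n i j a b K'.
Proof.
move=> an bn KK H w f s hw ad x y hx hy xy; apply: le_trans (H w f s hw ad x y hx hy xy) _.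
rewrite -!mulrA; apply: ler_wpM2r KK.
by rewrite mulr_ge0 // exprn_ge0 // (piece_ge0 _ _ ad).
Qed.

Lemma bilinear_sym n i j a b K : bilinear n i j a b K -> bilinear n j i b a K.
Proof.
move=> H w f s hw ad x y hx hy xy; rewrite mulrAC.
under eq_bigr => g _ do rewrite mulrC.
by apply: (H w f s hw ad y x hy hx); rewrite eq_sym.
Qed.

(** The piece at x is decoupled from scale a to a + m with |f_b|^(2j) as weight. The norm of the
    other piece is put into the bounds [s] through an i-th root, which turns the bilinear bound at
    scale a + m into the hypothesis of decoupling. *)
Lemma bilinear_refine n i j a m b K D : (0 < i)%N -> (0 < a)%N -> (a + m <= n)%N -> (b <= n)%N -> 0 <= K ->
  (forall w f s, (k * n <= w <= M)%N -> admissible n w f s ->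
   forall x y, (x < p ^ a)%N -> (y < p ^ b)%N -> x != y %[mod p] ->
   decouples p (@ph k w) (fun g => nm (pc n f b y g) ^+ (2 * j)) x%:R a m i D) ->
  bilinear n i j (a + m) b K -> bilinear n i j a b (D * K).
Proof.
move=> i0 a0 amn bn K0 HD HB w f s hw ad x y hx hy xy.
have an : (a <= n)%N by apply: leq_trans amn; rewrite leq_addr.
have [r r0 rE] := nth_root_exists K0 i0.
have Y0 : 0 <= piece n s b y by apply: (piece_ge0 bn hy ad).
have [t t0 tE] := nth_root_exists (exprn_ge0 j Y0) i0.
have lt v : (v < p ^ m)%N -> (x + p ^ a * v < p ^ (a + m))%N.
  by move=> hv; rewrite -[X in (_ < X)%N]/(p ^ (a + m))%N; apply: piece_lt; rewrite ?leq_addr // addKn.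
under eq_bigr => g _ do rewrite mulrC (piece_split _ _ amn).
apply: le_trans (HD w f s hw ad x y hx hy xy
  (fun v g => pc n f (a + m) (x + p ^ a * v) g) (fun v => r * t * piece n s (a + m) (x + p ^ a * v)) _ _ _) _.
- by move=> v hv; have := piece_quasi amn (lt v hv) ad; rewrite natrD natrM natrX.
- by move=> v hv; rewrite !mulr_ge0 // (piece_ge0 amn (lt v hv) ad).
- move=> v hv; under eq_bigr => g _ do rewrite mulrC.
  rewrite !exprMn rE tE mulrAC; apply: (HB w f s hw ad _ _ (lt v hv) hy).
  suff -> : (x + p ^ a * v = x %[mod p])%N by [].
  by rewrite -(prednK a0) expnS -mulnA -modnDmr modnMr addn0.
- by rewrite -mulr_sumr !exprMn rE tE -(piece_split _ _ amn) -!mulrA [piece _ _ b _ ^+ _ * _]mulrC.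
Qed.

Lemma bilinear_crude_left n i j a b K : (0 < i)%N -> (0 < a <= n)%N -> (b <= n)%N -> 0 <= K ->
  bilinear n i j a b K -> bilinear n i j 1 b ((p ^ a)%:R ^+ (2 * i) * K).
Proof.
move=> i0 /andP[a0 an] bn K0 H.
have e : (1 + a.-1 = a)%N by rewrite add1n prednK.
have H' : bilinear n i j (1 + a.-1) b K by rewrite e.
have := @bilinear_refine n i j 1 a.-1 b K ((p ^ a.-1)%:R ^+ (2 * i)) i0 isT _ bn K0 _ H'.
rewrite e => /(_ an) H2; apply: bilinear_le (H2 _) => //; first exact: leq_trans an.
  apply: ler_wpM2r => //.
  by apply: lerXn2r; rewrite ?nnegrE ?ler0n // ler_nat leq_pexp2l ?leq_pred //; lia.
move=> w f s hw ad x y hx hy xy; apply: decouples_crude => // g.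
by apply: exprn_ge0; apply: normc_ge0.
Qed.

(** The way back from the scales a and b to scale 1. Its loss p^(2ai + 2bj) has to be outweighed by
    the gain obtained at the finer scales. *)
Lemma bilinear_crude n i j a b K : (0 < i)%N -> (0 < j)%N -> (0 < a <= n)%N -> (0 < b <= n)%N -> 0 <= K ->
  bilinear n i j a b K ->
  bilinear n i j 1 1 ((p ^ b)%:R ^+ (2 * j) * ((p ^ a)%:R ^+ (2 * i) * K)).
Proof.
move=> i0 j0 ha hb K0 H; apply: bilinear_sym; apply: bilinear_crude_left => //.
- by case/andP: ha => a0 /(leq_trans a0).
- by rewrite mulr_ge0 ?exprn_ge0 ?ler0n.
by apply: bilinear_sym; apply: bilinear_crude_left => //; case/andP: hb.
Qed.

(** Hölder's inequality with weight 1/d on the estimate with x and y exchanged and (d-1)/d on the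
    other one; the two equations say that the exponents match. *)
Lemma bilinear_holder n i j i1 j1 i2 j2 d a b K K1 K2 : (0 < d)%N -> (a <= n)%N -> (b <= n)%N ->
  (d * i = j1 + d.-1 * i2)%N -> (d * j = i1 + d.-1 * j2)%N ->
  0 <= K1 -> 0 <= K2 -> 0 <= K -> K1 * K2 ^+ d.-1 <= K ^+ d ->
  bilinear n i1 j1 b a K1 -> bilinear n i2 j2 a b K2 -> bilinear n i j a b K.
Proof.
case: d => // d _ an bn ei ej K10 K20 K0 KK H1 H2 w f s hw ad x y hx hy xy.
have Sx : 0 <= piece n s a x := piece_ge0 an hx ad.
have Sy : 0 <= piece n s b y := piece_ge0 bn hy ad.
have yx : y != x %[mod p] by rewrite eq_sym.
rewrite -[_ <= _](@ler_pXn2r _ d.+1) ?nnegrE ?mulr_ge0 ?exprn_ge0 //; last first.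
  by apply: sumr_ge0 => g _; rewrite mulr_ge0 // exprn_ge0 // normc_ge0.
pose F1 g := nm (pc n f b y g) ^+ (2 * i1) * nm (pc n f a x g) ^+ (2 * j1).
pose F2 g := nm (pc n f a x g) ^+ (2 * i2) * nm (pc n f b y g) ^+ (2 * j2).
have F10 g : 0 <= F1 g by rewrite mulr_ge0 // exprn_ge0 // normc_ge0.
have F20 g : 0 <= F2 g by rewrite mulr_ge0 // exprn_ge0 // normc_ge0.
have := @holder_pow R _ xpredT d.+1 (fun g => nm (pc n f a x g) ^+ (2 * i) * nm (pc n f b y g) ^+ (2 * j))
  (fun (c : 'I_d.+1) g => if c == ord0 then F1 g else F2 g) isT.
move=> /(_ _ _ _)/le_trans; apply.
- by move=> g; rewrite mulr_ge0 // exprn_ge0 // normc_ge0.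
- by move=> c g; case: ifP.
- move=> g _; rewrite big_ord_recl eqxx /= prodr_const card_ord /F1 /F2 !exprMn -!exprM.
  have -> : (2 * i * d.+1 = 2 * j1 + 2 * i2 * d)%N by rewrite -mulnA [(i * _)%N]mulnC ei /=; ring.
  have -> : (2 * j * d.+1 = 2 * i1 + 2 * j2 * d)%N by rewrite -mulnA [(j * _)%N]mulnC ej /=; ring.
  by rewrite !exprD le_eqVlt; apply/orP; left; apply/eqP; ring.
rewrite big_ord_recl eqxx /= prodr_const card_ord.
have I1 : \sum_g F1 g <= _ := H1 w f s hw ad y x hy hx yx.
have I2 : \sum_g F2 g <= _ := H2 w f s hw ad x y hx hy xy.
have S1 : 0 <= \sum_g F1 g by apply: sumr_ge0.
have S2 : 0 <= \sum_g F2 g by apply: sumr_ge0.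
apply: le_trans (ler_pM S1 (exprn_ge0 d S2) I1 (lerXn2r d S2 (le_trans S2 I2) I2)) _.
rewrite !exprMn -!exprM [(i * _)%N]mulnC [(j * _)%N]mulnC ei ej !exprD /=.
rewrite ![(d * _)%N]mulnC.
have -> (A B D E F G : R) : A * B * D * (E * F * G) = A * E * (D * F * (B * G)) by ring.
rewrite -[X in _ <= X]mulrA; apply: le_trans (ler_wpM2r _ KK) _; rewrite ?mulr_ge0 ?exprn_ge0 //.
Qed.

Lemma psi0 : psi 0 = 1.
Proof.
have := psi_norm 0; have := psiD 0 0; rewrite addr0 => h n0.
have z0 : psi 0 != 0 by apply: contra_eq_neq n0 => ->; rewrite Normc.normc0 eq_sym oner_neq0.
by apply: (mulfI z0); rewrite mulr1.
Qed.

Lemma phaseD l w (g h : 'rV[Z]_l.+1) x : ph w (g + h) x = ph w g x * ph w h x.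
Proof. by rewrite /phase linearD hornerD mulrDr psiD. Qed.

(** Translation-dilation invariance: with all powers 1, ..., k at hand, the class x + p^a Z behaves
    like the whole ring with a range shorter by a. *)
Lemma decouples_rescaled w x a n (K : R) : (0 < k)%N -> (a <= n)%N -> (k * n <= w <= M)%N -> 0 <= K ->
  dec k (n - a) K -> decouples p (@ph k w) (fun=> 1) x a (n - a) (tri k) K.
Proof.
move=> k0 an /andP[hw wM] K0 HD.
have e : (k * (n - a) + k * a = k * n)%N by rewrite -mulnDr subnK.
(* The centre x + 1 makes x - eta = -1 a unit. *)
apply: (@decouples_section _ _ _ _ _ P_nil k k (fun j => j.+1) (x + 1) x a (n - a) w (k * (n - a))) => //.
- by move=> i j [] /val_inj.
- by move=> j; apply: ltn_ord.
- by rewrite opprD addrA subrr sub0r unitrN unitr1.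
- by rewrite e hw.
- by right.
- exact: tri_gt0.
- apply: HD; rewrite leqnn (leq_trans _ wM) // (leq_trans _ hw) // leq_mul2l leq_subr orbT //.
Qed.

Lemma piece_bound n w f s a x K : (0 < k)%N -> (a <= n)%N -> (k * n <= w <= M)%N -> 0 <= K ->
  dec k (n - a) K -> (x < p ^ a)%N -> admissible n w f s ->
  \sum_g nm (pc n f a x g) ^+ (2 * tri k) <= K * piece n s a x ^+ tri k.
Proof.
move=> k0 an hw K0 HD xa [Hf s0 Hs].
have := @decouples_rescaled w x%:R a n K k0 an hw K0 HD (fun u => f (x + p ^ a * u)%N) (fun u => s (x + p ^ a * u)%N).
move=> /(_ _ _ _).
under eq_bigr => g _ do rewrite mul1r.
apply=> u hu.
- by have := Hf _ (piece_lt an xa hu); rewrite subnKC // natrD natrM natrX.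
- by apply: s0; apply: piece_lt.
- by under eq_bigr => g _ do rewrite mul1r; apply: Hs; apply: piece_lt.
Qed.

Lemma bilinear_zero n a b K : (0 < k)%N -> (b <= n)%N -> 0 <= K ->
  dec k (n - b) K -> bilinear n 0 (tri k) a b K.
Proof.
move=> k0 bn K0 HD w f s hw ad x y hx hy xy; rewrite expr0 mulr1.
under eq_bigr => g _ do rewrite muln0 expr0 mul1r.
exact: (piece_bound k0 bn hw K0 HD hy ad).
Qed.

(** Hölder's inequality between the two pieces, each bounded by rescaled decoupling. *)
Lemma bilinear_trivial n i j a b K : (0 < k)%N -> (a <= n)%N -> (b <= n)%N -> 0 <= K -> tri k = (i + j)%N ->
  dec k (n - a) K -> dec k (n - b) K -> bilinear n i j a b K.
Proof.
move=> k0 an bn K0 T Ha Hb w f s hw ad x y hx hy xy.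
have ij0 : (0 < i + j)%N by rewrite -T tri_gt0.
have Sx : 0 <= piece n s a x := piece_ge0 an hx ad.
have Sy : 0 <= piece n s b y := piece_ge0 bn hy ad.
have N0 g a' x' m : 0 <= nm (pc n f a' x' g) ^+ m by apply: exprn_ge0; apply: normc_ge0.
have Ia := piece_bound k0 an hw K0 Ha hx ad; have Ib := piece_bound k0 bn hw K0 Hb hy ad.
rewrite -[_ <= _](@ler_pXn2r _ (i + j)) ?nnegrE ?mulr_ge0 ?exprn_ge0 //; last first.
  by apply: sumr_ge0 => g _; rewrite mulr_ge0.
pose F (c : 'I_(i + j)) g := if (c < i)%N then nm (pc n f a x g) ^+ (2 * tri k) else nm (pc n f b y g) ^+ (2 * tri k).
have FL c g : F (lshift j c) g = nm (pc n f a x g) ^+ (2 * tri k) by rewrite /F /= ltn_ord.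
have FR c g : F (rshift i c) g = nm (pc n f b y g) ^+ (2 * tri k) by rewrite /F /= ltnNge leq_addr.
apply: le_trans (@holder_pow R _ xpredT (i + j) _ F ij0 _ _ _) _.
- by move=> g; rewrite mulr_ge0.
- by move=> c g; rewrite /F; case: ifP.
- move=> g _; rewrite big_split_ord /=.
  rewrite (eq_bigr _ (fun c _ => FL c g)) (eq_bigr _ (fun c _ => FR c g)).
  rewrite !prodr_const !card_ord exprMn -!exprM T.
  have -> : (2 * i * (i + j) = 2 * (i + j) * i)%N by ring.
  by have -> : (2 * j * (i + j) = 2 * (i + j) * j)%N by ring.
rewrite big_split_ord /=.
rewrite (eq_bigr _ (fun c _ => eq_bigr _ (fun g _ => FL c g))) (eq_bigr _ (fun c _ => eq_bigr _ (fun g _ => FR c g))).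
rewrite !prodr_const !card_ord.
have S1 g' z : 0 <= \sum_g nm (pc n f g' z g) ^+ (2 * tri k) by apply: sumr_ge0.
apply: (@le_trans _ _ ((K * piece n s a x ^+ tri k) ^+ i * (K * piece n s b y ^+ tri k) ^+ j)).
  by apply: ler_pM; rewrite ?exprn_ge0 //; apply: lerXn2r; rewrite ?nnegrE ?mulr_ge0 ?exprn_ge0.
rewrite T !exprMn -!exprM le_eqVlt; apply/orP; left; apply/eqP.
by rewrite [((i + j) * i)%N]mulnC [((i + j) * j)%N]mulnC exprD; ring.
Qed.

(** On y + p^b Z the powers (X - y)^e with e > k - l are divisible by p^((k-l+1)b), so shifts along
    these l powers with modulus p^((k-l+1)b) leave |f_b| unchanged. Seen from x, which differs from
    y modulo p, the l powers are as good as a moment curve of degree l. Hence decoupling of degree l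
    applies to the piece at x down to the scale (k-l+1)b/l. *)
Lemma bilinear_lower n l j a m b c eps N inc K :
  (0 < l <= k)%N -> (0 < a)%N -> (b <= n)%N -> (a + m <= n)%N -> (l * inc <= a)%N -> (m <= N * inc)%N ->
  (l * (a + m) <= (k - l).+1 * b)%N -> 0 <= c -> 0 <= K ->
  (forall n, (l * n <= M)%N -> dec l n (c * p%:R `^ (eps * n%:R))) ->
  bilinear n (tri l) j (a + m) b K -> bilinear n (tri l) j a b (c ^+ N * p%:R `^ (eps * m%:R) * K).
Proof.
move=> /andP[l0 lk] a0 bn amn hinc hN hmb c0 K0 Hdec.
apply: bilinear_refine => //; first exact: tri_gt0.
move=> w f s hw ad x y hx hy xy.
have bw : ((k - l).+1 * b <= w)%N.
  case/andP: hw => hw _; apply: leq_trans hw; apply: leq_mul => //; lia.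
apply: (@decouples_section_iter l (fun j => (k - l + j.+1)%N) y%:R w ((k - l).+1 * b) _ c eps N inc) => //.
- by move=> i i' /eqP; rewrite eqn_add2l => /eqP [] /val_inj.
- by move=> i; have := ltn_ord i; lia.
- by case/andP: hw => _ ->; rewrite bw.
- by move=> g; apply: exprn_ge0; apply: normc_ge0.
- move=> g t c1; set h := section_poly _ _ _ _ _ _ _ _.
  have [Hq _ _] := ad.
  have ek (i : 'I_l) : (k - l + i.+1 <= k)%N by have := ltn_ord i; lia.
  have hE u : ph w h (y%:R + P ^+ b * u) = psi (P ^+ (M - w) * c1).
    rewrite /phase horner_section_poly // mulrDr psiD mulrA -exprD.
    suff -> : P ^+ (M - w + (w - (k - l).+1 * b)) * \sum_i t i * (y%:R + P ^+ b * u - y%:R) ^+ (k - l + i.+1) = 0.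
      by rewrite psi0 mul1r.
    rewrite mulr_sumr big1 // => i _; rewrite [_ + _ - _](_ : _ = P ^+ b * u); last by ring.
    rewrite exprMn -exprM mulrCA [P ^+ _ * (_ * _)]mulrA -exprD.
    suff -> : P ^+ (M - w + (w - (k - l).+1 * b) + b * (k - l + i.+1)) = 0 by rewrite mul0r mulr0.
    rewrite -(subnK (_ : M <= M - w + (w - (k - l).+1 * b) + b * (k - l + i.+1))%N) ?exprD ?P_nil ?mulr0 //.
    have : ((k - l).+1 * b <= b * (k - l + i.+1))%N by rewrite mulnC leq_mul2l; lia.
    by case/andP: hw => _; lia.
  have hy0 : ph w h y%:R = psi (P ^+ (M - w) * c1) by have := hE 0; rewrite mulr0 addr0.
  rewrite (piece_quasi bn hy ad) ?hy0 ?Normc.normcM ?psi_norm ?mul1r //.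
- exact: unit_diff.
Qed.

(* Either one residue class mod [p] dominates, or two distinct classes are both large. *)
Lemma dec_bilinear n l (t : R) K B : (0 < l < k)%N -> (0 < n)%N -> 0 < t -> t <= 1 -> 0 <= K -> 0 <= B ->
  dec k n.-1 K -> bilinear n (tri l) (tri k - tri l) 1 1 B ->
  dec k n ((1 + t) ^+ (2 * tri k) * K + (p%:R / t) ^+ (2 * tri k) * p%:R ^+ (2 * tri k) * ((p * p)%:R * B)).
Proof.
move=> /andP[l0 lk] n0 t0 t1 K0 B0 HK HB w hw f s Hf s0 Hs.
have k0 : (0 < k)%N by lia.
have p0 : (0 < p)%N by lia.
have ad : admissible n w f s.
  split=> // v hv; first by have := Hf v hv; rewrite add0n add0r expr0 mul1r.
  by have := Hs v hv; under eq_bigr => g _ do rewrite mul1r.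
set i := tri l; set j := (tri k - tri l)%N.
have T : tri k = (i + j)%N by rewrite subnKC // leq_tri // ltnW.
have x1 (x : 'I_p) : (x < p ^ 1)%N by rewrite expn1.
have S0 (x : 'I_p) : 0 <= piece n s 1 x := piece_ge0 n0 (x1 x) ad.
have A0 : 0 <= (1 + t) ^+ (2 * tri k) by rewrite exprn_ge0 // addr_ge0 // ltW.
have B0' : 0 <= (p%:R / t) ^+ (2 * tri k) * p%:R ^+ (2 * tri k).
  by rewrite mulr_ge0 ?exprn_ge0 ?divr_ge0 ?ler0n ?(ltW t0).
under eq_bigr => g _ do rewrite mul1r (@piece_total _ n (fun v => f v g)) //.
rewrite (@piece_total _ n s) // mulrDl.
have nmS g : nm (\sum_(x < p) pc n f 1 x g) <= \sum_(x < p) nm (pc n f 1 x g) by apply: le_normc_sum.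
apply: (@le_trans _ _ (\sum_g ((1 + t) ^+ (2 * tri k) * \sum_(x < p) nm (pc n f 1 x g) ^+ (2 * tri k) +
    (p%:R / t) ^+ (2 * tri k) * p%:R ^+ (2 * tri k) *
    \sum_(x < p) \sum_(y < p | y != x) nm (pc n f 1 x g) ^+ (2 * i) * nm (pc n f 1 y g) ^+ (2 * j)))).
  apply: ler_sum => g _; apply: (@le_trans _ _ ((\sum_(x < p) nm (pc n f 1 x g)) ^+ (2 * tri k))).
    by apply: lerXn2r; rewrite ?nnegrE ?normc_ge0 ?sumr_ge0 // => x _; apply: normc_ge0.
  rewrite T; apply: (@broad_narrow R p (fun x => nm (pc n f 1 x g))) => // x; exact: normc_ge0.
rewrite big_split /= -!mulr_sumr; apply: lerD.
  rewrite -mulrA; apply: ler_wpM2l => //.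
  rewrite exchange_big /=; apply: (@le_trans _ _ (\sum_(x < p) K * piece n s 1 x ^+ tri k)).
    apply: ler_sum => x _; apply: (piece_bound k0 n0 hw K0 _ (x1 x) ad).
    by rewrite subn1.
  rewrite -mulr_sumr; apply: ler_wpM2l => //.
  by apply: (@sum_pow_ge R 'I_p (fun x => piece n s 1 x)); rewrite ?tri_gt0.
rewrite -[X in _ <= X]mulrA; apply: ler_wpM2l => //.
rewrite exchange_big /=; under eq_bigr => x _ do rewrite exchange_big /=.
set S := \sum_(x < p) piece n s 1 x.
have SS (x : 'I_p) : piece n s 1 x <= S by rewrite /S (bigD1 x) //= lerDl sumr_ge0.
have SP : 0 <= B * S ^+ tri k by rewrite mulr_ge0 ?exprn_ge0 ?sumr_ge0.
apply: (@le_trans _ _ (\sum_(x < p) \sum_(y < p) B * S ^+ tri k)).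
  apply: ler_sum => x _; rewrite big_mkcond; apply: ler_sum => y _; case: ifP => // yx.
  apply: le_trans (HB w f s hw ad x y (x1 x) (x1 y) _) _.
    by rewrite !modn_small // eq_sym.
  rewrite -/i -/j [in X in _ <= X]T exprD -mulrA; apply: ler_wpM2l => //.
  by apply: ler_pM; rewrite ?exprn_ge0 //; apply: lerXn2r; rewrite ?nnegrE // sumr_ge0.
by rewrite !sumr_const !card_ord -mulrnA -[_ *+ _]mulr_natl mulrA.
Qed.
End Bilinear.

(** * Iteration of the bilinear estimates *)

Section Iteration.
Variables (R : realType) (p : nat).
Hypothesis p_gt1 : (1 < p)%N.
Local Notation C := R[i].
Local Notation nm := (@Normc.normc R).

(* The residue ring modulo [p^M] with an injective additive character, in characteristic large
   compared to the degree [k]. *)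
Record padic_setting k (Z : finComUnitRingType) (M : nat) (psi : Z -> C) : Prop := PadicSetting {
  ps_nil : (p%:R : Z) ^+ M = 0;
  ps_morph : {morph psi : x y / x + y >-> x * y};
  ps_norm : forall x, nm (psi x) = 1;
  ps_faithful : forall n u v, (n <= M)%N -> (u < p ^ n)%N -> (v < p ^ n)%N -> u != v ->
    psi ((p%:R : Z) ^+ (M - n) * (u%:R - v%:R)) != 1;
  ps_unit_le : forall n, (0 < n <= k)%N -> (n%:R : Z) \is a GRing.unit;
  ps_unit_diff : forall x y : nat, x != y %[mod p] -> (x%:R - y%:R : Z) \is a GRing.unit }.

Lemma padic_setting_le k l (Z : finComUnitRingType) M (psi : Z -> C) : (l <= k)%N -> padic_setting k M psi -> padic_setting l M psi.
Proof.
move=> lk [h1 h2 h3 h4 h5 h6]; split=> // n /andP[n0 nl]; apply: h5; rewrite n0 /=.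
exact: leq_trans nl lk.
Qed.

(** The constant c depends on p, k and eta only: ring, character and M are quantified after it
    because n and M grow together. *)
Definition dec_exponent k (eta : R) := exists2 c, 0 <= c &
  forall (Z : finComUnitRingType) M (psi : Z -> C), padic_setting k M psi -> forall n, dec p M psi k n (c * p%:R `^ (eta * n%:R)).

Local Notation pw x := (p%:R `^ x : R).

Lemma pwD x y : pw (x + y) = pw x * pw y.
Proof. by rewrite powRD //; apply/implyP => _; rewrite pnatr_eq0; lia. Qed.

Lemma pw_gt0 x : 0 < pw x.
Proof. by apply: powR_gt0; rewrite ltr0n; lia. Qed.

Lemma pw_ge0 x : 0 <= pw x. Proof. exact: ltW (pw_gt0 x). Qed.

Lemma pwX x n : pw x ^+ n = pw (x * n%:R).
Proof. by rewrite powRrM powR_mulrn // pw_ge0. Qed.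

Lemma pwn (n : nat) : (p ^ n)%:R = pw n%:R.
Proof. by rewrite natrX powR_mulrn ?ler0n. Qed.

Lemma ler_pw x y : x <= y -> pw x <= pw y.
Proof. by move=> h; apply: ler_powR => //; rewrite ler1n; lia. Qed.

Lemma pw_ge1 x : 0 <= x -> 1 <= pw x.
Proof. by move=> x0; have := ler_pw x0; rewrite powRr0. Qed.

Lemma pw_gt1 x : 0 < x -> 1 < pw x.
Proof.
move=> x0; have p0 : (p%:R : R) != 0 by rewrite pnatr_eq0 -lt0n ltnW.
by rewrite /powR (negbTE p0) expR_gt1 mulr_gt0 // ln_gt0 // ltr1n.
Qed.

Lemma dec_le (Z : finComUnitRingType) M (psi : Z -> C) k n (K K' : R) : K <= K' -> dec p M psi k n K -> dec p M psi k n K'.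
Proof. by move=> KK H w hw; apply: decouples_le KK (H w hw). Qed.

Lemma dec_exponent_le k eta eta' : eta <= eta' -> dec_exponent k eta -> dec_exponent k eta'.
Proof.
move=> h [c c0 H]; exists c => // Z M psi S n; apply: dec_le (H Z M psi S n).
by apply: ler_wpM2l => //; apply: ler_pw; apply: ler_wpM2r.
Qed.

Lemma dec_exponent_trivial k : (0 < k)%N -> dec_exponent k (2 * tri k)%:R.
Proof.
move=> k0; exists 1 => // Z M psi S n w hw.
have h := @decouples_crude R Z p _ (@phase R Z p M psi k w) (fun=> 1) 0 0 n (tri k) (fun=> ler01) (tri_gt0 k0).
by apply: decouples_le h; rewrite mul1r pwn pwX mulrC.
Qed.

Lemma scale_bounds k l u : (0 < l < k)%N ->
  [/\ ((k - l).+1 <= k)%N, ((k - l) * u <= l * (k - l) * u)%N,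
      (l.+1 * (k - l).+1 * u <= (k + 1) ^ 2 * (l * (k - l) * u))%N,
      (l * (k - l) * u <= l.+1 * (k - l).+1 * u)%N &
      (l.+1 * (k - l).+1 * u <= (l.+1 * (k - l).+1) * (l * u))%N].
Proof.
move=> /andP[l0 lk]; have [d dE] : exists d, k = (d.+1 + l)%N by exists (k - l).-1; lia.
rewrite {lk}dE addnK; case: l l0 => // l _; split; first lia.
- nia.
- rewrite mulnA leq_mul2r; apply/orP; right; apply: leq_trans (leq_pmulr _ _) => //.
  by rewrite -mulnn; apply: leq_mul; lia.
- by rewrite leq_mul2r; apply/orP; right; apply: leq_mul.
- by rewrite leq_mul2l; apply/orP; right; rewrite leq_pmull.
Qed.

(** Here u is (l-1)u', so that the refined scale of x, which is (k-l+2)b/(l-1), is integral as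
    well. *)
Lemma scale_bounds_pred k l u : (1 < l < k)%N ->
  [/\ ((k - l).+1 * (k - l) * (l.-1 * u) <= (k - l).+2 * l * (k - l) * u)%N,
      ((k - l).+2 * l * (k - l) * u <= (k + 1) ^ 2 * (l * (k - l) * (l.-1 * u)))%N &
      ((k - l).+2 * l * (k - l) * u <= 2 * l * ((k - l).+1 * (k - l) * u))%N].
Proof.
move=> /andP[l0 lk]; have [d dE] : exists d, k = (d.+1 + l)%N by exists (k - l).-1; lia.
rewrite {lk}dE addnK; case: l l0 => [|[|l]] // _ /=; split.
- have -> : (d.+2 * d.+1 * (l.+1 * u) = d.+2 * l.+1 * (d.+1 * u))%N by ring.
  have -> : (d.+3 * l.+2 * d.+1 * u = d.+3 * l.+2 * (d.+1 * u))%N by ring.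
  by rewrite leq_mul2r; apply/orP; right; apply: leq_mul.
- have -> : (d.+3 * l.+2 * d.+1 * u = d.+3 * (l.+2 * d.+1 * u))%N by ring.
  have -> : (l.+2 * d.+1 * (l.+1 * u) = l.+1 * (l.+2 * d.+1 * u))%N by ring.
  rewrite [leqRHS]mulnA leq_mul2r; apply/orP; right; apply: leq_trans (leq_pmulr _ _) => //.
  by rewrite -mulnn; apply: leq_trans (leq_pmulr _ _); lia.
- have -> : (d.+3 * l.+2 * d.+1 * u = d.+3 * (l.+2 * d.+1 * u))%N by ring.
  have -> : (2 * l.+2 * (d.+2 * d.+1 * u) = (2 * d.+2) * (l.+2 * d.+1 * u))%N by ring.
  by rewrite leq_mul2r; apply/orP; right; lia.
Qed.

Section Gain.
Variable k : nat.
Hypothesis k_gt1 : (1 < k)%N.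
Hypothesis lower : forall l eps, (0 < l < k)%N -> 0 < eps -> dec_exponent l eps.
Variable eta : R.
Hypothesis eta_dec : dec_exponent k eta.
Hypothesis eta_gt0 : 0 < eta.

(* Gain of [p^(A b)] over the trivial bound at the scales [a = (k-l+1)b/l] and [b];
   [T] bounds how small [b] has to be compared to [n]. *)
Definition gain (T l : nat) (A : R) := exists c B, 0 <= c /\ (0 < B)%N /\
  forall (Z : finComUnitRingType) M (psi : Z -> C), padic_setting k M psi -> forall n a b, (B %| b)%N -> (0 < b)%N ->
  (T * b <= n)%N -> ((0 < l)%N -> (l * a = (k - l).+1 * b)%N) -> (0 < a <= n)%N ->
  bilinear p M psi k n (tri l) (tri k - tri l) a b (c * pw (eta * n%:R - A * b%:R)).

(** The matching of exponents for [bilinear_holder] with d = k - l + 1: tri l is the mean of tri k -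
    tri (k-l), with weight 1/d, and of tri (l-1), with weight (d-1)/d. *)
Lemma tri_convex l : (0 < l < k)%N ->
  ((k - l).+1 * tri l = tri k - tri (k - l) + (k - l) * tri l.-1)%N.
Proof.
move=> /andP[l0 lk]; have := tri_double k; have := tri_double (k - l); have := tri_double l.
have := tri_double l.-1; have := leq_tri (leq_subr l k); rewrite prednK //.
case: l l0 lk => // l _ lk /=; have [d ->] : exists d, k = (d + l.+1)%N by exists (k - l.+1)%N; lia.
by rewrite addnK; nia.
Qed.

Lemma tri_convex_compl l : (0 < l < k)%N ->
  ((k - l).+1 * (tri k - tri l) = tri (k - l) + (k - l) * (tri k - tri l.-1))%N.
Proof.
move=> hl; have := tri_convex hl; have lk : (l <= k)%N by case/andP: hl => _ /ltnW.
have h1 := leq_tri (leq_subr l k); have h2 := leq_tri lk.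
have h3 := leq_tri (leq_trans (leq_pred l) lk).
move: (tri k) (tri l) (tri (k - l)) (tri l.-1) (k - l)%N h1 h2 h3 => K L Y Q x h1 h2 h3.
have h4 : (x * Q <= x * K)%N by rewrite leq_mul2l h3 orbT.
have h5 : (x * L <= x * K)%N by rewrite leq_mul2l h2 orbT.
by rewrite !mulnBr !mulSn; lia.
Qed.

(** For l = 0 only the piece of scale b is left; rescaling shortens its range by b and gains the
    whole exponent eta. *)
Lemma gain_zero_deg : gain 1 0 eta.
Proof.
have [c c0 H] := eta_dec; exists c, 1%N; split=> //; split=> // Z M psi S n a b _ b0 bn _ _.
rewrite mul1n in bn; rewrite subn0.
apply: (bilinear_zero (ps_nil S) (ps_unit_le S)) => //; first lia.
  by rewrite mulr_ge0 // pw_ge0.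
by apply: dec_le (H Z M psi S (n - b)%N); rewrite natrB // mulrBr.
Qed.

Lemma gain_trivial l : (0 < l < k)%N -> gain 1 l 0.
Proof.
move=> /andP[l0 lk]; have [c c0 H] := eta_dec; exists c, 1%N; split=> //; split=> // Z M psi S n a b _ b0 bn _ /andP[a0 an].
rewrite mul1n in bn; rewrite mul0r subr0.
have Kb m : (m <= n)%N -> dec p M psi k (n - m) (c * pw (eta * n%:R)).
  move=> mn; apply: dec_le (H Z M psi S (n - m)%N); apply: ler_wpM2l => //; apply: ler_pw.
  by rewrite ler_pM2l // ler_nat leq_subr.
have K0 : 0 <= c * pw (eta * n%:R) by rewrite mulr_ge0 // pw_ge0.
have T : tri k = (tri l + (tri k - tri l))%N by rewrite subnKC // leq_tri // ltnW.
by apply: (bilinear_trivial (ps_nil S) (ps_unit_le S) _ an bn K0 T (Kb a an) (Kb b bn)); lia.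
Qed.

(** Hölder's inequality produces two estimates. In the first, x and y are exchanged and decoupling
    of degree k - l refines the scale b of y; in the second, decoupling of degree l - 1 refines the
    scale a of x. Both then have the proportions required by the hypotheses. Since l a = (k-l+1) b,
    the gain A1 a, taken with weight 1/(k-l+1), is A1 b / l. *)
Lemma gain_step T l A1 A2 eps : (0 < l < k)%N -> 0 < eps -> (0 < T)%N ->
  gain T (k - l) A1 -> gain T l.-1 A2 ->
  gain ((k + 3) ^ 2 * T) l (A1 / l%:R + (k - l)%:R / (k - l).+1%:R * A2 - eps).
Proof.
move=> /andP[l0 lk] eps0 T0 [C1 [B1 [C10 [B10 H1]]]] [C2 [B2 [C20 [B20 H2]]]].
(* A refinement runs over at most (k+1)^2 b scales, so the exponent eps' loses at most eps b. *)
pose eps' := eps / ((k + 1) ^ 2)%:R.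
have eps'0 : 0 < eps' by rewrite divr_gt0 // ltr0n expn_gt0 addn1.
have [||c1 c10 L1] := @lower (k - l)%N eps'; [lia | done |].
have [c2 c20 L2] : exists2 c, 0 <= c & (1 < l)%N -> forall (Z : finComUnitRingType) M (psi : Z -> C),
    padic_setting l.-1 M psi -> forall n, dec p M psi l.-1 n (c * pw (eps' * n%:R)).
  have [l1|l1] := leqP l 1; first by exists 0 => //; lia.
  have [||c2 c20 L2] := @lower l.-1 eps'; [lia | done |].
  by exists c2 => // _; apply: L2.
set d := (k - l).+1.
pose D1 := c1 ^+ (l.+1 * d) * C1; pose D2 := (c2 ^+ (2 * l) + 1) * C2.
have D10 : 0 <= D1 by rewrite mulr_ge0 ?exprn_ge0.
have D20 : 0 <= D2 by rewrite mulr_ge0 ?addr_ge0 ?exprn_ge0.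
pose mx := maxn 1 l.-1.
exists (D1 + D2), (l * (k - l) * (mx * (B1 * B2)))%N; split; first exact: addr_ge0.
have mx0 : (0 < mx)%N by rewrite leq_max.
have kl0 : (0 < k - l)%N by lia.
split; first by rewrite !muln_gt0 l0 kl0 mx0 B10.
move=> Z M psi S n a b /dvdnP[v bE] b0 Tb /(_ l0) aE an.
pose u := (mx * (B1 * B2) * v)%N.
have {}bE : b = (l * (k - l) * u)%N by rewrite bE /u; ring.
have u0 : (0 < u)%N by move: b0; rewrite bE !muln_gt0 => /andP[].
have {}aE : a = (d * (k - l) * u)%N.
  by apply/eqP; rewrite -(eqn_pmul2l l0) aE bE /d; apply/eqP; ring.
have hlk : (0 < l < k)%N by rewrite l0 lk.
have := scale_bounds u hlk; rewrite -/d -bE; set b1 := (l.+1 * d * u)%N => -[dk lu b1b bb1 b1N].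
have ab : (a <= k * b)%N by rewrite aE -mulnA leq_mul.
have Ta : (T * a <= n)%N.
  apply: leq_trans Tb; rewrite [(_ * T)%N]mulnC -mulnA leq_mul2l (leq_trans ab) ?orbT // leq_mul2r.
  by apply/orP; right; clear; nia.
have k13 : ((k + 1) ^ 2 <= (k + 3) ^ 2)%N by clear; nia.
have big c : (c <= (k + 3) ^ 2)%N -> (c * b <= n)%N.
  by move=> h; apply: leq_trans Tb; rewrite leq_mul2r (leq_trans h) ?orbT // leq_pmulr.
have b1n : (b1 <= n)%N by apply: leq_trans b1b _; apply: big.
have bn : (b <= n)%N by rewrite -[b]mul1n; apply: big; rewrite expn_gt0 addn_gt0 orbT.
have [aa0 aan] := andP an.
have G1 : bilinear p M psi k n (tri (k - l)) (tri k - tri (k - l)) b a (D1 * pw (eps' * ((k + 1) ^ 2 * b)%:R + (eta * n%:R - A1 * a%:R))).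
  have h : bilinear p M psi k n (tri (k - l)) (tri k - tri (k - l)) b1 a (C1 * pw (eta * n%:R - A1 * a%:R)).
    apply: H1 => //.
    - by rewrite aE /u; apply/dvdnP; exists (d * (k - l) * (mx * B2 * v))%N; ring.
    - by move=> _; rewrite aE /b1 subKn ?(ltnW lk) //; ring.
    - by rewrite b1n (leq_trans b0 bb1).
  have := @bilinear_lower R Z p M psi (ps_nil S) p_gt1 (ps_morph S) (ps_norm S) k (ps_unit_le S) (ps_unit_diff S)
    n (k - l) (tri k - tri (k - l)) b (b1 - b) a c1 eps' (l.+1 * d) (l * u) (C1 * pw (eta * n%:R - A1 * a%:R)).
  rewrite subnKC // subKn ?(ltnW lk) //.
  move=> /(_ _ b0 aan b1n _ _ _ c10 _ _ h) hh; apply: bilinear_le (hh _ _ _ _ _ _) => //.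
  - rewrite [X in _ <= _ * X]pwD /D1; set P1 := p%:R `^ (eta * n%:R - A1 * a%:R).
    rewrite [X in _ <= X](_ : _ = c1 ^+ (l.+1 * d) * pw (eps' * ((k + 1) ^ 2 * b)%:R) * (C1 * P1)); last by ring.
    apply: ler_wpM2r; first by rewrite mulr_ge0 // pw_ge0.
    apply: ler_wpM2l; first exact: exprn_ge0.
    by apply: ler_pw; rewrite ler_pM2l // ler_nat; apply: leq_trans b1b; rewrite leq_subr.
  - by rewrite kl0 leq_subr.
  - by rewrite bE mulnCA mulnA.
  - exact: leq_trans (leq_subr _ _) b1N.
  - by rewrite aE /b1 leq_eqVlt; apply/orP; left; apply/eqP; ring.
  - by rewrite mulr_ge0 // pw_ge0.
  - by move=> n' _; apply: L1; apply: padic_setting_le S; rewrite leq_subr.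
have G2 : bilinear p M psi k n (tri l.-1) (tri k - tri l.-1) a b (D2 * pw (eps' * ((k + 1) ^ 2 * b)%:R + (eta * n%:R - A2 * b%:R))).
  (* For l = 1 the second estimate has degree 0 and needs no refinement. *)
  have [l1|l1] := leqP l 1.
    apply: bilinear_le (H2 Z M psi S n a b _ _ _ _ _) => //.
    - rewrite [X in _ <= _ * X]pwD /D2; set P1 := p%:R `^ (eta * n%:R - A2 * b%:R).
      rewrite [X in _ <= X](_ : _ = (c2 ^+ (2 * l) + 1) * pw (eps' * ((k + 1) ^ 2 * b)%:R) * (C2 * P1)); last by ring.
      apply: ler_peMl; first by rewrite mulr_ge0 // pw_ge0.
      rewrite -[X in X <= _]mul1r; apply: ler_pM => //; first by rewrite lerDr exprn_ge0.
      have := @ler_pw 0 (eps' * ((k + 1) ^ 2 * b)%:R); rewrite powRr0; apply.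
      by rewrite mulr_ge0 ?ler0n // ltW.
    - by rewrite bE /u; apply/dvdnP; exists (l * (k - l) * (mx * B1 * v))%N; ring.
    - by apply: leq_trans Tb; rewrite leq_mul2r leq_pmull ?orbT // expn_gt0 addn_gt0 orbT.
    - by move=> h; have := leq_trans h (leq_pred l); lia.
  have mxE : mx = l.-1 by rewrite /mx; apply/maxn_idPr; lia.
  pose u' := (B1 * B2 * v)%N.
  have uE : u = (l.-1 * u')%N by rewrite /u mxE /u'; ring.
  pose a2 := (d.+1 * l * (k - l) * u')%N.
  have := @scale_bounds_pred k l u'; rewrite l1 lk -uE -/d -bE -/a2 => /(_ isT)[aa2 a2b a2N].
  rewrite -aE in aa2.
  have a2n : (a2 <= n)%N by apply: leq_trans a2b _; apply: big.
  have kl1 : (k - l.-1 = d)%N by rewrite /d; clear -l0 lk; lia.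
  have l10 : (0 < l.-1)%N by clear -l1; lia.
  have h : bilinear p M psi k n (tri l.-1) (tri k - tri l.-1) a2 b (C2 * pw (eta * n%:R - A2 * b%:R)).
    apply: H2 => //.
    - by rewrite bE /u; apply/dvdnP; exists (l * (k - l) * (mx * B1 * v))%N; ring.
    - by apply: leq_trans Tb; rewrite leq_mul2r leq_pmull ?orbT // expn_gt0 addn_gt0 orbT.
    - by move=> _; rewrite kl1 /a2 bE uE; ring.
    - by rewrite a2n (leq_trans aa0 aa2).
  have := @bilinear_lower R Z p M psi (ps_nil S) p_gt1 (ps_morph S) (ps_norm S) k (ps_unit_le S) (ps_unit_diff S)
    n l.-1 (tri k - tri l.-1) a (a2 - a) b c2 eps' (2 * l) (d * (k - l) * u') (C2 * pw (eta * n%:R - A2 * b%:R)).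
  rewrite subnKC // kl1.
  move=> /(_ _ aa0 bn a2n _ _ _ c20 _ _ h) hh; apply: bilinear_le (hh _ _ _ _ _ _) => //.
  - rewrite [X in _ <= _ * X]pwD /D2; set P1 := p%:R `^ (eta * n%:R - A2 * b%:R).
    rewrite [X in _ <= X](_ : _ = (c2 ^+ (2 * l) + 1) * pw (eps' * ((k + 1) ^ 2 * b)%:R) * (C2 * P1)); last by ring.
    apply: ler_wpM2r; first by rewrite mulr_ge0 // pw_ge0.
    apply: ler_pM; rewrite ?exprn_ge0 ?pw_ge0 ?lerDl //.
    by apply: ler_pw; rewrite ler_pM2l // ler_nat; apply: leq_trans a2b; rewrite leq_subr.
  - by rewrite l10; clear -lk; lia.
  - by rewrite aE uE leq_eqVlt; apply/orP; left; apply/eqP; ring.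
  - exact: leq_trans (leq_subr _ _) a2N.
  - by rewrite bE uE /a2 leq_eqVlt; apply/orP; left; apply/eqP; ring.
  - by rewrite mulr_ge0 // pw_ge0.
  - by move=> n' _; apply: L2 => //; apply: padic_setting_le S; clear -lk; lia.
clearbody D1 D2.
apply: (@bilinear_holder R Z p M psi k n _ _ (tri (k - l)) (tri k - tri (k - l)) (tri l.-1) (tri k - tri l.-1) d a b) G1 G2 => //.
- exact: (tri_convex (introT andP (conj l0 lk))).
- exact: (tri_convex_compl hlk).
- by rewrite mulr_ge0 // pw_ge0.
- by rewrite mulr_ge0 // pw_ge0.
- by rewrite mulr_ge0 ?pw_ge0 // addr_ge0.
rewrite !exprMn !pwX mulrACA -pwD [d.-1]/=.
apply: ler_pM; rewrite ?pw_ge0 ?mulr_ge0 ?exprn_ge0 //.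
  rewrite exprS; apply: ler_pM; rewrite ?exprn_ge0 ?lerDl //.
  by apply: lerXn2r; rewrite ?nnegrE ?addr_ge0 ?lerDr.
apply: ler_pw; rewrite /eps'.
have dE : d%:R = (k - l)%:R + 1 :> R by rewrite natr1.
have lR : l%:R != 0 :> R by rewrite pnatr_eq0 -lt0n.
have dR : d%:R != 0 :> R by rewrite pnatr_eq0.
have kR : ((k + 1) ^ 2)%:R != 0 :> R by rewrite pnatr_eq0 -lt0n expn_gt0 addn1.
have aR : a%:R = d%:R * b%:R / l%:R :> R.
  by apply: (mulIf lR); rewrite divfK // -!natrM; congr (_ %:R); rewrite aE bE; ring.
rewrite aR natrM le_eqVlt; apply/orP; left; apply/eqP.
rewrite dE in dR *.
clear dE aR; set X := (((k + 1) ^ 2)%:R : R) in kR *; set x := ((k - l)%:R : R) in dR *; set y := (l%:R : R) in lR *.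
by clearbody X x y; field; rewrite kR lR dR.
Qed.

(* Gains obtained after [i] rounds, normalised by [eta]; the sum over [0 < l < k] increases by a
   fixed amount in each round. *)
Fixpoint gain_seq i l : R :=
  if l is 0 then 1 else
  if i is i'.+1 then gain_seq i' (k - l)%N / l%:R + (k - l)%:R / (k - l).+1%:R * gain_seq i' l.-1%N - (4 * k)%:R^-1
  else 0.

Lemma gain_seq0 i : gain_seq i 0 = 1. Proof. by case: i. Qed.

Lemma gain_le T T' l A : (T <= T')%N -> gain T l A -> gain T' l A.
Proof.
move=> TT [c [B [c0 [B0 H]]]]; exists c, B; split=> //; split=> // Z M psi S n a b Bb b0 Tb.
by apply: H => //; apply: leq_trans Tb; rewrite leq_mul2r TT orbT.
Qed.

Lemma gain_iter i l : (l < k)%N -> gain (((k + 3) ^ 2) ^ i) l (eta * gain_seq i l).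
Proof.
have T0 j : (0 < ((k + 3) ^ 2) ^ j)%N by rewrite !expn_gt0 addn_gt0 orbT.
elim: i l => [|i IH] [|l] lk; rewrite ?gain_seq0 ?mulr1.
- by rewrite expn0; apply: gain_zero_deg.
- by rewrite /= mulr0 expn0; apply: gain_trivial.
- by apply: gain_le gain_zero_deg; apply: T0.
rewrite expnS.
have -> : eta * gain_seq i.+1 l.+1 = eta * gain_seq i (k - l.+1)%N / l.+1%:R +
    (k - l.+1)%:R / (k - l.+1).+1%:R * (eta * gain_seq i l) - eta / (4 * k)%:R by rewrite /=; ring.
apply: gain_step (IH _ _) (IH _ _) => //.
- by rewrite mulr_gt0 // invr_gt0 ltr0n muln_gt0 /= ltnW.
- by rewrite ltn_subrL /= ltnW.
- exact: ltnW.
Qed.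

(** In the recursion summed over l, the value at m > 0 enters with weight 1/(k-m) from l = k - m and
    (k-m-1)/(k-m) from l = m + 1, in total 1. The value 1 at m = 0 enters with (k-1)/k, and the
    subtracted terms add up to (k-1)/(4k). The net increase 3(k-1)/(4k) is at least 1/8. *)
Lemma gain_seq_sum i : i%:R / 8%:R <= \sum_(l < k.-1) gain_seq i l.+1.
Proof.
have [K kE] : exists K, k = K.+2 by exists k.-2; clear -k_gt1; lia.
elim: i => [|i IH]; first by rewrite mul0r big1.
rewrite kE /= in IH *; rewrite kE big_split big_split /=.
set f := gain_seq i in IH *.
have -> : \sum_(l < K.+1) f (K.+2 - l.+1)%N / l.+1%:R = \sum_(l < K.+1) f l.+1 / (K.+1 - l)%:R.
  rewrite (reindex_inj rev_ord_inj) /=; apply: eq_bigr => l _; have := ltn_ord l => lK.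
  by congr (f _ / _%:R); clear -lK; lia.
have -> : \sum_(l < K.+1) (K.+2 - l.+1)%:R / (K.+2 - l.+1).+1%:R * f l =
    K.+1%:R / K.+2%:R + \sum_(l < K.+1) (K - l)%:R / (K.+1 - l)%:R * f l.+1.
  rewrite big_ord_recl (_ : f (@ord0 K) = 1) ?mulr1 ?subSS ?subn0; last exact: gain_seq0.
  congr (_ + _).
  rewrite [RHS]big_ord_recr /= subnn !mul0r addr0; apply: eq_bigr => l _.
  by rewrite /bump /= add1n !subSS -subSn ?subSS // ltnW.
have -> (A B D E : R) : A + (D + B) + E = (A + B) + (D + E) by ring.
rewrite -big_split /=.
have -> : \sum_(l < K.+1) (f l.+1 / (K.+1 - l)%:R + (K - l)%:R / (K.+1 - l)%:R * f l.+1) = \sum_(l < K.+1) f l.+1.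
  apply: eq_bigr => l _; have lK : (l <= K)%N by rewrite -ltnS.
  rewrite subSn // -natr1; field.
  by rewrite natr1 pnatr_eq0.
rewrite -natr1 mulrDl; apply: lerD => //.
rewrite sumr_const card_ord -[(- _) *+ _]mulr_natl.
have -> : (4 * K.+2)%:R = 4%:R * (K%:R + 2) :> R by rewrite natrM; congr (_ * _); rewrite -addn2 natrD.
have K0 : 0 <= K%:R :> R by rewrite ler0n.
rewrite -[K.+2]addn2 -[K.+1]addn1 !natrD.
have h : 0 < K%:R + 2 :> R by lra.
have -> : (K%:R + 1) / (K%:R + 2) + (K%:R + 1) * - (4%:R * (K%:R + 2))^-1 = 3%:R / 4%:R * (K%:R + 1) / (K%:R + 2) :> R.
  by field; rewrite gt_eqF.
rewrite ler_pdivlMr // ; lra.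
Qed.

Lemma gain_large (H : R) : exists i, exists2 l, (0 < l < k)%N & H <= gain_seq i l.
Proof.
pose i := (Num.truncn (`|H| * k%:R * 8%:R)).+1; exists i.
have : exists l : 'I_k.-1, H <= gain_seq i l.+1.
  apply/existsP; rewrite -[[exists _, _]]negbK negb_exists; apply/forallP => h.
  have := gain_seq_sum i; apply/negP; rewrite -ltNge.
  apply: (@le_lt_trans _ _ (\sum_(l < k.-1) `|H|)).
    by apply: ler_sum => l _; apply: le_trans (ler_norm H); apply: ltW; rewrite ltNge h.
  rewrite sumr_const card_ord ltr_pdivlMr // -[_ *+ k.-1]mulr_natr.
  apply: (@le_lt_trans _ _ (`|H| * k%:R * 8%:R)); last by rewrite truncnS_gt.
  by rewrite ler_wpM2r // ler_wpM2l // ler_nat leq_pred.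
case=> l Hl; exists l.+1 => //; have := ltn_ord l; move: k_gt1; clear; lia.
Qed.

(** With b close to n/(kT), the crude return to scale 1 costs at most p^(4 tri(k) (k+1) b). A gain
    exceeding this by H leaves p^(-H b), a fixed power of p^n. *)
Lemma bilinear_gain T l A H : gain T l A -> (0 < l < k)%N -> (0 < T)%N -> 0 <= H ->
  ((4 * tri k) * (k + 1))%:R + H <= A ->
  exists c n0, 0 <= c /\ forall (Z : finComUnitRingType) M (psi : Z -> C), padic_setting k M psi ->
  forall n, (n0 <= n)%N ->
  bilinear p M psi k n (tri l) (tri k - tri l) 1 1 (c * pw ((eta - H / (k * T)%:R) * n%:R)).
Proof.
move=> [c [B [c0 [B0 G]]]] /andP[l0 lk] T0 H0 HA.
pose n0 := (k * T * (l * B))%N.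
have kT0 : (0 < k * T)%N by rewrite muln_gt0 T0 ltnW.
have lB0 : (0 < l * B)%N by rewrite muln_gt0 l0.
exists (c * pw (H * (l * B)%:R)), n0; split; first by rewrite mulr_ge0 ?pw_ge0.
move=> Z M psi S n n0n; pose m := (n %/ n0)%N; pose b := (l * B * m)%N.
have n00 : (0 < n0)%N by rewrite muln_gt0 kT0.
have m0 : (0 < m)%N by rewrite divn_gt0.
pose a := ((k - l).+1 * B * m)%N.
have b0 : (0 < b)%N by rewrite muln_gt0 lB0.
have a0 : (0 < a)%N by rewrite !muln_gt0 /= B0.
have kTb : (k * T * b <= n)%N by rewrite /b mulnA mulnC leq_divM.
have ab : (a <= k * b)%N.
  rewrite /a /b -!mulnA; apply: leq_mul; first by clear -l0 lk; lia.
  exact: leq_pmull.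
have an : (a <= n)%N.
  apply: leq_trans ab _; apply: leq_trans kTb; rewrite leq_mul2r; apply/orP; right; exact: leq_pmulr.
have bn : (b <= n)%N by apply: leq_trans kTb; exact: leq_pmull.
have K0 : 0 <= c * pw (eta * n%:R - A * b%:R) by rewrite mulr_ge0 ?pw_ge0.
have h : bilinear p M psi k n (tri l) (tri k - tri l) a b (c * pw (eta * n%:R - A * b%:R)).
  apply: G => //.
  - by rewrite /b -mulnA dvdn_mull // dvdn_mulr.
  - apply: leq_trans kTb; rewrite leq_mul2r; apply/orP; right; exact: leq_pmull (ltnW k_gt1).
  - by move=> _; rewrite /a /b; ring.
  - by rewrite a0 an.
have tl : (0 < tri l)%N := tri_gt0 l0.
have tkl : (0 < tri k - tri l)%N.
  rewrite subn_gt0; have := leq_tri lk; rewrite triS; lia.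
have := bilinear_crude p_gt1 tl tkl (introT andP (conj a0 an)) (introT andP (conj b0 bn)) K0 h.
apply: bilinear_le; rewrite ?(leq_trans b0 bn) //.
rewrite !pwn !pwX.
have -> (x y z t : R) : x * (y * (z * t)) = z * (x * (y * t)) by ring.
rewrite -mulrA; apply: ler_wpM2l => //.
rewrite -!pwD; apply: ler_pw.
have e1 : b%:R * (2 * (tri k - tri l))%:R + a%:R * (2 * tri l)%:R <= ((4 * tri k) * (k + 1))%:R * b%:R :> R.
  rewrite -!natrM -natrD ler_nat.
  apply: (@leq_trans (b * (2 * tri k) + k * b * (2 * tri k))); last by clear; nia.
  apply: leq_add; first by rewrite leq_mul2l leq_mul2l leq_subr !orbT.
  by apply: leq_mul ab _; rewrite leq_mul2l leq_tri ?orbT // ltnW.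
have e2 : n%:R <= (k * T)%:R * (b + l * B)%:R :> R.
  rewrite -natrM ler_nat /b addnC -mulnS mulnA -/n0 mulnC.
  by apply: ltnW; apply: ltn_ceil.
have bR : 0 < b%:R :> R by rewrite ltr0n.
have kTR : 0 < (k * T)%:R :> R by rewrite ltr0n.
have e3 : H / (k * T)%:R * n%:R <= H * b%:R + H * (l * B)%:R.
  rewrite -mulrDr -natrD -mulrA; apply: ler_wpM2l => //.
  by rewrite ler_pdivrMl.
have e4 : (((4 * tri k) * (k + 1))%:R + H) * b%:R <= A * b%:R by rewrite ler_pM2r.
rewrite mulrBl; move: e1 e3 e4; rewrite mulrDl; lra.
Qed.

Lemma onePt_exp_le (t : R) N : 0 <= t -> t <= 1 -> (1 + t) ^+ N <= 1 + 2 ^+ N * t.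
Proof.
move=> t0 t1; suff : (1 + t) ^+ N <= 1 + (2 ^+ N - 1) * t.
  by move/le_trans; apply; rewrite lerD2l ler_wpM2r // gerBl.
elim: N => [|N IH]; first by rewrite !expr0 subrr mul0r addr0.
rewrite !exprS; apply: le_trans (ler_wpM2l (addr_ge0 ler01 t0) IH) _.
have : 1 <= 2 ^+ N :> R by rewrite exprn_ege1 // ler1n.
move: (2 ^+ N) => X X1; rewrite -subr_ge0.
have -> : 1 + (2 * X - 1) * t - (1 + t) * (1 + (X - 1) * t) = (X - 1) * t * (1 - t) by ring.
by rewrite !mulr_ge0 // subr_ge0.
Qed.

(** Induction on n. A dominant class costs a factor (1+t)^N per step, and the bilinear term adds a
    multiple of p^(h n). With (1+t)^N at most p^(h/2) the first part shrinks relative to p^(h n);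
    [C'] sums the resulting geometric series and covers the initial range of n. The maximum with e0
    keeps h positive, so that such a t exists. *)
Lemma dec_exponent_step l (kappa e0 : R) : (0 < l < k)%N -> 0 < e0 ->
  (exists c n0, 0 <= c /\ forall (Z : finComUnitRingType) M (psi : Z -> C), padic_setting k M psi ->
    forall n, (n0 <= n)%N ->
    bilinear p M psi k n (tri l) (tri k - tri l) 1 1 (c * pw ((eta - kappa) * n%:R))) ->
  dec_exponent k (Num.max (eta - kappa) e0).
Proof.
move=> hl e00 [c [n0 [c0 HB]]]; set h := Num.max _ _.
have h0 : 0 < h by rewrite lt_max e00 orbT.
have k0 : (0 < k)%N := ltnW k_gt1.
set N := (2 * tri k)%N.
have q1 : 1 < pw (h / 2%:R) by apply: pw_gt1; rewrite divr_gt0.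
pose t := Num.min 1 ((pw (h / 2%:R) - 1) / 2 ^+ N).
have t0 : 0 < t by rewrite lt_min ltr01 divr_gt0 ?subr_gt0 // exprn_gt0.
have t1 : t <= 1 by rewrite ge_min lexx.
have tN : (1 + t) ^+ N <= pw (h / 2%:R).
  apply: le_trans (onePt_exp_le _ (ltW t0) t1) _.
  have : t <= (pw (h / 2%:R) - 1) / 2 ^+ N by rewrite ge_min lexx orbT.
  by rewrite ler_pdivlMr ?exprn_gt0 // [t * _]mulrC; lra.
pose cb := (p%:R / t) ^+ N * p%:R ^+ N * ((p * p)%:R * c).
have cb0 : 0 <= cb by rewrite !mulr_ge0 ?exprn_ge0 ?divr_ge0 ?ler0n // ltW.
pose r := pw (- (h / 2%:R)).
have r1 : r < 1 by rewrite /r powRN invf_lt1 ?pw_gt0.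
pose C' := pw (N%:R * n0.+1%:R) + cb / (1 - r).
have C'0 : 0 <= C' by rewrite addr_ge0 ?pw_ge0 // divr_ge0 // subr_ge0 ltW.
have C'1 : pw (N%:R * n0.+1%:R) <= C' by rewrite lerDl divr_ge0 // subr_ge0 ltW.
have C'2 : cb + C' * r <= C'.
  have : cb / (1 - r) <= C' by rewrite lerDr pw_ge0.
  rewrite ler_pdivrMr ?subr_gt0 //; lra.
exists C' => // Z M psi S; elim=> [|n IH].
  move=> w hw; have H := @decouples_crude R Z p _ (@phase R Z p M psi k w) (fun=> 1) 0 0 0 (tri k) (fun=> ler01) (tri_gt0 k0).
  apply: decouples_le H; rewrite expn0 expr1n mulr0 powRr0 mulr1; apply: le_trans C'1.
  by apply: pw_ge1; rewrite mulr_ge0 ?ler0n.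
have [nn0|nn0] := leqP n0 n.+1; last first.
  move=> w hw; have H := @decouples_crude R Z p _ (@phase R Z p M psi k w) (fun=> 1) 0 0 n.+1 (tri k) (fun=> ler01) (tri_gt0 k0).
  apply: decouples_le H; rewrite pwn pwX -[X in X <= _]mulr1; apply: ler_pM; rewrite ?pw_ge0 //.
    apply: le_trans C'1; apply: ler_pw; rewrite mulrC; apply: ler_wpM2l => //.
    by rewrite ler_nat ltnW // ltnW.
  by apply: pw_ge1; rewrite mulr_ge0 ?ler0n // ltW.
have Bn : bilinear p M psi k n.+1 (tri l) (tri k - tri l) 1 1 (c * pw (h * n.+1%:R)).
  apply: bilinear_le (HB Z M psi S n.+1 nn0) => //.
  apply: ler_wpM2l => //; apply: ler_pw; apply: ler_wpM2r => //.
  by rewrite le_max lexx.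
have K0 m : 0 <= C' * pw m by rewrite mulr_ge0 ?pw_ge0.
have B0 : 0 <= c * pw (h * n.+1%:R) by rewrite mulr_ge0 ?pw_ge0.
have := dec_bilinear (ps_nil S) p_gt1 (ps_unit_le S) hl (ltn0Sn n) t0 t1 (K0 _) B0 IH Bn.
apply: dec_le; rewrite -/N.
have -> : (p%:R / t) ^+ N * p%:R ^+ N * ((p * p)%:R * (c * pw (h * n.+1%:R))) = cb * pw (h * n.+1%:R) by rewrite /cb; ring.
apply: (@le_trans _ _ ((cb + C' * r) * pw (h * n.+1%:R))); last by apply: ler_wpM2r; rewrite ?pw_ge0.
rewrite [leRHS]mulrDl [leRHS]addrC lerD2r.
apply: le_trans (ler_wpM2r (K0 _) tN) _.
rewrite mulrCA -mulrA; apply: ler_wpM2l => //; rewrite -!pwD; apply: ler_pw.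
by rewrite -[n.+1%:R]natr1 mulrDr mulr1; lra.
Qed.

End Gain.

Lemma conj_norm1 (z : C) : nm z = 1 -> z^*%C = z^-1.
Proof.
move=> h; have := normc_sqr z; rewrite h expr1n => e.
have z0 : z != 0 by apply: contra_eq_neq h => ->; rewrite Normc.normc0 eq_sym oner_neq0.
by apply: (mulfI z0); rewrite divff // -e.
Qed.

(* In degree one decoupling is orthogonality of the pieces. *)
Lemma dec_exponent_one : dec_exponent 1 0.
Proof.
exists 1 => // Z M psi S n w hw f s Hf s0 Hs; rewrite mul0r powRr0 !mul1r.
have t1 : tri 1 = 1%N by [].
rewrite t1 expr1 muln1 in Hs *.
have p0 := psi0 (ps_morph S) (ps_norm S).
pose D v u := \sum_g f v g * (f u g)^*%C.
have D0 v u : (v < p ^ n)%N -> (u < p ^ n)%N -> v != u -> D v u = 0.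
  (* A shift of the linear coefficient whose phase is constant on classes modulo p^n and separates
     distinct classes. *)
  move=> hv hu vu; pose h : 'rV[Z]_2 := poly_rV ((p%:R : Z) ^+ (w - n) *: 'X).
  have hE x : phase p M psi w h x = psi ((p%:R : Z) ^+ (M - n) * x).
    rewrite /phase poly_rV_K; last by apply: leq_trans (size_scale_leq _ _) _; rewrite size_polyX.
    by rewrite hornerZ hornerX mulrA -exprD; congr (psi (_ ^+ _ * _)); clear -hw; lia.
  have hc x y : phase p M psi w h (x + (p%:R : Z) ^+ n * y) = phase p M psi w h x.
    rewrite !hE mulrDr (ps_morph S) mulrA -exprD subnK; last by clear -hw; lia.
    by rewrite (ps_nil S) mul0r p0 mulr1.
  have fv g : f v (g + h) = phase p M psi w h v%:R * f v g.
    by have := Hf v hv h; rewrite add0n add0r expr0 mul1r; apply.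
  have fu g : f u (g + h) = phase p M psi w h u%:R * f u g.
    by have := Hf u hu h; rewrite add0n add0r expr0 mul1r; apply.
  have : D v u = psi ((p%:R : Z) ^+ (M - n) * (v%:R - u%:R)) * D v u.
    rewrite {1}/D (reindex_inj (addIr h)) mulr_sumr; apply: eq_bigr => g _.
    rewrite fv fu rmorphM /= mulrACA; congr (_ * _).
    rewrite conj_norm1 ?(ps_norm S) // !hE mulrBr (ps_morph S); congr (_ * _).
    apply: (mulfI (x := psi ((p%:R : Z) ^+ (M - n) * u%:R))).
      by apply: contra_eq_neq (ps_norm S ((p%:R : Z) ^+ (M - n) * u%:R)) => ->; rewrite Normc.normc0 eq_sym oner_neq0.
    rewrite divff -?(ps_morph S) ?subrr ?p0 //.
      by apply: contra_eq_neq (ps_norm S ((p%:R : Z) ^+ (M - n) * u%:R)) => ->; rewrite Normc.normc0 eq_sym oner_neq0.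
  have nM : (n <= M)%N by clear -hw; lia.
  have ne := ps_faithful S nM hv hu vu.
  set q := psi _ in ne *; move/eqP; rewrite -subr_eq0 -{1}[D v u]mul1r -mulrBl mulf_eq0 subr_eq0 eq_sym (negbTE ne) /=.
  by move/eqP.
have key : \sum_g nm (\sum_(v < p ^ n) f v g) ^+ 2 = \sum_(v < p ^ n) \sum_g nm (f v g) ^+ 2.
  apply: complexI; rewrite !rmorph_sum /=.
  under eq_bigr => g _.
    rewrite normc_sqr rmorph_sum big_distrlr /=; over.
  rewrite exchange_big /=; apply: eq_bigr => v _.
  rewrite exchange_big /= (bigD1 v) //= [X in _ + X]big1 ?addr0; last first.
    by move=> u uv; apply: D0 => //; rewrite eq_sym.
  by rewrite rmorph_sum; apply: eq_bigr => g _; rewrite /= normc_sqr.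
under eq_bigr => g _ do rewrite mul1r.
rewrite key; apply: ler_sum => v _.
by have := Hs v (ltn_ord v); under eq_bigr => g _ do rewrite mul1r.
Qed.

(* The gain per step is bounded below while [eta >= e0], so finitely many steps reach [e0]. *)
Lemma dec_exponent_all k eps : (0 < k)%N -> 0 < eps -> dec_exponent k eps.
Proof.
elim/ltn_ind: k eps => k IH eps k0 e0.
have [k1|k1] := leqP k 1.
  have -> : k = 1%N by clear -k0 k1; lia.
  exact: dec_exponent_le (ltW e0) dec_exponent_one.
have lower l (e : R) : (0 < l < k)%N -> 0 < e -> dec_exponent l e.
  by move=> /andP[l0 lk] e1; apply: IH.
pose Q : R := ((4 * tri k) * (k + 1))%:R + 1.
have Q0 : 0 < Q by rewrite ltr_wpDl ?ler0n.
have [i [l hl HA]] := gain_large k1 (Q / eps).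
pose T := (((k + 3) ^ 2) ^ i)%N.
have T0 : (0 < T)%N by rewrite !expn_gt0 addn_gt0 orbT.
pose kappa : R := 1 / (k * T)%:R.
have kap0 : 0 < kappa by rewrite divr_gt0 // ltr0n muln_gt0 k0.
pose E0 : R := (2 * tri k)%:R.
have step j : dec_exponent k (Num.max (E0 - j%:R * kappa) eps).
  elim: j => [|j IHj].
    by apply: dec_exponent_le (dec_exponent_trivial k0); rewrite mul0r subr0 le_max lexx.
  set eta := Num.max _ _ in IHj.
  have ee : eps <= eta by rewrite le_max lexx orbT.
  have eta0 : 0 < eta := lt_le_trans e0 ee.
  have lk : (l < k)%N by case/andP: hl.
  have G := gain_iter k1 lower IHj eta0 i lk.
  have HQ : Q <= eta * gain_seq k i l.
    have := HA; rewrite ler_pdivrMr // => h; apply: le_trans h _; rewrite mulrC.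
    apply: ler_wpM2r => //; apply: le_trans HA; rewrite divr_ge0 // ltW //.
  have B := bilinear_gain k1 eta0 G hl T0 ler01 HQ.
  have D := dec_exponent_step k1 hl e0 B.
  apply: dec_exponent_le D.
  rewrite -/T -/kappa ge_max le_max [X in _ && X]le_max lexx orbT andbT.
  rewrite /eta; case: (leP (E0 - j%:R * kappa) eps) => h.
    by apply/orP; right; rewrite gerBl ltW.
  by apply/orP; left; rewrite -natr1 mulrDl mul1r opprD addrA.
pose j := (Num.truncn (E0 / kappa)).+1.
have : E0 - j%:R * kappa <= eps.
  have : E0 / kappa < j%:R by rewrite truncnS_gt.
  rewrite ltr_pdivrMr //; lra.
by move/max_idPr => h; have := step j; rewrite h.
Qed.
End Iteration.

(** * Additive characters *)

Module SineBound.
Import normed_module.numFieldNormedType.Exports.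

Lemma sin_le_id (R : realType) (x : R) : 0 <= x -> sin x <= x.
Proof.
rewrite le_eqVlt => /predU1P[<-|x0]; first by rewrite sin0.
have [|c _] := @derive.MVT R sin cos 0 x x0.
- by apply: subspace_topology.continuous_subspaceT => y; apply: continuous_sin.
rewrite sin0 !subr0 => ->; rewrite -[leRHS]mul1r; apply: ler_wpM2r (cos_le1 c); exact: ltW.
Qed.

End SineBound.

Section Exponential.
Variable R : realType.
Local Notation C := R[i].
Local Notation nm := (@Normc.normc R).

Definition expi (x : R) : C := (cos (pi *+ 2 * x) +i* sin (pi *+ 2 * x))%C.

Lemma expiD x y : expi (x + y) = expi x * expi y.
Proof. by rewrite /expi mulrDr cosD sinD; simpc; congr (_ +i* _)%C; rewrite addrC. Qed.

Lemma expi0 : expi 0 = 1.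
Proof. by rewrite /expi mulr0 cos0 sin0. Qed.

Lemma expi1 : expi 1 = 1.
Proof. by rewrite /expi mulr1 cos2pi sin2pi. Qed.

Lemma normc_expi x : nm (expi x) = 1.
Proof. by rewrite /= cos2Dsin2 sqrtr1. Qed.

Lemma expi_neq0 x : expi x != 0.
Proof. by apply: contra_eq_neq (normc_expi x) => ->; rewrite Normc.normc0 eq_sym oner_neq0. Qed.

Lemma expiMn x n : expi (x *+ n) = expi x ^+ n.
Proof. by elim: n => [|n IH]; rewrite ?mulr0n ?expi0 // mulrS expiD IH exprS. Qed.

Lemma expi_nat n : expi n%:R = 1.
Proof. by rewrite expiMn expi1 expr1n. Qed.

Lemma expiN x : expi (- x) = (expi x)^-1.
Proof. by apply: (mulfI (expi_neq0 x)); rewrite -expiD subrr expi0 divff ?expi_neq0. Qed.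

Lemma expiJ x : (expi x)^*%C = expi (- x).
Proof. by rewrite /expi /= mulrN cosN sinN. Qed.

Lemma expi_int (z : int) : expi z%:~R = 1.
Proof. by case: z => n; rewrite ?NegzE ?mulrNz ?expiN expi_nat ?invr1. Qed.

Lemma expiD_int x (z : int) : expi (x + z%:~R) = expi x.
Proof. by rewrite expiD expi_int mulr1. Qed.

Lemma normc_expi_sub1 x : nm (expi x - 1) ^+ 2 = 2 - 2 * cos (pi *+ 2 * x).
Proof.
rewrite /expi /= sqr_sqrtr ?addr_ge0 ?sqr_ge0 // oppr0 addr0 sin2cos2; ring.
Qed.

Lemma normc_expi_subN x : nm (expi (- x) - 1) = nm (expi x - 1).
Proof.
have -> : expi (- x) - 1 = - (expi (- x) * (expi x - 1)).
  by rewrite mulrBr -expiD addNr expi0 mulr1 opprB.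
by rewrite normcN Normc.normcM normc_expi mul1r.
Qed.

Lemma normc_expi_mul_sub1 x n : nm (expi (x *+ n) - 1) <= n%:R * nm (expi x - 1).
Proof.
rewrite expiMn; elim: n => [|n IH]; first by rewrite expr0 subrr mul0r Normc.normc0.
have -> : expi x ^+ n.+1 - 1 = expi x * (expi x ^+ n - 1) + (expi x - 1) by rewrite exprS; ring.
apply: le_trans (le_normcD _ _) _; rewrite Normc.normcM normc_expi mul1r -natr1 mulrDl mul1r.
by rewrite lerD2r.
Qed.

Lemma normc_expi_sub1_le x : nm (expi x - 1) <= 8%:R * `|x|.
Proof.
wlog x0 : x / 0 <= x => [H|].
  have [/H//|/ltW x0] := leP 0 x.
  by rewrite -normc_expi_subN -normrN; apply: H; rewrite oppr_ge0.
have -> : nm (expi x - 1) = 2 * `|sin (pi * x)|.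
  apply/eqP; rewrite -(eqrXn2 (n := 2)) // ?normc_ge0 ?mulr_ge0 // normc_expi_sub1.
  rewrite exprMn real_normK ?num_real // [pi *+ 2 * x]mulrnAl cos_mulr2n sin2cos2 mulr2n; apply/eqP; ring.
have px : 0 <= pi * x by rewrite mulr_ge0 // pi_ge0.
have pi4 : pi <= 4 :> R by have := @pihalf_lt2 R; rewrite ltr_pdivrMr // => /ltW; rewrite -natrM.
have : `|sin (pi * x)| <= pi * x.
  have [s0|s0] := leP 0 (sin (pi * x)); first by rewrite ger0_norm // SineBound.sin_le_id.
  have [h|h] := leP (pi * x) pi.
    by have := sin_ge0_pi (introT andP (conj px h)); rewrite leNgt s0.
  by apply: le_trans (sin_max _) _; apply: ltW; apply: le_lt_trans h; have := @pi_ge2 R; lra.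
rewrite (ger0_norm x0) => h.
have : pi * x <= 4 * x by apply: ler_wpM2r.
lra.
Qed.

(* Multiplying [x] up into [1/4, 1/2] moves [expi x] to the left half plane. *)
Lemma normc_expi_sub1_ge x : 0 <= x -> x <= 2^-1 -> 2 * x <= nm (expi x - 1).
Proof.
rewrite le_eqVlt => /predU1P[<- _|x0 x1]; first by rewrite mulr0 normc_ge0.
have quarter y : 4^-1 <= y -> y <= 2^-1 -> 1 <= nm (expi y - 1).
  move=> y1 y2; have : 1 <= nm (expi y - 1) ^+ 2.
    rewrite normc_expi_sub1; suff : cos (pi *+ 2 * y) <= 0 by lra.
    rewrite -cos_pihalf le_eqVlt; case: (ltrgtP (cos _) _) => //=.
    rewrite ltr_cos ?in_itv /=.
    - have p0 := @pi_gt0 R; rewrite mulr2n => h; suff : pi / 2 <= (pi + pi) * y by rewrite leNgt h.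
      by have : pi * 4^-1 <= pi * y by [rewrite ler_pM2l]; lra.
    - have p0 := @pi_gt0 R; have : pi * y <= pi * 2^-1 by rewrite ler_pM2l.
      have : 0 <= pi * y by rewrite mulr_ge0 ?pi_ge0 //; lra.
      by move=> h1 h2; rewrite mulr2n mulrDl; apply/andP; split; lra.
    - by have p0 := @pi_gt0 R; lra.
  by rewrite -[X in X <= _](expr1n _ 2) ler_pXn2r ?nnegrE ?normc_ge0.
pose n := Num.truncn (2 * x)^-1.
have x20 : 0 < (2 * x)^-1 by rewrite invr_gt0; lra.
have /andP[n1 n2] := truncn_itv (ltW x20).
have n0 : (0 < n)%N by rewrite truncn_gt0 invf_ge1; lra.
have e1 : n%:R * (2 * x) <= 1 by rewrite -ler_pdivlMr ?div1r //; lra.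
have e2 : 1 < (n%:R + 1) * (2 * x) by rewrite natr1 -ltr_pdivrMr ?div1r //; lra.
have : 1 <= nm (expi (x *+ n) - 1).
  apply: quarter; rewrite -mulr_natl; last lra.
  have : 1 <= n%:R :> R by rewrite ler1n.
  move=> h; have : x <= n%:R * x by rewrite ler_peMl // ltW.
  lra.
move=> /le_trans/(_ (normc_expi_mul_sub1 x n)) h.
have nR : 0 < n%:R :> R by rewrite ltr0n.
have : 2 * x <= n%:R^-1 by rewrite -[_^-1]mul1r ler_pdivlMr //; lra.
by move=> /le_trans; apply; rewrite -[_^-1]mul1r ler_pdivrMr // mulrC.
Qed.

Definition addchar Q (z : 'Z_Q) : C := expi (z%:R / Q%:R).

Lemma addchar_nat Q n : (1 < Q)%N -> addchar (n%:R : 'Z_Q) = expi (n%:R / Q%:R).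
Proof.
move=> Q1; rewrite /addchar val_Zp_nat // {2}(divn_eq n Q) natrD mulrDl natrM mulfK ?pnatr_eq0; last by lia.
by rewrite addrC expiD expi_nat mulr1.
Qed.

Lemma addcharD Q : (1 < Q)%N -> {morph (@addchar Q) : x y / x + y >-> x * y}.
Proof.
move=> Q1 x y; rewrite -{1}[x]natr_Zp -{1}[y]natr_Zp -natrD addchar_nat // natrD mulrDl expiD //.
Qed.

Lemma normc_addchar Q (z : 'Z_Q) : nm (addchar z) = 1.
Proof. exact: normc_expi. Qed.

Lemma addchar_eq1 Q (z : 'Z_Q) : (1 < Q)%N -> addchar z = 1 -> z = 0.
Proof.
move=> Q1 z1; have zQ : (z < Q)%N by have := ltn_ord z; rewrite [X in (_ < X)%N]Zp_cast.
have QR : 0 < Q%:R :> R by rewrite ltr0n; lia.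
have [/eqP z0|z0] := posnP z; first by apply: val_inj; apply/eqP.
exfalso; have zR : 0 < z%:R :> R by rewrite ltr0n.
have [h|h] := leP (z%:R / Q%:R : R) 2^-1.
  have := normc_expi_sub1_ge (ltW (divr_gt0 zR QR)) h; rewrite -/(addchar z) z1 subrr Normc.normc0 leNgt.
  by rewrite mulr_gt0 // divr_gt0.
have zQR : z%:R < Q%:R :> R by rewrite ltr_nat.
have q1 : z%:R / Q%:R < 1 :> R by rewrite ltr_pdivrMr // mul1r.
have h1 : 0 <= 1 - z%:R / Q%:R :> R by lra.
have h2 : 1 - z%:R / Q%:R <= 2^-1 :> R by lra.
have := normc_expi_sub1_ge h1 h2.
rewrite expiD expi1 mul1r normc_expi_subN -/(addchar z) z1 subrr Normc.normc0; lra.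
Qed.

Lemma Zp_nat_eq0 Q n : (1 < Q)%N -> ((n%:R : 'Z_Q) == 0) = (Q %| n)%N.
Proof. by move=> Q1; rewrite -val_eqE /= val_Zp_nat. Qed.

Lemma addchar_setting p k M : prime p -> (k < p)%N -> (0 < M)%N ->
  padic_setting p k M (@addchar (p ^ M)).
Proof.
move=> pp kp M0; have p1 := prime_gt1 pp; have Q1 : (1 < p ^ M)%N by rewrite -(expn0 p) ltn_exp2l.
have un n : (p %| n)%N = false -> (n%:R : 'Z_(p ^ M)) \is a GRing.unit.
  by move=> h; rewrite unitZpE // coprimeXl // prime_coprime // h.
split.
- by apply/eqP; rewrite -natrX Zp_nat_eq0.
- exact: addcharD.
- exact: normc_addchar.
- move=> n u v nM un' vn uv; apply/eqP => /(addchar_eq1 Q1)/eqP.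
  rewrite mulrBr subr_eq0 -!natrX -!natrM -(inj_eq val_inj) /= !val_Zp_nat //.
  have lt w : (w < p ^ n)%N -> (p ^ (M - n) * w < p ^ M)%N.
    by move=> h; rewrite -{2}(subnK nM) expnD ltn_pmul2l // expn_gt0 ltnW.
  by rewrite !modn_small ?lt // eqn_pmul2l ?expn_gt0 ?(ltnW p1) // (negbTE uv).
- move=> n /andP[n0 nk]; apply: un; apply: contraTF nk => /(dvdn_leq n0) h.
  by rewrite -ltnNge (leq_trans kp).
- move=> x y xy; have [xy'|yx] := leqP y x.
    by rewrite -natrB //; apply: un; apply: contraNF xy; rewrite eqn_mod_dvd.
  rewrite -opprB unitrN -natrB ?(ltnW yx) //; apply: un; apply: contraNF xy.
  by rewrite eq_sym eqn_mod_dvd // ltnW.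
Qed.

Lemma addchar_sum Q (a : 'Z_Q) : (1 < Q)%N -> \sum_(z : 'Z_Q) addchar (a * z) = if a == 0 then Q%:R else 0.
Proof.
move=> Q1; case: eqP => [->|a0].
  have -> : Q%:R = \sum_(z : 'Z_Q) 1 :> C by rewrite sumr_const card_ord Zp_cast.
  by apply: eq_bigr => z _; rewrite mul0r /addchar mul0r expi0.
have : addchar a * \sum_(z : 'Z_Q) addchar (a * z) = \sum_(z : 'Z_Q) addchar (a * z).
  rewrite mulr_sumr [RHS](reindex_inj (addrI 1)); apply: eq_bigr => z _.
  by rewrite mulrDr mulr1 addcharD.
move/eqP; rewrite -subr_eq0 -{2}[\sum_z _]mul1r -mulrBl mulf_eq0 subr_eq0.
by case/orP => /eqP // /(addchar_eq1 Q1).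
Qed.

End Exponential.

(** * Mean values of exponential sums *)

Section Sieve.
Variables (R : realType) (Q : nat).
Hypothesis Q_gt1 : (1 < Q)%N.
Local Notation C := R[i].
Local Notation nm := (@Normc.normc R).
Local Notation psi := (@addchar R Q).

Lemma addchar0 : psi 0 = 1.
Proof. by rewrite /addchar mul0r expi0. Qed.

Lemma addcharMn z n : psi (n%:R * z) = psi z ^+ n.
Proof.
elim: n => [|n IH]; first by rewrite mul0r addchar0 expr0.
by rewrite -natr1 mulrDl mul1r addcharD // IH exprSr.
Qed.

Lemma addcharJ z : (psi z)^*%C = psi (- z).
Proof.
rewrite conj_norm1 ?normc_addchar //.
have z0 : psi z != 0 by apply: expi_neq0.
by apply: (mulfI z0); rewrite divff // -addcharD // subrr addchar0.
Qed.

Lemma sum_normc_sqr_poly (H : {poly C}) b (I : finType) (theta : I -> 'Z_Q) : (size H <= b)%N ->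
  (\sum_y nm (H.[psi (theta y)]) ^+ 2)%:C%C =
  \sum_(i < b) \sum_(j < b) H`_i * (H`_j)^*%C * \sum_y psi ((i%:R - j%:R) * theta y).
Proof.
move=> Hb; rewrite rmorph_sum /=.
under eq_bigr => y _.
  rewrite normc_sqr (horner_coef_wide _ Hb) rmorph_sum big_distrlr /=; over.
rewrite exchange_big /=; apply: eq_bigr => i _.
rewrite exchange_big /=; apply: eq_bigr => j _.
rewrite mulr_sumr; apply: eq_bigr => y _.
by rewrite rmorphM /= mulrACA -!addcharMn addcharJ -addcharD // mulrBl.
Qed.

Lemma parseval_poly (H : {poly C}) b : (size H <= b)%N -> (b <= Q)%N ->
  \sum_z nm (H.[psi z]) ^+ 2 = Q%:R * \sum_(i < b) nm (H`_i) ^+ 2.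
Proof.
move=> Hb bQ; apply: complexI.
rewrite (@sum_normc_sqr_poly H b _ id) // rmorphM rmorph_sum mulr_sumr; apply: eq_bigr => i _.
rewrite (bigD1 i) //= subrr addchar_sum // eqxx big1 ?addr0 => [|j ji].
  by rewrite normc_sqr mulrC; congr (_ * _); rewrite rmorph_nat.
rewrite addchar_sum // subr_eq0 -(inj_eq val_inj) /= !val_Zp_nat // !modn_small; try by apply: leq_trans bQ.
by rewrite (eq_sym _ (j : nat)) (inj_eq val_inj) (negbTE ji) mulr0.
Qed.

(** A large sieve inequality by Schur's test: the square is expanded, |H_i H_j| is bounded by the
    mean of |H_i|^2 and |H_j|^2, and the row sums of the kernel are at most Delta. Parseval's
    identity, valid for degree below Q, returns the sum of the |H_i|^2 to a mean over Z / Q. *)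
Lemma sieve_poly (H : {poly C}) b (I : finType) (theta : I -> 'Z_Q) (Delta : R) :
  (size H <= b)%N -> (b <= Q)%N ->
  (forall i, (i < b)%N -> \sum_(j < b) nm (\sum_y psi ((i%:R - j%:R) * theta y)) <= Delta) ->
  \sum_y nm (H.[psi (theta y)]) ^+ 2 <= Delta / Q%:R * \sum_z nm (H.[psi z]) ^+ 2.
Proof.
move=> Hb bQ HD; pose D (i j : nat) := nm (\sum_y psi ((i%:R - j%:R) * theta y)).
have Dsym i j : D i j = D j i.
  rewrite /D -normc_conj rmorph_sum; congr (nm _); apply: eq_bigr => y _.
  by apply: etrans (addcharJ _) _; rewrite -mulNr opprB.
rewrite (parseval_poly Hb bQ) mulrA divfK; last by rewrite pnatr_eq0; lia.
apply: (@le_trans _ _ (\sum_(i < b) \sum_(j < b) nm (H`_i) * nm (H`_j) * D i j)).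
  rewrite -[leLHS]ger0_norm ?sumr_ge0 // => [|y _]; last by rewrite exprn_ge0 // normc_ge0.
  rewrite -normc_real (sum_normc_sqr_poly _ Hb).
  apply: le_trans (le_normc_sum _ _ _) _; apply: ler_sum => i _.
  apply: le_trans (le_normc_sum _ _ _) _; apply: ler_sum => j _.
  by rewrite !Normc.normcM normc_conj.
apply: (@le_trans _ _ (\sum_(i < b) \sum_(j < b) (nm (H`_i) ^+ 2 / 2%:R * D i j + nm (H`_j) ^+ 2 / 2%:R * D j i))).
  apply: ler_sum => i _; apply: ler_sum => j _.
  rewrite (Dsym j i) -mulrDl; apply: ler_wpM2r; first exact: normc_ge0.
  by have := sqr_ge0 (nm (H`_i) - nm (H`_j)); rewrite sqrrB; lra.
have half : \sum_(i < b) \sum_(j < b) nm (H`_i) ^+ 2 / 2%:R * D i j <= Delta / 2%:R * \sum_(i < b) nm (H`_i) ^+ 2.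
  rewrite mulr_sumr; apply: ler_sum => i _; rewrite -mulr_sumr.
  rewrite [leRHS](_ : _ = nm (H`_i) ^+ 2 / 2%:R * Delta); last by ring.
  by apply: ler_wpM2l; [rewrite divr_ge0 // exprn_ge0 // normc_ge0 | apply: HD].
under eq_bigr => i _ do rewrite big_split /=.
rewrite big_split /= [X in _ + X]exchange_big /=.
by apply: le_trans (lerD half half) _; rewrite -mulrDl -splitr.
Qed.

Section Coordinates.
Variable k : nat.
Local Notation rV := 'rV['Z_Q]_k.+1.

Definition wsum X (a : nat -> C) (c : rV) : C := \sum_(x < X) a x * psi ((rVpoly c).[x%:R]).

Definition coord_poly X (a : nat -> C) (c : rV) (j : 'I_k.+1) : {poly C} :=
  \sum_(x < X) (a x * psi ((rVpoly c).[x%:R])) *: 'X^(x ^ j).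

Lemma wsum_shift X a c (j : 'I_k.+1) z :
  wsum X a (c + z *: delta_mx 0 j) = (coord_poly X a c j).[psi z].
Proof.
rewrite horner_sum; apply: eq_bigr => x _.
rewrite hornerZ hornerXn -mulrA; congr (_ * _).
rewrite -addcharMn -addcharD //; congr psi.
rewrite !horner_rVpoly_sum (eq_bigr (fun i => c 0 i * x%:R ^+ i + (z *: delta_mx 0 j : rV) 0 i * x%:R ^+ i)); last first.
  by move=> i _; rewrite mxE mulrDl.
rewrite big_split /=; congr (_ + _).
rewrite (bigD1 j) //= big1 ?addr0 => [|i ij]; last by rewrite !mxE eqxx /= (negbTE ij) mulr0 mul0r.
by rewrite !mxE !eqxx mulr1 natrX mulrC.
Qed.

Lemma size_coord_poly X a c j t : (size (coord_poly X a c j ^+ t) <= (X ^ j * t).+1)%N.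
Proof.
apply: leq_trans (size_poly_exp_leq _ _) _; rewrite ltnS leq_mul2r; apply/orP; right.
suff : (size (coord_poly X a c j) <= (X ^ j).+1)%N by case: (size _).
apply: leq_trans (size_sum _ _ _) _; apply/bigmax_leqP => x _.
apply: leq_trans (size_scale_leq _ _) _; rewrite size_polyXn ltnS.
by case: (posnP j) => [->|j0]; rewrite ?expn0 // leq_exp2r // ltnW.
Qed.

Lemma wsum_sieve X a c (j : 'I_k.+1) t (I : finType) (theta : I -> 'Z_Q) (Delta : R) :
  (X ^ j * t < Q)%N ->
  (forall i, (i <= X ^ j * t)%N -> \sum_(i' < (X ^ j * t).+1) nm (\sum_y psi ((i%:R - i'%:R) * theta y)) <= Delta) ->
  \sum_y nm (wsum X a (c + theta y *: delta_mx 0 j)) ^+ (2 * t) <=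
  Delta / Q%:R * \sum_z nm (wsum X a (c + z *: delta_mx 0 j)) ^+ (2 * t).
Proof.
move=> bQ HD.
have e z : nm (wsum X a (c + z *: delta_mx 0 j)) ^+ (2 * t) = nm ((coord_poly X a c j ^+ t).[psi z]) ^+ 2.
  by rewrite wsum_shift horner_exp normcX -exprM mulnC.
rewrite (eq_bigr _ (fun y _ => e (theta y))) (eq_bigr _ (fun z _ => e z)).
exact: sieve_poly (size_coord_poly X a c j t) bQ HD.
Qed.

(** The sieve with one point: the t-th power of the sum is a polynomial with X^j t + 1 coefficients,
    and a value is bounded by this number times the mean square. *)
Lemma wsum_point X a c (j : 'I_k.+1) t : (X ^ j * t < Q)%N ->
  nm (wsum X a c) ^+ (2 * t) <=
  (X ^ j * t).+1%:R / Q%:R * \sum_z nm (wsum X a (c + z *: delta_mx 0 j)) ^+ (2 * t).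
Proof.
move=> bQ; have := @wsum_sieve X a c j t 'I_1 (fun=> 0) (X ^ j * t).+1%:R bQ.
rewrite big_ord1 scale0r addr0; apply=> i _.
under eq_bigr => i' _ do rewrite big_ord1 normc_addchar.
by rewrite sumr_const card_ord.
Qed.

Definition supported (D : {set 'I_k.+1}) : pred rV := fun u => [forall i, (i \notin D) ==> (u 0 i == 0)].

Definition supp_sum (G : rV -> R) (D : {set 'I_k.+1}) (c : rV) : R := \sum_(u | supported D u) G (c + u).

Lemma supp_sum_add G (D : {set 'I_k.+1}) c j : j \notin D ->
  supp_sum G (j |: D) c = \sum_z supp_sum G D (c + z *: delta_mx 0 j).
Proof.
move=> jD; rewrite /supp_sum (partition_big (fun u : rV => u 0 j) xpredT) //=.
apply: eq_bigr => z _.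
rewrite (reindex_inj (addIr (z *: delta_mx 0 j))) /=; apply: eq_big => [u|u _]; last first.
  by rewrite addrA addrAC.
apply/andP/forallP => [[/forallP h /eqP uz] i|h].
  apply/implyP => iD; have [->|ij] := eqVneq i j.
    by move: uz; rewrite !mxE !eqxx mulr1 => /eqP; rewrite -subr_eq0 addrK.
  by have := h i; rewrite !inE negb_or ij iD !mxE eqxx (negbTE ij) mulr0 addr0.
split; last by have := h j; rewrite jD !mxE !eqxx mulr1 => /eqP ->; rewrite add0r.
apply/forallP => i; rewrite !inE negb_or; apply/implyP => /andP[ij iD].
by have := h i; rewrite iD !mxE eqxx (negbTE ij) mulr0 addr0.
Qed.

Lemma supp_sum0 G c : supp_sum G set0 c = G c.
Proof.
rewrite /supp_sum (big_pred1 0) ?addr0 // => u /=; apply/forallP/eqP => [h|-> i].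
  by apply/rowP => i; have := h i; rewrite inE mxE => /eqP.
by rewrite mxE eqxx implybT.
Qed.

Lemma supp_sum_shift G D c u : supported D u -> supp_sum G D (c + u) = supp_sum G D c.
Proof.
move=> Du; rewrite [RHS](reindex_inj (addrI u)) /=; apply: eq_big => [v|v _]; last by rewrite addrA.
apply/forallP/forallP => h i; apply/implyP => iD; have := h i; have := forallP Du i; rewrite iD /= mxE => /eqP ->.
  by rewrite add0r.
by rewrite add0r.
Qed.

Lemma supp_sumT G c : supp_sum G setT c = \sum_u G u.
Proof.
rewrite /supp_sum [RHS](reindex_inj (addrI c)); apply: eq_bigl => u.
by apply/forallP => i; rewrite inE.
Qed.

Lemma supp_sum_insert G (D : {set 'I_k.+1}) c j (B : R) : j \notin D ->
  (forall c, G c <= B / Q%:R * \sum_z G (c + z *: delta_mx 0 j)) ->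
  supp_sum G D c <= B / Q%:R * supp_sum G (j |: D) c.
Proof.
move=> jD H; rewrite supp_sum_add // /supp_sum exchange_big mulr_sumr; apply: ler_sum => u _.
apply: le_trans (H _) _; rewrite le_eqVlt; apply/orP; left; apply/eqP; congr (_ * _).
by apply: eq_bigr => z _; rewrite addrAC.
Qed.

Lemma supp_sum_ge0 G D c : (forall u, 0 <= G u) -> 0 <= supp_sum G D c.
Proof. by move=> G0; apply: sumr_ge0. Qed.

(* Completing the sum over the coordinates in [s] costs the degrees of the phases in them. *)
Lemma supp_sum_complete X a t (D : {set 'I_k.+1}) (s : seq 'I_k.+1) c :
  let G := fun c => nm (wsum X a c) ^+ (2 * t) in
  uniq s -> {in s, forall j, j \notin D} -> {in s, forall j : 'I_k.+1, (X ^ j * t < Q)%N} ->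
  supp_sum G D c <= (\prod_(j <- s) ((X ^ j * t).+1%:R / Q%:R)) * supp_sum G (D :|: [set j in s]) c.
Proof.
move=> G; elim: s D => [|j s IH] D /= us sD sQ.
  rewrite big_nil mul1r; suff -> : D :|: [set j in [::]] = D by [].
  by apply/setP => i; rewrite !inE orbF.
have /andP[js us'] := us.
have jD : j \notin D by apply: sD; rewrite inE eqxx.
apply: le_trans (@supp_sum_insert G D c j (X ^ j * t).+1%:R jD _) _.
  by move=> c'; apply: wsum_point; apply: sQ; rewrite inE eqxx.
rewrite big_cons -[leRHS]mulrA; apply: ler_wpM2l; first by rewrite divr_ge0 ?ler0n.
apply: le_trans (IH (j |: D) us' _ _) _.
- move=> i si; rewrite !inE negb_or sD ?inE ?si ?orbT // andbT.
  by apply: contraNneq js => <-.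
- by move=> i si; apply: sQ; rewrite inE si orbT.
suff -> : (j |: D) :|: [set j0 in s] = D :|: [set j0 in j :: s] by [].
by apply/setP => i; rewrite !inE orbCA orbA.
Qed.

End Coordinates.
End Sieve.

(** * Mean values deduced from decoupling *)

Section MeanValues.
Variables (R : realType) (p k : nat).
Hypothesis p_prime : prime p.
Hypothesis k_lt_p : (k < p)%N.
Hypothesis k_gt0 : (0 < k)%N.
Local Notation C := R[i].
Local Notation nm := (@Normc.normc R).
Local Notation pw x := (p%:R `^ x : R).
Let p_gt1 : (1 < p)%N := prime_gt1 p_prime.

Lemma wsum_pieces M n X (a : nat -> C) (u : 'rV['Z_(p ^ M)]_k.+1) : (X <= p ^ n)%N ->
  wsum X a u = \sum_(v < p ^ n) (if (v < X)%N then a v else 0) * phase p M (@addchar R (p ^ M)) M u v%:R.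
Proof.
move=> Xn; rewrite /wsum (big_ord_widen _ (fun x => a x * addchar R ((rVpoly u).[x%:R])) Xn) big_mkcond /=.
apply: eq_bigr => v _; case: ifP => _; last by rewrite mul0r.
by rewrite /phase subnn expr0 mul1r.
Qed.

Lemma normc_phase M w (u : 'rV['Z_(p ^ M)]_k.+1) x : nm (phase p M (@addchar R (p ^ M)) w u x) = 1.
Proof. exact: normc_addchar. Qed.

Lemma piece_quasi_phase M w n (b : C) (x : 'Z_(p ^ M)) : (0 < M)%N ->
  quasi p (@phase R _ p M (@addchar R (p ^ M)) k w) n x (fun u => b * phase p M (@addchar R (p ^ M)) w u x).
Proof.
move=> M0 h _ g; have S := @addchar_setting R p k M p_prime k_lt_p M0.
by rewrite (phaseD _ _ (ps_morph S)) [X in b * X]mulrC mulrCA.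
Qed.

(** Decoupling down to single values of x. Each piece has modulus at most 1, so its squared norm is
    at most the tri(k)-th root of the number of coefficient vectors, and adding X of these gives the
    factor X^(tri k). *)
Lemma vinogradov_mean eps : 0 < eps -> exists2 c, 0 <= c & forall M n X (a : nat -> C),
  (k * n <= M)%N -> (0 < M)%N -> (X <= p ^ n)%N -> (forall x, nm (a x) <= 1) ->
  \sum_(u : 'rV['Z_(p ^ M)]_k.+1) nm (wsum X a u) ^+ (2 * tri k) <=
  c * pw (eps * n%:R) * ((p ^ M)%:R ^+ k.+1 * X%:R ^+ tri k).
Proof.
move=> e0; have [c c0 H] := dec_exponent_all p_gt1 k_gt0 e0; exists c => // M n X a knM M0 Xn a1.
have S := @addchar_setting R p k M p_prime k_lt_p M0.
have Q1 : (1 < p ^ M)%N by rewrite -(expn0 p) ltn_exp2l.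
have cardE : #|'rV['Z_(p ^ M)]_k.+1|%:R = (p ^ M)%:R ^+ k.+1 :> R.
  by rewrite card_mx mul1n card_ord Zp_cast // natrX.
have [r r0 rE] := nth_root_exists (ler0n R #|'rV['Z_(p ^ M)]_k.+1|) (tri_gt0 k_gt0).
have hw : (k * n <= M <= M)%N by rewrite knM leqnn.
have := H _ M _ S n M hw
  (fun v u => (if (v < X)%N then a v else 0) * phase p M (@addchar R (p ^ M)) M u v%:R)
  (fun v => if (v < X)%N then r else 0).
under eq_bigr => u _ do rewrite mul1r -wsum_pieces //.
have -> : \sum_(v < p ^ n) (if (v < X)%N then r else 0) = r * X%:R.
  by rewrite -big_mkcond -(big_ord_widen _ (fun=> r) Xn) sumr_const card_ord mulr_natr.
rewrite exprMn rE cardE; apply => v hv.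
- by rewrite add0r expr0 mul1r; apply: piece_quasi_phase.
- by case: ifP.
- under eq_bigr => u _ do rewrite mul1r Normc.normcM normc_phase mulr1.
  case: ifP => _; last by rewrite big1 ?exprn_ge0 // => u _; rewrite Normc.normc0 expr0n muln_eq0 /= eqn0Ngt tri_gt0.
  rewrite rE -sum1_card natr_sum; apply: ler_sum => u _.
  by apply: exprn_ile1; rewrite ?normc_ge0.
Qed.

(** The coefficient of degree k belongs to the Weyl sum; those of degree below r are auxiliary and
    are introduced by completion. *)
Definition hua_support r : {set 'I_k.+1} := [set j : 'I_k.+1 | (j < r)%N || (j == k :> nat)].

Definition hua_exponent r (j : 'I_r) : nat := if (j.+1 < r)%N then j.+1 else k.

Lemma hua_exponent_inj r : (r <= k)%N -> injective (@hua_exponent r).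
Proof.
move=> rk i j; rewrite /hua_exponent => h; apply: ord_inj; move: h (ltn_ord i) (ltn_ord j).
by case: ifP => h1; case: ifP => h2 h h3 h4; lia.
Qed.

Lemma hua_exponent_bnd r (j : 'I_r) : (r <= k)%N -> (0 < hua_exponent j <= k)%N.
Proof. by rewrite /hua_exponent; case: ifP; have := ltn_ord j; lia. Qed.

Lemma supported_section M r w m (t : 'I_r -> 'Z_(p ^ M)) c0 (g : 'rV['Z_(p ^ M)]_k.+1) : (0 < r)%N ->
  supported (hua_support r) (g + section_poly p k w m (@hua_exponent r) 0 t c0) = supported (hua_support r) g.
Proof.
move=> r0; apply: eq_forallb => i; rewrite inE negb_or.
case: (boolP (i < r)%N) => //= ir; case: (boolP (i == k :> nat)) => //= ik.
rewrite !mxE coefD coefZ coefC coef_sum.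
have -> : (i == 0 :> nat) = false by move: ir; lia.
rewrite big1 ?mulr0 ?addr0 // => j _; rewrite coefZ polyC0 subr0 coefXn.
suff -> : (i == hua_exponent j :> nat) = false by rewrite mulr0.
rewrite /hua_exponent; case: ifP => h; last exact: negbTE.
by apply/negbTE; move: ir h; lia.
Qed.

(** The powers 1, ..., r-1, k are not translation invariant, so the sections are centred at 0, where
    the binomial matrix is inverted at units only; hence the restriction to x prime to p. The
    iteration of decoupling needs a starting scale proportional to n, which crude decoupling reaches
    at a cost of p^(eps n / 2) up to a constant. *)
Lemma hua_unit_mean r eps : (0 < r <= k)%N -> 0 < eps -> exists2 c, 0 <= c & forall M n X (a : nat -> C),
  (k * n <= M)%N -> (0 < M)%N -> (X <= p ^ n)%N -> (forall x, nm (a x) <= 1) ->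
  (forall x, (p %| x)%N -> a x = 0) ->
  \sum_(u : 'rV['Z_(p ^ M)]_k.+1 | supported (hua_support r) u) nm (wsum X a u) ^+ (2 * tri r) <=
  c * pw (eps * n%:R) * (#|[pred u : 'rV['Z_(p ^ M)]_k.+1 | supported (hua_support r) u]|%:R * X%:R ^+ tri r).
Proof.
move=> /andP[r0 rk] e0; set q := tri r.
have q0 : (0 < q)%N := tri_gt0 r0.
have e20 : 0 < eps / 2%:R by rewrite divr_gt0.
have [c c0 H] := dec_exponent_all p_gt1 r0 e20.
(* There are [D] steps of length about n/D. The crude start at scale about r n / D costs p^(2 q r n
   / D), and D makes 2 q r / D at most eps / 2. *)
pose D := (Num.truncn ((4 * q * r)%:R / eps)).+1.
pose c1 := pw (2 * q * r)%:R * (c ^+ D + 1).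
have c10 : 0 <= c1 by rewrite mulr_ge0 ?pw_ge0 ?addr_ge0 ?exprn_ge0.
exists c1 => // M n X a knM M0 Xn a1 ap.
have S := @addchar_setting R p k M p_prime k_lt_p M0.
have S' : padic_setting p r M (@addchar R (p ^ M)) by apply: addchar_setting => //; lia.
pose W (u : 'rV['Z_(p ^ M)]_k.+1) : R := (supported (hua_support r) u)%:R.
have W0 u : 0 <= W u by rewrite ler0n.
set A := #|_|%:R.
have WA : \sum_u W u = A.
  rewrite /A -sum1_card natr_sum [RHS]big_mkcond /=; apply: eq_bigr => u _.
  by rewrite /W inE; case: ifP.
have [kap kap0 kapE] := nth_root_exists (ler0n R #|[pred u : 'rV['Z_(p ^ M)]_k.+1 | supported (hua_support r) u]|) q0.
pose inc := (n %/ D).+1; pose a0 := (r * inc)%N.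
pose f v (u : 'rV['Z_(p ^ M)]_k.+1) := (if (v < X)%N then a v else 0) * phase p M (@addchar R (p ^ M)) M u v%:R.
pose s v : R := if (v < X)%N then kap else 0.
have s0 v : 0 <= s v by rewrite /s; case: ifP.
have fs v : \sum_u W u * nm (f v u) ^+ (2 * q) <= s v ^+ q.
  rewrite /s /f; case: ifP => _; last first.
    by rewrite expr0n eqn0Ngt q0 big1 // => u _; rewrite mul0r Normc.normc0 expr0n muln_eq0 /= eqn0Ngt q0 mulr0.
  rewrite kapE -/A -WA; apply: ler_sum => u _.
  rewrite Normc.normcM normc_phase mulr1 -[leRHS]mulr1; apply: ler_wpM2l => //.
  by apply: exprn_ile1; rewrite ?normc_ge0.
have fp v u : (p %| v)%N -> f v u = 0 by move=> pv; rewrite /f ap // if_same mul0r.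
have Ss : \sum_(v < p ^ n) s v = kap * X%:R.
  by rewrite /s -big_mkcond -(big_ord_widen _ (fun=> kap) Xn) sumr_const card_ord mulr_natr.
have -> : A * X%:R ^+ q = (\sum_(v < p ^ n) s v) ^+ q by rewrite Ss exprMn kapE.
have -> : \sum_(u : 'rV['Z_(p ^ M)]_k.+1 | supported (hua_support r) u) nm (wsum X a u) ^+ (2 * q) =
    \sum_u W u * nm (\sum_(v < p ^ n) f v u) ^+ (2 * q).
  by rewrite big_mkcond; apply: eq_bigr => u _; rewrite /W (wsum_pieces _ _ Xn); case: ifP; rewrite ?mul1r ?mul0r.
have Sge0 : 0 <= (\sum_(v < p ^ n) s v) ^+ q by rewrite exprn_ge0 ?sumr_ge0.
have pa0 : pw ((2 * q)%:R * a0%:R) <= pw (2 * q * r)%:R * pw (eps / 2%:R * n%:R).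
  rewrite -pwD //; apply: ler_pw => //.
  have h1 : ((2 * q)%:R * a0%:R <= (2 * q * r)%:R * (n%:R / D%:R + 1) :> R).
    rewrite -natrM mulnA natrM; apply: ler_wpM2l; first exact: ler0n.
    rewrite /inc -natr1 lerD2r ler_pdivlMr ?ltr0n // -natrM ler_nat; exact: leq_divM.
  apply: le_trans h1 _; rewrite mulrDr mulr1 addrC lerD2l mulrCA mulrC; apply: ler_wpM2r; first exact: ler0n.
  rewrite ler_pdivrMr ?ltr0n // mulrC.
  have : (4 * q * r)%:R / eps < D%:R by rewrite /D truncnS_gt.
  rewrite ltr_pdivrMr // !natrM; lra.
have qf m v : quasi p (@phase R _ p M (@addchar R (p ^ M)) k M) m v%:R (fun u => f v u) by apply: piece_quasi_phase.
have addE v : (v%:R : 'Z_(p ^ M)) = 0 + (p%:R : 'Z_(p ^ M)) ^+ 0 * v%:R by rewrite add0r expr0 mul1r.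
have [na0|a0n] := leqP n a0.
  have := @decouples_crude R _ p _ (@phase R _ p M (@addchar R (p ^ M)) k M) W 0 0 n q W0 q0 f s.
  move=> /(_ _ _ _)/le_trans; apply=> [v hv|v hv|v hv|]; [by rewrite -addE; apply: qf | exact: s0 | exact: fs |].
  apply: ler_wpM2r => //; rewrite pwn // pwX // /c1 -mulrA.
  apply: (@le_trans _ _ (pw ((2 * q)%:R * a0%:R))).
    by apply: ler_pw => //; rewrite mulrC; apply: ler_wpM2l; rewrite ?ler0n // ler_nat.
  apply: le_trans pa0 _; apply: ler_wpM2l; first exact: pw_ge0.
  rewrite -[leLHS]mul1r; apply: ler_pM; rewrite ?pw_ge0 ?lerDr ?exprn_ge0 //.
  apply: ler_pw => //; apply: ler_wpM2r; rewrite ?ler0n //; lra.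
have a00 : (0 < a0)%N by rewrite muln_gt0 r0.
pose m := (n - a0)%N; have am : (a0 + m = n)%N by rewrite subnKC // ltnW.
pose K2 := c ^+ D * pw (eps / 2%:R * m%:R).
have K20 : 0 <= K2 by rewrite mulr_ge0 ?exprn_ge0 ?pw_ge0.
have [k2 k20 k2E] := nth_root_exists K20 q0.
have sp (F : nat -> R) : \sum_(v < p ^ n) F v = \sum_(v < p ^ a0) \sum_(u < p ^ m) F (v + p ^ a0 * u)%N.
  by have := @sum_digits R p a0 m F (ltnW p_gt1); rewrite am.
have spC u : \sum_(v < p ^ n) f v u = \sum_(v < p ^ a0) \sum_(u' < p ^ m) f (v + p ^ a0 * u')%N u.
  by have := @sum_digits _ p a0 m (fun v => f v u) (ltnW p_gt1); rewrite am.
under eq_bigr => u _ do rewrite spC.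
have := @decouples_crude R _ p _ (@phase R _ p M (@addchar R (p ^ M)) k M) W 0 0 a0 q W0 q0
  (fun v u => \sum_(u' < p ^ m) f (v + p ^ a0 * u')%N u) (fun v => k2 * \sum_(u' < p ^ m) s (v + p ^ a0 * u')%N).
move=> /(_ _ _ _)/le_trans; apply=> [v hv|v hv|v hv|].
- rewrite -addE // => h hh g; rewrite mulr_sumr; apply: eq_bigr => u' _.
  have := qf a0 (v + p ^ a0 * u')%N h; rewrite natrD natrM natrX.
  have -> : phase p M (@addchar R (p ^ M)) M h (v%:R + (p%:R : 'Z_(p ^ M)) ^+ a0 * u'%:R) = phase p M (@addchar R (p ^ M)) M h v%:R.
    by rewrite hh.
  by apply=> z; rewrite -addrA -mulrDr !hh.
- by rewrite mulr_ge0 // sumr_ge0.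
- case: (boolP (p %| v)%N) => pv.
    rewrite big1 ?exprn_ge0 ?mulr_ge0 ?sumr_ge0 // => u _; rewrite big1 ?Normc.normc0 ?expr0n ?muln_eq0 /= ?eqn0Ngt ?q0 ?mulr0 // => u' _.
    apply: fp; rewrite dvdn_addr // dvdn_mulr // -(prednK a00) expnS dvdn_mulr //.
  rewrite exprMn k2E.
  have rn : (r * n <= M)%N by apply: leq_trans knM; rewrite leq_mul2r rk orbT.
  have ux : (v%:R - 0 : 'Z_(p ^ M)) \is a GRing.unit.
    by have := @ps_unit_diff _ _ _ _ _ _ S v 0%N; apply; rewrite mod0n.
  have hm : (m <= D * inc)%N.
    apply: (@leq_trans n); first exact: leq_subr.
    by rewrite mulnC; apply: ltnW; apply: ltn_ceil.
  have hmt : (r * (a0 + m) <= r * n)%N by rewrite am.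
  have := decouples_section_iter (ps_nil S) p_gt1 (ps_unit_le S) r0 (hua_exponent_inj rk) (fun j => hua_exponent_bnd j rk)
    (introT andP (conj rn (leqnn M))) W0 _ c0 (fun n' _ => H _ M _ S' n') ux a00 (leqnn _) hm hmt.
  move=> /(_ _ (fun u' u => f (v + p ^ a0 * u')%N u) (fun u' => s (v + p ^ a0 * u')%N)); apply.
  + by move=> g t c2; rewrite /W supported_section.
  + by move=> u' hu'; have := qf (a0 + m)%N (v + p ^ a0 * u')%N; rewrite natrD natrM natrX.
  + by [].
  + by move=> u' _; apply: fs.
- rewrite -mulr_sumr exprMn k2E -sp mulrA; apply: ler_wpM2r => //.
  rewrite pwn // pwX // [a0%:R * _]mulrC.
  apply: (@le_trans _ _ (pw (2 * q * r)%:R * pw (eps / 2%:R * n%:R) * ((c ^+ D + 1) * pw (eps / 2%:R * n%:R)))).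
    apply: ler_pM; rewrite ?pw_ge0 //; apply: ler_pM; rewrite ?exprn_ge0 ?pw_ge0 ?lerDl //.
    apply: ler_pw => //; apply: ler_wpM2l; first exact: ltW.
    by rewrite ler_nat leq_subr.
  rewrite /c1 mulrACA -pwD // le_eqVlt; apply/orP; left; apply/eqP; congr (_ * pw _).
  by rewrite -mulrDl -splitr.
Qed.

End MeanValues.

(** * Hua's lemma *)

Lemma sum_Zp (V : nmodType) Q (F : nat -> V) : (1 < Q)%N -> \sum_(z : 'Z_Q) F z = \sum_(c < Q) F c.
Proof. by move=> Q1; rewrite -(big_mkord xpredT F) Zp_cast // big_mkord. Qed.

Section Counting.
Variables (R : realType) (Q k : nat).
Hypothesis Q_gt1 : (1 < Q)%N.

Lemma supp_sum_const (D : {set 'I_k.+1}) (c : 'rV['Z_Q]_k.+1) :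
  supp_sum (fun=> 1 : R) D c = Q%:R ^+ #|D|.
Proof.
move En : #|D| => n; elim: n D c En => [|n IH] D c En.
  by rewrite (cards0_eq En) supp_sum0 expr0.
have /card_gt0P[j jD] : (0 < #|D|)%N by rewrite En.
have En' : #|D :\ j| = n by move: En; rewrite (cardsD1 j) jD => -[].
rewrite -(setD1K jD) supp_sum_add ?inE ?eqxx //.
rewrite (eq_bigr (fun=> Q%:R ^+ n)); last by move=> z _; apply: IH.
by rewrite sumr_const card_ord Zp_cast // exprS mulr_natl.
Qed.

Lemma card_supported (D : {set 'I_k.+1}) :
  #|[pred u : 'rV['Z_Q]_k.+1 | supported D u]|%:R = Q%:R ^+ #|D| :> R.
Proof. by rewrite -(supp_sum_const D 0) -sum1_card natr_sum; apply: eq_bigl => u; rewrite inE. Qed.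

End Counting.

Section Hua.
Variables (R : realType) (k : nat).
Hypothesis k_gt0 : (0 < k)%N.
Local Notation C := R[i].
Local Notation nm := (@Normc.normc R).

Definition weyl (P : nat) (theta : R) : C := \sum_(1 <= x < P.+1) expi (theta * (x ^ k)%:R).

Lemma weyl_period P theta (z : int) : weyl P (theta + z%:~R) = weyl P theta.
Proof.
apply: eq_bigr => x _; rewrite mulrDl.
have -> : z%:~R * (x ^ k)%:R = (z * (x ^ k)%:Z)%:~R :> R by rewrite intrM.
exact: expiD_int.
Qed.

Lemma normc_weyl_le P theta : nm (weyl P theta) <= P%:R.
Proof.
apply: le_trans (le_normc_sum _ _ _) _.
by rewrite (eq_bigr (fun=> 1)) ?sumr_const_nat ?subn1 // => x _; rewrite normc_expi.
Qed.

Lemma sum_periodic_mul Q m (F : R -> R) : (0 < Q)%N -> (0 < m)%N -> (forall t, F (t + 1) = F t) ->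
  \sum_(c < Q * m) F (c%:R / Q%:R) = m%:R * \sum_(c < Q) F (c%:R / Q%:R).
Proof.
move=> Q0 m0 FP; have FPn t n : F (t + n%:R) = F t.
  by elim: n => [|n IH]; rewrite ?addr0 // -natr1 addrA FP.
have Q0' : Q%:R != 0 :> R by rewrite pnatr_eq0 -lt0n.
elim: m {m0} => [|m IH]; first by rewrite muln0 big_ord0 mul0r.
rewrite mulnS addnC -natr1 mulrDl mul1r -IH big_split_ord /=; congr (_ + _).
by apply: eq_bigr => c _; rewrite natrD mulrDl natrM [Q%:R * _]mulrC mulfK // addrC FPn.
Qed.

Lemma card_hua_support r : (r <= k)%N -> #|hua_support k r| = r.+1.
Proof.
move=> rk; have -> : hua_support k r = ord_max |: [set j : 'I_k.+1 | (j < r)%N].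
  by apply/setP => j; rewrite !inE orbC -(inj_eq val_inj).
rewrite cardsU1 inE /= -leqNgt rk /= -sum1_card.
rewrite (eq_bigl (fun j : 'I_k.+1 => (j < r)%N)); last by move=> j; rewrite inE.
by rewrite -(big_ord_widen k.+1 (fun=> 1%N)) ?sum1_card ?card_ord //; exact: leqW.
Qed.

Lemma prod_degrees_le X q Q r : (0 < X)%N -> (0 < Q)%N ->
  \prod_(j < r) ((X ^ j * q).+1%:R / Q%:R) <= q.+1%:R ^+ r * X%:R ^+ (tri r.-1) / Q%:R ^+ r :> R.
Proof.
move=> X0 Q0; have QR : 0 < Q%:R :> R by rewrite ltr0n.
elim: r => [|r IH]; first by rewrite big_ord0 /= (_ : tri 0 = 0%N) // !expr0 invr1 !mul1r.
rewrite big_ord_recr /=.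
have -> : tri r = (tri r.-1 + r)%N by case: r {IH} => // r; rewrite triS addnC.
have -> : q.+1%:R ^+ r.+1 * X%:R ^+ (tri r.-1 + r) / Q%:R ^+ r.+1 =
  (q.+1%:R ^+ r * X%:R ^+ (tri r.-1) / Q%:R ^+ r) * ((q.+1 * X ^ r)%:R / Q%:R) :> R.
  rewrite exprD !exprS natrM natrX; field; by rewrite gt_eqF // gt_eqF // exprn_gt0.
apply: ler_pM => //; first by apply: prodr_ge0 => j _; rewrite divr_ge0 ?ler0n.
  by rewrite divr_ge0 ?ler0n.
rewrite ler_pM2r ?invr_gt0 // ler_nat mulSn addnC mulnC -addn1 leq_add2l expn_gt0 X0 //.
Qed.

(** Completing the degrees 0, ..., r-1 costs X^(tri (r-1)), and the completed mean contributes
    X^(tri r); the exponents add up to r^2. *)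
Lemma hua_unit p r eps : prime p -> (k < p)%N -> (tri k < p)%N -> (0 < r <= k)%N -> 0 < eps ->
  exists2 c, 0 <= c & forall M n P, (k * n <= M)%N -> (0 < n)%N -> (P < p ^ n)%N ->
  \sum_(c < p ^ M) nm (\sum_(x < P.+1) (~~ (p %| x)%N)%:R * expi (c%:R / (p ^ M)%:R * (x ^ k)%:R)) ^+ (2 * tri r)
  <= c * (p ^ M)%:R * (p%:R `^ ((r * r)%:R * n%:R + eps * n%:R)).
Proof.
move=> pp kp tp /andP[r0 rk] e0.
have hr : (0 < r <= k)%N by rewrite r0.
have p1 := prime_gt1 pp.
have [c c0 H] := @hua_unit_mean R p k pp kp k_gt0 r eps hr e0.
set q := tri r in H *.
pose c1 := (q.+1%:R ^+ r) * c.
have c10 : 0 <= c1 by rewrite mulr_ge0 // exprn_ge0.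
exists c1 => // M n P knM n0 Pn.
have M0 : (0 < M)%N by apply: leq_trans knM; rewrite muln_gt0 k_gt0.
have Q1 : (1 < p ^ M)%N by rewrite -(expn0 p) ltn_exp2l.
set Q := (p ^ M)%N in Q1 *.
pose a (x : nat) : C := (~~ (p %| x)%N)%:R.
have a1 x : nm (a x) <= 1 by rewrite /a; case: (p %| x)%N; rewrite ?Normc.normc0 ?Normc.normc1 ?ler01.
have ap x : (p %| x)%N -> a x = 0 by move=> h; rewrite /a h.
pose G (u : 'rV['Z_Q]_k.+1) := nm (wsum (p ^ n) (fun x => if (x < P.+1)%N then a x else 0) u) ^+ (2 * q).
have lhs : \sum_(c < Q) nm (\sum_(x < P.+1) (~~ (p %| x)%N)%:R * expi (c%:R / Q%:R * (x ^ k)%:R)) ^+ (2 * q) =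
   supp_sum G [set ord_max] 0.
  rewrite -[X in supp_sum _ X]setU0 supp_sum_add ?inE // -(@sum_Zp _ Q (fun c => nm (\sum_(x < P.+1) (~~ (p %| x)%N)%:R * expi (c%:R / Q%:R * (x ^ k)%:R)) ^+ (2 * q)) Q1).
  apply: eq_bigr => z _; rewrite supp_sum0 add0r /G; congr (nm _ ^+ _).
  rewrite /wsum (big_ord_widen _ (fun x : nat => (~~ (p %| x)%N)%:R * expi (z%:R / Q%:R * (x ^ k)%:R)) Pn) big_mkcond.
  apply: eq_bigr => x _; case: ifP => _; last by rewrite mul0r.
  congr (_ * _).
  have -> : (rVpoly (z *: delta_mx 0 ord_max : 'rV['Z_Q]_k.+1)).[x%:R] = (z * x ^ k)%N%:R.
    rewrite horner_rVpoly_sum (bigD1 ord_max) //= big1 ?addr0 => [|i ij]; last first.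
      by rewrite !mxE eqxx /= (negbTE ij) mulr0 mul0r.
    by rewrite !mxE !eqxx mulr1 natrM natrX natr_Zp.
  by rewrite addchar_nat // natrM mulrAC.
rewrite lhs.
pose s : seq 'I_k.+1 := [seq j : 'I_k.+1 <- enum 'I_k.+1 | (j < r)%N].
have sr j : j \in s -> (j < r)%N by rewrite mem_filter => /andP[].
have rkM : forall j : 'I_k.+1, (j < r)%N -> ((p ^ n) ^ j * q < Q)%N.
  move=> j jr; rewrite -expnM; apply: (@leq_trans (p ^ (n * j) * p)).
    by rewrite ltn_pmul2l ?expn_gt0 ?(ltnW p1) //; apply: leq_ltn_trans tp; apply: leq_tri.
  rewrite -expnSr leq_exp2l //; apply: leq_trans knM.
  have jk : (j.+1 <= k)%N by apply: leq_trans rk.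
  apply: (@leq_trans (j.+1 * n)); last by rewrite leq_mul2r jk orbT.
  by rewrite mulSn mulnC addnC -addn1 leq_add2l.
have := @supp_sum_complete R Q Q1 k (p ^ n) (fun x => if (x < P.+1)%N then a x else 0) q [set ord_max] s 0.
rewrite filter_uniq ?enum_uniq // => /(_ isT _ _)/le_trans; apply.
- by move=> j /sr jr; rewrite inE; apply: contraTneq jr => ->; rewrite -leqNgt.
- by move=> j /sr; apply: rkM.
have -> : [set ord_max] :|: [set j in s] = hua_support k r.
  by apply/setP => j; rewrite !inE mem_filter mem_enum andbT orbC -(inj_eq val_inj).
have HH : supp_sum G (hua_support k r) 0 <= c * p%:R `^ (eps * n%:R) * (Q%:R ^+ r.+1 * (p ^ n)%:R ^+ tri r).
  rewrite -[in Q%:R ^+ _](card_hua_support rk).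
  rewrite -(card_supported _ Q1); apply: le_trans (H M n (p ^ n)%N _ knM M0 (leqnn _) _ _).
  - by rewrite /supp_sum; under eq_bigr => u _ do rewrite add0r; apply: lexx.
  - by move=> x /=; case: ifP => _ //; rewrite Normc.normc0 ler01.
  - by move=> x px /=; rewrite ap // if_same.
have QR : 0 < Q%:R :> R by rewrite ltr0n; lia.
have prodle : \prod_(j <- s) (((p ^ n) ^ j * q).+1%:R / Q%:R) <= q.+1%:R ^+ r * (p ^ n)%:R ^+ (tri r.-1) / Q%:R ^+ r :> R.
  have -> : \prod_(j <- s) (((p ^ n) ^ j * q).+1%:R / Q%:R) = \prod_(j < r) (((p ^ n) ^ j * q).+1%:R / Q%:R) :> R.
    rewrite /s big_filter big_enum_cond /= (big_ord_widen k.+1 (fun j : nat => ((p ^ n) ^ j * q).+1%:R / Q%:R)) //.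
    exact: leqW.
  by apply: prod_degrees_le; rewrite ?expn_gt0 ?(ltnW p1) // ltnW.
have G0 : 0 <= supp_sum G (hua_support k r) 0.
  by apply: supp_sum_ge0 => u; rewrite exprn_ge0 ?normc_ge0.
have P0 : 0 <= \prod_(j <- s) (((p ^ n) ^ j * q).+1%:R / Q%:R) :> R.
  by apply: prodr_ge0 => j _; rewrite divr_ge0 ?ler0n.
apply: le_trans (ler_pM P0 G0 prodle HH) _.
rewrite le_eqVlt; apply/orP; left; apply/eqP.
rewrite /c1 pwn // !pwX //.
have -> : (r * r)%:R * n%:R + eps * n%:R = n%:R * (tri r.-1)%:R + (n%:R * (tri r)%:R + eps * n%:R) :> R.
  have -> : (r * r = tri r.-1 + tri r)%N.
    by have := tri_double r; have := tri_double r.-1; rewrite prednK //; nia.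
  rewrite natrD; ring.
rewrite !pwD // exprS; field.
by rewrite gt_eqF // exprn_gt0.
Qed.

Lemma sum_multiples (V : nmodType) p P (g : nat -> V) : (0 < p)%N ->
  \sum_(1 <= x < P.+1 | (p %| x)%N) g x = \sum_(1 <= y < (P %/ p).+1) g (p * y)%N.
Proof.
move=> p0; elim: P => [|P IH]; first by rewrite div0n !big_geq.
rewrite big_mkcond big_nat_recr //= -big_mkcond IH divnS //.
case: ifP => h; last by rewrite addr0.
rewrite [(nat_of_bool true + _)%N]add1n [RHS]big_nat_recr //=; congr (_ + g _).
by have := divnS P p0; rewrite h [(nat_of_bool true + _)%N]add1n => <-; rewrite mulnC divnK.
Qed.

Lemma weyl_split p P theta : (0 < p)%N ->
  weyl P theta = \sum_(x < P.+1) (~~ (p %| x)%N)%:R * expi (theta * (x ^ k)%:R) + weyl (P %/ p) (theta * (p ^ k)%:R).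
Proof.
move=> p0; rewrite /weyl (bigID (fun x => (p %| x)%N)) /= sum_multiples // addrC; congr (_ + _); last first.
  by apply: eq_bigr => x _; rewrite expnMn natrM mulrA.
rewrite big_ord_recl dvdn0 mul0r add0r big_mkcond big_add1 big_mkord /=.
by apply: eq_bigr => x _; rewrite /bump /= add1n; case: (p %| x.+1)%N; rewrite ?mul0r ?mul1r.
Qed.

Lemma add_pow_le (x y : R) m : 0 <= x -> 0 <= y -> (x + y) ^+ m <= 2 ^+ m * (x ^+ m + y ^+ m).
Proof.
move=> x0 y0; have [xy|yx] := leP x y.
  apply: (@le_trans _ _ ((2 * y) ^+ m)).
    by apply: lerXn2r; rewrite ?nnegrE ?addr_ge0 ?mulr_ge0 //; lra.
  by rewrite exprMn; apply: ler_wpM2l; rewrite ?exprn_ge0 // lerDr exprn_ge0.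
apply: (@le_trans _ _ ((2 * x) ^+ m)).
  by apply: lerXn2r; rewrite ?nnegrE ?addr_ge0 ?mulr_ge0 //; lra.
by rewrite exprMn; apply: ler_wpM2l; rewrite ?exprn_ge0 // lerDl exprn_ge0.
Qed.

(* Multiples of [p] are removed by recursion on [n]: they cost a factor [2^(2q)], which
   is less than the gain [p^(r^2)] from the shorter range. *)
Lemma hua_mean p r eps : prime p -> (k < p)%N -> (tri k < p)%N -> (8 <= p)%N -> (0 < r <= k)%N -> 0 < eps ->
  exists2 c, 0 <= c & forall n M P, (k * n <= M)%N -> (P < p ^ n)%N ->
  \sum_(c < p ^ M) nm (weyl P (c%:R / (p ^ M)%:R)) ^+ (2 * tri r) <=
  c * (p ^ M)%:R * (p%:R `^ ((r * r)%:R * n%:R + eps * n%:R)).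
Proof.
move=> pp kp tp p8 hr e0; have p1 := prime_gt1 pp.
have [c c0 H] := hua_unit pp kp tp hr e0; set q := tri r in H *.
have /andP[r0 rk] := hr; have q0 : (0 < q)%N := tri_gt0 r0.
pose c1 := 2 ^+ (2 * q).+1 * c.
have c10 : 0 <= c1 by rewrite mulr_ge0 // exprn_ge0.
have E0 (n : nat) : 0 <= (p%:R : R) `^ ((r * r)%:R * n%:R + eps * n%:R) by exact: powR_ge0.
exists c1 => //; elim=> [|n IH] M P knM Pn.
  move: Pn; rewrite expn0 ltnS leqn0 => /eqP ->; rewrite big1 => [|c' _]; first by rewrite mulr_ge0 ?E0 // mulr_ge0 ?ler0n.
  by rewrite /weyl big_geq // Normc.normc0 expr0n muln_eq0 /= eqn0Ngt q0.
have kM : (k <= M)%N by apply: leq_trans knM; rewrite leq_pmulr.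
have Q0 : (0 < p ^ M)%N by rewrite expn_gt0 ltnW.
have QE : (p ^ M = p ^ (M - k) * p ^ k)%N by rewrite -expnD subnK.
pose F (t : R) := nm (weyl (P %/ p) t) ^+ (2 * q).
have FP t : F (t + 1) = F t by rewrite /F; have := weyl_period (P %/ p) t 1; rewrite mulr1z => ->.
have I1 := H M n.+1 P knM (ltn0Sn n) Pn.
have I2 : \sum_(c' < p ^ M) F (c'%:R / (p ^ M)%:R * (p ^ k)%:R) <= (p ^ M)%:R * (c1 * p%:R `^ ((r * r)%:R * n%:R + eps * n%:R)).
  have -> : \sum_(c' < p ^ M) F (c'%:R / (p ^ M)%:R * (p ^ k)%:R) = \sum_(c' < p ^ (M - k) * p ^ k) F (c'%:R / (p ^ (M - k))%:R).
    rewrite -QE; apply: eq_bigr => c' _; congr F.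
    have -> : (p ^ M)%:R = (p ^ (M - k))%:R * (p ^ k)%:R :> R by rewrite -natrM -QE.
    by field; rewrite !pnatr_eq0 -!lt0n !expn_gt0 ltnW.
  rewrite sum_periodic_mul ?expn_gt0 ?(ltnW p1) // QE natrM [_ * (p ^ k)%:R]mulrC -mulrA; apply: ler_wpM2l; first exact: ler0n.
  rewrite mulrA [_ * c1]mulrC; apply: IH; first by move: knM; rewrite mulnS; lia.
  by rewrite ltn_divLR ?(ltnW p1) // -expnSr.
apply: (@le_trans _ _ (2 ^+ (2 * q) * (c * (p ^ M)%:R * p%:R `^ ((r * r)%:R * n.+1%:R + eps * n.+1%:R) +
    (p ^ M)%:R * (c1 * p%:R `^ ((r * r)%:R * n%:R + eps * n%:R))))).
  apply: (@le_trans _ _ (\sum_(c' < p ^ M) 2 ^+ (2 * q) * (nm (\sum_(x < P.+1) (~~ (p %| x)%N)%:R * expi (c'%:R / (p ^ M)%:R * (x ^ k)%:R)) ^+ (2 * q) + F (c'%:R / (p ^ M)%:R * (p ^ k)%:R)))).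
    apply: ler_sum => c' _; apply: le_trans (add_pow_le _ (normc_ge0 _) (normc_ge0 _)).
    by apply: lerXn2r; rewrite ?nnegrE ?normc_ge0 ?addr_ge0 ?normc_ge0 // (weyl_split P _ (ltnW p1)) le_normcD.
  rewrite -mulr_sumr big_split /=; apply: ler_wpM2l; first exact: exprn_ge0.
  exact: lerD.
have step : 2 ^+ (2 * q).+1 * p%:R `^ ((r * r)%:R * n%:R + eps * n%:R) <= p%:R `^ ((r * r)%:R * n.+1%:R + eps * n.+1%:R) :> R.
  have -> : (r * r)%:R * n.+1%:R + eps * n.+1%:R = ((r * r)%:R + eps) + ((r * r)%:R * n%:R + eps * n%:R) :> R.
    by rewrite -natr1; ring.
  rewrite [p%:R `^ (_ + eps + _)]pwD //; apply: ler_wpM2r; first exact: E0.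
  apply: (@le_trans _ _ (p%:R `^ (r * r)%:R)); last by apply: ler_pw => //; rewrite lerDl ltW.
  rewrite powR_mulrn ?ler0n // -!natrX ler_nat; apply: (@leq_trans (8 ^ (r * r))); last by rewrite leq_exp2r // muln_gt0 r0.
  rewrite (_ : 8 = 2 ^ 3)%N // -expnM leq_exp2l //; have := tri_double r; rewrite -/q; clear -r0; nia.
have QR : 0 <= (p ^ M)%:R :> R by rewrite ler0n.
move: step; set A := p%:R `^ _; set B := p%:R `^ _ => step.
have h : (p ^ M)%:R * (c1 * A) <= c * (p ^ M)%:R * B.
  rewrite /c1 [leLHS](_ : _ = c * (p ^ M)%:R * (2 ^+ (2 * q).+1 * A)); last by ring.
  by apply: ler_wpM2l step; apply: mulr_ge0.
rewrite {2}/c1 exprS [leRHS](_ : _ = 2 ^+ (2 * q) * (c * (p ^ M)%:R * B + c * (p ^ M)%:R * B)); last by ring.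
by apply: ler_wpM2l; rewrite ?exprn_ge0 // lerD2l.
Qed.
End Hua.

(** * Shifts and Wooley's minor arc estimate *)

Section GeometricSums.
Variable R : realType.
Local Notation C := R[i].
Local Notation nm := (@Normc.normc R).

Lemma normc_nat n : nm n%:R = n%:R.
Proof. by rewrite -(rmorph_nat (real_complex R)) normc_real ger0_norm. Qed.

Definition geosum (X : nat) (t : R) : C := \sum_(w < X) expi (w%:R * t).

(** The term j = 0 vanishes, as 0^-1 = 0. *)
Definition harm (n : nat) : R := \sum_(j < n) j%:R^-1.

Lemma geosum_int X t (z : int) : geosum X (t + z%:~R) = geosum X t.
Proof.
apply: eq_bigr => w _; rewrite mulrDr.
have -> : w%:R * z%:~R = (w%:Z * z)%:~R :> R by rewrite intrM.
exact: expiD_int.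
Qed.

Lemma normc_geosum_le X t : nm (geosum X t) <= X%:R.
Proof.
apply: le_trans (le_normc_sum _ _ _) _.
by rewrite (eq_bigr (fun=> 1)) ?sumr_const ?card_ord // => w _; rewrite normc_expi.
Qed.

Lemma normc_geosumN X t : nm (geosum X (- t)) = nm (geosum X t).
Proof.
rewrite -[RHS]normc_conj rmorph_sum; congr (nm _); apply: eq_bigr => w _.
by rewrite mulrN; exact: esym (expiJ _).
Qed.

Lemma normc_geosum_mul X t : 0 <= t -> t <= 2^-1 -> nm (geosum X t) * t <= 1.
Proof.
move=> t0 t1; have h := normc_expi_sub1_ge t0 t1.
have : nm ((expi t - 1) * geosum X t) <= 2.
  have -> : geosum X t = \sum_(w < X) expi t ^+ w.
    by apply: eq_bigr => w _; rewrite mulr_natl expiMn.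
  rewrite -subrX1 -expiMn; apply: le_trans (le_normcD _ _) _.
  by rewrite normcN normc_expi Normc.normc1.
rewrite Normc.normcM => h2.
have := ler_wpM2r (normc_ge0 (geosum X t)) h; lra.
Qed.

Lemma sum_inj_le (I : finType) (N : nat) (cell : I -> 'I_N) (h : 'I_N -> R) : injective cell ->
  (forall j, 0 <= h j) -> \sum_i h (cell i) <= \sum_j h j.
Proof.
move=> ci h0; rewrite (bigID (fun j => j \in [set cell i | i in [set: I]])) /=.
rewrite big_imset /=; last by move=> i j _ _; apply: ci.
rewrite [X in _ <= X + _](eq_bigl xpredT) => [|i]; last by rewrite inE.
by rewrite lerDl sumr_ge0.
Qed.

(** The points lie in distinct arcs of length 1/N. With j arcs between it and 0 on its shorter side,
    a point contributes at most N / j; the two arcs next to 0 contribute at most X each. *)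
Lemma sum_geosum_cells (I : finType) (x : I -> R) X N (cell : I -> 'I_N) : injective cell ->
  (forall i, exists z : int, (cell i)%:R <= N%:R * (x i - z%:~R) <= (cell i).+1%:R) ->
  \sum_i nm (geosum X (x i)) <= 2 * X%:R + 2 * (N%:R * harm N).
Proof.
move=> ci H; pose h (j : 'I_N) := ((j == 0 :> nat)%:R * X%:R + (j == N.-1 :> nat)%:R * X%:R) +
  (N%:R * j%:R^-1 + N%:R * (N.-1 - j)%N%:R^-1) : R.
have h0 j : 0 <= h j by rewrite !addr_ge0 ?mulr_ge0 ?invr_ge0 ?ler0n.
apply: (@le_trans _ _ (\sum_i h (cell i))).
  apply: ler_sum => i _; have [z /andP[z1 z2]] := H i.
  set y := x i - z%:~R in z1 z2.
  have -> : x i = y + z%:~R by rewrite subrK.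
  rewrite geosum_int; set j := cell i in z1 z2 *; clearbody y j.
  have N0 : 0 < N%:R :> R by rewrite ltr0n; apply: leq_ltn_trans (leq0n j) (ltn_ord j).
  have y0 : 0 <= y by rewrite -(pmulr_rge0 _ N0); apply: le_trans z1; rewrite ler0n.
  have Nj : (N = N.-1 - j + j.+1)%N by have := ltn_ord j; lia.
  have inv_ge0 n : 0 <= N%:R * n%:R^-1 :> R by rewrite mulr_ge0 ?invr_ge0 ?ler0n.
  have e0 b : 0 <= (nat_of_bool b)%:R * X%:R :> R by rewrite mulr_ge0 ?ler0n.
  have [hy|hy] := leP y 2^-1.
    have [j0|j0] := posnP j.
      apply: le_trans (normc_geosum_le X y) _; rewrite /h j0 eqxx mul1r.
      by rewrite -addrA lerDl !addr_ge0.
    apply: (@le_trans _ _ (N%:R * j%:R^-1)); last by rewrite /h addrCA lerDl !addr_ge0.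
    have j0' : 0 < j%:R :> R by rewrite ltr0n.
    rewrite ler_pdivlMr //; apply: le_trans (ler_wpM2l (normc_ge0 _) z1) _.
    rewrite mulrCA ler_piMr ?ler0n //; exact: normc_geosum_mul.
  have [j0|j0] := posnP (N.-1 - j)%N.
    apply: le_trans (normc_geosum_le X y) _; rewrite /h.
    have -> : (j == N.-1 :> nat) by apply/eqP; have := ltn_ord j; lia.
    by rewrite mul1r addrAC lerDr !addr_ge0.
  apply: (@le_trans _ _ (N%:R * (N.-1 - j)%N%:R^-1)); last by rewrite /h addrA lerDr !addr_ge0.
  have j0' : 0 < (N.-1 - j)%N%:R :> R by rewrite ltr0n.
  have y1 : (N.-1 - j)%N%:R <= N%:R * (1 - y).
    have : (N.-1 - j)%N%:R + j.+1%:R = N%:R :> R by rewrite -natrD -Nj.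
    by move: z2; rewrite mulrBr mulr1; set A := (_ - j)%N%:R; set B := j.+1%:R; lra.
  have y2 : 0 <= 1 - y by rewrite -(pmulr_rge0 _ N0); apply: le_trans y1; rewrite ler0n.
  rewrite ler_pdivlMr //; apply: le_trans (ler_wpM2l (normc_ge0 _) y1) _.
  rewrite mulrCA ler_piMr ?ler0n //.
  have -> : nm (geosum X y) = nm (geosum X (1 - y)).
    by rewrite -normc_geosumN -(geosum_int X (- y) 1) addrC.
  by apply: normc_geosum_mul => //; lra.
apply: le_trans (sum_inj_le ci h0) _.
have -> : \sum_j h j = \sum_(j < N) (((j == 0 :> nat)%:R * X%:R + (j == N.-1 :> nat)%:R * X%:R) +
    (N%:R * j%:R^-1 + N%:R * (N.-1 - j)%N%:R^-1)) by [].
clear; case: N => [|N].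
  by rewrite big_ord0 mul0r mulr0 addr0 mulr_ge0.
rewrite !big_split /= -!mulr_suml -!mulr_sumr.
have -> : \sum_(i < N.+1) (i == 0 :> nat)%:R = 1 :> R.
  by rewrite big_ord_recl /= big1 ?addr0.
have -> : \sum_(i < N.+1) (i == N :> nat)%:R = 1 :> R.
  rewrite big_ord_recr /= eqxx big1 ?add0r // => i _.
  by rewrite (ltn_eqF (ltn_ord i)).
have -> : \sum_(i < N.+1) (N - i)%N%:R^-1 = harm N.+1.
  by rewrite (reindex_inj rev_ord_inj); apply: eq_bigr => i _; rewrite /= subSS subKn // -ltnS.
rewrite /harm; lra.
Qed.

Lemma harm_pow p m : (0 < p)%N -> harm (p ^ m) <= p%:R * m%:R.
Proof.
move=> p0; elim: m => [|m IH]; first by rewrite /harm expn0 big_ord1 invr0 mulr0.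
have pm0 : (0 < p ^ m)%N by rewrite expn_gt0 p0.
have -> : harm (p ^ m.+1) = harm (p ^ m) + \sum_(p ^ m <= j < p ^ m.+1) j%:R^-1.
  by rewrite /harm -!(big_mkord xpredT (fun j => j%:R^-1)) [LHS](big_cat_nat (n := p ^ m)) // leq_pexp2l.
rewrite -natr1 mulrDr mulr1; apply: lerD => //.
apply: (@le_trans _ _ (\sum_(p ^ m <= j < p ^ m.+1) (p ^ m)%:R^-1)).
  rewrite !big_nat; apply: ler_sum => j /andP[j1 _].
  by rewrite lef_pV2 ?posrE ?ltr0n ?ler_nat // (leq_trans pm0).
rewrite big_const_nat iter_addr_0 -[leLHS]mulr_natl ler_pdivrMr ?ltr0n // -natrM ler_nat expnS.
exact: leq_subr.
Qed.

Lemma leq_harm m n : (m <= n)%N -> harm m <= harm n.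
Proof.
move=> mn; rewrite /harm -!(big_mkord xpredT (fun j => j%:R^-1)) [leRHS](big_cat_nat (n := m)) //=.
by rewrite lerDl sumr_ge0 // => j _; rewrite invr_ge0.
Qed.

End GeometricSums.

(** Absorbs the logarithm, which appears as a multiple of M, into p^(eps M). *)
Lemma lin_le_pw (R : realType) p (eps : R) : (1 < p)%N -> 0 < eps ->
  exists2 c, 0 <= c & forall m : nat, m%:R <= c * p%:R `^ (eps * m%:R).
Proof.
move=> p1 e0; have p0 : (p%:R : R) != 0 by rewrite pnatr_eq0 -lt0n ltnW.
have l0 : 0 < ln (p%:R : R) by rewrite ln_gt0 // ltr1n.
exists (eps * ln p%:R)^-1 => [|m]; first by rewrite invr_ge0 ltW // mulr_gt0.
rewrite mulrC ler_pdivlMr ?mulr_gt0 // /powR (negbTE p0).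
apply: le_trans (expR_ge1Dx _); rewrite mulrA [m%:R * _]mulrC lerDr //.
Qed.

(** Each distance from i is attained by at most two indices j. *)
Lemma sum_distn_le (R : realType) (F : nat -> R) i b : (forall u, 0 <= F u) -> (i <= b)%N ->
  \sum_(j < b.+1) F (i - j + (j - i))%N <= 2 * \sum_(u < b.+1) F u.
Proof.
move=> F0 ib; rewrite -(big_mkord xpredT (fun j => F (i - j + (j - i))%N)) (big_cat_nat (n := i.+1)) //=.
have sub n m : (n <= m)%N -> \sum_(0 <= u < n) F u <= \sum_(0 <= u < m) F u.
  by move=> nm; rewrite [leRHS](big_cat_nat (n := n)) //= lerDl sumr_ge0.
rewrite -(big_mkord xpredT F) mulr_natl mulr2n; apply: lerD.
  rewrite big_nat_rev /= add0n; apply: le_trans (sub i.+1 b.+1 ib).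
  by rewrite !big_nat; apply: ler_sum => j /andP[_ h]; rewrite (_ : (_ + _)%N = j) //; lia.
rewrite -{1}[i.+1]add0n big_addn; apply: le_trans (sub (b.+1 - i)%N b.+1 (leq_subr _ _)).
rewrite subSS [leRHS](_ : _ = \sum_(0 <= u < (b - i).+1) F u) -?subSn //.
rewrite subSn // [leRHS]big_nat_recl //= ler_wpDl //.
by rewrite !big_nat; apply: ler_sum => j /andP[_ h]; rewrite (_ : (_ + _)%N = j.+1) //; lia.
Qed.

(** * Averaging over shifts of the variable *)

Section Wooley.
Variables (R : realType) (k : nat).
Local Notation C := R[i].
Local Notation nm := (@Normc.normc R).
Hypothesis k_gt1 : (1 < k)%N.
Let k_gt0 : (0 < k)%N := ltnW k_gt1.
Local Notation t := (tri k).

Section Modulus.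
Variable Q : nat.
Hypothesis Q_gt1 : (1 < Q)%N.
Local Notation psi := (@addchar R Q).
Local Notation rV := 'rV['Z_Q]_k.+1.

(** The coefficient vector of c (X - y)^k. *)
Definition shift_row (c y : 'Z_Q) : rV := \row_i (c * ((- y) ^+ (k - i) *+ 'C(k, i))).

Lemma horner_shift_row c y x : (rVpoly (shift_row c y)).[x] = c * (x - y) ^+ k.
Proof.
rewrite horner_rVpoly_sum [x - y]addrC exprDn mulr_sumr; apply: eq_bigr => i _.
by rewrite mxE -mulrA mulrnAl.
Qed.

Definition idx1 : 'I_k.+1 := Ordinal (ltnW k_gt1 : (1 < k.+1)%N).
Definition idx_pred : 'I_k.+1 := Ordinal (leq_subr 1 k : (k - 1 < k.+1)%N).

Lemma horner_rVpoly_delta (v : rV) h (j : 'I_k.+1) x :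
  (rVpoly (v + h *: delta_mx 0 j)).[x] = (rVpoly v).[x] + h * x ^+ j.
Proof. by rewrite linearD linearZ /= rVpoly_delta hornerD hornerZ hornerXn. Qed.

(** Fourier coefficient at h of the window y < z <= y + X. *)
Definition kernel X (y : nat) (h : 'Z_Q) : C := \sum_(w < X) psi (- (h * (y + w.+1)%:R)).

Lemma normc_kernel X y h : nm (kernel X y h) = nm (geosum X (h%:R / Q%:R : R)).
Proof.
rewrite -normc_conj /kernel rmorph_sum.
have -> : \sum_(w < X) (psi (- (h * (y + w.+1)%:R)))^*%C = psi (h * y.+1%:R) * geosum X (h%:R / Q%:R).
  rewrite mulr_sumr; apply: eq_bigr => w _; rewrite addcharJ // opprK.
  have -> : h * (y + w.+1)%:R = h * y.+1%:R + (h * w)%N%:R by rewrite natrM natr_Zp -mulrDr -natrD addnS addSn.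
  rewrite addcharD // addchar_nat //; congr (_ * expi _); rewrite natrM; ring.
by rewrite Normc.normcM normc_addchar mul1r.
Qed.

Lemma sum_kernel_le X y : \sum_h nm (kernel X y h) <= 2 * X%:R + 2 * (Q%:R * harm R Q).
Proof.
have QE : (Zp_trunc Q).+2 = Q by exact: Zp_cast.
under eq_bigr => h _ do rewrite normc_kernel.
apply: (@sum_geosum_cells R 'Z_Q (fun h => h%:R / Q%:R) X Q (cast_ord QE)); first exact: cast_ord_inj.
move=> i; exists 0; rewrite subr0 mulrC divfK ?lexx ?ler_nat ?leqnSn //=.
by rewrite pnatr_eq0; lia.
Qed.

(** The variable is replaced by z - y with z in the window. The longer range z < 2X is independent
    of y, and the window is detected by linear phases h, which act on the coefficient of degree
    1. *)
Lemma weyl_shift X y (c : 'Z_Q) : (2 * X <= Q)%N -> (y < X)%N ->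
  Q%:R * weyl k X (c%:R / Q%:R) =
  \sum_h kernel X y h * wsum (2 * X) (fun=> 1) (shift_row c y%:R + h *: delta_mx 0 idx1).
Proof.
move=> XQ yX; symmetry.
pose g (w z : nat) : C := psi (c * (z%:R - y%:R) ^+ k).
transitivity (\sum_(w < X) \sum_(z < 2 * X) g w z * \sum_h psi ((z%:R - (y + w.+1)%:R) * h)).
  under eq_bigr => h _ do rewrite /kernel /wsum big_distrlr /=.
  rewrite exchange_big; apply: eq_bigr => w _; rewrite exchange_big; apply: eq_bigr => z _.
  rewrite mulr_sumr; apply: eq_bigr => h _.
  rewrite horner_rVpoly_delta horner_shift_row mul1r /g -!addcharD //; congr psi; rewrite expr1; ring.
rewrite /weyl big_add1 big_mkord mulr_sumr; apply: eq_bigr => w _.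
have zX : (y + w.+1 < 2 * X)%N by have := ltn_ord w; lia.
rewrite (bigD1 (Ordinal zX)) //= subrr addchar_sum // eqxx big1 ?addr0 => [|z zw].
  rewrite /g natrD [_ - _]addrAC subrr add0r mulrC; congr (_ * _).
  by rewrite -natrX -{1}[c]natr_Zp -natrM addchar_nat // natrM mulrAC.
rewrite addchar_sum // subr_eq0 -(inj_eq val_inj) /= !val_Zp_nat // !modn_small; try by apply: leq_trans XQ.
by move: zw; rewrite -(inj_eq val_inj) /= => /negbTE ->; rewrite mulr0.
Qed.

(** Jensen's inequality with the moduli of the kernel as weights. They do not depend on y, and their
    mean over h is logarithmic. *)
Lemma weyl_shift_pow X y (c : 'Z_Q) T : (2 * X <= Q)%N -> (y < X)%N -> (0 < T)%N ->
  let K (h : nat) := nm (geosum X (h%:R / Q%:R : R)) in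
  (Q%:R * nm (weyl k X (c%:R / Q%:R))) ^+ T <= (\sum_(h : 'Z_Q) K h) ^+ T.-1 *
   \sum_(h : 'Z_Q) K h * nm (wsum (2 * X) (fun=> 1) (shift_row c y%:R + h *: delta_mx 0 idx1)) ^+ T.
Proof.
move=> XQ yX T0; pose K (h : nat) : R := nm (geosum X (h%:R / Q%:R : R)); rewrite -/K; cbv zeta.
case: T T0 => // T _; set S := \sum_(h : 'Z_Q) K h.
pose G (h : 'Z_Q) : R := nm (wsum (2 * X) (fun=> 1) (shift_row c y%:R + h *: delta_mx 0 idx1)).
have K0 h : 0 <= K h by exact: normc_ge0.
have S0 : 0 < S.
  rewrite /S (bigD1 0) //=; apply: ltr_wpDr; first exact: sumr_ge0.
  rewrite /K mul0r /geosum; under eq_bigr => w _ do rewrite mulr0 expi0.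
  rewrite sumr_const card_ord normc_nat ltr0n.
  exact: leq_ltn_trans (leq0n y) yX.
have := @jensen_pow R _ (fun h : 'Z_Q => K h / S) G T.+1.
move=> /(_ (fun h => divr_ge0 (K0 h) (ltW S0)) (fun h => normc_ge0 _) _ isT).
rewrite -mulr_suml divff ?gt_eqF // => /(_ erefl) h1.
apply: (@le_trans _ _ (S ^+ T.+1 * \sum_(h : 'Z_Q) K h / S * G h ^+ T.+1)); last first.
  rewrite exprSr -mulrA; apply: ler_wpM2l; first by rewrite exprn_ge0 // ltW.
  by rewrite mulr_sumr le_eqVlt; apply/orP; left; apply/eqP/eq_bigr => h _; field; rewrite gt_eqF.
apply: le_trans (ler_wpM2l (exprn_ge0 _ (ltW S0)) h1); rewrite -exprMn.
apply: lerXn2r; rewrite ?nnegrE.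
- by rewrite mulr_ge0 ?normc_ge0.
- by rewrite mulr_ge0 ?(ltW S0) // sumr_ge0 // => h _; rewrite !mulr_ge0 ?invr_ge0 ?normc_ge0 // ltW.
rewrite -[X in X * _]normc_nat -Normc.normcM (weyl_shift c XQ yX).
apply: le_trans (le_normc_sum _ _ _) _; rewrite mulr_sumr; apply: ler_sum => h _.
rewrite Normc.normcM normc_kernel /G le_eqVlt; apply/orP; left; apply/eqP.
by rewrite mulrA [S * _]mulrC divfK // gt_eqF.
Qed.

Lemma normc_sum_addchar X (i j : nat) (c h : 'Z_Q) :
  nm (\sum_(y < X) psi ((i%:R - j%:R) * (- (k%:R * y%:R * c) + h))) =
  nm (geosum X ((i - j + (j - i))%N%:R * k%:R * (c%:R / Q%:R : R))).
Proof.
have E (z : 'Z_Q) : \sum_(y < X) psi (z * (k%:R * y%:R * c)) = \sum_(y < X) psi (y%:R * (z * k%:R * c)).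
  by apply: eq_bigr => y _; congr psi; ring.
have G (n : nat) : \sum_(y < X) psi (n%:R * (k%:R * y%:R * c)) = geosum X (n%:R * k%:R * (c%:R / Q%:R : R)).
  rewrite E; apply: eq_bigr => y _; rewrite -[c in LHS]natr_Zp -!natrM addchar_nat //; congr expi.
  by rewrite !natrM; ring.
have -> : \sum_(y < X) psi ((i%:R - j%:R) * (- (k%:R * y%:R * c) + h)) =
    psi ((i%:R - j%:R) * h) * \sum_(y < X) psi ((j%:R - i%:R) * (k%:R * y%:R * c)).
  by rewrite mulr_sumr; apply: eq_bigr => y _; rewrite -addcharD //; congr psi; ring.
rewrite Normc.normcM normc_addchar mul1r.
have [ij|/ltnW ji] := leqP i j.
  by rewrite -natrB // G (eqP ij) add0n.
rewrite -opprB -natrB // -normc_conj rmorph_sum (eqP ji) addn0 -G; congr (nm _).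
by apply: eq_bigr => y _; apply: etrans (addcharJ R Q_gt1 _) _; rewrite mulNr opprK.
Qed.

Definition low : {set 'I_k.+1} := [set j : 'I_k.+1 | (j < k - 1)%N].

(** Once the degrees below k - 1 are completed, only the coefficients c of degree k and -k y c of
    degree k - 1 survive. The phase h joins the latter exactly when k = 2, where the degrees 1 and k
    - 1 coincide. *)
Lemma supp_sum_shift_row (G : rV -> R) (c y h : 'Z_Q) :
  supp_sum G low (shift_row c y + h *: delta_mx 0 idx1) =
  supp_sum G low (c *: delta_mx 0 ord_max + (- (k%:R * y * c) + (k == 2)%N%:R * h) *: delta_mx 0 idx_pred).
Proof.
set w := _ + h *: _.
pose r : rV := \row_i (if (i < k - 1)%N then w 0 i else 0).
rewrite -[w](subrK r) supp_sum_shift; last first.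
  by apply/forallP => i; rewrite inE mxE; case: ifP => //= _; rewrite eqxx.
congr (supp_sum _ _ _); apply/rowP => i; rewrite !mxE.
have e (j : 'I_k.+1) : (i == j) = (i == j :> nat)%N by [].
have [h1|h1] := ltnP i (k - 1).
  rewrite subrr !e /= (ltn_eqF h1) (ltn_eqF (leq_trans h1 (leq_subr _ _))) !mulr0 addr0 //.
rewrite subr0; have [ik|ik] := eqVneq (i : nat) k.
  rewrite !e /= ik subnn expr0 binn mulr1n mulr1 eqxx.
  have -> : (k == 1) = false by lia.
  have -> : (k == k - 1)%N = false by lia.
  by rewrite !mulr0 mulr1.
have ik1 : (i = k - 1 :> nat)%N by have := ltn_ord i; lia.
rewrite !e /= ik1 eqxx.
have -> : (k - 1 == k)%N = false by lia.
have -> : (k - 1 == 1)%N = (k == 2) by lia.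
have -> : (k - (k - 1) = 1)%N by lia.
rewrite bin_sub // bin1 expr1 /= -[_ *+ k]mulr_natl; case: (k == 2) => /=; rewrite ?mulr1 ?mulr0; ring.
Qed.

Lemma low_all : ord_max |: (idx_pred |: low) = setT.
Proof. by apply/setP => i; rewrite !inE -!(inj_eq val_inj) /=; have := ltn_ord i; lia. Qed.

(** For fixed c and h the shifts y place the coefficient of degree k - 1 at a translate of the
    points -k y c. The sieve compares these X points with the mean over the whole coordinate, at a
    cost Delta that measures their distribution; the sum over c then completes the top
    coordinate. *)
Lemma wooley_fibre X (B : pred 'Z_Q) (Delta : R) h :
  let G (u : rV) := nm (wsum (2 * X) (fun=> 1 : C) u) ^+ (2 * t) in
  let b := ((2 * X) ^ (k - 1) * t)%N in
  (0 < X)%N -> (b < Q)%N -> 0 <= Delta ->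
  (forall c, B c -> \sum_(u < b.+1) nm (geosum X (u%:R * k%:R * (c%:R / Q%:R : R))) <= Delta) ->
  \sum_(c | B c) \sum_(y < X) G (shift_row c y%:R + h *: delta_mx 0 idx1) <=
  t.+1%:R ^+ (k - 1) * (2 * X)%:R ^+ (tri (k - 2)) / Q%:R ^+ (k - 1) * (2 * Delta / Q%:R) * \sum_u G u.
Proof.
move=> G b X0 bQ D0 HB.
have Q0 : (0 < Q)%N := ltnW Q_gt1.
have G0 u : 0 <= G u by rewrite exprn_ge0 // normc_ge0.
set Pi := _ / _.
have Pi0 : 0 <= Pi by rewrite divr_ge0 ?mulr_ge0 ?exprn_ge0 ?ler0n.
have step1 (w : rV) : G w <= Pi * supp_sum G low w.
  pose s : seq 'I_k.+1 := [seq j : 'I_k.+1 <- enum 'I_k.+1 | (j < k - 1)%N].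
  have := @supp_sum_complete R Q Q_gt1 k (2 * X) (fun=> 1) t set0 s w.
  cbv zeta; rewrite filter_uniq ?enum_uniq // supp_sum0 => /(_ isT _ _)/le_trans; apply.
  - by move=> j _; rewrite inE.
  - move=> j; rewrite mem_filter => /andP[jk _]; apply: leq_ltn_trans bQ.
    by rewrite leq_mul2r leq_pexp2l ?orbT ?muln_gt0 // ltnW.
  have -> : set0 :|: [set j in s] = low by apply/setP => j; rewrite !inE mem_filter mem_enum andbT.
  apply: ler_wpM2r; first exact: supp_sum_ge0.
  have -> : \prod_(j <- s) (((2 * X) ^ j * t).+1%:R / Q%:R) = \prod_(j < k - 1) (((2 * X) ^ j * t).+1%:R / Q%:R) :> R.
    rewrite /s big_filter big_enum_cond /= (big_ord_widen k.+1 (fun j : nat => ((2 * X) ^ j * t).+1%:R / Q%:R)) //.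
    by apply: leqW; apply: leq_subr.
  apply: le_trans (prod_degrees_le _ _ _ _ _) _ => //; first by rewrite muln_gt0.
  by rewrite /Pi; have -> : (k - 2 = (k - 1).-1)%N by lia.
rewrite -mulrA.
apply: (@le_trans _ _ (\sum_(c | B c) \sum_(y < X) Pi * supp_sum G low (shift_row c y%:R + h *: delta_mx 0 idx1))).
  by apply: ler_sum => c _; apply: ler_sum => y _.
under eq_bigr => c _ do rewrite -mulr_sumr.
rewrite -mulr_sumr; apply: ler_wpM2l => //.
have jlow : idx_pred \notin low by rewrite inE ltnn.
have klow : ord_max \notin idx_pred |: low by rewrite !inE -(inj_eq val_inj) /=; lia.
apply: (@le_trans _ _ (\sum_(c | B c) 2 * Delta / Q%:R * supp_sum G (idx_pred |: low) (c *: delta_mx 0 ord_max))).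
  apply: ler_sum => c Bc.
  under eq_bigr => y _ do rewrite supp_sum_shift_row.
  rewrite supp_sum_add // /supp_sum exchange_big [X in _ <= _ * X]exchange_big mulr_sumr; apply: ler_sum => u _.
  rewrite (eq_bigr (fun y : 'I_X => G (c *: delta_mx 0 ord_max + u + (- (k%:R * y%:R * c) + (k == 2)%N%:R * h) *: delta_mx 0 idx_pred))); last by move=> y _; rewrite addrAC.
  rewrite [X in _ <= _ * X](eq_bigr (fun z => G (c *: delta_mx 0 ord_max + u + z *: delta_mx 0 idx_pred))); last by move=> y _; rewrite addrAC.
  apply: (@wsum_sieve R Q Q_gt1 k (2 * X) (fun=> 1) (c *: delta_mx 0 ord_max + u) idx_pred t 'I_X
    (fun y => - (k%:R * y%:R * c) + (k == 2)%N%:R * h) (2 * Delta) bQ) => i ib.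
  under eq_bigr => i' _ do rewrite normc_sum_addchar.
  apply: le_trans (ler_wpM2l _ (HB c Bc)) => //.
  exact: (@sum_distn_le R (fun u => nm (geosum X (u%:R * k%:R * (c%:R / Q%:R : R)))) i b (fun u => normc_ge0 _) ib).
rewrite -mulr_sumr; apply: ler_wpM2l; first by rewrite divr_ge0 ?mulr_ge0.
rewrite -(supp_sumT G 0) -low_all supp_sum_add //.
under [leRHS]eq_bigr => z _ do rewrite add0r.
rewrite [leRHS](bigID B) /= lerDl; apply: sumr_ge0 => c _; exact: supp_sum_ge0.
Qed.

End Modulus.

Lemma tri_shift : (tri (k - 2) + t = (k * k - k).+1)%N.
Proof.
have := tri_double k; have := tri_double (k - 2); case: k k_gt1 => [//|[//|m]] _.
have -> : (m.+2 - 2 = m)%N by lia.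
have -> : (m.+2 * m.+2 - m.+2 = m.+2 * m.+1)%N by rewrite -{3}[m.+2]muln1 -mulnBr subn1.
move=> h1 h2; clear -h1 h2; nia.
Qed.

(** All X shifts represent the same Weyl sum, so the moment is averaged over them, and Vinogradov's
    theorem bounds the completed mean. The powers of X are tri (k-2) from completion, tri k from the
    mean value and -1 from averaging, in total k^2 - k. *)
Lemma wooley_mean p eps : prime p -> (k < p)%N -> (t < p)%N -> 0 < eps ->
  exists2 c, 0 <= c & forall M n X (B : pred nat) Delta, (k * n <= M)%N -> (0 < X)%N -> (2 * X <= p ^ n)%N -> 0 <= Delta ->
  (forall c : nat, B c -> \sum_(u < ((2 * X) ^ (k - 1) * t).+1) nm (geosum X (u%:R * k%:R * (c%:R / (p ^ M)%:R : R))) <= Delta) ->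
  \sum_(c < p ^ M | B c) nm (weyl k X (c%:R / (p ^ M)%:R)) ^+ (2 * t) <=
  c * p%:R `^ (eps * M%:R) * (p ^ M)%:R * X%:R ^+ (k * k - k) * Delta.
Proof.
move=> pp kp tp e0; have p1 := prime_gt1 pp.
have t0 : (0 < t)%N := tri_gt0 k_gt0.
have T0 : 0 < (2 * t)%:R :> R by rewrite ltr0n muln_gt0.
have e20 : 0 < eps / 2%:R by rewrite divr_gt0.
have [cV cV0 HV] := @vinogradov_mean R p k pp kp k_gt0 _ e20.
have [cL cL0 HL] := @lin_le_pw R p _ p1 (divr_gt0 e20 T0).
pose c1 := 2 + 2 * (p%:R * cL); have c10 : 0 <= c1 by rewrite addr_ge0 ?mulr_ge0.
pose c2 := c1 ^+ (2 * t) * (t.+1%:R ^+ (k - 1) * 2 * 2 ^+ (k * k - k).+1 * cV).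
have c20 : 0 <= c2 by rewrite !mulr_ge0 ?exprn_ge0.
exists c2 => // M n X B Delta knM X0 Xn D0 HB.
have n0 : (0 < n)%N by case: n Xn {knM} => //; lia.
have M0 : (0 < M)%N by apply: leq_trans knM; rewrite muln_gt0 k_gt0.
have Q1 : (1 < p ^ M)%N by rewrite -(expn0 p) ltn_exp2l.
have nM : (n <= M)%N by apply: leq_trans knM; rewrite leq_pmull.
set Q := (p ^ M)%N in Q1 HB *.
have XQ : (2 * X <= Q)%N by apply: leq_trans Xn _; rewrite leq_pexp2l ?(ltnW p1).
have bQ : ((2 * X) ^ (k - 1) * t < Q)%N.
  apply: (@leq_ltn_trans ((p ^ n) ^ (k - 1) * t)); first by rewrite leq_mul2r leq_exp2r ?subn_gt0 // Xn orbT.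
  rewrite -expnM; apply: (@leq_trans (p ^ (n * (k - 1)) * p)); first by rewrite ltn_pmul2l ?expn_gt0 ?(ltnW p1).
  rewrite -expnSr leq_pexp2l ?(ltnW p1) //; apply: leq_trans knM; rewrite mulnC.
  by case: k k_gt1 => // k' _; rewrite subn1 /= mulSn -addn1 addnC leq_add2r.
pose K (h : nat) : R := nm (geosum X (h%:R / Q%:R : R)).
pose G (u : 'rV['Z_Q]_k.+1) : R := nm (wsum (2 * X) (fun=> 1 : C) u) ^+ (2 * t).
pose S : R := \sum_(h : 'Z_Q) K h.
pose f (c : nat) : R := nm (weyl k X (c%:R / Q%:R)).
have QR : 0 < Q%:R :> R by rewrite ltr0n ltnW.
have XR : 0 < X%:R :> R by rewrite ltr0n.
have K0 h : 0 <= K h by exact: normc_ge0.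
have S0 : 0 <= S by exact: sumr_ge0.
have G0 u : 0 <= G u by rewrite exprn_ge0 // normc_ge0.
pose E : R := t.+1%:R ^+ (k - 1) * (2 * X)%:R ^+ (tri (k - 2)) / Q%:R ^+ (k - 1) * (2 * Delta / Q%:R) * \sum_u G u.
have lower : X%:R * Q%:R ^+ (2 * t) * \sum_(c < Q | B c) f c ^+ (2 * t) <= S ^+ (2 * t) * E.
  have -> : \sum_(c < Q | B c) f c ^+ (2 * t) = \sum_(c : 'Z_Q | B c) f c ^+ (2 * t).
    by rewrite big_mkcond [RHS]big_mkcond (@sum_Zp _ Q (fun c => if B c then f c ^+ (2 * t) else 0)).
  have -> : X%:R * Q%:R ^+ (2 * t) * \sum_(c : 'Z_Q | B c) f c ^+ (2 * t) =
     \sum_(c : 'Z_Q | B c) \sum_(y < X) (Q%:R * f c) ^+ (2 * t).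
    rewrite mulr_sumr; apply: eq_bigr => c _.
    by rewrite sumr_const card_ord -[RHS]mulr_natl exprMn mulrA.
  apply: (@le_trans _ _ (\sum_(c : 'Z_Q | B c) \sum_(y < X) S ^+ (2 * t).-1 *
      \sum_(h : 'Z_Q) K h * G (shift_row c y%:R + h *: delta_mx 0 idx1))).
    apply: ler_sum => c _; apply: ler_sum => y _.
    by apply: weyl_shift_pow => //; rewrite muln_gt0.
  under eq_bigr => c _ do rewrite -mulr_sumr.
  rewrite -mulr_sumr -[in leRHS](prednK (_ : 0 < 2 * t)%N) ?muln_gt0 // exprSr -mulrA.
  apply: ler_wpM2l; first exact: exprn_ge0.
  under eq_bigr => c _ do rewrite exchange_big.
  rewrite exchange_big /= mulr_suml; apply: ler_sum => h _.
  under eq_bigr => c _ do rewrite -mulr_sumr.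
  rewrite -mulr_sumr; apply: ler_wpM2l => //.
  by apply: (@wooley_fibre Q Q1 X (fun c : 'Z_Q => B c)) => // c; apply: HB.
have GV : \sum_u G u <= cV * p%:R `^ (eps / 2%:R * M%:R) * (Q%:R ^+ k.+1 * (2 * X)%:R ^+ t).
  apply: le_trans (HV M n (2 * X)%N _ knM M0 Xn _) _; first by move=> x; rewrite Normc.normc1.
  apply: ler_wpM2r; first by rewrite mulr_ge0 ?exprn_ge0.
  apply: ler_wpM2l => //; apply: ler_pw => //; apply: ler_wpM2l; [exact: ltW | by rewrite ler_nat].
have SQ : S <= Q%:R * (c1 * p%:R `^ (eps / 2%:R / (2 * t)%:R * M%:R)).
  have -> : S = \sum_(h : 'Z_Q) nm (kernel X 0 h) by apply: eq_bigr => h _; rewrite normc_kernel.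
  apply: le_trans (sum_kernel_le Q1 _ _) _; have h1 := harm_pow R M (ltnW p1).
  have h2 := HL M; set A := p%:R `^ _ in h2 *.
  have A1 : 1 <= A by apply: pw_ge1 => //; rewrite !mulr_ge0 ?invr_ge0 // ltW.
  have XQ' : X%:R <= Q%:R :> R by rewrite ler_nat; apply: leq_trans XQ; rewrite leq_pmull.
  have -> : Q%:R * (c1 * A) = Q%:R * (2 * A) + Q%:R * (2 * (p%:R * cL) * A) by rewrite /c1; ring.
  apply: lerD.
    rewrite mulrCA; apply: ler_wpM2l => //; rewrite -[leLHS]mulr1; apply: ler_pM => //.
  rewrite mulrCA; apply: ler_wpM2l; first exact: ltW.
  rewrite -[leRHS]mulrA.
  apply: ler_wpM2l => //; apply: le_trans h1 _; rewrite -mulrA; apply: ler_wpM2l => //.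
have ST : S ^+ (2 * t) <= Q%:R ^+ (2 * t) * (c1 ^+ (2 * t) * p%:R `^ (eps / 2%:R * M%:R)).
  have -> : p%:R `^ (eps / 2%:R * M%:R) = (p%:R `^ (eps / 2%:R / (2 * t)%:R * M%:R)) ^+ (2 * t) :> R.
    by rewrite pwX // [_ * M%:R * _]mulrAC divfK ?gt_eqF.
  rewrite -!exprMn; apply: lerXn2r => //; rewrite nnegrE !mulr_ge0 ?powR_ge0 // ltW.
rewrite -(ler_pM2l (mulr_gt0 XR (exprn_gt0 (2 * t) QR))); apply: le_trans lower _.
have E0 : 0 <= E by rewrite !mulr_ge0 ?invr_ge0 ?exprn_ge0 ?sumr_ge0.
have EV : E <= t.+1%:R ^+ (k - 1) * (2 * X)%:R ^+ (tri (k - 2)) / Q%:R ^+ (k - 1) * (2 * Delta / Q%:R) *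
   (cV * p%:R `^ (eps / 2%:R * M%:R) * (Q%:R ^+ k.+1 * (2 * X)%:R ^+ t)).
  by apply: ler_wpM2l GV; rewrite !mulr_ge0 ?invr_ge0 ?exprn_ge0.
apply: le_trans (ler_pM (exprn_ge0 _ S0) E0 ST EV) _.
rewrite le_eqVlt; apply/orP; left; apply/eqP.
have -> : eps * M%:R = eps / 2%:R * M%:R + eps / 2%:R * M%:R by rewrite -mulrDl -splitr.
rewrite pwD // /c2 natrM.
have e1 : (2 * X%:R) ^+ tri (k - 2) * (2 * X%:R) ^+ t = 2 ^+ (k * k - k).+1 * (X%:R * X%:R ^+ (k * k - k)) :> R.
  by rewrite -exprD tri_shift -exprS exprMn.
have e2 : Q%:R ^+ k.+1 = Q%:R ^+ (k - 1) * Q%:R * Q%:R :> R by rewrite -!exprSr subn1 (prednK k_gt0).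
rewrite e2; set q := Q%:R ^+ (k - 1); have q0 : q != 0 by rewrite gt_eqF // exprn_gt0.
transitivity (Q%:R ^+ (2 * t) * (c1 ^+ (2 * t) * p%:R `^ (eps / 2%:R * M%:R)) * (t.+1%:R ^+ (k - 1) * 2 * Delta *
  (cV * p%:R `^ (eps / 2%:R * M%:R)) * Q%:R * ((2 * X%:R) ^+ tri (k - 2) * (2 * X%:R) ^+ t))).
  by set x1 := _ ^+ tri _; set x2 := _ ^+ t; field; rewrite q0 (gt_eqF QR).
by rewrite e1; ring.
Qed.

End Wooley.

(** * Major and minor arcs *)

Section Diophantine.
Variable R : realType.
Local Notation C := R[i].
Local Notation nm := (@Normc.normc R).

Definition circle_cell (N : nat) (y : R) : nat := Num.truncn (N%:R * (y - (Num.floor y)%:~R)).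

Lemma circle_cell_itv N y : (0 < N)%N ->
  (circle_cell N y)%:R <= N%:R * (y - (Num.floor y)%:~R) <= (circle_cell N y).+1%:R.
Proof.
move=> N0; have /andP[y0 _] := floor_itv y.
have h : 0 <= N%:R * (y - (Num.floor y)%:~R) by rewrite mulr_ge0 ?ler0n // subr_ge0.
by have /andP[-> /ltW ->] := truncn_itv h.
Qed.

Lemma circle_cell_lt N y : (0 < N)%N -> (circle_cell N y < N)%N.
Proof.
move=> N0; have /andP[y0 y1] := floor_itv y.
have h : 0 <= N%:R * (y - (Num.floor y)%:~R) by rewrite mulr_ge0 ?ler0n // subr_ge0.
rewrite truncn_lt_nat // -[ltRHS]mulr1 ltr_pM2l ?ltr0n //.
by move: y1; rewrite intrD; lra.
Qed.

Lemma circle_cell_close N y z : (0 < N)%N -> circle_cell N y = circle_cell N z ->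
  exists m : int, N%:R * `|y - z - m%:~R| < 1.
Proof.
move=> N0 e; exists (Num.floor y - Num.floor z).
have /andP[y0 _] := floor_itv y; have /andP[z0 _] := floor_itv z.
have hy : 0 <= N%:R * (y - (Num.floor y)%:~R) by rewrite mulr_ge0 ?ler0n // subr_ge0.
have hz : 0 <= N%:R * (z - (Num.floor z)%:~R) by rewrite mulr_ge0 ?ler0n // subr_ge0.
have /andP[y1 y2] := truncn_itv hy; have /andP[z1 z2] := truncn_itv hz.
move: y1 y2 z1 z2; rewrite -/(circle_cell N y) -/(circle_cell N z) e -[_.+1%:R]natr1 => y1 y2 z1 z2.
rewrite -{1}[N%:R]ger0_norm // -normrM intrB ltr_norml; lra.
Qed.

(** Pigeonhole for N + 1 multiples of alpha in N arcs; dividing q and a by their gcd only improves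
    the approximation. *)
Lemma dirichlet_approx (alpha : R) N : (0 < N)%N -> exists q (a : int),
  [/\ (0 < q <= N)%N, coprime q `|a| & N%:R * `|q%:R * alpha - a%:~R| < 1].
Proof.
move=> N0; pose f (j : 'I_N.+1) := Ordinal (circle_cell_lt (j%:R * alpha) N0).
have [q [a [/andP[q0 qN] h]]] : exists q (a : int), (0 < q <= N)%N /\ N%:R * `|q%:R * alpha - a%:~R| < 1.
  case: (boolP (injectiveb f)) => [/injectiveP/leq_card|/injectivePn[x [y xy fxy]]].
    by rewrite !card_ord ltnn.
  wlog lxy : x y xy fxy / (x < y)%N => [H|].
    have [lt|lt|e] := ltngtP x y; [exact: (H x y) | apply: (H y x) => // |].
      by rewrite eq_sym.
    by move: xy; rewrite -(inj_eq val_inj) /= e eqxx.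
  have [m hm] := circle_cell_close N0 (congr1 val (esym fxy) : circle_cell N (y%:R * alpha) = circle_cell N (x%:R * alpha)).
  exists (y - x)%N, m; split; first by have := ltn_ord y; lia.
  by rewrite natrB 1?ltnW // mulrBl.
pose g := gcdn q `|a|; have g0 : (0 < g)%N by rewrite gcdn_gt0 q0.
have [q' qE] : exists q', q = (q' * g)%N by apply/dvdnP/dvdn_gcdl.
have [b bE] : exists b, `|a|%N = (b * g)%N by apply/dvdnP/dvdn_gcdr.
have [a' aE] : exists a' : int, a = a' * g%:Z.
  have [a0|a0] := leP 0 a; [exists b%:Z | exists (- b%:Z)].
    by rewrite -PoszM -bE gez0_abs.
  by rewrite mulNr -PoszM -bE ltz0_abs // opprK.
exists q', a'; split.
- have q'0 : (0 < q')%N by move: q0; rewrite qE muln_gt0 => /andP[].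
  by rewrite q'0; apply: leq_trans qN; rewrite qE leq_pmulr.
- have bE' : b = `|a'|%N by apply/eqP; rewrite -(eqn_pmul2r g0) -bE aE abszM.
  have : (gcdn q' `|a'| * g == 1 * g)%N by rewrite muln_gcdl -bE' -qE -bE mul1n.
  by rewrite eqn_pmul2r.
apply: le_lt_trans h; apply: ler_wpM2l => //.
have -> : q%:R * alpha - a%:~R = g%:R * (q'%:R * alpha - a'%:~R).
  by rewrite qE aE natrM intrM; ring.
by rewrite normrM ger0_norm // ler_peMl // ler1n.
Qed.

Lemma sum_blocks (F : nat -> R) m n : \sum_(i < m * n) F i = \sum_(b < m) \sum_(r < n) F (b * n + r)%N.
Proof.
elim: m => [|m IH]; first by rewrite !big_ord0.
by rewrite big_ord_recr /= mulSnr big_split_ord /= IH.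
Qed.

(* In a block of [(q+3)/4] consecutive integers [v] the points [v alpha] are [1/(2q)]-separated. *)
Lemma sum_geosum_approx (alpha : R) N q (a : int) X V : (0 < q <= N)%N -> coprime q `|a| ->
  N%:R * `|q%:R * alpha - a%:~R| < 1 ->
  \sum_(v < V) nm (geosum X (v%:R * alpha)) <=
  (4 * V%:R / q%:R + 1) * (2 * X%:R + 4 * q%:R * harm R (2 * q)).
Proof.
move=> /andP[q0 qN] cqa app; set L := ((q + 3) %/ 4)%N.
have L0 : (0 < L)%N by rewrite divn_gt0 //; lia.
have qL : (q <= 4 * L)%N by have := ltn_ceil (q + 3) (isT : 0 < 4)%N; rewrite -/L; lia.
have Lq : (4 * (L - 1) < q)%N by have := leq_divM (q + 3) 4; rewrite -/L; lia.
have qR : 0 < q%:R :> R by rewrite ltr0n.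
have sep d (z : int) : (0 < d)%N -> (d < L)%N -> 1 <= (2 * q)%:R * `|d%:R * alpha - z%:~R|.
  move=> d0 dL; have dq : (4 * d < q)%N by lia.
  have ne : d%:Z * a - q%:Z * z != 0.
    apply/eqP => h; have : (q %| d * `|a|)%N.
      have e : (d * `|a| = q * `|z|)%N by rewrite -[d]/`|d%:Z|%N -[q]/`|q%:Z|%N -!abszM; congr absz; lia.
      by rewrite e dvdn_mulr.
    by rewrite Gauss_dvdl // => /dvdn_leq; lia.
  have h1 : 1 <= `|(d%:R * a%:~R - q%:R * z%:~R : R)|.
    have -> : d%:R * a%:~R - q%:R * z%:~R = (d%:Z * a - q%:Z * z)%:~R :> R by rewrite intrB !intrM.
    by rewrite -intr_norm ler1z -gtz0_ge1 normr_gt0.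
  have h2 : 4 * (d%:R * `|q%:R * alpha - a%:~R|) <= 1.
    apply: le_trans (ltW app); rewrite mulrA; apply: ler_wpM2r => //.
    by rewrite -natrM ler_nat; lia.
  rewrite natrM -mulrA -[q%:R]ger0_norm // -normrM.
  have -> : q%:R * (d%:R * alpha - z%:~R) = (d%:R * a%:~R - q%:R * z%:~R) + d%:R * (q%:R * alpha - a%:~R) by ring.
  have := lerB_normD (d%:R * a%:~R - q%:R * z%:~R) (d%:R * (q%:R * alpha - a%:~R)).
  rewrite normrM (ger0_norm (ler0n R d)); lra.
have N0 : (0 < 2 * q)%N by rewrite muln_gt0.
set H := 2 * X%:R + 4 * q%:R * harm R (2 * q).
have harm0 : 0 <= harm R (2 * q) by apply: sumr_ge0 => j _; rewrite invr_ge0.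
have H0 : 0 <= H by rewrite addr_ge0 ?mulr_ge0.
have block b : \sum_(r < L) nm (geosum X ((b * L + r)%N%:R * alpha)) <= H.
  have := @sum_geosum_cells R 'I_L (fun r => (b * L + r)%N%:R * alpha) X (2 * q)
    (fun r => Ordinal (circle_cell_lt ((b * L + r)%N%:R * alpha) N0)).
  move=> /(_ _ _)/le_trans; apply; last by rewrite /H natrM; lra.
    move=> r s /(congr1 val) /= e; apply: val_inj; apply/eqP => /=; apply: contraT => rs.
    wlog lt : r s e rs / (s < r)%N => [W|].
      by move: rs; case: (ltngtP r s) => // h _; [apply: (W s r) => //; lia | apply: (W r s) => //; lia].
    have [m] := circle_cell_close N0 e; rewrite -mulrBl -natrB; last by lia.
    have -> : (b * L + r - (b * L + s) = r - s)%N by lia.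
    by rewrite ltNge sep //; [lia | have := ltn_ord r; lia].
  by move=> r; exists (Num.floor ((b * L + r)%N%:R * alpha)); apply: circle_cell_itv.
pose F v := nm (geosum X (v%:R * alpha)).
apply: (@le_trans _ _ (\sum_(v < (V %/ L).+1 * L) F v)).
  rewrite -!(big_mkord xpredT F) [leRHS](big_cat_nat (n := V)) ?lerDl //=; last by rewrite ltnW // ltn_ceil.
  by rewrite sumr_ge0 // => v _; apply: normc_ge0.
rewrite sum_blocks; apply: (@le_trans _ _ (\sum_(b < (V %/ L).+1) H)); first by apply: ler_sum => b _; apply: block.
rewrite sumr_const card_ord -[leLHS]mulr_natl -[_.+1%:R]natr1; apply: ler_wpM2r => //; rewrite lerD2r.
rewrite ler_pdivlMr // -!natrM ler_nat; apply: (@leq_trans (V %/ L * (4 * L))); first by rewrite leq_mul2l qL orbT.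
by rewrite mulnCA leq_mul2l leq_divM.
Qed.

End Diophantine.

Section NatPowers.
Variables (R : realType) (X : nat).
Hypothesis X_gt0 : (0 < X)%N.

Lemma npowD (a b : R) : X%:R `^ (a + b) = X%:R `^ a * X%:R `^ b.
Proof. by rewrite powRD //; apply/implyP => _; rewrite pnatr_eq0 -lt0n. Qed.

Lemma npow_gt0 (a : R) : 0 < X%:R `^ a. Proof. by rewrite powR_gt0 ?ltr0n. Qed.

Lemma ler_npow (a b : R) : a <= b -> X%:R `^ a <= X%:R `^ b.
Proof. by move=> h; apply: ler_powR => //; rewrite ler1n. Qed.

Lemma npow_ge1 (a : R) : 0 <= a -> 1 <= X%:R `^ a.
Proof. by move=> h; have := ler_npow h; rewrite powRr0. Qed.

Lemma npow_nat n : X%:R `^ n%:R = X%:R ^+ n :> R.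
Proof. by rewrite powR_mulrn. Qed.

Lemma npowX (a : R) n : (X%:R `^ a) ^+ n = X%:R `^ (a * n%:R).
Proof. by rewrite powRrM powR_mulrn ?powR_ge0. Qed.

Lemma npowN (a : R) : X%:R `^ (- a) * X%:R `^ a = 1.
Proof. by rewrite -npowD addNr powRr0. Qed.

End NatPowers.

Section MajorArcs.
Variables (R : realType) (k : nat).
Local Notation C := R[i].
Local Notation nm := (@Normc.normc R).
Hypothesis k_gt1 : (1 < k)%N.
Let k_gt0 : (0 < k)%N := ltnW k_gt1.
Local Notation t := (tri k).

(** The condition bounds |q alpha - a|, so the arc around a/q has half-width X^(tau-k)/q; the
    fraction need not be reduced. *)
Definition major (tau : R) (X : nat) (alpha : R) : bool :=
  `[< exists q (a : int), [/\ (0 < q)%N, q%:R <= X%:R `^ tau & `|q%:R * alpha - a%:~R| <= X%:R `^ (tau - k%:R)] >].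

(** Dirichlet's theorem with N of order X^(k-tau) approximates as closely as a major arc requires,
    so q must exceed X^tau. *)
Lemma minor_approx tau X alpha : (0 < X)%N -> tau <= k%:R -> ~~ major tau X alpha ->
  exists N q (a : int), [/\ (0 < q <= N)%N, coprime q `|a|, N%:R * `|q%:R * alpha - a%:~R| < 1,
    X%:R `^ tau < q%:R & N%:R <= 2 * X%:R `^ (k%:R - tau)].
Proof.
move=> X0 tk /asboolPn mj; pose Y : R := X%:R `^ (k%:R - tau).
have Y1 : 1 <= Y by apply: npow_ge1 => //; rewrite subr_ge0.
have Y20 : 0 <= 2 * Y by lra.
have /andP[n1 n2] := truncn_itv Y20; set N := Num.truncn _ in n1 n2.
have YN : Y <= N%:R by move: n2; rewrite -natr1; lra.
have N0 : (0 < N)%N by rewrite -(ltr0n R); lra.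
have [q [a [qN cq h]]] := dirichlet_approx alpha N0.
exists N, q, a; split=> //; rewrite ltNge; apply/negP => qX; apply: mj; exists q, a; split=> //.
  by case/andP: qN.
have e : X%:R `^ (tau - k%:R) * Y = 1 by rewrite -opprB npowN.
have -> : `|q%:R * alpha - a%:~R| = X%:R `^ (tau - k%:R) * (Y * `|q%:R * alpha - a%:~R|) by rewrite mulrA e mul1r.
rewrite -[leRHS]mulr1.
apply: ler_wpM2l; first exact: powR_ge0.
by apply: le_trans (ltW h); apply: ler_wpM2r.
Qed.

(** The multiples u k alpha are among the v alpha with v < V, where V has order X^(k-1). The sum is
    then at most (V/q + 1)(X + q log q) up to a constant, and X^tau < q <= 2 X^(k-tau) with tau <= 1
    bounds every term by X^(k-tau) times a logarithm. *)
Lemma minor_geosum p eps : (1 < p)%N -> 0 < eps -> exists2 c, 0 <= c & forall M X tau alpha,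
  0 <= tau -> tau <= 1 -> (0 < X)%N -> ((2 * p * X) ^ k <= p ^ M)%N -> ~~ major tau X alpha ->
  \sum_(u < ((2 * X) ^ (k - 1) * t).+1) nm (geosum X (u%:R * k%:R * alpha)) <=
  c * p%:R `^ (eps * M%:R) * X%:R `^ (k%:R - tau).
Proof.
move=> p1 e0; have [cL cL0 HL] := @lin_le_pw R p _ p1 e0.
pose A : R := (k * t * 2 ^ (k - 1)).+1%:R.
have A0 : 0 <= A by exact: ler0n.
exists ((8 * A + 2) + (16 * A + 8) * (p%:R * cL)) => [|M X tau alpha t0 t1 X0 XM mn].
  by rewrite !(addr_ge0, mulr_ge0).
have k1 : 1 <= k%:R :> R by rewrite ler1n.
have tk : tau <= k%:R by lra.
have k2 : 2 <= k%:R :> R by rewrite ler_nat.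
have [N [q [a [qN cq h qX NX]]]] := minor_approx X0 tk mn.
have /andP[q0 qN'] := qN; have q0' : 0 < q%:R :> R by rewrite ltr0n.
set Y := X%:R `^ (k%:R - tau) in NX *.
set V := (k * ((2 * X) ^ (k - 1) * t)).+1.
have Y0 : 0 < Y by exact: npow_gt0.
have qY : q%:R <= 2 * Y by apply: le_trans NX; rewrite ler_nat.
have XY n : (n <= k - 1)%N -> X%:R ^+ n <= Y.
  move=> nk; rewrite -npow_nat; apply: ler_npow => //; have : n%:R <= (k - 1)%:R :> R by rewrite ler_nat.
  by rewrite natrB //; lra.
have VA : V%:R <= A * X%:R ^+ (k - 1).
  rewrite /A -natrX -natrM ler_nat /V expnMn mulSn addnC -addn1; apply: leq_add; last by rewrite expn_gt0 X0.
  by rewrite mulnA mulnAC mulnA [(_ * 2 ^ _ * _)%N]mulnAC mulnAC.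
have Xk : X%:R ^+ k = Y * X%:R `^ tau by rewrite -npowD // subrK npow_nat.
set H := harm R (2 * q).
have H0 : 0 <= H by apply: sumr_ge0 => j _; rewrite invr_ge0.
set B := p%:R `^ (eps * M%:R).
have B1 : 1 <= B by apply: pw_ge1 => //; rewrite mulr_ge0 ?ler0n // ltW.
have HB : H <= p%:R * cL * B.
  have qM : (2 * q <= p ^ M)%N.
    apply: leq_trans XM; rewrite -(ler_nat R) natrM.
    apply: (@le_trans _ _ (4 * X%:R ^+ k)).
      have : Y <= X%:R ^+ k by rewrite -npow_nat; apply: ler_npow => //; lra.
      lra.
    rewrite -natrX -natrM ler_nat expnMn leq_mul2r; apply/orP; right.
    apply: (@leq_trans (4 ^ k)); last by rewrite leq_exp2r //; exact: (leq_mul (leqnn 2) p1).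
    by have : (4 ^ 1 <= 4 ^ k)%N by rewrite leq_exp2l.
  apply: le_trans (leq_harm R qM) _; apply: le_trans (harm_pow R M (ltnW p1)) _.
  by rewrite -mulrA; apply: ler_wpM2l.
apply: (@le_trans _ _ (\sum_(v < V) nm (geosum X (v%:R * alpha)))).
  have ltV (u : 'I_((2 * X) ^ (k - 1) * t).+1) : (k * u < V)%N by rewrite ltnS leq_mul2l -ltnS ltn_ord orbT.
  have := @sum_inj_le R _ V (fun u => Ordinal (ltV u)) (fun v => nm (geosum X (v%:R * alpha))).
  move=> /(_ _ _)/(le_trans _); apply; last by move=> v; exact: normc_ge0.
    by apply: ler_sum => u _; rewrite /= natrM [k%:R * _]mulrC.
  by move=> u v /(congr1 val) /= /eqP; rewrite eqn_pmul2l // => /eqP/val_inj.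
apply: le_trans (sum_geosum_approx X V qN cq h) _; rewrite -/H.
have e1 : V%:R / q%:R * X%:R <= A * Y.
  rewrite mulrAC ler_pdivrMr //; apply: (@le_trans _ _ (A * X%:R ^+ (k - 1) * X%:R)).
    by apply: ler_wpM2r.
  rewrite -mulrA -exprSr subn1 (prednK k_gt0) Xk -[leRHS]mulrA; apply: ler_wpM2l => //.
  by apply: ler_wpM2l; exact: ltW.
have e2 : V%:R * H <= A * Y * H.
  by apply: ler_wpM2r => //; apply: le_trans VA _; apply: ler_wpM2l => //; exact: XY.
have e3 : X%:R <= Y by rewrite -[X%:R]expr1; apply: XY; rewrite subn_gt0.
have e4 : q%:R * H <= 2 * Y * H by apply: ler_wpM2r.
have -> : (4 * V%:R / q%:R + 1) * (2 * X%:R + 4 * q%:R * H) =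
  8 * (V%:R / q%:R * X%:R) + 16 * (V%:R * H) + 2 * X%:R + 4 * (q%:R * H) by field; rewrite gt_eqF.
apply: (@le_trans _ _ ((8 * A + 2) * Y + (16 * A + 8) * Y * H)); first by lra.
apply: (@le_trans _ _ ((8 * A + 2) * Y * B + (16 * A + 8) * Y * (p%:R * cL * B))); last first.
  by rewrite le_eqVlt; apply/orP; left; apply/eqP; ring.
apply: lerD; first by rewrite ler_peMr // mulr_ge0 ?ltW //; lra.
by apply: ler_wpM2l HB; rewrite mulr_ge0 ?ltW //; lra.
Qed.

Lemma scale_exists p X M : (1 < p)%N -> (0 < X)%N -> ((2 * p * X) ^ k <= p ^ M)%N ->
  exists n, [/\ (k * n <= M)%N, (2 * X <= p ^ n)%N & (p ^ n <= 2 * p * X)%N].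
Proof.
move=> p1 X0 XM; exists (up_log p (2 * X)).
have X2 : (1 < 2 * X)%N by lia.
have /andP[l1 l2] := up_log_bounds p1 X2.
have nX : (p ^ up_log p (2 * X) <= 2 * p * X)%N.
  rewrite -(prednK (_ : 0 < up_log p (2 * X))%N) ?up_log_gt0 ?p1 // expnS.
  by rewrite [(2 * p)%N]mulnC -mulnA leq_mul2l (ltnW l1) orbT.
split=> //; rewrite -(leq_exp2l _ _ p1); apply: leq_trans XM.
by rewrite mulnC expnM leq_exp2r.
Qed.

Lemma minor_mean p eps : prime p -> (k < p)%N -> (t < p)%N -> 0 < eps ->
  exists2 c, 0 <= c & forall M X tau, 0 <= tau -> tau <= 1 -> (0 < X)%N -> ((2 * p * X) ^ k <= p ^ M)%N ->
  \sum_(c < p ^ M | ~~ major tau X (c%:R / (p ^ M)%:R)) nm (weyl k X (c%:R / (p ^ M)%:R)) ^+ (2 * t) <=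
  c * p%:R `^ (eps * M%:R) * (p ^ M)%:R * X%:R `^ ((k * k)%:R - tau).
Proof.
move=> pp kp tp e0; have p1 := prime_gt1 pp; have e20 : 0 < eps / 2%:R by rewrite divr_gt0.
have [c1 c10 H1] := wooley_mean k_gt1 pp kp tp e20.
have [c2 c20 H2] := minor_geosum p1 e20.
exists (c1 * c2) => [|M X tau t0 t1 X0 XM]; first exact: mulr_ge0.
have [n [knM Xn _]] := scale_exists p1 X0 XM.
have := H1 M n X (fun c => ~~ major tau X (c%:R / (p ^ M)%:R)) (c2 * p%:R `^ (eps / 2%:R * M%:R) * X%:R `^ (k%:R - tau))
   knM X0 Xn _ _.
move=> /(_ _ _)/le_trans; apply.
- by rewrite !mulr_ge0 ?powR_ge0.
- by move=> c mc; apply: H2.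
rewrite le_eqVlt; apply/orP; left; apply/eqP.
have -> : (k * k)%:R - tau = (k * k - k)%N%:R + (k%:R - tau).
  by rewrite natrB ?leq_pmulr //; ring.
have -> : eps * M%:R = eps / 2%:R * M%:R + eps / 2%:R * M%:R by rewrite -mulrDl -splitr.
by rewrite (npowD X0 (k * k - k)%N%:R) (npowD (ltnW p1)) npow_nat; ring.
Qed.

End MajorArcs.

Lemma le_sum1 (R : realType) (I : finType) (F : I -> R) i : (forall j, 0 <= F j) -> F i <= \sum_j F j.
Proof. by move=> F0; rewrite (bigD1 i) //= lerDl sumr_ge0. Qed.

Lemma count_interval (R : realType) n (b g : R) : 0 <= g ->
  \sum_(c < n) (`|c%:R - b| <= g)%R%:R <= 2 * g + 1 :> R.
Proof.
(* Strengthened for the induction: the second bound counts from the left end of the interval. *)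
move=> g0; suff [] : \sum_(c < n) (`|c%:R - b| <= g)%R%:R <= 2 * g + 1 :> R /\
    \sum_(c < n) (`|c%:R - b| <= g)%R%:R <= Num.max 0 (n%:R - (b - g)) :> R by [].
elim: n => [|n [IH1 IH2]]; first by rewrite !big_ord0 le_max lexx; split=> //; lra.
rewrite !big_ord_recr /=; case: (boolP (_ <= g)) => h; rewrite ?addr0; last first.
  by split=> //; apply: le_trans IH2 _; rewrite ge_max !le_max lexx /= lerD2r ler_nat leqnSn orbT.
move: h; rewrite ler_norml => /andP[h1 h2].
have m0 : Num.max 0 (n%:R - (b - g)) = n%:R - (b - g) by apply: max_r; lra.
move: IH2; rewrite m0 => IH2; split; first by move: IH2 h2; rewrite /=; lra.
by rewrite le_max -natr1; apply/orP; right; move: IH2; rewrite /=; lra.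
Qed.

Lemma prod_ord_if (R : realType) (a b : R) m d : (m <= d)%N ->
  \prod_(j < d) (if (j < m)%N then a else b) = a ^+ m * b ^+ (d - m).
Proof.
move=> md; rewrite -(subnKC md) addKn big_split_ord /=; congr (_ * _).
  by rewrite (eq_bigr (fun=> a)) ?prodr_const ?card_ord // => i _; rewrite ltn_ord.
rewrite (eq_bigr (fun=> b)) ?prodr_const ?card_ord // => i _.
by rewrite ltnNge leq_addr.
Qed.

(** Log-convexity of moments in the exponent, cleared of roots. *)
Lemma interpolate_pow (R : realType) (T : finType) (P : pred T) (F : T -> R) u s v :
  (forall x, 0 <= F x) -> (u <= s <= v)%N -> (u < v)%N ->
  (\sum_(x | P x) F x ^+ s) ^+ (v - u) <=
  (\sum_(x | P x) F x ^+ v) ^+ (s - u) * (\sum_(x | P x) F x ^+ u) ^+ (v - s).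
Proof.
move=> F0 /andP[us sv] uv.
have dE : (v - u - (s - u) = v - s)%N by lia.
have md : (s - u <= v - u)%N by lia.
have := @holder_pow R T P (v - u) (fun x => F x ^+ s) (fun j x => if (j < s - u)%N then F x ^+ v else F x ^+ u).
move=> /(_ _ _ _ _)/le_trans; apply=> [|x|j x|x _|].
- by rewrite subn_gt0.
- exact: exprn_ge0.
- by case: ifP => _; apply: exprn_ge0.
- rewrite prod_ord_if // dE -!exprM -exprD.
  have -> : (s * (v - u) = v * (s - u) + u * (v - s))%N; last exact: lexx.
  have [a sE] : exists a, s = (u + a)%N by exists (s - u)%N; lia.
  have [b vE] : exists b, v = (s + b)%N by exists (v - s)%N; lia.
  rewrite vE sE.
  have -> : (u + a + b - u = a + b)%N by lia.
  have -> : (u + a - u = a)%N by lia.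
  by have -> : (u + a + b - (u + a) = b)%N by [lia]; ring.
have -> : \prod_(j < v - u) \sum_(x | P x) (if (j < s - u)%N then F x ^+ v else F x ^+ u) =
  \prod_(j < v - u) (if (j < s - u)%N then \sum_(x | P x) F x ^+ v else \sum_(x | P x) F x ^+ u).
  by apply: eq_bigr => j _; case: ifP.
by rewrite prod_ord_if // dE.
Qed.

Lemma interpolated_root (R : realType) (S E a b : R) X m d : (0 < X)%N -> 0 <= S -> 0 <= E -> (0 < d)%N -> (m <= d)%N ->
  S ^+ d <= (E * X%:R `^ a) ^+ m * (E * X%:R `^ b) ^+ (d - m) ->
  S <= E * X%:R `^ ((m%:R * a + (d - m)%N%:R * b) / d%:R).
Proof.
move=> X0 S0 E0 d0 md H; rewrite -(ler_pXn2r d0) ?nnegrE ?mulr_ge0 ?powR_ge0 //.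
apply: le_trans H _; rewrite !exprMn !npowX // mulrACA -exprD subnKC // -npowD //.
rewrite divfK ?pnatr_eq0 -?lt0n //; apply: ler_wpM2l; first exact: exprn_ge0.
by apply: ler_npow => //; rewrite [a * _]mulrC [b * _]mulrC.
Qed.

Lemma subn_mul_lt D T S U : (S <= T)%N -> (D * T < D * S + U)%N -> (D * (T - S) < U)%N.
Proof. by move=> ST h; rewrite mulnBr; have : (D * S <= D * T)%N by [rewrite leq_mul2l ST orbT]; lia. Qed.

(** * Power saving at the exponent s *)

Section MinorPowerMean.
Variables (R : realType) (k : nat).
Local Notation C := R[i].
Local Notation nm := (@Normc.normc R).
Hypothesis k_gt1 : (1 < k)%N.
Let k_gt0 : (0 < k)%N := ltnW k_gt1.
Local Notation t := (tri k).

Lemma major_card tau X Q : 0 <= tau -> tau <= k%:R -> (0 < X)%N -> (X ^ k <= Q)%N ->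
  \sum_(c < Q | major k tau X (c%:R / Q%:R : R)) 1 <= 9 * Q%:R * X%:R `^ (2 * tau - k%:R).
Proof.
move=> t0 tk X0 XQ; set del := X%:R `^ (tau - k%:R).
have del0 : 0 <= del by exact: powR_ge0.
have del1 : del <= 1.
  by rewrite -(powRr0 (X%:R : R)); apply: ler_npow => //; lra.
have Q0 : 0 < Q%:R :> R by rewrite ltr0n; apply: leq_trans XQ; rewrite expn_gt0 X0.
set T := Num.truncn (X%:R `^ tau : R).
have /andP[T1 T2] := truncn_itv (powR_ge0 X%:R tau); rewrite -/T in T1 T2.
(* The denominator is q + 1 and the numerator j - 1: as 0 <= c/Q < 1, numerators lie between -1 and
   the denominator, which leaves q + 3 values of j. *)
pose H (c q j : nat) : R := (`|c%:R - Q%:R * (j%:R - 1) / q.+1%:R| <= Q%:R * del / q.+1%:R)%R%:R.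
have H0 c q j : 0 <= H c q j by exact: ler0n.
apply: (@le_trans _ _ (\sum_(c < Q) \sum_(q < T) \sum_(j < q.+3) H c q j)).
  rewrite big_mkcond; apply: ler_sum => c _; rewrite /major; case: asboolP => [[q [a [q0 qX h]]]|_]; last first.
    by rewrite sumr_ge0 // => q _; rewrite sumr_ge0.
  have qT : (q.-1 < T)%N by rewrite prednK // -ltnS -(ltr_nat R); apply: le_lt_trans qX T2.
  have qR : 0 < q%:R :> R by rewrite ltr0n.
  have cQ : c%:R < Q%:R :> R by rewrite ltr_nat.
  have y0 : 0 <= q%:R * (c%:R / Q%:R) :> R by rewrite mulr_ge0 ?divr_ge0.
  have y1 : q%:R * (c%:R / Q%:R) < q%:R :> R by rewrite gtr_pMr // ltr_pdivrMr ?mul1r.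
  move: h; rewrite -/del; set y := q%:R * _ in y0 y1 * => h.
  have [h1 h2] : -2 < (a%:~R : R) /\ (a%:~R : R) < q%:R + 1 by move: h; rewrite ler_norml => /andP[]; lra.
  have a1 : -1 <= a.
    have : (-2)%:~R < (a%:~R : R) by rewrite intrN.
    by rewrite ltr_int; clear; lia.
  have aq : (a <= q%:Z)%R.
    have : (a%:~R : R) < (q%:Z + 1)%:~R by rewrite intrD.
    by rewrite ltr_int; clear; lia.
  have jq : (`|(a + 1)%R|%N < q.-1.+3)%N by clear -a1 aq q0; lia.
  have jE : (`|(a + 1)%R|%N%:R : R) = a%:~R + 1.
    have -> : `|(a + 1)%R|%N%:R = (`|(a + 1)%R|%N%:Z)%:~R :> R by [].
    by rewrite gez0_abs ?intrD //; clear -a1; lia.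
  apply: le_trans (le_sum1 (Ordinal qT) _); last by move=> q'; rewrite sumr_ge0.
  apply: le_trans (le_sum1 (Ordinal jq) _) => //=.
  rewrite /H prednK // jE addrK ler1n lt0b.
  have -> : c%:R - Q%:R * a%:~R / q%:R = (Q%:R / q%:R) * (y - a%:~R).
    by rewrite /y; field; rewrite !gt_eqF.
  rewrite normrM ger0_norm ?divr_ge0 // [leRHS]mulrAC; apply: ler_wpM2l => //; exact: divr_ge0.
rewrite exchange_big /=.
apply: (@le_trans _ _ (\sum_(q < T) (6 * (Q%:R * del) + 3 * X%:R `^ tau))).
  apply: ler_sum => q _; rewrite exchange_big /=.
  apply: (@le_trans _ _ (\sum_(j < q.+3) (2 * (Q%:R * del / q.+1%:R) + 1))).
    by apply: ler_sum => j _; apply: count_interval; rewrite !mulr_ge0 ?invr_ge0 // ltW.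
  rewrite sumr_const card_ord -[leLHS]mulr_natl.
  have q1 : 0 < q.+1%:R :> R by rewrite ltr0n.
  have q3 : q.+3%:R <= 3 * q.+1%:R :> R by rewrite -natrM ler_nat; lia.
  apply: le_trans (ler_wpM2r _ q3) _; first by rewrite addr_ge0 ?mulr_ge0 ?invr_ge0 // ltW.
  have -> : 3 * q.+1%:R * (2 * (Q%:R * del / q.+1%:R) + 1) = 6 * (Q%:R * del) + 3 * q.+1%:R.
    by move: q1; move: (q.+1%:R : R) => z z0; field; rewrite gt_eqF.
  by rewrite lerD2l; apply: ler_wpM2l => //; apply: le_trans T1; rewrite ler_nat ltn_ord.
rewrite sumr_const card_ord -[leLHS]mulr_natl.
have e1 : X%:R `^ tau * del = X%:R `^ (2 * tau - k%:R).
  by rewrite -npowD //; congr (_ `^ _); ring.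
have e2 : X%:R `^ tau * X%:R `^ tau <= Q%:R * X%:R `^ (2 * tau - k%:R).
  have -> : X%:R `^ tau * X%:R `^ tau = X%:R ^+ k * X%:R `^ (2 * tau - k%:R).
    by rewrite -npow_nat // -!npowD //; congr (_ `^ _); ring.
  by apply: ler_wpM2r; rewrite ?powR_ge0 // -natrX ler_nat.
apply: (@le_trans _ _ (X%:R `^ tau * (6 * (Q%:R * del) + 3 * X%:R `^ tau))).
  by apply: ler_wpM2r => //; rewrite addr_ge0 ?mulr_ge0 ?powR_ge0 // ltW.
rewrite -e1 in e2 *.
apply: (@le_trans _ _ (6 * (Q%:R * (X%:R `^ tau * del)) + 3 * (X%:R `^ tau * X%:R `^ tau))); last lra.
by rewrite le_eqVlt; apply/orP; left; apply/eqP; ring.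
Qed.

Variables (p r s : nat).
Hypothesis p_prime : prime p.
Hypothesis k_lt_p : (k < p)%N.
Hypothesis t_lt_p : (t < p)%N.
Hypothesis p_ge8 : (8 <= p)%N.
Hypothesis r_bnd : (0 < r <= k)%N.
Hypothesis s_large : ((k.+1 - r) * (2 * t) < (k.+1 - r) * s + (2 * t - 2 * tri r))%N.
Hypothesis s_large' : (4 * t < 3 * s)%N.
Let p_gt1 : (1 < p)%N := prime_gt1 p_prime.
Local Notation pw x := (p%:R `^ x : R).

Lemma hua_mean_scale eps : 0 < eps -> exists2 c, 0 <= c & forall M X, (0 < X)%N -> ((2 * p * X) ^ k <= p ^ M)%N ->
  \sum_(c < p ^ M) nm (weyl k X (c%:R / (p ^ M)%:R)) ^+ (2 * tri r) <=
  c * pw (eps * M%:R) * (p ^ M)%:R * X%:R `^ ((r * r)%:R).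
Proof.
move=> e0; have [c c0 H] := hua_mean k_gt0 p_prime k_lt_p t_lt_p p_ge8 r_bnd e0.
exists (c * (2 * p)%:R ^+ (r * r)) => [|M X X0 XM]; first by rewrite mulr_ge0 ?exprn_ge0.
have [n [knM Xn nX]] := scale_exists k_gt1 p_gt1 X0 XM.
have nM : (n <= M)%N by apply: leq_trans knM; rewrite leq_pmull.
have XX : (X < p ^ n)%N by apply: leq_trans Xn; rewrite mul2n -addnn -addn1 leq_add2l.
apply: le_trans (H n M X knM XX) _.
rewrite pwD // [(r * r)%:R * _]mulrC -pwX // !npow_nat.
have h1 : p%:R ^+ n ^+ (r * r) <= (2 * p)%:R ^+ (r * r) * X%:R ^+ (r * r) :> R.
  by rewrite -exprMn -natrM -natrX; apply: lerXn2r; rewrite ?nnegrE ?ler0n // ler_nat.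
have h2 : pw (eps * n%:R) <= pw (eps * M%:R).
  by apply: ler_pw => //; apply: ler_wpM2l; [exact: ltW | rewrite ler_nat].
have -> : c * (2 * p)%:R ^+ (r * r) * pw (eps * M%:R) * (p ^ M)%:R * X%:R ^+ (r * r) =
   c * (p ^ M)%:R * (((2 * p)%:R ^+ (r * r) * X%:R ^+ (r * r)) * pw (eps * M%:R)) by ring.
apply: ler_wpM2l; first exact: mulr_ge0.
by apply: ler_pM => //; rewrite ?exprn_ge0 ?pw_ge0.
Qed.

(** The saving delta is chosen before eps, so that the loss p^(eps M) can be made small against
    it. *)
Definition power_saving (tau : R) := exists2 delta, 0 < delta & forall eps, 0 < eps ->
  exists2 c, 0 <= c & forall M X, (0 < X)%N -> ((2 * p * X) ^ k <= p ^ M)%N ->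
  \sum_(c < p ^ M | ~~ major k tau X (c%:R / (p ^ M)%:R)) nm (weyl k X (c%:R / (p ^ M)%:R)) ^+ s <=
  c * pw (eps * M%:R) * (p ^ M)%:R * X%:R `^ (s%:R - k%:R - delta).

Let t2E : (2 * t)%:R = k%:R * k%:R + k%:R :> R.
Proof. by rewrite tri_double mulnS natrD natrM addrC. Qed.

Let rkE : (2 * tri r)%:R = r%:R * r%:R + r%:R :> R.
Proof. by rewrite tri_double mulnS natrD natrM addrC. Qed.

(** Above the critical exponent the surplus factors are bounded by X. *)
Lemma power_saving_large tau : 0 < tau -> tau <= 1 -> (2 * t <= s)%N -> power_saving tau.
Proof.
move=> t0 t1 ts; exists tau => // eps e0.
have [c c0 H] := minor_mean k_gt1 p_prime k_lt_p t_lt_p e0.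
exists c => // M X X0 XM; pose P (c : 'I_(p ^ M)) := ~~ major k tau X (c%:R / (p ^ M)%:R : R).
apply: (@le_trans _ _ (X%:R ^+ (s - 2 * t) * \sum_(c < p ^ M | P c) nm (weyl k X (c%:R / (p ^ M)%:R)) ^+ (2 * t))).
  rewrite mulr_sumr; apply: ler_sum => c' _; rewrite -[in leLHS](subnK ts) exprD.
  apply: ler_wpM2r; first by rewrite exprn_ge0 // normc_ge0.
  by apply: lerXn2r; rewrite ?nnegrE ?normc_ge0 ?normc_weyl_le.
apply: le_trans (ler_wpM2l (exprn_ge0 _ (ler0n R X)) (H M X tau (ltW t0) t1 X0 XM)) _.
rewrite mulrCA; apply: ler_wpM2l; first by rewrite !mulr_ge0 ?pw_ge0.
rewrite -npow_nat // -npowD //; apply: ler_npow => //.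
by rewrite natrB // t2E natrM; lra.
Qed.

(** Interpolates the power k^2 - 1 at the exponent 2t, from the minor arcs of level 1, with the
    power r^2 at the exponent 2 tri r. The result is below s - k exactly when (k+1-r)(2t - s) < 2t -
    2 tri r, which is [s_large]. *)
Lemma power_saving_one : (s < 2 * t)%N -> power_saving 1.
Proof.
move=> st; have /andP[r0 rk] := r_bnd.
have D0 : (0 < k.+1 - r)%N by lia.
have rt : (tri r <= t)%N by exact: leq_tri.
have us : (2 * tri r < s)%N.
  have := subn_mul_lt (ltnW st) s_large.
  have : (2 * t - s <= (k.+1 - r) * (2 * t - s))%N by rewrite leq_pmull.
  lia.
pose m := (s - 2 * tri r)%N; pose d := (2 * t - 2 * tri r)%N.
have d0 : (0 < d)%N by rewrite /d; lia.
have md : (m <= d)%N by rewrite /d /m; lia.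
have dm : (d - m = 2 * t - s)%N by rewrite /d /m; lia.
have dR : 0 < d%:R :> R by rewrite ltr0n.
pose e := (m%:R * ((k * k)%:R - 1) + (d - m)%N%:R * (r * r)%:R) / d%:R : R.
exists (s%:R - k%:R - e).
  rewrite subr_gt0 /e ltr_pdivrMr // -subr_gt0.
  have : (k.+1 - r)%:R * (2 * t - s)%:R < d%:R :> R.
    by rewrite -natrM ltr_nat; exact: subn_mul_lt (ltnW st) s_large.
  rewrite dm /m /d !natrB //; try lia.
  rewrite t2E rkE !natrM -!natr1 => h.
  suff -> : (s%:R - k%:R) * (k%:R * k%:R + k%:R - (r%:R * r%:R + r%:R)) -
    ((s%:R - (r%:R * r%:R + r%:R)) * (k%:R * k%:R - 1) + (k%:R * k%:R + k%:R - s%:R) * (r%:R * r%:R)) =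
    (k%:R * k%:R + k%:R - (r%:R * r%:R + r%:R)) - (k%:R + 1 - r%:R) * (k%:R * k%:R + k%:R - s%:R) :> R by rewrite subr_gt0.
  ring.
move=> eps e0.
have [c1 c10 H1] := minor_mean k_gt1 p_prime k_lt_p t_lt_p e0.
have [c2 c20 H2] := hua_mean_scale e0.
exists (c1 + c2) => [|M X X0 XM]; first exact: addr_ge0.
pose P (c : 'I_(p ^ M)) := ~~ major k 1 X (c%:R / (p ^ M)%:R : R).
rewrite (_ : s%:R - k%:R - (s%:R - k%:R - e) = e); last by ring.
pose F (c : 'I_(p ^ M)) := nm (weyl k X (c%:R / (p ^ M)%:R)).
have F0 c : 0 <= F c by exact: normc_ge0.
have E0 : 0 <= pw (eps * M%:R) * (p ^ M)%:R by rewrite mulr_ge0 ?pw_ge0.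
rewrite -2!mulrA mulrA mulrA -/(F _).
apply: interpolated_root => //; [by apply: sumr_ge0 => c _; rewrite exprn_ge0 // normc_ge0 | by rewrite -mulrA mulr_ge0 ?addr_ge0 |].
have := @interpolate_pow R _ P F (2 * tri r) s (2 * t) F0.
rewrite (ltnW us) (ltnW st) -/d -/m -dm => /(_ isT)/(_ (ltn_trans us st))/le_trans; apply.
apply: ler_pM; rewrite ?exprn_ge0 ?sumr_ge0 //; try by move=> c _; exact: exprn_ge0.
  apply: lerXn2r; rewrite ?nnegrE; [by apply: sumr_ge0 => c _; rewrite exprn_ge0 // normc_ge0 | by rewrite mulr_ge0 ?powR_ge0 // -mulrA mulr_ge0 ?addr_ge0 |].
  apply: le_trans (H1 M X 1 ler01 (lexx _) X0 XM) _.
  rewrite -!mulrA; apply: ler_wpM2r; first by rewrite !mulr_ge0 ?powR_ge0.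
  by rewrite lerDl.
apply: lerXn2r; rewrite ?nnegrE; [by apply: sumr_ge0 => c _; rewrite exprn_ge0 // normc_ge0 | by rewrite mulr_ge0 ?powR_ge0 // -mulrA mulr_ge0 ?addr_ge0 |].
apply: (@le_trans _ _ (\sum_c F c ^+ (2 * tri r))).
  by rewrite [leRHS](bigID P) /= lerDl sumr_ge0 // => c _; exact: exprn_ge0.
apply: le_trans (H2 M X X0 XM) _.
rewrite -!mulrA; apply: ler_wpM2r; first by rewrite !mulr_ge0 ?powR_ge0.
by rewrite lerDr.
Qed.

(** Points that are minor at level tau' are covered by the hypothesis. The others are minor at level
    tau and major at level tau'; on them the saving X^tau at the exponent 2t is interpolated with
    their number, of order Q X^(2 tau' - k), that is, with the exponent 0. This saves a power if s
    tau > 2 tau' (2t - s), which 3s > 4t permits for some tau' larger than tau. *)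
Lemma power_saving_step tau tau' : (s < 2 * t)%N -> 0 < tau -> tau <= 1 -> 0 < tau' -> tau' <= 1 ->
  tau' <= tau * (1 + (3 * s - 4 * t)%:R / (8 * t)%:R) -> power_saving tau' -> power_saving tau.
Proof.
move=> st t0 t1 t0' t1' tt [del del0 H].
have tR : 0 < (2 * t)%:R :> R by rewrite ltr0n muln_gt0 /= tri_gt0.
have kR : 1 <= k%:R :> R by rewrite ler1n.
pose e := (s%:R * ((k * k)%:R - tau) + (2 * t - s)%N%:R * (2 * tau' - k%:R)) / (2 * t)%:R : R.
have he : 0 < s%:R - k%:R - e.
  rewrite subr_gt0 /e ltr_pdivrMr // -subr_gt0 natrB ?(ltnW st) //.
  have -> : (s%:R - k%:R) * (2 * t)%:R - (s%:R * ((k * k)%:R - tau) + ((2 * t)%:R - s%:R) * (2 * tau' - k%:R)) =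
     s%:R * tau - 2 * tau' * ((2 * t)%:R - s%:R) :> R by rewrite t2E natrM; ring.
  have h1 : 0 < (2 * t)%:R - s%:R :> R by rewrite subr_gt0 ltr_nat.
  (* The margin 3s - 4t equals 8 t kap, whence 2 (1 + kap)(2t - s) < s. *)
  set kap := (3 * s - 4 * t)%:R / (8 * t)%:R in tt.
  have kapE : kap * (2 * (2 * t)%:R) * 2 = 3 * s%:R - 2 * (2 * t)%:R.
    rewrite /kap natrB; last exact: ltnW.
    by rewrite !natrM; field; rewrite pnatr_eq0 -lt0n tri_gt0.
  have s3 : 0 < 3 * s%:R - 2 * (2 * t)%:R :> R.
    by rewrite subr_gt0 -!natrM ltr_nat mulnA.
  have kap0 : 0 < kap by rewrite /kap divr_gt0 // ltr0n ?subn_gt0 ?muln_gt0 ?tri_gt0.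
  have : 2 * tau' * ((2 * t)%:R - s%:R) <= 2 * (tau * (1 + kap)) * ((2 * t)%:R - s%:R).
    by apply: ler_wpM2r; [exact: ltW | apply: ler_wpM2l].
  have : 0 < tau * (s%:R - 2 * (1 + kap) * ((2 * t)%:R - s%:R)).
    apply: mulr_gt0 => //; have : 0 < kap * s%:R by apply: mulr_gt0 => //; lra.
    lra.
  lra.
exists (Num.min del (s%:R - k%:R - e)); first by rewrite lt_min del0.
move=> eps e0; have [c1 c10 H1] := H _ e0.
have [c2 c20 H2] := minor_mean k_gt1 p_prime k_lt_p t_lt_p e0.
exists (c1 + (c2 + 9)) => [|M X X0 XM]; first by rewrite !addr_ge0.
pose F (c : 'I_(p ^ M)) := nm (weyl k X (c%:R / (p ^ M)%:R)).
have F0 c : 0 <= F c by exact: normc_ge0.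
pose P (c : 'I_(p ^ M)) := ~~ major k tau X (c%:R / (p ^ M)%:R : R).
pose P' (c : 'I_(p ^ M)) := major k tau' X (c%:R / (p ^ M)%:R : R).
have pe1 : 1 <= pw (eps * M%:R) by apply: pw_ge1 => //; rewrite mulr_ge0 ?ler0n // ltW.
have E0 : 0 <= pw (eps * M%:R) * (p ^ M)%:R by rewrite mulr_ge0 ?pw_ge0.
set Y := X%:R `^ _.
have YE d : Num.min del (s%:R - k%:R - e) <= d -> X%:R `^ (s%:R - k%:R - d) <= Y.
  by move=> h; apply: ler_npow => //; lra.
rewrite -/(F _) (bigID P') /= addrC [leRHS](_ : _ = c1 * pw (eps * M%:R) * (p ^ M)%:R * Y +
  (c2 + 9) * pw (eps * M%:R) * (p ^ M)%:R * Y); last by ring.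
apply: lerD.
  apply: (@le_trans _ _ (\sum_(c | ~~ P' c) F c ^+ s)).
    rewrite [leRHS](bigID P) /= [X in _ <= X + _](eq_bigl (fun c => P c && ~~ P' c)).
      by rewrite lerDl sumr_ge0 // => c _; exact: exprn_ge0.
    by move=> c; rewrite andbC.
  apply: le_trans (H1 M X X0 XM) _; rewrite -!mulrA; do 3 (apply: ler_wpM2l; rewrite ?pw_ge0 ?ler0n //).
  by apply: YE; rewrite ge_min lexx.
apply: (@le_trans _ _ ((c2 + 9) * pw (eps * M%:R) * (p ^ M)%:R * X%:R `^ e)); last first.
  apply: ler_wpM2l; first by rewrite !mulr_ge0 ?addr_ge0 ?pw_ge0.
  by rewrite -{1}(subKr (s%:R - k%:R) e); apply: YE; rewrite ge_min lexx orbT.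
rewrite -2!mulrA mulrA mulrA.
apply: interpolated_root; rewrite ?muln_gt0 ?tri_gt0 ?(ltnW st) //.
- by apply: sumr_ge0 => c _; rewrite exprn_ge0 // normc_ge0.
- by rewrite -mulrA mulr_ge0 ?addr_ge0.
have t20 : (0 < 2 * t)%N by rewrite muln_gt0 tri_gt0.
have := @interpolate_pow R _ (fun c => P c && P' c) F 0 s (2 * t) F0.
rewrite /= (ltnW st) !subn0 => /(_ isT t20)/le_trans; apply.
apply: ler_pM; rewrite ?exprn_ge0 ?sumr_ge0 //; try by move=> c _; exact: exprn_ge0.
  apply: lerXn2r; rewrite ?nnegrE; [by apply: sumr_ge0 => c _; rewrite exprn_ge0 // normc_ge0 | by rewrite mulr_ge0 ?powR_ge0 // -mulrA mulr_ge0 ?addr_ge0 |].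
  apply: (@le_trans _ _ (\sum_(c | P c) F c ^+ (2 * t))).
    by rewrite [leRHS](bigID P') /= lerDl sumr_ge0 // => c _; exact: exprn_ge0.
  apply: le_trans (H2 M X tau (ltW t0) t1 X0 XM) _.
  rewrite -!mulrA; apply: ler_wpM2r; first by rewrite !mulr_ge0 ?powR_ge0.
  by rewrite lerDl.
apply: lerXn2r; rewrite ?nnegrE; [by apply: sumr_ge0 => c _; rewrite exprn_ge0 // normc_ge0 | by rewrite mulr_ge0 ?powR_ge0 // -mulrA mulr_ge0 ?addr_ge0 |].
apply: (@le_trans _ _ (\sum_(c | P' c) 1)).
  rewrite [leRHS](bigID P) /= [X in _ <= X + _](eq_bigl (fun c => P c && P' c)).
    by rewrite lerDl sumr_ge0.
  by move=> c; rewrite andbC.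
have XQ : (X ^ k <= p ^ M)%N.
  by apply: leq_trans XM; rewrite leq_exp2r // leq_pmull // muln_gt0 /= ltnW.
apply: le_trans (major_card (ltW t0') (le_trans t1' kR) X0 XQ) _.
apply: ler_wpM2r; rewrite ?powR_ge0 //; apply: ler_wpM2r; rewrite ?ler0n //.
apply: (@le_trans _ _ (9 * pw (eps * M%:R))); first by rewrite ler_peMr.
by apply: ler_wpM2r; rewrite ?pw_ge0 // lerDr.
Qed.

(** Descent from level 1 to tau; each step lowers the level by the fixed amount tau kap. *)
Lemma minor_power_mean tau : 0 < tau -> tau <= 1 -> power_saving tau.
Proof.
move=> t0 t1; have [ts|st] := leqP (2 * t) s; first exact: power_saving_large.
set kap := (3 * s - 4 * t)%:R / (8 * t)%:R : R.
have kap0 : 0 < kap by rewrite /kap divr_gt0 // ltr0n ?subn_gt0 ?muln_gt0 ?tri_gt0.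
have h0 : 0 < tau * kap by exact: mulr_gt0.
have claim j tau' : tau <= tau' -> tau' <= 1 -> 1 - tau' <= j%:R * (tau * kap) -> power_saving tau'.
  elim: j tau' => [|j IH] tau' h1 h2 h3.
    have -> : tau' = 1 by move: h3; rewrite mul0r; lra.
    exact: power_saving_one.
  apply: (@power_saving_step tau' (Num.min 1 (tau' + tau * kap))) => //.
  - lra.
  - by rewrite lt_min ltr01; lra.
  - by rewrite ge_min lexx.
  - rewrite ge_min; apply/orP; right; rewrite mulrDr mulr1 lerD2l; apply: ler_wpM2r => //; exact: ltW.
  apply: IH; rewrite ?ge_min ?lexx // ?le_min; first by rewrite t1; lra.
  have [h|h] := leP 1 (tau' + tau * kap); first by rewrite subrr mulr_ge0 // ltW.
  by move: h3; rewrite -natr1; lra.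
apply: (claim (Num.truncn (1 / (tau * kap))).+1 tau) => //.
have := truncnS_gt (1 / (tau * kap)); rewrite ltr_pdivrMr //; lra.
Qed.

(** With tau at most eta / 2 the trivial bound X^s on the major arcs, of total size X^(2 tau - k),
    loses at most X^eta. *)
Lemma full_power_mean eta eps : 0 < eta -> 0 < eps -> exists2 c, 0 <= c & forall M X, (0 < X)%N -> ((2 * p * X) ^ k <= p ^ M)%N ->
  \sum_(c < p ^ M) nm (weyl k X (c%:R / (p ^ M)%:R)) ^+ s <=
  c * pw (eps * M%:R) * (p ^ M)%:R * X%:R `^ (s%:R - k%:R + eta).
Proof.
move=> h0 e0; pose tau := Num.min 1 (eta / 2%:R).
have t0 : 0 < tau by rewrite lt_min ltr01 divr_gt0.
have t1 : tau <= 1 by rewrite ge_min lexx.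
have kR : 1 <= k%:R :> R by rewrite ler1n.
have te : 2 * tau <= eta.
  by have : tau <= eta / 2%:R by [rewrite ge_min lexx orbT]; lra.
have [del del0 /(_ _ e0)[c c0 H]] := minor_power_mean t0 t1.
exists (9 + c) => [|M X X0 XM]; first exact: addr_ge0.
have pe1 : 1 <= pw (eps * M%:R) by apply: pw_ge1 => //; rewrite mulr_ge0 ?ler0n // ltW.
have XQ : (X ^ k <= p ^ M)%N.
  by apply: leq_trans XM; rewrite leq_exp2r // leq_pmull // muln_gt0 /= ltnW.
rewrite (bigID (fun c : 'I_(p ^ M) => major k tau X (c%:R / (p ^ M)%:R : R))) /=.
rewrite [leRHS](_ : _ = 9 * (pw (eps * M%:R) * (p ^ M)%:R * X%:R `^ (s%:R - k%:R + eta)) +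
  c * pw (eps * M%:R) * (p ^ M)%:R * X%:R `^ (s%:R - k%:R + eta)); last by ring.
apply: lerD; last first.
  apply: le_trans (H M X X0 XM) _; apply: ler_wpM2l; first by rewrite !mulr_ge0 ?pw_ge0.
  by apply: ler_npow => //; lra.
apply: (@le_trans _ _ (X%:R ^+ s * \sum_(c < p ^ M | major k tau X (c%:R / (p ^ M)%:R : R)) 1)).
  rewrite mulr_sumr; apply: ler_sum => c' _; rewrite mulr1.
  by apply: lerXn2r; rewrite ?nnegrE ?normc_ge0 ?normc_weyl_le.
apply: le_trans (ler_wpM2l (exprn_ge0 _ (ler0n R X)) (major_card (ltW t0) (le_trans t1 kR) X0 XQ)) _.
rewrite [leLHS](_ : _ = 9 * ((p ^ M)%:R * (X%:R ^+ s * X%:R `^ (2 * tau - k%:R)))); last by ring.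
apply: ler_wpM2l => //.
rewrite [leRHS](_ : _ = (p ^ M)%:R * (pw (eps * M%:R) * X%:R `^ (s%:R - k%:R + eta))); last by ring.
apply: ler_wpM2l => //.
apply: (@le_trans _ _ (X%:R `^ (s%:R - k%:R + eta))); last by rewrite ler_peMl ?powR_ge0.
by rewrite -npow_nat // -npowD //; apply: ler_npow => //; lra.
Qed.

End MinorPowerMean.

(** * The singular series *)

Section CompleteSums.
Variables (R : realType) (k : nat).
Local Notation C := R[i].
Local Notation nm := (@Normc.normc R).
Hypothesis k_gt0 : (0 < k)%N.

Definition csum (q a : nat) : C := \sum_(b < q) expi ((a * b ^ k)%:R / q%:R : R).

Lemma normc_csum_le q a : nm (csum q a) <= q%:R.
Proof.
apply: le_trans (le_normc_sum _ _ _) _.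
by rewrite (eq_bigr (fun=> 1)) ?sumr_const ?card_ord // => b _; rewrite normc_expi.
Qed.

Lemma expi_modn q n : (0 < q)%N -> expi ((n %% q)%:R / q%:R : R) = expi (n%:R / q%:R : R).
Proof.
move=> q0; rewrite [in RHS](divn_eq n q) natrD mulrDl natrM mulfK ?pnatr_eq0 -?lt0n // addrC.
by rewrite expiD expi_nat mulr1.
Qed.

Lemma expi_pow_period q a x y : (0 < q)%N -> x = y %[mod q] ->
  expi ((a * x ^ k)%:R / q%:R : R) = expi ((a * y ^ k)%:R / q%:R : R).
Proof.
move=> q0 xy; rewrite -(expi_modn _ q0) -[RHS](expi_modn _ q0); congr (expi (_%:R / _)).
by rewrite -modnMmr -modnXm xy modnXm modnMmr.
Qed.

(** Full periods cancel; at most q - 1 terms remain. *)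
Lemma sum_period_bound q (T : nat -> C) : (0 < q)%N -> (forall x, T (x + q)%N = T x) ->
  \sum_(x < q) T x = 0 -> (forall x, nm (T x) <= 2) -> forall n, nm (\sum_(x < n) T x) <= 2 * (q.-1)%:R.
Proof.
move=> q0 TP T0 T2 n; elim/ltn_ind: n => n IH; have [nq|qn] := ltnP n q.
  apply: le_trans (le_normc_sum _ _ _) _; apply: (@le_trans _ _ (\sum_(x < n) 2)); first by apply: ler_sum.
  by rewrite sumr_const card_ord -[leLHS]mulr_natr; apply: ler_wpM2l => //; rewrite ler_nat -ltnS prednK.
have nE : (n = q + (n - q))%N by rewrite subnKC.
rewrite nE big_split_ord /= T0 add0r (eq_bigr (fun x : 'I_(n - q) => T x)); last by move=> x _; rewrite addnC TP.
by apply: IH; rewrite ltn_subrL q0 (leq_trans q0).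
Qed.

(* Abel summation against the partial sums of the zero-mean periodic part of the phase. *)
Lemma weyl_major q a P (beta : R) : (0 < q)%N ->
  nm (weyl k P (a%:R / q%:R + beta) - csum q a / q%:R * weyl k P beta) <=
  2 * q%:R * (1 + 8 * `|beta| * P%:R ^+ k).
Proof.
move=> q0; have qR : 0 < q%:R :> R by rewrite ltr0n.
have qC : (q%:R : C) != 0 by rewrite pnatr_eq0 -lt0n.
set u := csum q a / q%:R.
have u1 : nm u <= 1.
  have e : nm u * q%:R = nm (csum q a) by rewrite -[X in _ * X](@normc_nat R) -Normc.normcM divfK.
  by rewrite -(ler_pM2r qR) mul1r e; exact: normc_csum_le.
pose T x : C := expi ((a * x ^ k)%:R / q%:R : R) - u.
pose g x : C := expi (beta * (x ^ k)%:R).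
pose A n := \sum_(1 <= x < n.+1) T x.
have T2 x : nm (T x) <= 2.
  by apply: le_trans (le_normcD _ _) _; rewrite normcN normc_expi; lra.
have TP x : T (x + q)%N = T x by rewrite /T (@expi_pow_period q a (x + q) x) // modnDr.
have T0 : \sum_(x < q) T x = 0.
  by rewrite /T sumrB sumr_const card_ord -[X in _ - X]mulr_natr /u divfK // subrr.
have A2 n : nm (A n) <= 2 * q%:R.
  have -> : A n = \sum_(x < n.+1) T x - T 0%N.
    by rewrite big_ord_recl /= addrC addKr /A big_add1 big_mkord.
  apply: le_trans (le_normcD _ _) _; rewrite normcN.
  have := sum_period_bound q0 TP T0 T2 n.+1; have := T2 0%N.
  have -> : q%:R = q.-1%:R + 1 :> R by rewrite natr1 prednK.
  lra.
have -> : weyl k P (a%:R / q%:R + beta) - u * weyl k P beta = \sum_(1 <= x < P.+1) T x * g x.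
  rewrite /weyl mulr_sumr -sumrB; apply: eq_bigr => x _.
  by rewrite mulrDl expiD mulrBl natrM; congr (expi _ * _ - _); rewrite mulrAC.
have H n : nm (\sum_(1 <= x < n.+1) T x * g x - A n * g n) <= 2 * q%:R * (8 * `|beta| * n%:R ^+ k).
  elim: n => [|n IH].
    by rewrite /A !big_geq // mul0r subr0 Normc.normc0 !mulr_ge0 ?exprn_ge0.
  have -> : \sum_(1 <= x < n.+2) T x * g x - A n.+1 * g n.+1 =
      (\sum_(1 <= x < n.+1) T x * g x - A n * g n) + A n * (g n - g n.+1).
    by rewrite /A !(big_nat_recr n.+1) //=; ring.
  apply: le_trans (le_normcD _ _) _.
  have -> : n.+1%:R ^+ k = n%:R ^+ k + (n.+1 ^ k - n ^ k)%N%:R :> R.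
    by rewrite -!natrX -natrD subnKC // leq_exp2r.
  have -> : forall z, 2 * q%:R * (8 * `|beta| * (n%:R ^+ k + z)) =
     2 * q%:R * (8 * `|beta| * n%:R ^+ k) + 2 * q%:R * (8 * (`|beta| * z)) by move=> z; ring.
  apply: lerD => //; rewrite Normc.normcM; apply: ler_pM; rewrite ?normc_ge0 //.
  have -> : g n - g n.+1 = - (g n * (expi (beta * (n.+1 ^ k - n ^ k)%N%:R) - 1)).
    by rewrite mulrBr mulr1 -expiD -mulrDr -natrD subnKC ?leq_exp2r // opprB.
  rewrite normcN Normc.normcM normc_expi mul1r.
  by apply: le_trans (normc_expi_sub1_le _) _; rewrite normrM [`|_%:R|]ger0_norm.
have -> : \sum_(1 <= x < P.+1) T x * g x = (\sum_(1 <= x < P.+1) T x * g x - A P * g P) + A P * g P by rewrite subrK.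
apply: le_trans (le_normcD _ _) _; rewrite mulrDr mulr1 addrC; apply: lerD; last exact: H.
by rewrite Normc.normcM normc_expi mulr1.
Qed.

(** Every phase is within 1/2 of 1 here. *)
Lemma weyl_near_zero X (beta : R) : 16 * `|beta| * X%:R ^+ k <= 1 -> X%:R <= 2 * nm (weyl k X beta).
Proof.
move=> h; have e : X%:R = weyl k X beta - \sum_(1 <= x < X.+1) (expi (beta * (x ^ k)%:R) - 1) :> C.
  by rewrite sumrB sumr_const_nat subn1 /= opprB addrC subrK.
have h1 : nm (\sum_(1 <= x < X.+1) (expi (beta * (x ^ k)%:R) - 1)) <= X%:R / 2%:R.
  apply: le_trans (le_normc_sum _ _ _) _.
  apply: (@le_trans _ _ (\sum_(1 <= x < X.+1) 2%:R^-1)); last by rewrite sumr_const_nat subn1 /= -[leLHS]mulr_natl.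
  rewrite !big_nat; apply: ler_sum => x /andP[_ xX].
  apply: le_trans (normc_expi_sub1_le _) _; rewrite normrM [`|_%:R|]ger0_norm //.
  have : `|beta| * (x ^ k)%:R <= `|beta| * X%:R ^+ k by apply: ler_wpM2l => //; rewrite -natrX ler_nat leq_exp2r.
  lra.
have : nm (X%:R : C) <= nm (weyl k X beta) + nm (\sum_(1 <= x < X.+1) (expi (beta * (x ^ k)%:R) - 1)).
  by rewrite [in leLHS]e; apply: le_trans (le_normcD _ _) _; rewrite normcN.
rewrite normc_nat; lra.
Qed.

End CompleteSums.

Lemma frac_separated (q a q' a' : nat) (z : int) (R : realType) : (a < q)%N -> (a' < q')%N ->
  coprime q a -> coprime q' a' ->
  (q * q')%:R * `|a%:R / q%:R - a'%:R / q'%:R - z%:~R| < 1 :> R -> q = q' /\ a = a'.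
Proof.
move=> aq aq' c c' h; have q0 : (0 < q)%N by exact: leq_ltn_trans aq.
have q'0 : (0 < q')%N by exact: leq_ltn_trans aq'.
have n0 : (a * q')%N%:Z - (a' * q)%N%:Z - z * (q * q')%N%:Z = 0.
  apply/eqP; apply: contraLR h => n0; rewrite -leNgt -[(q * q')%:R]ger0_norm // -normrM.
  rewrite (_ : _ * _ = ((a * q')%N%:Z - (a' * q)%N%:Z - z * (q * q')%N%:Z)%:~R).
    by rewrite -intr_norm ler1z -gtz0_ge1 normr_gt0.
  rewrite !intrD !intrN !intrM !natrM /=; field.
  by rewrite !pnatr_eq0 -!lt0n q'0 q0.
have d1 : (q %| q')%N.
  have : (q%:Z %| (a * q')%N%:Z)%Z.
    by apply/dvdzP; exists (a'%:Z + z * q'%:Z); move: n0; rewrite !PoszM; lia.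
  by rewrite dvdzE /= Gauss_dvdr.
have d2 : (q' %| q)%N.
  have : (q'%:Z %| (a' * q)%N%:Z)%Z.
    by apply/dvdzP; exists (a%:Z - z * q%:Z); move: n0; rewrite !PoszM; lia.
  by rewrite dvdzE /= Gauss_dvdr.
have qq : q = q' by apply/eqP; rewrite eqn_dvd d1.
split=> //; move: n0 aq' aq; rewrite -qq => n0 aq' aq.
have n1 : a%:Z - a'%:Z = z * q%:Z.
  have : (a%:Z - a'%:Z - z * q%:Z) * q%:Z = 0 by move: n0; rewrite !PoszM; lia.
  by move/eqP; rewrite mulf_eq0 => /orP[/eqP|/eqP]; lia.
have z0 : z = 0 by clear -n1 aq aq'; nia.
by move: n1; rewrite z0 mul0r; lia.
Qed.

Lemma sum_inj_on (R : realType) (I : finType) (P : pred I) n (f : I -> nat) (B : pred nat) (h : nat -> R) :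
  (forall i, P i -> (f i < n)%N /\ B (f i)) -> {in P &, injective f} -> (forall j, 0 <= h j) ->
  \sum_(i | P i) h (f i) <= \sum_(j < n | B j) h j.
Proof.
move=> H finj h0.
have -> : \sum_(i | P i) h (f i) = \sum_(i | P i) \sum_(j < n | B j && (f i == j)) h j.
  apply: eq_bigr => i Pi; have [fn Bf] := H i Pi.
  rewrite (big_pred1 (Ordinal fn)) // => j; rewrite /= -(inj_eq val_inj) /= [RHS]eq_sym.
  by case: eqP => [<-|_]; rewrite ?Bf ?andbF.
under eq_bigr => i _ do rewrite big_mkcondr.
rewrite exchange_big; apply: ler_sum => j _; rewrite -big_mkcondr.
have [i /andP[Pi /eqP fi]|no] := pickP (fun i => P i && (f i == j)); last by rewrite big_pred0.
rewrite (big_pred1 i) // => i' /=; apply/andP/eqP => [[Pi' /eqP fi']|->]; last by rewrite Pi fi.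
by apply: finj => //; rewrite fi fi'.
Qed.

(** * Convergence of the singular series from the minor arcs *)

Section SingularSeries.
Variables (R : realType) (k p s : nat).
Local Notation C := R[i].
Local Notation nm := (@Normc.normc R).
Hypothesis k_gt1 : (1 < k)%N.
Let k_gt0 : (0 < k)%N := ltnW k_gt1.
Hypothesis p_gt1 : (1 < p)%N.
Hypothesis p_ge8 : (8 <= p)%N.
Hypothesis s_gt1 : (1 < s)%N.
Local Notation pw x := (p%:R `^ x : R).

Lemma modulus_exists L : (0 < L)%N -> exists M, (L <= p ^ M)%N /\ (p ^ M <= p * L)%N.
Proof.
move=> L0; have [L1|L1] := leqP L 1.
  by exists 0%N; split; rewrite ?expn0 //; apply: leq_trans (leq_pmulr _ L0) => //; exact: ltnW.
exists (up_log p L); have /andP[l1 l2] := up_log_bounds p_gt1 L1; split=> //.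
by rewrite -(prednK (_ : 0 < up_log p L)%N) ?up_log_gt0 ?p_gt1 // expnS leq_mul2l (ltnW l1) orbT.
Qed.

Lemma modulus_pw M X b (e : R) : (0 < X)%N -> 0 <= e -> (p ^ M <= b * X ^ k)%N ->
  pw (e * M%:R) <= b%:R `^ e * X%:R `^ (k%:R * e).
Proof.
move=> X0 e0 h; rewrite mulrC powRrM -pwn // powRrM powR_mulrn // -powRM ?exprn_ge0 //.
by apply: ge0_ler_powR; rewrite ?nnegrE ?mulr_ge0 ?exprn_ge0 // -natrX -natrM ler_nat.
Qed.

(** With X = Y^3, a fraction a/q with Y < q <= 2Y lies on the minor arcs of level 1/3, and so do the
    J grid points next to it within 1/(16 X^k). At these points the Weyl sum is at least a constant
    times |csum / q| X, up to an error O(Y). All these points are distinct, so the block times J X^s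
    is bounded by the minor arc mean. *)
Lemma singular_block (hS : power_saving k p s (3%:R^-1 : R)) : exists2 d : R, 0 < d & exists2 c : R, 0 <= c &
  forall Y, (1 < Y)%N -> \sum_(q < (2 * Y).+1 | (Y < q)%N) \sum_(a < q | coprime q a) (nm (csum R k q a) / q%:R) ^+ s <=
  c * Y%:R `^ (- d).
Proof.
have [del del0 H] := hS.
have kR : 0 < k%:R :> R by rewrite ltr0n.
(* The loss p^(e M) is then X^(del/2) up to a constant, half of the saving. *)
pose e : R := del / (2 * k%:R).
have e0 : 0 < e by rewrite divr_gt0 // mulr_gt0.
have [c c0 Hc] := H _ e0.
pose b := (p * (2 * p) ^ k)%N.
(* The remaining X^(-del/2) is Y^(-3 del/2). The bound 1 comes from the errors O(Y) at the
   points. *)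
pose d : R := Num.min 1 (3 / 2 * del).
have d0 : 0 < d by rewrite lt_min ltr01 mulr_gt0 // divr_gt0.
exists d => //; pose c1 := 4 ^+ s * (32 * c * b%:R `^ e + 9 * 8 ^+ s).
have c10 : 0 <= c1 by rewrite mulr_ge0 ?exprn_ge0 // addr_ge0 ?mulr_ge0 ?powR_ge0 ?exprn_ge0.
exists c1 => // Y Y1; have Y0 : (0 < Y)%N by exact: ltnW.
pose X := (Y ^ 3)%N; have X0 : (0 < X)%N by rewrite expn_gt0 Y0.
have L0 : (0 < (2 * p * X) ^ k)%N by rewrite expn_gt0 muln_gt0 X0 andbT muln_gt0 /= ltnW.
have [M [XM MX]] := modulus_exists L0.
have {}MX : (p ^ M <= b * X ^ k)%N by rewrite /b -mulnA -expnMn.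
set Q := (p ^ M)%N in XM MX.
have XkQ : (256 * X ^ k <= Q)%N.
  apply: leq_trans XM; rewrite expnMn leq_mul2r; apply/orP; right.
  apply: (@leq_trans (16 ^ k)); last by rewrite leq_exp2r // (leq_mul (leqnn 2) p_ge8).
  by rewrite (_ : 256 = 16 ^ 2)%N // leq_exp2l.
have Xk0 : (0 < X ^ k)%N by rewrite expn_gt0 X0.
have XkR : 0 < X%:R ^+ k :> R by rewrite exprn_gt0 // ltr0n.
have QR : 0 < Q%:R :> R by rewrite ltr0n; apply: leq_trans XkQ; rewrite muln_gt0.
have YR : 2 <= Y%:R :> R by rewrite ler_nat.
have X13 : X%:R `^ 3%:R^-1 = Y%:R :> R.
  by rewrite /X natrX -powR_mulrn // -powRrM divff ?pnatr_eq0 // powRr1.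
have XkY : Y%:R ^+ 6 <= X%:R ^+ k :> R.
  by rewrite -!natrX ler_nat /X -expnM leq_exp2l //; lia.
pose J := (Q %/ (16 * X ^ k))%N.
have J1 : (J * (16 * X ^ k) <= Q)%N by exact: leq_divM.
have J2 : (Q < 2 * (J * (16 * X ^ k)))%N.
  have := ltn_ceil Q (_ : 0 < 16 * X ^ k)%N; rewrite muln_gt0 Xk0 -/J => /(_ isT).
  have : (16 <= J)%N by rewrite /J leq_divRL ?muln_gt0 //; apply: leq_trans XkQ; rewrite mulnA.
  clear; set x := (16 * X ^ k)%N; rewrite mulSn; nia.
have J0 : (0 < J)%N by rewrite divn_gt0 ?muln_gt0 //; apply: leq_trans XkQ; rewrite leq_mul2r orbT.
have JR : 0 < J%:R :> R by rewrite ltr0n.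
pose Z := (2 * Y).+1.
pose I := ('I_Z * 'I_Z * 'I_J)%type.
pose P0 (q a : nat) := [&& (Y < q)%N, (a < q)%N & coprime q a].
pose P (i : I) := P0 i.1.1 i.1.2.
(* The grid points just to the right of a/q. *)
pose f (i : I) := ((Q * i.1.2) %/ i.1.1 + i.2).+1.
pose u (i : I) : R := (f i)%:R / Q%:R - i.1.2%:R / i.1.1%:R.
have uP i : P i -> 0 <= u i /\ 16 * u i * X%:R ^+ k <= 1.
  case: i => [[q a] j]; rewrite /P /P0 /u /f /= => /and3P[Yq aq _].
  have q0 : (0 < q)%N by exact: leq_ltn_trans Yq.
  have qR : 0 < q%:R :> R by rewrite ltr0n.
  have h1 := leq_divM (Q * a) q; have h2 := ltn_ceil (Q * a) q0.
  set n := ((Q * a) %/ q)%N in h1 h2 *.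
  have h1' : n%:R * q%:R <= Q%:R * a%:R :> R by rewrite -!natrM ler_nat.
  have h2' : Q%:R * a%:R <= n.+1%:R * q%:R :> R by rewrite -!natrM ler_nat ltnW.
  have uE : ((n + j).+1%:R / Q%:R - a%:R / q%:R) * Q%:R = n%:R + 1 + j%:R - Q%:R * a%:R / q%:R :> R.
    by rewrite -addn1 !natrD; field; rewrite !gt_eqF.
  have a1 : Q%:R * a%:R / q%:R <= n%:R + 1 :> R by rewrite ler_pdivrMr // natr1.
  have a2 : n%:R <= Q%:R * a%:R / q%:R :> R by rewrite ler_pdivlMr.
  have jJ : j%:R + 1 <= J%:R :> R by rewrite natr1 ler_nat.
  split; first by rewrite -(pmulr_lge0 _ QR) uE; have := ler0n R j; lra.
  rewrite -(ler_pM2r QR) mul1r [leLHS](_ : _ = 16 * X%:R ^+ k * (((n + j).+1%:R / Q%:R - a%:R / q%:R) * Q%:R)); last by ring.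
  apply: (@le_trans _ _ (16 * X%:R ^+ k * J%:R)).
    by apply: ler_wpM2l; [rewrite mulr_ge0 // ltW | rewrite uE; lra].
  by rewrite -natrX -!natrM ler_nat mulnC.
have uP' i : P i -> 16 * `|u i| * X%:R ^+ k <= 1 by move=> /uP[u0 ui]; rewrite ger0_norm.
have uX i : P i -> u i <= (X%:R ^+ k)^-1.
  move=> /uP[u0 ui]; rewrite -(ler_pM2r XkR) mulVf ?gt_eqF //.
  have : 0 <= u i * X%:R ^+ k by rewrite mulr_ge0 // ltW.
  lra.
have PqY i : P i -> (i.1.1%:R <= 2 * Y%:R :> R) by move=> _; rewrite -natrM ler_nat -ltnS.
have fQ i : P i -> (f i < Q)%N.
  move=> Pi; rewrite -(ltr_nat R); have fu : (f i)%:R = (u i + i.1.2%:R / i.1.1%:R) * Q%:R.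
    by rewrite /u subrK divfK // gt_eqF.
  rewrite fu -[ltRHS]mul1r ltr_pM2r //.
  have /and3P[Yq aq _] := Pi; have qR : 0 < i.1.1%:R :> R by rewrite ltr0n; exact: leq_ltn_trans Yq.
  have a1 : i.1.2%:R / i.1.1%:R <= 1 - i.1.1%:R^-1 :> R.
    by rewrite ler_pdivrMr // mulrBl mul1r mulVf ?gt_eqF // lerBrDr natr1 ler_nat.
  have ux := uX _ Pi; suff : (X%:R ^+ k)^-1 < i.1.1%:R^-1 :> R by lra.
  rewrite ltf_pV2 ?posrE //; apply: le_lt_trans (PqY _ Pi) _; apply: lt_le_trans XkY.
  rewrite -natrM -natrX ltr_nat; apply: (@leq_trans (Y ^ 3)); last by rewrite leq_exp2l.
  by clear -Y1; rewrite !expnS expn0; nia.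
have XkI : 4 * Y%:R * Y%:R * (X%:R ^+ k)^-1 < 1 :> R.
  rewrite ltr_pdivrMr // mul1r; apply: lt_le_trans XkY.
  rewrite -!natrM -natrX ltr_nat (_ : Y ^ 6 = (Y * Y) * (Y * Y) * (Y * Y))%N; last by rewrite !expnS expn0; ring.
  rewrite -[(4 * Y * Y)%N]mulnA; have : (4 <= Y * Y)%N by exact: (leq_mul Y1 Y1).
  move: (Y * Y)%N => z; clear => z4; apply: (@leq_trans (4 * z).+1) => //.
  rewrite -mulnA; apply: (@leq_trans (z * (4 * 4))); first by lia.
  by rewrite leq_mul2l (leq_mul z4 z4) orbT.
have fminor i : P i -> ~~ major k 3%:R^-1 X ((f i)%:R / Q%:R : R).
  move=> Pi; apply/asboolPn => -[q' [a' [q'0 q'X h]]].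
  have /and3P[Yq aq cqa] := Pi; have [u0 _] := uP _ Pi; have ux := uX _ Pi; have qY := PqY _ Pi.
  have fu : (f i)%:R / Q%:R = u i + i.1.2%:R / i.1.1%:R :> R by rewrite /u subrK.
  have q0 : (0 < i.1.1)%N by exact: leq_ltn_trans Yq.
  have qR : 0 < i.1.1%:R :> R by rewrite ltr0n.
  have q'Y : q'%:R <= Y%:R :> R by rewrite -X13.
  have XkN : X%:R `^ (- k%:R) = (X%:R ^+ k)^-1 :> R by rewrite powRN npow_nat.
  rewrite npowD // XkN X13 in h.
  have n0 : (q' * i.1.2)%N%:Z - i.1.1%:Z * a' = 0.
    apply/eqP; apply/negPn/negP => n0.
    have : 1 <= `|((q' * i.1.2)%N%:Z - i.1.1%:Z * a')%:~R| :> R by rewrite -intr_norm ler1z -gtz0_ge1 normr_gt0.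
    rewrite leNgt => /negP; apply.
    have -> : ((q' * i.1.2)%N%:Z - i.1.1%:Z * a')%:~R = i.1.1%:R * ((q'%:R * ((f i)%:R / Q%:R) - a'%:~R) - q'%:R * u i) :> R.
      by rewrite fu intrB !intrM ?natrM /=; field; rewrite gt_eqF.
    rewrite normrM ger0_norm ?ltW //.
    have h2 : `|q'%:R * u i| <= Y%:R * (X%:R ^+ k)^-1.
      by rewrite ger0_norm ?mulr_ge0 //; apply: ler_pM.
    have h3 : `|(q'%:R * ((f i)%:R / Q%:R) - a'%:~R) - q'%:R * u i| <= 2 * (Y%:R * (X%:R ^+ k)^-1).
      by apply: le_trans (ler_normB _ _) _; move: h h2; lra.
    apply: le_lt_trans (ler_pM (ler0n R _) (normr_ge0 _) qY h3) _.
    by apply: le_lt_trans XkI; rewrite le_eqVlt; apply/orP; left; apply/eqP; ring.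
  have : (i.1.1 %| q' * i.1.2)%N.
    have : (i.1.1%:Z %| (q' * i.1.2)%N%:Z)%Z by apply/dvdzP; exists a'; apply/eqP; rewrite -subr_eq0 [a' * _]mulrC n0.
    by rewrite dvdzE.
  rewrite Gauss_dvdl // => /(dvdn_leq q'0) h4.
  by move: q'Y; rewrite ler_nat => h5; have := leq_trans Yq (leq_trans h4 h5); rewrite ltnn.
have finj : {in P &, injective f}.
  move=> i i' Pi Pi' fe; have [u0 _] := uP _ Pi; have ux := uX _ Pi.
  have [u0' _] := uP _ Pi'; have ux' := uX _ Pi'.
  have /and3P[_ aq cqa] := Pi; have /and3P[_ aq' cqa'] := Pi'.
  have [|qq aa] := @frac_separated i.1.1 i.1.2 i'.1.1 i'.1.2 0 R aq aq' cqa cqa'.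
    have -> : i.1.2%:R / i.1.1%:R - i'.1.2%:R / i'.1.1%:R - 0%:~R = u i' - u i :> R.
      by rewrite /u fe subr0; ring.
    apply: (@le_lt_trans _ _ ((2 * Y%:R) * (2 * Y%:R) * (X%:R ^+ k)^-1)).
      rewrite natrM; apply: ler_pM => //; first by rewrite mulr_ge0.
        by apply: ler_pM; rewrite ?PqY.
      by rewrite ler_norml; lra.
    by apply: le_lt_trans XkI; rewrite le_eqVlt; apply/orP; left; apply/eqP; ring.
  move: fe; rewrite /f qq aa => -[] /addnI jj.
  case: i i' qq aa jj {Pi Pi' u0 ux u0' ux' aq cqa aq' cqa'} => [[q a] j] [[q' a'] j'] /= qq aa jj.
  by rewrite (val_inj qq) (val_inj aa) (val_inj jj).
pose S (q a : nat) : R := nm (csum R k q a) / q%:R.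
have S0 q a : 0 <= S q a by rewrite divr_ge0 ?normc_ge0.
pose F (c : nat) : R := nm (weyl k X (c%:R / Q%:R : R)).
have F0 z : 0 <= F z by exact: normc_ge0.
have point i : P i -> (S i.1.1 i.1.2 * X%:R) ^+ s <= 4 ^+ s * (F (f i) ^+ s + (8 * Y%:R) ^+ s).
  move=> Pi; have /and3P[Yq aq cqa] := Pi; have qY := PqY _ Pi.
  have q0 : (0 < i.1.1)%N by exact: leq_ltn_trans Yq.
  have qR : 0 < i.1.1%:R :> R by rewrite ltr0n.
  have ui := uP' _ Pi; have h1 := weyl_near_zero k_gt0 ui.
  have h2 := @weyl_major R k k_gt0 i.1.1 i.1.2 X (u i) q0.
  have fu : i.1.2%:R / i.1.1%:R + u i = (f i)%:R / Q%:R :> R by rewrite /u addrC subrK.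
  rewrite fu in h2.
  have SE : nm (csum R k i.1.1 i.1.2 / i.1.1%:R * weyl k X (u i)) = S i.1.1 i.1.2 * nm (weyl k X (u i)).
    rewrite Normc.normcM /S; congr (_ * _).
    have ne : nm (csum R k i.1.1 i.1.2 / i.1.1%:R) * i.1.1%:R = nm (csum R k i.1.1 i.1.2).
      by rewrite -[X in _ * X](@normc_nat R) -Normc.normcM divfK // pnatr_eq0 -lt0n.
    by rewrite -ne mulfK // gt_eqF.
  have h3 : S i.1.1 i.1.2 * nm (weyl k X (u i)) <= F (f i) + 4 * Y%:R * 2.
    rewrite -SE; set z := _ * weyl k X (u i) in h2 *.
    have -> : z = weyl k X ((f i)%:R / Q%:R) - (weyl k X ((f i)%:R / Q%:R) - z) by rewrite subKr.
    apply: le_trans (le_normcD _ _) _; rewrite normcN; apply: lerD => //; apply: le_trans h2 _.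
    have : 8 * `|u i| * X%:R ^+ k <= 1 by have : 0 <= `|u i| * X%:R ^+ k by [rewrite mulr_ge0 // ltW]; move: ui; lra.
    move=> h; apply: ler_pM; [by rewrite mulr_ge0 | by rewrite addr_ge0 // !mulr_ge0 ?exprn_ge0 | |].
      by move: qY; lra.
    by move: h; lra.
  have h4 : S i.1.1 i.1.2 * X%:R <= 2 * (F (f i) + 8 * Y%:R).
    apply: (@le_trans _ _ (S i.1.1 i.1.2 * (2 * nm (weyl k X (u i))))); first by apply: ler_wpM2l.
    by move: h3; lra.
  apply: (@le_trans _ _ ((2 * (F (f i) + 8 * Y%:R)) ^+ s)).
    apply: lerXn2r h4; rewrite nnegrE; first by rewrite mulr_ge0.
    by rewrite mulr_ge0 // addr_ge0 // mulr_ge0.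
  rewrite exprMn (_ : (4 : R) = 2 * 2); last by ring.
  rewrite [leRHS](_ : _ = 2 ^+ s * (2 ^+ s * (F (f i) ^+ s + (8 * Y%:R) ^+ s))); last by rewrite exprMn mulrA.
  by apply: ler_wpM2l; [exact: exprn_ge0 | apply: add_pow_le; rewrite ?mulr_ge0].
pose T := \sum_(x : 'I_Z * 'I_Z | P0 x.1 x.2) S x.1 x.2 ^+ s.
have -> : \sum_(q < Z | (Y < q)%N) \sum_(a < q | coprime q a) S q a ^+ s = T.
  rewrite /T -(pair_big_dep (fun q : 'I_Z => (Y < q)%N) (fun q a : 'I_Z => (a < q)%N && coprime q a) (fun q a : 'I_Z => S q a ^+ s)) /=.
  apply: eq_bigr => q _; have qZ : (q <= Z)%N by exact: ltnW.
  rewrite (big_ord_widen_cond Z (fun a => coprime q a) (fun a => S q a ^+ s) qZ).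
  by apply: eq_bigl => a; rewrite andbC.
have JT : T * (J%:R * X%:R ^+ s) = \sum_(i | P i) (S i.1.1 i.1.2 * X%:R) ^+ s.
  transitivity (\sum_(x : 'I_Z * 'I_Z | P0 x.1 x.2) \sum_(j < J) (S x.1 x.2 * X%:R) ^+ s).
    rewrite /T mulr_suml; apply: eq_bigr => x _.
    by rewrite sumr_const card_ord -[RHS]mulr_natl [(S _ _ * X%:R) ^+ s]exprMn mulrCA.
  by rewrite pair_big_dep; apply: eq_bigl => i; rewrite andbT.
have X0R : 0 < J%:R * X%:R ^+ s :> R by rewrite mulr_gt0 // exprn_gt0 // ltr0n.
rewrite -(ler_pM2r X0R) JT.
apply: (@le_trans _ _ (4 ^+ s * (\sum_(i | P i) F (f i) ^+ s + \sum_(i : I) (8 * Y%:R) ^+ s))).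
  apply: (@le_trans _ _ (\sum_(i | P i) 4 ^+ s * (F (f i) ^+ s + (8 * Y%:R) ^+ s))); first exact: ler_sum.
  rewrite -mulr_sumr; apply: ler_wpM2l; first exact: exprn_ge0.
  rewrite big_split /=; apply: lerD => //; rewrite [leRHS](bigID P) /= lerDl sumr_ge0 // => i _.
  by rewrite exprn_ge0 // mulr_ge0.
rewrite /c1 -[leRHS]mulrA -[leRHS]mulrA; apply: ler_wpM2l; first exact: exprn_ge0.
have XY n : X%:R ^+ n = Y%:R ^+ (3 * n) :> R by rewrite /X natrX -exprM.
have Yd (x : R) : d <= x -> Y%:R `^ (- x) <= Y%:R `^ (- d) by move=> h; apply: ler_npow => //; lra.
rewrite [leRHS]mulrDl; apply: lerD.
  have := @sum_inj_on R I P Q f (fun c => ~~ major k 3%:R^-1 X (c%:R / Q%:R : R)) (fun c => F c ^+ s)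
    (fun i Pi => conj (fQ i Pi) (fminor i Pi)) finj (fun j => exprn_ge0 s (F0 j)).
  move/le_trans; apply; apply: le_trans (Hc M X X0 XM) _; rewrite -/Q.
  have e1 : pw (e * M%:R) <= b%:R `^ e * X%:R `^ (k%:R * e) by apply: modulus_pw => //; exact: ltW.
  have e2 : Q%:R <= 32 * J%:R * X%:R ^+ k :> R.
    have := ltnW J2; rewrite -(ler_nat R) [(2 * _)%:R]natrM [(J * _)%:R]natrM [(16 * _)%:R]natrM [(X ^ k)%:R]natrX; move: (J%:R : R) (X%:R ^+ k : R) => j x; lra.
  apply: (@le_trans _ _ (c * (b%:R `^ e * X%:R `^ (k%:R * e)) * (32 * J%:R * X%:R ^+ k) * X%:R `^ (s%:R - k%:R - del))).
    apply: ler_wpM2r; first exact: powR_ge0.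
    by apply: ler_pM; rewrite ?mulr_ge0 ?powR_ge0 //; apply: ler_wpM2l.
  have e3 : X%:R `^ (k%:R * e) * X%:R ^+ k * X%:R `^ (s%:R - k%:R - del) = X%:R ^+ s * Y%:R `^ (- (3 / 2 * del)) :> R.
    have -> : Y%:R `^ (- (3 / 2 * del)) = X%:R `^ (- (del / 2)) :> R.
      by rewrite /X natrX -powR_mulrn // -powRrM; congr (_ `^ _); field.
    by rewrite -!npow_nat -!npowD //; congr (_ `^ _); rewrite /e; field; rewrite gt_eqF.
  rewrite [leLHS](_ : _ = 32 * c * b%:R `^ e * (X%:R `^ (k%:R * e) * X%:R ^+ k * X%:R `^ (s%:R - k%:R - del)) * J%:R); last by ring.
  rewrite e3 [leRHS](_ : _ = 32 * c * b%:R `^ e * (X%:R ^+ s * Y%:R `^ (- d)) * J%:R); last by ring.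
  apply: ler_wpM2r => //; apply: ler_wpM2l; first by rewrite !mulr_ge0 ?powR_ge0.
  by apply: ler_wpM2l; [exact: exprn_ge0 | apply: Yd; rewrite ge_min lexx orbT].
rewrite sumr_const !card_prod !card_ord -[leLHS]mulr_natl.
have Z3 : Z%:R <= 3 * Y%:R :> R by rewrite -natrM ler_nat /Z; clear -Y0; lia.
apply: (@le_trans _ _ ((3 * Y%:R) * (3 * Y%:R) * J%:R * (8 * Y%:R) ^+ s)).
  rewrite !natrM; apply: ler_wpM2r; first by rewrite exprn_ge0 // mulr_ge0.
  by apply: ler_wpM2r => //; apply: ler_pM.
rewrite exprMn XY [leLHS](_ : _ = 9 * 8 ^+ s * J%:R * (Y%:R * Y%:R * Y%:R ^+ s)); last by ring.
rewrite [leRHS](_ : _ = 9 * 8 ^+ s * J%:R * (Y%:R `^ (- d) * Y%:R ^+ (3 * s))); last by ring.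
apply: ler_wpM2l; first by rewrite !mulr_ge0 ?exprn_ge0.
apply: (@le_trans _ _ (Y%:R `^ (- 1) * Y%:R ^+ (3 * s))).
  rewrite -expr2 -exprD -!npow_nat -npowD //; apply: ler_npow => //.
  have : 2 <= s%:R :> R by rewrite ler_nat.
  by rewrite natrM natrD; lra.
by apply: ler_wpM2r; [exact: exprn_ge0 | apply: Yd; rewrite ge_min lexx].
Qed.

Lemma sum_geometric_le (x : R) n : 0 <= x -> x < 1 -> \sum_(i < n) x ^+ i <= (1 - x)^-1.
Proof.
move=> x0 x1; have h : 0 < 1 - x by lra.
rewrite -[leRHS]mul1r ler_pdivlMr // mulrC -opprB mulNr -subrX1 opprB.
by have : 0 <= x ^+ n by [exact: exprn_ge0]; lra.
Qed.

(** Dyadic blocks sum to a geometric series; the denominators q <= 2 contribute at most 9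
    trivially. *)
Lemma singular_series : power_saving k p s (3%:R^-1 : R) -> exists2 c : R, 0 <= c &
  forall Z, \sum_(q < Z) \sum_(a < q | coprime q a) (nm (csum R k q a) / q%:R) ^+ s <= c.
Proof.
move=> /singular_block[d d0 [c c0 H]].
pose x : R := 2 `^ (- d).
have x0 : 0 <= x by exact: powR_ge0.
have x1 : x < 1.
  by rewrite /x powRN invf_lt1 ?powR_gt0 //; exact: (@pw_gt1 R 2 isT d d0).
have hx : 0 <= (1 - x)^-1 by rewrite invr_ge0; lra.
exists (9 + c * (1 - x)^-1) => [|Z]; first by rewrite addr_ge0 ?mulr_ge0.
pose g q := \sum_(a < q | coprime q a) (nm (csum R k q a) / q%:R) ^+ s.
have g0 q : 0 <= g q by apply: sumr_ge0 => a _; rewrite exprn_ge0 // divr_ge0 ?normc_ge0.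
have dy n : \sum_(q < (2 ^ n.+1).+1) g q <= 9 + c * \sum_(i < n) x ^+ i.
  elim: n => [|n IH].
    rewrite big_ord0 mulr0 addr0; apply: (@le_trans _ _ (\sum_(q < (2 ^ 1).+1) (3 : R))).
      apply: ler_sum => q _; apply: (@le_trans _ _ (\sum_(a < q) 1)).
        rewrite /g big_mkcond; apply: ler_sum => a _; case: ifP => _; last exact: ler01.
        apply: exprn_ile1; first by rewrite divr_ge0 ?normc_ge0.
        have qR : 0 < q%:R :> R by rewrite ltr0n; exact: leq_ltn_trans (ltn_ord a).
        by rewrite ler_pdivrMr // mul1r normc_csum_le.
      by rewrite sumr_const card_ord ler_nat ltnW.
    by rewrite sumr_const card_ord -[leLHS]mulr_natr -natrM ler_nat.
  have le2 : ((2 ^ n.+1).+1 <= (2 ^ n.+2).+1)%N by rewrite ltnS leq_exp2l.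
  rewrite -(big_mkord xpredT g) (big_cat_nat (n := (2 ^ n.+1).+1)) //= big_mkord.
  rewrite [in leRHS]big_ord_recr /= mulrDr addrA; apply: lerD => //.
  have := H (2 ^ n.+1)%N; rewrite -[X in (X < _)%N](expn0 2) ltn_exp2l // -expnS => /(_ isT) h.
  have -> : \sum_((2 ^ n.+1).+1 <= i < (2 ^ n.+2).+1) g i = \sum_(q < (2 ^ n.+2).+1 | (2 ^ n.+1 < q)%N) g q.
    by rewrite -(big_mkord (fun q => (2 ^ n.+1 < q)%N) g) [RHS](big_cat_nat (n := (2 ^ n.+1).+1)) //=
      [X in _ = X + _]big_nat_cond [X in _ = X + _]big_pred0 ?add0r 1?[RHS]big_nat_cond 1?[LHS]big_nat_cond
      => [|i]; [apply: eq_bigl => i; case: (ltnP (2 ^ n.+1) i) => ?; rewrite ?andbT // | case: (ltnP (2 ^ n.+1) i) => ?; rewrite ?andbF // andbT; apply/negP; lia].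
  apply: le_trans h _; apply: ler_wpM2l => //.
  rewrite natrX -powR_mulrn // -powRrM /x -powR_mulrn ?powR_ge0 // -powRrM.
  by apply: ler_powR; rewrite ?ler1n // -natr1; have := ler0n R n; nra.
apply: le_trans (_ : _ <= \sum_(q < (2 ^ Z.+1).+1) g q) _.
  have le2 : (Z <= (2 ^ Z.+1).+1)%N by apply: ltnW; apply: ltnW; exact: ltnW (ltn_expl Z.+1 (isT : 1 < 2)%N).
  by rewrite -!(big_mkord xpredT g) [leRHS](big_cat_nat (n := Z)) //= lerDl sumr_ge0.
apply: le_trans (dy Z) _; rewrite lerD2l; apply: ler_wpM2l => //; exact: sum_geometric_le.
Qed.

End SingularSeries.

(** * Sums of powers *)

Section PowerSums.
Variables (R : realType) (k : nat).
Local Notation C := R[i].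
Local Notation nm := (@Normc.normc R).
Hypothesis k_gt0 : (0 < k)%N.

(** A list with multiplicities, so that the occurrences of N in it are the solutions of the
    equation. *)
Definition power_sums (Ps : seq nat) : seq nat :=
  foldr (fun P vs => [seq (x ^ k + v)%N | x <- iota 1 P, v <- vs]) [:: 0%N] Ps.

Lemma big_power_sums_cons (V : nmodType) P Ps (F : nat -> V) :
  \sum_(v <- power_sums (P :: Ps)) F v = \sum_(1 <= x < P.+1) \sum_(v <- power_sums Ps) F (x ^ k + v)%N.
Proof. by rewrite /= big_allpairs_dep /index_iota subn1. Qed.

Lemma prod_weyl Ps (t : R) :
  \prod_(P <- Ps) weyl k P t = \sum_(v <- power_sums Ps) expi (t * v%:R).
Proof.
elim: Ps => [|P Ps IH]; first by rewrite big_nil big_seq1 mulr0 expi0.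
rewrite big_cons IH big_power_sums_cons /weyl big_distrlr /=; apply: eq_bigr => x _; apply: eq_bigr => v _.
by rewrite natrD mulrDr expiD.
Qed.

Lemma sum_power_sums_const Ps (c : R) : \sum_(v <- power_sums Ps) c = (\prod_(P <- Ps) P%:R) * c.
Proof.
elim: Ps => [|P Ps IH]; first by rewrite big_nil big_seq1 mul1r.
by rewrite big_power_sums_cons big_cons (eq_bigr _ (fun _ _ => IH)) sumr_const_nat subn1 /= -[LHS]mulr_natl mulrA.
Qed.

Lemma power_sums_le X Ps v : {in Ps, forall P, (P <= X)%N} -> v \in power_sums Ps -> (v <= size Ps * X ^ k)%N.
Proof.
elim: Ps v => [|P Ps IH] v H /=; first by rewrite inE => /eqP ->.
move=> /allpairsP[[x w] /= [xP wPs ->]]; rewrite mulSn; apply: leq_add.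
  rewrite leq_exp2r //; move: xP; rewrite mem_iota add1n ltnS => /andP[_ xP].
  by apply: leq_trans xP (H P _); rewrite inE eqxx.
by apply: IH => // P' P'Ps; apply: H; rewrite inE P'Ps orbT.
Qed.

(* If the sum of the powers exceeds [n T], one of its [n] terms exceeds [T]. *)
Lemma power_sums_tail Ps (Phi : nat -> R) (B T : R) : (forall v, 0 <= Phi v) -> 0 <= B ->
  (forall w, {in Ps, forall P : nat, \sum_(1 <= x < P.+1 | T < (x ^ k)%:R) Phi (x ^ k + w)%N <= B * P%:R}) ->
  \sum_(v <- power_sums Ps | (size Ps)%:R * T < v%:R) Phi v <= (size Ps)%:R * B * \prod_(P <- Ps) P%:R.
Proof.
elim: Ps Phi => [|P Ps IH] Phi Phi0 B0 H.
  by rewrite /= big_cons /= mul0r ltxx big_nil !mul0r.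
rewrite big_mkcond big_power_sums_cons big_cons /=.
pose U := \prod_(P' <- Ps) P'%:R : R.
have U0 : 0 <= U by apply: prodr_ge0 => P' _; exact: ler0n.
apply: (@le_trans _ _ (\sum_(1 <= x < P.+1) \sum_(v <- power_sums Ps)
    ((if T < (x ^ k)%:R then Phi (x ^ k + v)%N else 0) + (if (size Ps)%:R * T < v%:R then Phi (x ^ k + v)%N else 0)))).
  apply: ler_sum => x _; apply: ler_sum => v _.
  case: ifP => [h|_]; last by rewrite addr_ge0 //; case: ifP.
  have [h1|h1] := ltP T (x ^ k)%:R; first by rewrite lerDl; case: ifP.
  have [h2|h2] := ltP ((size Ps)%:R * T) v%:R; first by rewrite add0r.
  by move: h; rewrite natrD -natr1; lra.
have -> : \sum_(1 <= x < P.+1) \sum_(v <- power_sums Ps)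
    ((if T < (x ^ k)%:R then Phi (x ^ k + v)%N else 0) + (if (size Ps)%:R * T < v%:R then Phi (x ^ k + v)%N else 0)) =
  \sum_(1 <= x < P.+1) \sum_(v <- power_sums Ps) (if T < (x ^ k)%:R then Phi (x ^ k + v)%N else 0) +
  \sum_(1 <= x < P.+1) \sum_(v <- power_sums Ps) (if (size Ps)%:R * T < v%:R then Phi (x ^ k + v)%N else 0).
  by rewrite -big_split; apply: eq_bigr => x _; rewrite -big_split.
rewrite -/U.
have h1 : \sum_(1 <= x < P.+1) \sum_(v <- power_sums Ps) (if T < (x ^ k)%:R then Phi (x ^ k + v)%N else 0) <= U * (B * P%:R).
  rewrite exchange_big -sum_power_sums_const; apply: ler_sum => v _.
  by rewrite -big_mkcond; apply: H; rewrite inE eqxx.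
have h2 : \sum_(1 <= x < P.+1) \sum_(v <- power_sums Ps) (if (size Ps)%:R * T < v%:R then Phi (x ^ k + v)%N else 0) <= P%:R * ((size Ps)%:R * B * U).
  apply: (@le_trans _ _ (\sum_(1 <= x < P.+1) (size Ps)%:R * B * U)); last by rewrite sumr_const_nat subn1 /= -[leLHS]mulr_natl.
  apply: ler_sum => x _; rewrite -big_mkcond; apply: (IH (fun v => Phi (x ^ k + v)%N)) => // w P' P'Ps.
  have := H (x ^ k + w)%N P'; rewrite inE P'Ps orbT => /(_ isT).
  by under eq_bigr => y _ do rewrite addnCA.
by apply: le_trans (lerD h1 h2) _; rewrite -natr1 le_eqVlt; apply/orP; left; apply/eqP; ring.
Qed.

(** Telescoping: one factor is replaced at a time, the others being bounded by P. *)
Lemma prod_diff_le Ps (a b : nat -> C) (eta : R) :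
  {in Ps, forall P : nat, [/\ nm (a P) <= P%:R, nm (b P) <= P%:R & nm (a P - b P) <= eta * P%:R]} ->
  nm (\prod_(P <- Ps) a P - \prod_(P <- Ps) b P) <= (size Ps)%:R * eta * \prod_(P <- Ps) P%:R.
Proof.
elim: Ps => [|P Ps IH] H; first by rewrite !big_nil subrr Normc.normc0 !mul0r.
have HP : {in Ps, forall P : nat, [/\ nm (a P) <= P%:R, nm (b P) <= P%:R & nm (a P - b P) <= eta * P%:R]}.
  by move=> P' P'Ps; apply: H; rewrite inE P'Ps orbT.
have [aP bP abP] := H P (mem_head _ _); have {}IH := IH HP.
rewrite !big_cons; set A := \prod_(P' <- Ps) a P' in IH *; set B := \prod_(P' <- Ps) b P' in IH *.
set U := \prod_(P' <- Ps) P'%:R in IH *.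
have AU : nm A <= U.
  rewrite /A /U; elim: (Ps) HP => [|P' Ps' IH'] HP; first by rewrite !big_nil Normc.normc1.
  rewrite !big_cons Normc.normcM; apply: ler_pM; rewrite ?normc_ge0 //.
    by have [] := HP P' (mem_head _ _).
  by apply: IH' => P'' P''Ps; apply: HP; rewrite inE P''Ps orbT.
have -> : a P * A - b P * B = (a P - b P) * A + b P * (A - B) by ring.
apply: le_trans (le_normcD _ _) _; rewrite !Normc.normcM.
apply: (@le_trans _ _ (eta * P%:R * U + P%:R * ((size Ps)%:R * eta * U))).
  by apply: lerD; apply: ler_pM; rewrite ?normc_ge0.
by rewrite /= -natr1 le_eqVlt; apply/orP; left; apply/eqP; ring.
Qed.

Lemma normc_geosum_abs W (t : R) : `|t| <= 2^-1 -> nm (geosum W t) * `|t| <= 1.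
Proof.
move=> h; have [t0|t0] := leP 0 t; first by rewrite ger0_norm //; apply: normc_geosum_mul => //; rewrite ger0_norm // in h.
by rewrite ltr0_norm // -normc_geosumN; rewrite ltr0_norm // in h; apply: normc_geosum_mul => //; lra.
Qed.

Lemma pow_gap L x i : (L <= x)%N -> (x ^ k + i * L ^ (k - 1) <= (x + i) ^ k)%N.
Proof.
move=> Lx; case: k k_gt0 => // k' _; rewrite subn1 /= !expnS mulnDl; apply: leq_add.
  by rewrite leq_mul2l; apply/orP; right; case: k' => // k'; rewrite leq_exp2r // leq_addr.
rewrite leq_mul2l; apply/orP; right; case: k' => // k'.
by rewrite leq_exp2r // (leq_trans Lx) // leq_addr.
Qed.

(** * Fejér weights and sums of powers near N *)

Section Density.
Variables (N W X Q : nat) (Ps : seq nat).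
Hypothesis Q_gt0 : (0 < Q)%N.
Hypothesis W_gt0 : (0 < W)%N.
Hypothesis X_gt0 : (0 < X)%N.
Hypothesis PsX : {in Ps, forall P, (P <= X)%N}.
Hypothesis XN : (X ^ k <= N)%N.
Hypothesis NX : (N <= size Ps * X ^ k)%N.
Hypothesis XQ : (2 * (size Ps * X ^ k) <= Q)%N.
Hypothesis WX : (W * X ^ (k - 1) <= Q)%N.

Let QR : 0 < Q%:R :> R. Proof. by rewrite ltr0n. Qed.
Let WR : 0 < W%:R :> R. Proof. by rewrite ltr0n. Qed.
Let G (v : nat) : R := nm (geosum W ((v%:R - N%:R) / Q%:R : R)).
(** The cut-off at Q/2 ensures |v - N| <= Q/2, where the geometric sum is controlled by |v - N| / Q;
    it removes no element of [power_sums]. *)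
Let Phi v : R := if (2 * v <= Q)%N then G v ^+ 2 else 0.

Let G_ge0 v : 0 <= G v. Proof. exact: normc_ge0. Qed.

Let Phi_ge0 v : 0 <= Phi v. Proof. by rewrite /Phi; case: ifP => // _; exact: exprn_ge0. Qed.

Let G_mul v : (2 * v <= Q)%N -> G v * `|v%:R - N%:R| <= Q%:R.
Proof.
move=> vQ; have e : `|v%:R - N%:R| = `|(v%:R - N%:R) / Q%:R| * Q%:R :> R.
  by rewrite normrM [`|_^-1|]ger0_norm ?invr_ge0 // divfK // gt_eqF.
rewrite e mulrA -[leRHS]mul1r; apply: ler_wpM2r => //; apply: normc_geosum_abs.
rewrite normrM [`|_^-1|]ger0_norm ?invr_ge0 // ler_pdivrMr //.
have v2 : 2 * v%:R <= Q%:R :> R by rewrite -natrM ler_nat.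
have N2 : 2 * N%:R <= Q%:R :> R by rewrite -natrM ler_nat; apply: leq_trans XQ; rewrite leq_mul2l NX orbT.
have v0 : 0 <= v%:R :> R by []. have N0 : 0 <= N%:R :> R by [].
rewrite ler_norml; lra.
Qed.

(** The bound min(W, W h / i)^2 is at most a multiple of W^2 h^2 / ((i+h)(i+1+h)), a difference of
    consecutive terms, so that sums over i telescope. *)
Lemma fejer_weight_le (g i h : R) : 0 <= g -> g <= W%:R -> 0 <= i -> 1 <= h -> g * i <= W%:R * h ->
  g ^+ 2 <= 6 * W%:R ^+ 2 * h ^+ 2 * ((i + h)^-1 - (i + 1 + h)^-1).
Proof.
move=> g0 gW i0 h1 gi.
have ih : 0 < i + h by lra. have ih1 : 0 < i + 1 + h by lra.
have -> : 6 * W%:R ^+ 2 * h ^+ 2 * ((i + h)^-1 - (i + 1 + h)^-1) = (2 * (W%:R * h)) * (3 * (W%:R * h)) / ((i + h) * (i + 1 + h)).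
  by field; rewrite !gt_eqF.
rewrite ler_pdivlMr ?mulr_gt0 //.
have -> : g ^+ 2 * ((i + h) * (i + 1 + h)) = (g * i + g * h) * (g * i + g + g * h) by ring.
have gh : g * h <= W%:R * h by apply: ler_wpM2r => //; lra.
have gg : g <= W%:R * h by apply: le_trans gW _; rewrite ler_peMr.
by apply: ler_pM; rewrite ?addr_ge0 ?mulr_ge0 //; lra.
Qed.

Lemma fejer_weight_sum (h : R) n : 0 < h -> \sum_(i < n) ((i%:R + h)^-1 - (i%:R + 1 + h)^-1) <= h^-1.
Proof.
move=> h0; suff -> : \sum_(i < n) ((i%:R + h)^-1 - (i%:R + 1 + h)^-1) = h^-1 - (n%:R + h)^-1.
  by rewrite gerBl invr_ge0 addr_ge0 // ltW.
elim: n => [|n IH]; first by rewrite big_ord0 add0r subrr.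
by rewrite big_ord_recr /= IH natr1; ring.
Qed.

(** For x >= L the values x^k + w are at least g = L^(k-1) apart. Counted from the first one that
    reaches N, the i-th value on either side is at distance at least i g from N, and each side sums
    to at most 6 W Q / g. *)
Lemma line_density (L w P : nat) : (0 < L)%N -> (L <= X)%N ->
  \sum_(L <= x < P.+1) Phi (x ^ k + w)%N <= 12 * W%:R * Q%:R / L%:R ^+ (k - 1).
Proof.
move=> L0 LX; set g := L%:R ^+ (k - 1) : R.
have g0 : 0 < g by rewrite exprn_gt0 // ltr0n.
(* The width Q / W of the kernel in units of the spacing g; [WX] makes it at least 1. *)
pose h := Q%:R / (W%:R * g).
have Wh : W%:R * h = Q%:R / g by rewrite /h; field; rewrite !gt_eqF.
have h1 : 1 <= h.
  rewrite ler_pdivlMr ?mulr_gt0 // mul1r /g -natrX -natrM ler_nat; apply: leq_trans WX.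
  by rewrite leq_mul2l; case: (k - 1)%N => [|m]; rewrite ?expn0 ?leqnn ?orbT // leq_exp2r // LX orbT.
have h0 : 0 <= h by exact: le_trans h1.
pose phi (i : nat) := 6 * W%:R ^+ 2 * h ^+ 2 * ((i%:R + h)^-1 - (i%:R + 1 + h)^-1).
have phi0 i : 0 <= phi i.
  have i0 : 0 <= i%:R :> R by [].
  rewrite /phi; apply: mulr_ge0; first by rewrite mulr_ge0 ?exprn_ge0 // mulr_ge0 ?exprn_ge0.
  by rewrite subr_ge0 lef_pV2 ?posrE; lra.
have point v i : i%:R * g <= `|v%:R - N%:R| -> Phi v <= phi i.
  move=> hi; rewrite /Phi; case: ifP => vQ //.
  apply: fejer_weight_le => //; first exact: normc_geosum_le.
  rewrite Wh ler_pdivlMr // -mulrA; apply: le_trans (G_mul vQ).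
  by apply: ler_wpM2l.
have sumphi n : \sum_(i < n) phi i <= 6 * W%:R * Q%:R / g.
  rewrite -mulr_sumr; apply: (@le_trans _ _ (6 * W%:R ^+ 2 * h ^+ 2 * h^-1)).
    by apply: ler_wpM2l; [rewrite mulr_ge0 ?exprn_ge0 // mulr_ge0 ?exprn_ge0 // | apply: fejer_weight_sum; lra].
  rewrite [leLHS](_ : _ = 6 * W%:R * (W%:R * h)); last by field; rewrite gt_eqF //; lra.
  by rewrite Wh mulrA.
have ex : exists x, (N <= x ^ k + w)%N.
  exists N; apply: leq_trans (leq_addr _ _); case: (posnP N) => [->//|N0].
  by rewrite -{1}(expn1 N) leq_pexp2l.
case: (ex_minnP ex) => x0 x0N x0min.
have right : \sum_(maxn L x0 <= x < P.+1) Phi (x ^ k + w)%N <= 6 * W%:R * Q%:R / g.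
  set x2 := maxn L x0; rewrite -{1}[x2]add0n big_addn big_mkord.
  apply: le_trans (sumphi (P.+1 - x2)%N); apply: ler_sum => i _; apply: point.
  have Lx2 : (L <= x2)%N by rewrite leq_maxl.
  have h2 := @pow_gap L x2 i Lx2.
  have h3 : (x0 ^ k <= x2 ^ k)%N by rewrite leq_exp2r // leq_maxr.
  have h4 : (N + i * L ^ (k - 1) <= (i + x2) ^ k + w)%N by rewrite [(i + x2)%N]addnC; clear -h2 h3 x0N; lia.
  rewrite ger0_norm ?subr_ge0 ?ler_nat; last by apply: leq_trans h4; rewrite leq_addr.
  by rewrite lerBrDl /g -natrX -natrM -natrD ler_nat.
have left : \sum_(L <= x < x0) Phi (x ^ k + w)%N <= 6 * W%:R * Q%:R / g.
  rewrite big_nat_rev /= -{1}[L]add0n big_addn big_mkord.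
  apply: le_trans (sumphi (x0 - L)%N); apply: ler_sum => i _; apply: point.
  have ix : (i < x0 - L)%N := ltn_ord i.
  set x := (L + x0 - (i + L).+1)%N.
  have Lx : (L <= x)%N by rewrite /x; clear -ix; lia.
  have xx : (x + i = x0.-1)%N by rewrite /x; clear -ix; lia.
  have h2 := @pow_gap L x i Lx; rewrite xx in h2.
  have h3 : (x0.-1 ^ k + w < N)%N.
    by rewrite ltnNge; apply/negP => /x0min; clear -ix; lia.
  have h4 : (x ^ k + w + i * L ^ (k - 1) <= N)%N by clear -h2 h3; lia.
  rewrite ler0_norm ?subr_le0 ?ler_nat; last by apply: leq_trans h4; rewrite leq_addr.
  by rewrite opprB lerBrDl /g -natrX -natrM -natrD ler_nat.
have -> : 12 * W%:R * Q%:R / g = 6 * W%:R * Q%:R / g + 6 * W%:R * Q%:R / g by field; rewrite gt_eqF.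
apply: le_trans (lerD left right).
have [h2|h2] := leqP x0 L.
  by rewrite [X in _ <= X + _]big_geq // add0r.
have [h3|h3] := leqP P.+1 x0.
  rewrite [X in _ <= _ + X]big_geq // addr0; have [h4|h4] := leqP L P.+1.
    by rewrite [leRHS](big_cat_nat (n := P.+1)) //= lerDl sumr_ge0.
  by rewrite [leLHS]big_geq ?sumr_ge0 // ltnW.
by rewrite (big_cat_nat (n := x0)) //= ltnW.
Qed.

(** A value above N/2 has a term above T = N/(2s), hence a variable that is at least L, where L^k >
    T; along this variable [line_density] applies, and P >= L turns 1/L^(k-1) into P / L^k. A value
    up to N/2 is far from N, and there one kernel factor is at most 2Q/N, the other at most W. *)
Lemma fejer_density :
  \sum_(v <- power_sums Ps) G v ^+ 2 <=
  (24 * (size Ps)%:R ^+ 2 + 2) * (W%:R * Q%:R * (\prod_(P <- Ps) P%:R) / N%:R).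
Proof.
have N0 : (0 < N)%N by apply: leq_trans XN; rewrite expn_gt0 X_gt0.
have s0 : (0 < size Ps)%N by apply: contraTT NX; rewrite -leqNgt leqn0 => /eqP ->; rewrite mul0n -ltnNge.
have NR : 0 < N%:R :> R by rewrite ltr0n.
have sR : 0 < (size Ps)%:R :> R by rewrite ltr0n.
have rng v : v \in power_sums Ps -> (2 * v <= Q)%N.
  by move=> /(power_sums_le PsX) h; apply: leq_trans XQ; rewrite leq_mul2l h orbT.
pose T := N%:R / (2 * (size Ps)%:R) : R.
have T0 : 0 <= T by rewrite divr_ge0 // mulr_ge0.
have exT : exists x, T < (x ^ k)%:R.
  exists X; rewrite ltr_pdivrMr ?mulr_gt0 // mulrA [_ * 2]mulrC -mulrA -!natrM ltr_nat.
  apply: leq_ltn_trans NX _; rewrite [(X ^ k * _)%N]mulnC -[ltnLHS]mul1n ltn_pmul2r // muln_gt0 s0 expn_gt0 X_gt0 //.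
case: (ex_minnP exT) => L TL Lmin.
have L0 : (0 < L)%N by rewrite lt0n; apply: contraTneq TL => ->; rewrite exp0n // -leNgt.
have LX : (L <= X)%N.
  apply: Lmin; rewrite ltr_pdivrMr ?mulr_gt0 // mulrA [_ * 2]mulrC -mulrA -!natrM ltr_nat.
  apply: leq_ltn_trans NX _; rewrite [(X ^ k * _)%N]mulnC -[ltnLHS]mul1n ltn_pmul2r // muln_gt0 s0 expn_gt0 X_gt0 //.
have LR : 0 < L%:R :> R by rewrite ltr0n.
pose U := \prod_(P <- Ps) P%:R : R.
have U0 : 0 <= U by apply: prodr_ge0 => P' _; exact: ler0n.
pose B := 12 * W%:R * Q%:R / L%:R ^+ k : R.
have B0 : 0 <= B by rewrite divr_ge0 ?exprn_ge0 // !mulr_ge0.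
have Lk : L%:R ^+ k = L%:R ^+ (k - 1) * L%:R :> R by rewrite -exprSr subn1 prednK.
rewrite (bigID (fun v : nat => (size Ps)%:R * T < v%:R)) /= mulrDl; apply: lerD.
  apply: (@le_trans _ _ (\sum_(v <- power_sums Ps | (size Ps)%:R * T < v%:R) Phi v)).
    rewrite big_seq_cond [leRHS]big_seq_cond; apply: ler_sum => v /andP[vP _].
    by rewrite /Phi rng.
  apply: le_trans (power_sums_tail Phi_ge0 B0 _) _ => [w P PPs|].
    have [LP|PL] := leqP L P; last first.
      rewrite big_nat_cond big_pred0 => [|x]; first exact: mulr_ge0.
      by apply/negP => /andP[/andP[x1 xP] /Lmin]; clear -xP PL; lia.
    apply: (@le_trans _ _ (\sum_(L <= x < P.+1) Phi (x ^ k + w)%N)).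
      rewrite (big_cat_nat (n := L)) //=; last exact: leqW.
      rewrite [X in X + _ <= _]big_nat_cond big_pred0 => [|x]; last first.
        by apply/negP => /andP[/andP[x1 xP] /Lmin]; clear -xP; lia.
      by rewrite add0r big_mkcond; apply: ler_sum => x _; case: ifP.
    apply: le_trans (line_density w P L0 LX) _.
    have -> : 12 * W%:R * Q%:R / L%:R ^+ (k - 1) = B * L%:R.
      by rewrite /B Lk; move: (L%:R ^+ (k - 1)) (exprn_gt0 (k - 1) LR) => g g0; field; rewrite !gt_eqF.
    by apply: ler_wpM2l => //; rewrite ler_nat.
  rewrite -/U -[leRHS]mulrA; set z := W%:R * Q%:R * U / N%:R.
  have -> : (size Ps)%:R * B * U = 12 * (size Ps)%:R * (N%:R / L%:R ^+ k) * z.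
    by rewrite /B /z; move: (L%:R ^+ k) (exprn_gt0 k LR) => g g0; field; rewrite !gt_eqF.
  have -> : 24 * ((size Ps)%:R ^+ 2 * z) = 12 * (size Ps)%:R * (2 * (size Ps)%:R) * z by ring.
  apply: ler_wpM2r; first by rewrite divr_ge0 // !mulr_ge0.
  apply: ler_wpM2l; first by rewrite mulr_ge0.
  rewrite ler_pdivrMr ?exprn_gt0 // -natrX mulrC -ler_pdivrMr ?mulr_gt0 //; exact: ltW.
apply: (@le_trans _ _ (\sum_(v <- power_sums Ps) (W%:R * (2 * Q%:R / N%:R)))); last first.
  by rewrite sum_power_sums_const -/U le_eqVlt; apply/orP; left; apply/eqP; ring.
rewrite big_mkcond big_seq [leRHS]big_seq; apply: ler_sum => v vP.
case: ifP => [|_]; last by rewrite !mulr_ge0 ?invr_ge0.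
rewrite -leNgt => vT; rewrite expr2; apply: ler_pM; rewrite ?normc_geosum_le ?normc_ge0 //.
have vN : 2 * v%:R <= N%:R :> R.
  have : (size Ps)%:R * T = N%:R / 2%:R by rewrite /T; field; rewrite gt_eqF.
  by move: vT => /[swap] ->; lra.
rewrite ler_pdivlMr // -/(G v); have := G_mul (rng _ vP).
have -> : `|v%:R - N%:R| = N%:R - v%:R :> R by rewrite distrC ger0_norm // subr_ge0; have : 0 <= v%:R :> R by []; lra.
have : G v * N%:R <= G v * (2 * (N%:R - v%:R)) by apply: ler_wpM2l => //; lra.
lra.
Qed.

End Density.

(** * The main term on a single major arc *)

Section Arc.
Variables (N W Q q a n : nat) (Ps : seq nat) (eta : R).
Hypothesis Q_gt0 : (0 < Q)%N.
Hypothesis q_gt0 : (0 < q)%N.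

Definition generating (t : R) : C := \prod_(P <- Ps) weyl k P t * expi (- (N%:R * t)).

Lemma generating_sum t : generating t = \sum_(v <- power_sums Ps) expi (t * (v%:R - N%:R)).
Proof.
rewrite /generating prod_weyl mulr_suml; apply: eq_bigr => v _.
by rewrite -expiD mulrBr [N%:R * t]mulrC.
Qed.

Lemma normc_generating_le t : nm (generating t) <= \prod_(P <- Ps) P%:R.
Proof.
rewrite generating_sum; apply: le_trans (le_normc_sum _ _ _) _.
apply: (@le_trans _ _ (\sum_(v <- power_sums Ps) (1 : R))); last by rewrite sum_power_sums_const mulr1.
by apply: ler_sum => v _; rewrite normc_expi.
Qed.

Lemma generating_int t (z : int) : generating (t + z%:~R) = generating t.
Proof.
rewrite /generating; congr (_ * _); first by apply: eq_bigr => P _; exact: weyl_period.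
rewrite mulrDr opprD; have -> : - (N%:R * z%:~R) = (- (N%:Z * z))%:~R :> R by rewrite intrN intrM.
exact: expiD_int.
Qed.

Let shift (i j : nat) : R := (n%:R + i%:R - j%:R) / Q%:R.

Hypothesis n_close : `|n%:R / Q%:R - a%:R / q%:R| <= Q%:R^-1 :> R.
Hypothesis eta_large : {in Ps, forall P : nat, 2 * q%:R * (1 + 8 * (W%:R / Q%:R) * P%:R ^+ k) <= eta * P%:R}.

(** Each Weyl sum is replaced by csum / q times the Weyl sum at the distance [b i j] from a/q. In
    the main term the sums over i and j become, for each value v, two geometric sums of equal
    modulus, whose product is the Fejér kernel. *)
Lemma arc_bound :
  nm (\sum_(i < W) \sum_(j < W) generating (shift i j)) <=
  (nm (csum R k q a) / q%:R) ^+ size Ps * (\sum_(v <- power_sums Ps) nm (geosum W ((v%:R - N%:R) / Q%:R : R)) ^+ 2) +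
  W%:R ^+ 2 * ((size Ps)%:R * eta * \prod_(P <- Ps) P%:R).
Proof.
have QR : 0 < Q%:R :> R by rewrite ltr0n.
have qR : 0 < q%:R :> R by rewrite ltr0n.
have qC : (q%:R : C) != 0 by rewrite pnatr_eq0 -lt0n.
set U := \prod_(P <- Ps) P%:R.
set u : C := csum R k q a / q%:R.
have uE : nm u = nm (csum R k q a) / q%:R.
  have e : nm u * q%:R = nm (csum R k q a) by rewrite -[X in _ * X](@normc_nat R) -Normc.normcM divfK.
  by rewrite -e mulfK // gt_eqF.
have u1 : nm u <= 1 by rewrite uE ler_pdivrMr // mul1r normc_csum_le.
pose b i j := shift i j - a%:R / q%:R.
pose main i j := u ^+ size Ps * \prod_(P <- Ps) weyl k P (b i j) * expi (- (N%:R * shift i j)).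
have close i j : (i < W)%N -> (j < W)%N -> nm (generating (shift i j) - main i j) <= (size Ps)%:R * eta * U.
  move=> iW jW; have -> : generating (shift i j) - main i j =
      (\prod_(P <- Ps) weyl k P (shift i j) - \prod_(P <- Ps) (u * weyl k P (b i j))) * expi (- (N%:R * shift i j)).
    by rewrite /main /generating mulrBl big_split /= big_const_seq count_predT -Monoid.iteropE.
  rewrite Normc.normcM normc_expi mulr1; apply: prod_diff_le => P PPs; split.
  - exact: normc_weyl_le.
  - rewrite Normc.normcM -[leRHS]mul1r; apply: ler_pM; rewrite ?normc_ge0 // normc_weyl_le //.
  apply: le_trans (eta_large PPs).
  have -> : shift i j = a%:R / q%:R + b i j by rewrite /b addrC subrK.
  apply: le_trans (weyl_major k_gt0 a P (b i j) q_gt0) _.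
  apply: ler_wpM2l; first by rewrite mulr_ge0.
  rewrite lerD2l; apply: ler_wpM2r; first exact: exprn_ge0.
  apply: ler_wpM2l => //.
  have -> : b i j = (n%:R / Q%:R - a%:R / q%:R) + (i%:R - j%:R) / Q%:R by rewrite /b /shift; field; rewrite !gt_eqF.
  apply: le_trans (ler_normD _ _) _; apply: le_trans (lerD n_close (lexx _)) _.
  rewrite normrM [`|Q%:R^-1|]ger0_norm ?invr_ge0 // -[X in X + _]mul1r -mulrDl; apply: ler_wpM2r; first by rewrite invr_ge0.
  have i1 : i%:R + 1 <= W%:R :> R by rewrite natr1 ler_nat.
  have j1 : j%:R + 1 <= W%:R :> R by rewrite natr1 ler_nat.
  have i0 : 0 <= i%:R :> R by []. have j0 : 0 <= j%:R :> R by [].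
  have : `|i%:R - j%:R| <= W%:R - 1 :> R by rewrite ler_norml; lra.
  lra.
have mainE : nm (\sum_(i < W) \sum_(j < W) main i j) <=
    (nm u) ^+ size Ps * (\sum_(v <- power_sums Ps) nm (geosum W ((v%:R - N%:R) / Q%:R : R)) ^+ 2).
  have -> : \sum_(i < W) \sum_(j < W) main i j = u ^+ size Ps * expi (- (N%:R * (a%:R / q%:R))) *
      \sum_(v <- power_sums Ps) expi ((n%:R / Q%:R - a%:R / q%:R) * (v%:R - N%:R)) *
        (geosum W ((v%:R - N%:R) / Q%:R) * (geosum W (- ((v%:R - N%:R) / Q%:R)))).
    rewrite mulr_sumr.
    under [RHS]eq_bigr => v _ do rewrite [geosum W _ * _]big_distrlr /= mulrA mulr_sumr.
    rewrite [RHS]exchange_big; apply: eq_bigr => i _ /=.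
    under [RHS]eq_bigr => v _ do rewrite mulr_sumr.
    rewrite [RHS]exchange_big; apply: eq_bigr => j _ /=.
    rewrite /main prod_weyl -mulrA mulr_suml mulr_sumr; apply: eq_bigr => v _.
    rewrite -!mulrA; congr (_ * _); rewrite -!expiD; congr expi.
    by rewrite /b /shift; field; rewrite !gt_eqF.
  rewrite (Normc.normcM (u ^+ _ * _)) (Normc.normcM (u ^+ _)) normc_expi mulr1 normcX; apply: ler_wpM2l; first by rewrite exprn_ge0 // normc_ge0.
  apply: le_trans (le_normc_sum _ _ _) _; apply: ler_sum => v _.
  by rewrite !Normc.normcM normc_expi mul1r normc_geosumN.
have -> : \sum_(i < W) \sum_(j < W) generating (shift i j) =
  \sum_(i < W) \sum_(j < W) main i j + \sum_(i < W) \sum_(j < W) (generating (shift i j) - main i j).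
  by rewrite -big_split; apply: eq_bigr => i _; rewrite -big_split; apply: eq_bigr => j _ /=; rewrite addrC subrK.
apply: le_trans (le_normcD _ _) _; rewrite -uE; apply: lerD => //.
apply: le_trans (le_normc_sum _ _ _) _.
apply: (@le_trans _ _ (\sum_(i < W) \sum_(j < W) (size Ps)%:R * eta * U)).
  apply: ler_sum => i _; apply: le_trans (le_normc_sum _ _ _) _; apply: ler_sum => j _; exact: close.
by rewrite !sumr_const !card_ord -mulrnA -[leLHS]mulr_natl natrM expr2.
Qed.

End Arc.
End PowerSums.

(** * The major arcs *)

Lemma reduce_fraction (R : realType) q0 (a0 : int) : (0 < q0)%N -> exists q a (z : int),
  [/\ (0 < q <= q0)%N, (a < q)%N, coprime q a & a0%:~R / q0%:R = a%:R / q%:R + z%:~R :> R].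
Proof.
move=> q00; pose b := `|(a0 %% q0%:Z)%Z|%N.
have q0z : q0%:Z != 0 by move: q00; rewrite lt0n.
have bE : b%:Z = (a0 %% q0%:Z)%Z by rewrite gez0_abs // modz_ge0.
have bq : (b < q0)%N by rewrite -ltz_nat bE ltz_pmod.
pose g := gcdn q0 b; have g0 : (0 < g)%N by rewrite gcdn_gt0 q00.
have [q qE] : exists q, q0 = (q * g)%N by apply/dvdnP/dvdn_gcdl.
have [a aE] : exists a, b = (a * g)%N by apply/dvdnP/dvdn_gcdr.
have q_gt0 : (0 < q)%N by move: q00; rewrite qE muln_gt0 => /andP[].
exists q, a, (a0 %/ q0%:Z)%Z; split.
- by rewrite q_gt0 qE leq_pmulr.
- by move: bq; rewrite {1}qE aE ltn_pmul2r.
- by have : (gcdn q a * g == 1 * g)%N by [rewrite muln_gcdl -qE -aE mul1n]; rewrite eqn_pmul2r.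
have qR : q%:R != 0 :> R by rewrite pnatr_eq0 -lt0n.
have gR : g%:R != 0 :> R by rewrite pnatr_eq0 -lt0n.
rewrite {1}(divz_eq a0 q0%:Z) -bE intrD intrM -!pmulrn aE qE !natrM; field.
by rewrite qR gR.
Qed.

Lemma modn_int m c Q (z : int) : (c < Q)%N -> m%:Z = c%:Z + z * Q%:Z -> (m %% Q = c)%N.
Proof.
move=> cQ h; have z0 : 0 <= z by move: h cQ; clear; nia.
case: z z0 h => // n _ h; have -> : m = (n * Q + c)%N by move: h; clear; nia.
by rewrite modnMDl modn_small.
Qed.

Lemma small_mul_eq0 x y Q (z : int) : (x < Q)%N -> (y < Q)%N -> y%:Z - x%:Z = z * Q%:Z -> x = y.
Proof. by move=> xQ yQ h; have z0 : z = 0 by [clear -xQ yQ h; nia]; move: h; rewrite z0; lia. Qed.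

Section MajorContribution.
Variables (R : realType) (k s M p N X : nat) (Ps : seq nat) (c0 : R).
Local Notation C := R[i].
Local Notation nm := (@Normc.normc R).
Hypothesis k_gt1 : (1 < k)%N.
Let k_gt0 : (0 < k)%N := ltnW k_gt1.
Let Q := (p ^ M)%N.
Hypothesis s_gt0 : (0 < s)%N.
Hypothesis sizePs : size Ps = s.
Hypothesis X_gt1 : (1 < X)%N.
Let X_gt0 : (0 < X)%N := ltnW X_gt1.
Hypothesis PsX : {in Ps, forall P, (P <= X)%N}.
Hypothesis Ps_balanced : {in Ps, forall P, (X <= P * P)%N}.
Hypothesis XN : (X ^ k <= N)%N.
Hypothesis NX : (N <= s * X ^ k)%N.
Hypothesis XQ : (2 * (s * X ^ k) <= Q)%N.
Hypothesis c0_ge0 : 0 <= c0.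
Hypothesis singular : forall Z, \sum_(q < Z) \sum_(a < q | coprime q a) (nm (csum R k q a) / q%:R) ^+ s <= c0.

(** The arcs have level tau and are smoothed at level tau'. The edge of the smoothing costs X^(tau -
    tau') on a set of size X^(2 tau - k), and the approximation error costs X^(2 tau' + 3 tau - 1/2
    - k); both are X^(-k) when tau' = 3 tau and 2 tau' + 3 tau = 1/2. *)
Let tau : R := 18%:R^-1.
Let tau' : R := 6%:R^-1.
Let xw (e : R) : R := X%:R `^ e.
(** In units of 1/Q, [W] is the length of the smoothing window and [D] bounds the half-width of the
    arcs of level tau. *)
Let B := Q%:R * xw (tau' - k%:R).
Let W := Num.truncn B.
Let D := Q%:R * xw (tau - k%:R).
Let Y := (Num.truncn (xw tau)).+1.
Let U : R := \prod_(P <- Ps) P%:R.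
Local Notation F := (generating k N Ps : R -> C).

Let X_k : X%:R ^+ k = xw k%:R. Proof. by rewrite /xw npow_nat. Qed.

Let Xk_Q : (X ^ k <= Q)%N.
Proof. by apply: leq_trans XQ; rewrite mulnA leq_pmull // muln_gt0. Qed.

Let Q_gt0 : (0 < Q)%N. Proof. by apply: leq_trans Xk_Q; rewrite expn_gt0 X_gt0. Qed.
Let QR : 0 < Q%:R :> R. Proof. by rewrite ltr0n. Qed.

Let D_ge1 : 1 <= D.
Proof.
have : 1 <= xw tau by apply: npow_ge1 => //; rewrite invr_ge0.
move/le_trans; apply; have -> : xw tau = xw k%:R * xw (tau - k%:R) by rewrite -npowD //; congr (_ `^ _); ring.
by apply: ler_wpM2r; [exact: powR_ge0 | rewrite -X_k -natrX ler_nat].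
Qed.

Let D_B : D = B * xw (tau - tau').
Proof. by rewrite /D /B -mulrA -npowD //; congr (_ * _ `^ _); ring. Qed.

Let B_ge1 : 1 <= B.
Proof.
apply: le_trans D_ge1 _; apply: ler_wpM2l; first exact: ltW.
by apply: ler_npow => //; rewrite /tau /tau' lerD2r lef_pV2 ?posrE // ler_nat.
Qed.

Let W_itv : W%:R <= B < W%:R + 1.
Proof. by rewrite natr1; apply: truncn_itv; exact: le_trans B_ge1. Qed.

Let W_gt0 : (0 < W)%N.
Proof. by rewrite -(ltr0n R); have /andP[_ h] := W_itv; have := B_ge1; lra. Qed.

Let X_R : 2 <= X%:R :> R. Proof. by rewrite ler_nat. Qed.

Let W_small : 2 * W%:R * (xw tau * xw tau) <= Q%:R.
Proof.
have /andP[WB _] := W_itv.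
apply: (@le_trans _ _ (X%:R * B * (xw tau * xw tau))).
  apply: ler_wpM2r; first by rewrite mulr_ge0 ?powR_ge0.
  by apply: ler_pM.
rewrite /B -[leRHS]mulr1 [leLHS](_ : _ = Q%:R * (X%:R `^ 1%:R * xw (tau' - k%:R) * (xw tau * xw tau))); last first.
  by rewrite npow_nat expr1; ring.
apply: ler_wpM2l; first exact: ltW.
rewrite /xw -!npowD // -[leRHS](@powRr0 _ X%:R); apply: ler_npow => //.
have : 2 <= k%:R :> R by rewrite ler_nat.
have : tau <= 6%:R^-1 by rewrite /tau lef_pV2 ?posrE // ler_nat.
by rewrite /tau'; lra.
Qed.

Let WQ : (W <= Q)%N.
Proof.
rewrite -(ler_nat R); apply: le_trans W_small.
have h : 1 <= xw tau by apply: npow_ge1 => //; rewrite invr_ge0.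
have : 1 <= xw tau * xw tau by rewrite -[1]mulr1; apply: ler_pM.
have : 0 <= W%:R :> R by []. nra.
Qed.

Let base (q a : nat) := ((Q * a) %/ q)%N.

Let base_itv q a : (0 < q)%N -> ((base q a)%:R / Q%:R - a%:R / q%:R : R) \in `[- Q%:R^-1, 0].
Proof.
move=> q0; have qR : 0 < q%:R :> R by rewrite ltr0n.
have h1 := leq_divM (Q * a) q; have h2 := ltn_ceil (Q * a) q0.
rewrite -/(base q a) in h1 h2; set n := base q a in h1 h2 *.
have h1' : n%:R * q%:R <= Q%:R * a%:R :> R by rewrite -!natrM ler_nat.
have h2' : Q%:R * a%:R <= (n%:R + 1) * q%:R :> R by rewrite natr1 -!natrM ler_nat ltnW.
have -> : n%:R / Q%:R - a%:R / q%:R = (n%:R - Q%:R * a%:R / q%:R) / Q%:R :> R by field; rewrite !gt_eqF.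
have a1 : Q%:R * a%:R / q%:R <= n%:R + 1 :> R by rewrite ler_pdivrMr.
have a2 : n%:R <= Q%:R * a%:R / q%:R :> R by rewrite ler_pdivlMr.
rewrite in_itv /= -mulN1r ler_pM2r ?invr_gt0 // pmulr_lle0 ?invr_gt0 //; apply/andP; split; lra.
Qed.

Let base_close q a : (0 < q)%N -> `|(base q a)%:R / Q%:R - a%:R / q%:R| <= Q%:R^-1 :> R.
Proof.
move=> /(base_itv a); rewrite in_itv /= => /andP[h1 h2]; rewrite ler_norml h1 (le_trans h2) //.
by rewrite invr_ge0 ltW.
Qed.

Let I : finType := (('I_Y * 'I_Y) * ('I_W * 'I_W))%type.
Let fracs (x : 'I_Y * 'I_Y) := (x.2 < x.1)%N && coprime x.1 x.2.
Let arcs (i : I) := fracs i.1.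
(** The grid point of a/q moved by i - j; [Q] is added to stay in the natural numbers. *)
Let point (i : I) := (base i.1.1 i.1.2 + i.2.1 + (Q - i.2.2))%N.
(** The triangular Fejér weight around the fractions: a grid point at distance d from c accounts for
    W - |d| pairs when |d| <= W. *)
Let hits (c : nat) := #|[pred i : I | arcs i && ((point i %% Q)%N == c)]|.

Let Y_le (q : 'I_Y) : q%:R <= xw tau.
Proof.
have /andP[h _] := truncn_itv (powR_ge0 X%:R tau).
by apply: le_trans h; rewrite ler_nat -ltnS.
Qed.

Let point_diff (i : I) : (point i)%:Z = (base i.1.1 i.1.2)%:Z + (i.2.1)%:Z - (i.2.2)%:Z + Q%:Z.
Proof.
rewrite /point; have : (i.2.2 <= Q)%N by apply: leq_trans WQ; exact: ltnW.
by move: (i.2.2 : nat) (i.2.1 : nat) (base _ _) => x y z; clear; lia.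
Qed.

(** Distinct fractions are at least X^(-2 tau) apart, hence at least 2W/Q by [W_small]; so c
    determines the fraction, and then one of the two shifts determines the other. *)
Lemma hits_le c : (hits c <= W)%N.
Proof.
rewrite /hits -[leqRHS]card_ord -(card_in_imset (f := fun i : I => i.2.1)); first exact: max_card.
move=> i i'; rewrite !inE => /andP[ai /eqP hi] /andP[ai' /eqP hi'] e.
have /andP[aq cqa] := ai; have /andP[aq' cqa'] := ai'.
have q0 : (0 < i.1.1)%N by exact: leq_ltn_trans aq.
have q0' : (0 < i'.1.1)%N by exact: leq_ltn_trans aq'.
pose z : int := (point i %/ Q)%N%:Z - (point i' %/ Q)%N%:Z.
have zE : (point i)%:Z - (point i')%:Z = z * Q%:Z.
  by rewrite {1}(divn_eq (point i) Q) {1}(divn_eq (point i') Q) hi hi' /z !PoszD !PoszM; ring.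
have zR : ((base i.1.1 i.1.2)%:R - (i.2.2)%:R) - ((base i'.1.1 i'.1.2)%:R - (i'.2.2)%:R) = z%:~R * Q%:R :> R.
  have := congr1 (fun z : int => z%:~R : R) zE; rewrite !point_diff e intrM !intrD !intrN => <-.
  by rewrite -!pmulrn; ring.
have := base_itv i.1.2 q0; rewrite in_itv /= => /andP[b1 b1'].
have := base_itv i'.1.2 q0'; rewrite in_itv /= => /andP[b2 b2'].
have j1 : (i.2.2)%:R + 1 <= W%:R :> R by rewrite natr1 ler_nat.
have j2 : (i'.2.2)%:R + 1 <= W%:R :> R by rewrite natr1 ler_nat.
have j10 : 0 <= (i.2.2)%:R :> R by []. have j20 : 0 <= (i'.2.2)%:R :> R by [].
have iQ0 : 0 < Q%:R^-1 :> R by rewrite invr_gt0.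
have W1 : 1 <= W%:R :> R by rewrite ler1n.
have close : `|(i.1.2)%:R / (i.1.1)%:R - (i'.1.2)%:R / (i'.1.1)%:R - z%:~R| < 2 * W%:R * Q%:R^-1 :> R.
  have -> : (i.1.2)%:R / (i.1.1)%:R - (i'.1.2)%:R / (i'.1.1)%:R - z%:~R =
    ((base i'.1.1 i'.1.2)%:R / Q%:R - (i'.1.2)%:R / (i'.1.1)%:R) - ((base i.1.1 i.1.2)%:R / Q%:R - (i.1.2)%:R / (i.1.1)%:R)
    + ((i.2.2)%:R - (i'.2.2)%:R) * Q%:R^-1 :> R.
    have -> : z%:~R = (((base i.1.1 i.1.2)%:R - (i.2.2)%:R) - ((base i'.1.1 i'.1.2)%:R - (i'.2.2)%:R)) / Q%:R :> R.
      by rewrite zR mulfK // gt_eqF.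
    by ring.
  have : `|((i.2.2)%:R - (i'.2.2)%:R) * Q%:R^-1| <= (W%:R - 1) * Q%:R^-1 :> R.
    rewrite normrM [`|Q%:R^-1|]ger0_norm ?invr_ge0 //; apply: ler_wpM2r; first exact: ltW.
    by rewrite ler_norml; lra.
  have yx : Q%:R^-1 <= W%:R * Q%:R^-1 :> R by rewrite ler_peMl // ltW.
  have -> : (W%:R - 1) * Q%:R^-1 = W%:R * Q%:R^-1 - Q%:R^-1 :> R by ring.
  rewrite ler_norml ltr_norml -[2 * W%:R * _]mulrA => /andP[h2 h3].
  move: yx h2 h3 iQ0 b1 b1' b2 b2'.
  set A := (base i.1.1 i.1.2)%:R / Q%:R - _; set A' := (base i'.1.1 i'.1.2)%:R / Q%:R - _.
  by move: (Q%:R^-1 : R) (W%:R * Q%:R^-1 : R) (((i.2.2)%:R - (i'.2.2)%:R) * Q%:R^-1 : R) A A' => x y E A A'; lra.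
have [|qq aa] := @frac_separated i.1.1 i.1.2 i'.1.1 i'.1.2 z R aq aq' cqa cqa'.
  apply: (@lt_le_trans _ _ ((i.1.1 * i'.1.1)%:R * (2 * W%:R * Q%:R^-1))).
    by rewrite ltr_pM2l // ltr0n muln_gt0 q0.
  rewrite mulrA ler_pdivrMr // mul1r; apply: le_trans W_small.
  rewrite mulrC; apply: ler_wpM2l; first exact: mulr_ge0.
  by rewrite natrM; apply: ler_pM.
have jj : i.2.2 = i'.2.2 :> nat.
  move: zE; rewrite !point_diff e qq aa => zE.
  have l1 : (i.2.2 < Q)%N by apply: leq_trans WQ; exact: ltn_ord.
  have l2 : (i'.2.2 < Q)%N by apply: leq_trans WQ; exact: ltn_ord.
  have : (i'.2.2)%:Z - (i.2.2)%:Z = z * Q%:Z by rewrite -zE; ring.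
  exact: small_mul_eq0.
case: i i' qq aa jj e {ai ai' hi hi' aq cqa aq' cqa' q0 q0' z zE zR b1 b1' b2 b2' j1 j2 j10 j20 close} => [[q a] [x y]] [[q' a'] [x' y']] /= qq aa jj e.
by rewrite (val_inj qq) (val_inj aa) (val_inj jj) e.
Qed.

(** After reduction of the fraction, c is at distance at most D + 1 from its grid point, the 1 being
    the rounding error. *)
Lemma hits_ge (c : nat) : (c < Q)%N -> major k tau X (c%:R / Q%:R : R) -> W%:R - (D + 1) <= (hits c)%:R.
Proof.
move=> cQ /asboolP[q1 [a1 [q10 q1X h]]].
have [q [a [z [/andP[q0 qq1] aq cqa e]]]] := reduce_fraction R a1 q10.
have qR : 0 < q%:R :> R by rewrite ltr0n.
have q1R : 0 < q1%:R :> R by rewrite ltr0n.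
have qY : (q < Y)%N.
  rewrite ltnS truncn_ge_nat ?powR_ge0 //.
  by apply: le_trans q1X; rewrite ler_nat.
have aY : (a < Y)%N by exact: ltn_trans aq qY.
have hc : `|c%:R / Q%:R - (a%:R / q%:R + z%:~R)| <= xw (tau - k%:R) :> R.
  apply: le_trans h; rewrite -e.
  have -> : q1%:R * (c%:R / Q%:R) - a1%:~R = q1%:R * (c%:R / Q%:R - a1%:~R / q1%:R) :> R by field; rewrite !gt_eqF.
  by rewrite normrM [`|q1%:R|]ger0_norm // ler_peMl // ler1n.
pose d : int := c%:Z - z * Q%:Z - (base q a)%:Z.
have dD : `|d%:~R| <= D + 1 :> R.
  have b1 := base_close a q0.
  have -> : d%:~R = ((c%:R / Q%:R - (a%:R / q%:R + z%:~R)) - ((base q a)%:R / Q%:R - a%:R / q%:R)) * Q%:R :> R.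
    by rewrite /d !intrD !intrN intrM -!pmulrn; field; rewrite !gt_eqF.
  rewrite normrM [`|Q%:R|]ger0_norm // -ler_pdivlMr // [leRHS](_ : _ = xw (tau - k%:R) + Q%:R^-1); last first.
    by rewrite /D; field; rewrite gt_eqF.
  by apply: le_trans (ler_normB _ _) _; apply: lerD.
have [Wd|dW] := leqP W `|d|%N.
  apply: (@le_trans _ _ 0) => //; rewrite subr_le0; apply: le_trans dD.
  by rewrite -intr_norm -abszE -pmulrn ler_nat.
suff h1 : (W - `|d| <= hits c)%N.
  apply: (@le_trans _ _ (W - `|d|)%N%:R); last by rewrite ler_nat.
  rewrite natrB ?(ltnW dW) // lerD2l lerN2; apply: le_trans dD.
  by rewrite -intr_norm -abszE -pmulrn.
pose d1 := `|Num.max d 0|%N; pose d2 := `|Num.max (- d) 0|%N.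
have dE : d = d1%:Z - d2%:Z by rewrite /d1 /d2; clear; lia.
have dd : (d1 + d2 = `|d|)%N by rewrite /d1 /d2; clear; lia.
have l1 (j : 'I_(W - `|d|)) : (j + d1 < W)%N by have := ltn_ord j; move: dd dW; clear; lia.
have l2 (j : 'I_(W - `|d|)) : (j + d2 < W)%N by have := ltn_ord j; move: dd dW; clear; lia.
pose f (j : 'I_(W - `|d|)) : I := ((Ordinal qY, Ordinal aY), (Ordinal (l1 j), Ordinal (l2 j))).
have finj : injective f by move=> j j' /(congr1 (fun i : I => i.2.1 : nat)) /= /addIn /val_inj.
rewrite -[leqLHS]card_ord -(card_codom finj) /hits; apply: subset_leq_card; apply/subsetP => _ /codomP[j ->].
rewrite inE /arcs /fracs /= aq cqa /=; apply/eqP; apply: (@modn_int _ _ _ (1 - z)) => //.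
rewrite point_diff /= !PoszD.
apply/eqP; rewrite -subr_eq0; apply/eqP.
transitivity (d1%:Z - d2%:Z - (c%:Z - z * Q%:Z - (base q a)%:Z)); first by ring.
by rewrite -dE; exact: subrr.
Qed.

Let FU t : nm (F t) <= U. Proof. exact: normc_generating_le. Qed.

Let U_ge0 : 0 <= U. Proof. by apply: prodr_ge0 => P _; exact: ler0n. Qed.

Let N_gt0 : 0 < N%:R :> R.
Proof. by rewrite ltr0n; apply: leq_trans XN; rewrite expn_gt0 X_gt0. Qed.

Let xw_N : xw (- k%:R) <= s%:R / N%:R.
Proof.
rewrite ler_pdivlMr // /xw powRN npow_nat mulrC ler_pdivrMr ?exprn_gt0 ?ltr0n //.
by rewrite -natrX -natrM ler_nat.
Qed.

Lemma point_generating i j n : (j <= Q)%N ->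
  F ((n%:R + i%:R - j%:R) / Q%:R) = F (((n + i + (Q - j)) %% Q)%N%:R / Q%:R).
Proof.
move=> jQ; set m := (n + i + (Q - j))%N.
have -> : (n%:R + i%:R - j%:R) / Q%:R = (m %% Q)%:R / Q%:R + ((m %/ Q)%:Z - 1)%:~R :> R.
  have : m%:R = (m %/ Q)%:R * Q%:R + (m %% Q)%:R :> R by rewrite {1}(divn_eq m Q) natrD natrM.
  rewrite {1}/m !natrD natrB // => h.
  have -> : (m %% Q)%:R = n%:R + i%:R + (Q%:R - j%:R) - (m %/ Q)%:R * Q%:R :> R by rewrite h addrC addKr.
  by rewrite intrD intrN -pmulrn; field; rewrite gt_eqF.
exact: generating_int.
Qed.

Lemma sum_hits : \sum_(x | fracs x) \sum_(i < W) \sum_(j < W) F (((base x.1 x.2)%:R + i%:R - j%:R) / Q%:R) =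
  \sum_(c < Q) (hits c)%:R * F (c%:R / Q%:R).
Proof.
transitivity (\sum_(i : I | arcs i) F ((point i %% Q)%N%:R / Q%:R)).
  have -> : \sum_(i : I | arcs i) F ((point i %% Q)%N%:R / Q%:R) =
      \sum_(x | fracs x) \sum_(y : 'I_W * 'I_W) F ((point (x, y) %% Q)%N%:R / Q%:R).
    by rewrite pair_big_dep; apply: eq_big => [i|[x y] _] //=; rewrite andbT.
  apply: eq_bigr => x _; rewrite pair_bigA; apply: eq_bigr => y _ /=.
  by rewrite point_generating //; apply: leq_trans WQ; exact: ltnW.
rewrite (partition_big (fun i => Ordinal (ltn_pmod (point i) Q_gt0)) xpredT) //=; apply: eq_bigr => c _.
rewrite (eq_bigr (fun=> F (c%:R / Q%:R))) => [|i /andP[_ /eqP <-]] //.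
rewrite sumr_const -[LHS]mulr_natl (_ : #|_| = hits c) //; apply: eq_card => i; rewrite !inE.
Qed.

Let pairs_le : \sum_(x | fracs x) 1 <= 4 * (xw tau * xw tau) :> R.
Proof.
have h : 1 <= xw tau by apply: npow_ge1 => //; rewrite invr_ge0.
apply: (@le_trans _ _ (\sum_(x : 'I_Y * 'I_Y) 1)).
  by rewrite [leRHS](bigID fracs) /= lerDl sumr_ge0.
rewrite sumr_const card_prod !card_ord natrM.
have : Y%:R <= 2 * xw tau.
  have /andP[h1 _] := truncn_itv (powR_ge0 X%:R tau).
  by rewrite /Y -natr1; move: h1 h; rewrite -/(xw tau); lra.
move=> hY; have : Y%:R * Y%:R <= (2 * xw tau) * (2 * xw tau) by apply: ler_pM.
lra.
Qed.

(** The weight 1 is written as (1 - hits/W) + hits/W. The first part is at most 1 on the minor arcs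
    and of order X^(tau - tau') on the major arcs, where the trivial bound U is enough. The second
    is a sum of Fejér averages over the fractions, to which [arc_bound] and the singular series
    apply. *)
Lemma major_contribution :
  nm (\sum_(c < Q) F (c%:R / Q%:R)) <=
  \sum_(c < Q | ~~ major k tau X (c%:R / Q%:R : R)) nm (F (c%:R / Q%:R)) +
  (36 * s%:R + c0 * (24 * s%:R ^+ 2 + 2) + 72 * s%:R * s%:R) * (Q%:R * (U / N%:R)).
Proof.
have WR : 0 < W%:R :> R by rewrite ltr0n.
have WC : (W%:R : C) != 0 by rewrite pnatr_eq0 -lt0n.
have /andP[WB BW] := W_itv.
have UN0 : 0 <= U / N%:R by rewrite divr_ge0.
have -> : \sum_(c < Q) F (c%:R / Q%:R) = \sum_(c < Q) (1 - (hits c)%:R / W%:R) * F (c%:R / Q%:R) +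
   W%:R^-1 * \sum_(c < Q) (hits c)%:R * F (c%:R / Q%:R).
  by rewrite mulr_sumr -big_split /=; apply: eq_bigr => c _; field.
apply: le_trans (le_normcD _ _) _.
have weight c : nm (1 - (hits c)%:R / W%:R : C) = 1 - (hits c)%:R / W%:R.
  have -> : 1 - (hits c)%:R / W%:R = (1 - (hits c)%:R / W%:R)%:C%C :> C.
    by rewrite rmorphB rmorph1 rmorphM fmorphV !rmorph_nat.
  by rewrite normc_real ger0_norm // subr_ge0 ler_pdivrMr // mul1r ler_nat hits_le.
have part1 : nm (\sum_(c < Q) (1 - (hits c)%:R / W%:R) * F (c%:R / Q%:R)) <=
    \sum_(c < Q | ~~ major k tau X (c%:R / Q%:R : R)) nm (F (c%:R / Q%:R)) + 36 * s%:R * (Q%:R * (U / N%:R)).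
  apply: le_trans (le_normc_sum _ _ _) _.
  rewrite (bigID (fun c : 'I_Q => major k tau X (c%:R / Q%:R : R))) /= addrC; apply: lerD.
    apply: ler_sum => c _; rewrite Normc.normcM weight -[leRHS]mul1r; apply: ler_wpM2r; first exact: normc_ge0.
    by rewrite gerBl divr_ge0.
  apply: (@le_trans _ _ (\sum_(c < Q | major k tau X (c%:R / Q%:R : R)) (4 * xw (tau - tau') * U) * 1)).
    apply: ler_sum => c cm; rewrite Normc.normcM weight mulr1; apply: ler_pM; rewrite ?normc_ge0 //.
      by rewrite subr_ge0 ler_pdivrMr // mul1r ler_nat hits_le.
    have h := hits_ge (ltn_ord c) cm.
    rewrite lerBlDr -lerBlDl ler_pdivlMr // mulrBl mul1r; apply: le_trans h; rewrite lerD2l lerN2.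
    have h1 : D + 1 <= 2 * D by have := D_ge1; lra.
    apply: le_trans h1 _; rewrite D_B [leRHS](_ : _ = 4 * W%:R * xw (tau - tau')); last by ring.
    rewrite mulrA; apply: ler_wpM2r; first exact: powR_ge0.
    by have : 1 <= W%:R :> R by [rewrite ler1n]; move: BW; lra.
  rewrite -mulr_sumr.
  have tk : tau <= k%:R by have : 1 <= k%:R :> R by [rewrite ler1n]; have : tau <= 1 by [rewrite /tau invf_le1 // ler1n]; lra.
  have tau0 : 0 <= tau by rewrite invr_ge0.
  apply: le_trans (ler_wpM2l _ (major_card k_gt1 tau0 tk X_gt0 Xk_Q)) _; first by rewrite !mulr_ge0 ?powR_ge0.
  have e : xw (tau - tau') * xw (2 * tau - k%:R) = xw (- k%:R).
    by rewrite -npowD //; congr (_ `^ _); rewrite /tau /tau'; field.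
  rewrite [leLHS](_ : _ = 36 * (Q%:R * (U * (xw (tau - tau') * xw (2 * tau - k%:R))))); last by rewrite -/(xw _); ring.
  rewrite e [leRHS](_ : _ = 36 * (Q%:R * (U * (s%:R / N%:R)))); last by ring.
  by apply: ler_wpM2l => //; apply: ler_wpM2l; [exact: ltW | apply: ler_wpM2l].
apply: le_trans (lerD part1 (lexx _)) _.
rewrite -addrA lerD2l -[36 * s%:R + _ + _]addrA [leRHS]mulrDl lerD2l.
rewrite Normc.normcM -sum_hits.
have -> : nm (W%:R^-1 : C) = W%:R^-1.
  by rewrite -(rmorph_nat (real_complex R)) -fmorphV normc_real ger0_norm // invr_ge0.
rewrite mulrC ler_pdivrMr //.
(* The relative error on an arc: q (1 + |beta| P^k) / P has order at most X^(tau + tau') /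
   X^(1/2). *)
pose eta : R := 18 * xw (tau + tau' - 2^-1).
have eta0 : 0 <= eta by rewrite mulr_ge0 ?powR_ge0.
have eta_large q : q%:R <= xw tau -> {in Ps, forall P : nat, 2 * q%:R * (1 + 8 * (W%:R / Q%:R) * P%:R ^+ k) <= eta * P%:R}.
  move=> qx P PPs.
  have PR : xw 2^-1 <= P%:R.
    rewrite -(@ler_pXn2r _ 2) ?nnegrE ?powR_ge0 // /xw npowX mulVf ?pnatr_eq0 // powRr1 //.
    by rewrite -natrX ler_nat -mulnn; exact: Ps_balanced.
  have h1 : W%:R / Q%:R * P%:R ^+ k <= xw tau'.
    have -> : xw tau' = B / Q%:R * X%:R ^+ k.
      by rewrite /B [Q%:R * xw _]mulrC mulfK ?gt_eqF // X_k -npowD // subrK.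
    apply: ler_pM; rewrite ?exprn_ge0 ?divr_ge0 //.
      by apply: ler_wpM2r; rewrite // invr_ge0 ltW.
    by apply: lerXn2r; rewrite ?nnegrE // ler_nat; exact: PsX.
  have t1 : 1 <= xw tau' by apply: npow_ge1 => //; rewrite invr_ge0.
  apply: (@le_trans _ _ (2 * xw tau * (9 * xw tau'))).
    apply: ler_pM; [by rewrite mulr_ge0 | by rewrite addr_ge0 // mulr_ge0 ?exprn_ge0 // mulr_ge0 // divr_ge0 | by apply: ler_wpM2l |].
    by move: h1 t1; rewrite -[8 * _ * _]mulrA; lra.
  apply: (@le_trans _ _ (eta * xw 2^-1)); last by apply: ler_wpM2l.
  rewrite /eta -[leRHS]mulrA -npowD // subrK npowD // le_eqVlt; apply/orP; left; apply/eqP; rewrite -/(xw _) -/(xw tau'); ring.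
have WX : (W * X ^ (k - 1) <= Q)%N.
  rewrite -(ler_nat R) natrM natrX; apply: (@le_trans _ _ (B * X%:R ^+ (k - 1))).
    by apply: ler_wpM2r => //; exact: exprn_ge0.
  rewrite /B -mulrA -[leRHS]mulr1; apply: ler_wpM2l; first exact: ltW.
  rewrite -npow_nat -npowD // -[leRHS](@powRr0 _ X%:R); apply: ler_npow => //.
  rewrite natrB //; have : tau' <= 1 by rewrite /tau' invf_le1 // ler1n.
  lra.
have XQ' : (2 * (size Ps * X ^ k) <= Q)%N by rewrite sizePs.
have NX' : (N <= size Ps * X ^ k)%N by rewrite sizePs.
have dens := @fejer_density R k k_gt0 N W X Q Ps Q_gt0 W_gt0 X_gt0 PsX XN NX' XQ' WX.
rewrite sizePs -/U in dens.
set DD := \sum_(v <- _) _ in dens.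
apply: (@le_trans _ _ (\sum_(x | fracs x) ((nm (csum R k x.1 x.2) / x.1%:R) ^+ s * DD + W%:R ^+ 2 * (s%:R * eta * U)))).
  apply: le_trans (le_normc_sum _ _ _) _; apply: ler_sum => x /andP[ax cx].
  have x0 : (0 < x.1)%N by exact: leq_ltn_trans ax.
  have := @arc_bound R k k_gt0 N W Q x.1 x.2 (base x.1 x.2) Ps eta Q_gt0 x0 (base_close _ x0) (eta_large _ (Y_le _)).
  by rewrite sizePs.
rewrite big_split /= -mulr_suml -[leRHS]mulrA [leRHS]mulrDl; apply: lerD.
  have DD0 : 0 <= DD by apply: sumr_ge0 => v _; rewrite exprn_ge0 // normc_ge0.
  have hs : \sum_(x | fracs x) (nm (csum R k x.1 x.2) / x.1%:R) ^+ s <= c0.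
    rewrite -(pair_big_dep xpredT (fun q a : 'I_Y => (a < q)%N && coprime q a) (fun q a : 'I_Y => (nm (csum R k q a) / q%:R) ^+ s)) /=.
    apply: le_trans (singular Y); apply: ler_sum => q _.
    rewrite (big_ord_widen_cond Y (fun a => coprime q a) (fun a => (nm (csum R k q a) / q%:R) ^+ s) (ltnW (ltn_ord q))).
    by rewrite (eq_bigl (fun i : 'I_Y => coprime q i && (i < q)%N)) // => a; rewrite andbC.
  apply: le_trans (ler_pM (sumr_ge0 _ _) DD0 hs dens) _ => [x _|].
    by rewrite exprn_ge0 // divr_ge0 ?normc_ge0.
  by rewrite le_eqVlt; apply/orP; left; apply/eqP; ring.
have -> : \sum_(x | fracs x) W%:R ^+ 2 * (s%:R * eta * U) = W%:R ^+ 2 * (s%:R * eta * U) * \sum_(x | fracs x) 1.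
  by rewrite mulr_sumr; apply: eq_bigr => x _; rewrite mulr1.
have E0 : 0 <= s%:R * eta * U by apply: mulr_ge0 => //; apply: mulr_ge0.
apply: le_trans (ler_wpM2l _ pairs_le) _; first by rewrite mulr_ge0 ?exprn_ge0.
apply: (@le_trans _ _ (W%:R * B * (s%:R * eta * U) * (4 * (xw tau * xw tau)))).
  apply: ler_wpM2r; first by rewrite !mulr_ge0 ?powR_ge0.
  by apply: ler_wpM2r => //; rewrite expr2; apply: ler_wpM2l.
have e : xw (tau' - k%:R) * xw (tau + tau' - 2^-1) * (xw tau * xw tau) = xw (- k%:R).
  by rewrite /xw -!npowD //; congr (_ `^ _); rewrite /tau /tau'; field.
rewrite [leLHS](_ : _ = 72 * s%:R * W%:R * Q%:R * U * (xw (tau' - k%:R) * xw (tau + tau' - 2^-1) * (xw tau * xw tau))); last by rewrite /B /eta; ring.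
rewrite e [leRHS](_ : _ = 72 * s%:R * W%:R * Q%:R * U * (s%:R / N%:R)); last by ring.
by apply: ler_wpM2l xw_N; rewrite !mulr_ge0.
Qed.

End MajorContribution.

(** * Counting *)

Section CountBound.
Variables (R : realType) (k s p : nat).
Local Notation C := R[i].
Local Notation nm := (@Normc.normc R).
Hypothesis k_gt1 : (1 < k)%N.
Let k_gt0 : (0 < k)%N := ltnW k_gt1.
Hypothesis p_prime : prime p.
Let p_gt1 : (1 < p)%N := prime_gt1 p_prime.
Hypothesis s_gt2k : (2 * k < s)%N.
Let s_gt0 : (0 < s)%N := leq_ltn_trans (leq0n _) s_gt2k.
Hypothesis s_le_p : (s <= p)%N.
Local Notation pw x := (p%:R `^ x : R).
Local Notation U Ps := (\prod_(P <- Ps) P%:R : R).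

Let sR : 0 < s%:R :> R. Proof. by rewrite ltr0n. Qed.

Lemma prod_powR Ps (e : R) : \prod_(P <- Ps) P%:R `^ e = U Ps `^ e.
Proof.
elim: Ps => [|P Ps IH]; first by rewrite !big_nil powR1.
by rewrite !big_cons IH powRM // prodr_ge0.
Qed.

Lemma prod_ge1 Ps : {in Ps, forall P, (0 < P)%N} -> 1 <= U Ps.
Proof.
elim: Ps => [|P Ps IH] H; first by rewrite big_nil.
rewrite big_cons -[leLHS]mulr1; apply: ler_pM => //; first by rewrite ler1n H ?mem_head.
by apply: IH => P' h; apply: H; rewrite inE h orbT.
Qed.

Lemma prod_le X Ps : {in Ps, forall P, (P <= X)%N} -> U Ps <= X%:R ^+ size Ps.
Proof.
elim: Ps => [|P Ps IH] H; first by rewrite big_nil.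
rewrite big_cons exprS; apply: ler_pM; rewrite ?prodr_ge0 //; first by rewrite ler_nat H ?mem_head.
by apply: IH => P' h; apply: H; rewrite inE h orbT.
Qed.

(** The upper bound makes p^(eps M) at most a constant times X^(k eps). *)
Definition modulus M X := ((2 * p * X) ^ k <= p ^ M)%N /\ (p ^ M <= p * (2 * p) ^ k * X ^ k)%N.

Hypothesis saving : forall tau : R, 0 < tau -> tau <= 1 -> power_saving k p s tau.
Hypothesis full : forall eta eps : R, 0 < eta -> 0 < eps -> exists2 c : R, 0 <= c & forall M X, (0 < X)%N -> ((2 * p * X) ^ k <= p ^ M)%N ->
  \sum_(c < p ^ M) nm (weyl k X (c%:R / (p ^ M)%:R)) ^+ s <=
  c * pw (eps * M%:R) * (p ^ M)%:R * X%:R `^ (s%:R - k%:R + eta).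

(** Hölder's inequality over the s factors. The largest range X carries the minor arc saving
    X^(-del); the other factors take the full mean with a small loss. As the product U is at most
    X^s, the saving becomes a power of U. *)
Lemma minor_count (tau : R) : 0 < tau -> tau <= 1 -> exists2 delta : R, 0 < delta & exists2 c : R, 0 <= c &
  forall M X Ps, size Ps = s -> X \in Ps -> {in Ps, forall P, (0 < P <= X)%N} -> modulus M X ->
  \sum_(c < p ^ M | ~~ major k tau X (c%:R / (p ^ M)%:R : R)) \prod_(P <- Ps) nm (weyl k P (c%:R / (p ^ M)%:R)) <=
  c * (p ^ M)%:R * U Ps `^ (1 - k%:R / s%:R - delta).
Proof.
move=> t0 t1; have [del del0 H] := saving t0 t1.
have kR : 0 < k%:R :> R by rewrite ltr0n.
(* The losses U^eta and p^(s eps M) are each at most X^(del/4) up to constants and together spend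
   half of the saving. *)
pose eta : R := del / (4 * s%:R).
have eta0 : 0 < eta by rewrite divr_gt0 ?mulr_gt0.
pose eps : R := del / (4 * s%:R * k%:R).
have eps0 : 0 < eps by rewrite divr_gt0 ?mulr_gt0.
have [c1 c10 H1] := H _ eps0; have [c2 c20 H2] := full eta0 eps0.
pose b := (p * (2 * p) ^ k)%N.
(* X^(-del/2) is at most U^(-del/(2s)), and the s-th root divides the exponent by s again. *)
exists (del / (2 * s%:R * s%:R)); first by rewrite divr_gt0 ?mulr_gt0.
exists ((c1 + c2) * b%:R `^ eps) => [|M X Ps sPs XPs PsX [QX Qb]]; first by rewrite mulr_ge0 ?addr_ge0 ?powR_ge0.
have X0 : (0 < X)%N by have /andP[] := PsX X XPs.
have U0 : 0 < U Ps by apply: lt_le_trans ltr01 _; apply: prod_ge1 => P /PsX/andP[].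
pose j0 := index X Ps; have j0s : (j0 < s)%N by rewrite -sPs index_mem.
pose P_ (j : 'I_s) := nth 0%N Ps j.
have P_in j : P_ j \in Ps by rewrite mem_nth // sPs.
set Q := (p ^ M)%N in QX Qb *.
pose E := pw (eps * M%:R).
have E0 : 0 <= E by exact: powR_ge0.
pose G (j : 'I_s) := (c1 + c2) * E * Q%:R * (P_ j)%:R `^ (s%:R - k%:R + eta) * (if j == Ordinal j0s then X%:R `^ (- del) else 1).
have factor j : \sum_(c < Q | ~~ major k tau X (c%:R / Q%:R : R)) nm (weyl k (P_ j) (c%:R / Q%:R)) ^+ s <= G j.
  have /andP[P0 PX] := PsX _ (P_in j).
  rewrite /G; case: eqP => [->|_]; last first.
    rewrite mulr1; apply: (@le_trans _ _ (\sum_(c < Q) nm (weyl k (P_ j) (c%:R / Q%:R)) ^+ s)).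
      by rewrite [leRHS](bigID (fun c : 'I_Q => ~~ major k tau X (c%:R / Q%:R : R))) /= lerDl sumr_ge0 // => c _; rewrite exprn_ge0 // normc_ge0.
    apply: le_trans (H2 M (P_ j) P0 _) _.
      by apply: leq_trans QX; rewrite leq_exp2r // leq_mul2l PX orbT.
    rewrite -/Q -/E; apply: ler_wpM2r; first exact: powR_ge0.
    by apply: ler_wpM2r => //; apply: ler_wpM2r => //; rewrite lerDr.
  have -> : P_ (Ordinal j0s) = X by rewrite /P_ nth_index.
  apply: le_trans (H1 M X X0 QX) _; rewrite -[leRHS]mulrA -npowD //; apply: ler_pM; rewrite ?mulr_ge0 ?powR_ge0 //.
    by rewrite -/Q -/E; apply: ler_wpM2r => //; apply: ler_wpM2r => //; rewrite lerDl.
  by apply: ler_npow => //; lra.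
pose F c := \prod_(P <- Ps) nm (weyl k P (c%:R / Q%:R)) : R.
have F0 c : 0 <= F c by apply: prodr_ge0 => P _; exact: normc_ge0.
have FE c : F c ^+ s = \prod_(j < s) nm (weyl k (P_ j) (c%:R / Q%:R)) ^+ s.
  by rewrite prodrXl /F (big_nth 0%N) big_mkord sPs.
have := @holder_pow R 'I_Q (fun c => ~~ major k tau X (c%:R / Q%:R : R)) s F (fun j c => nm (weyl k (P_ j) (c%:R / Q%:R)) ^+ s) s_gt0.
move=> /(_ (fun c => F0 c) (fun j c => exprn_ge0 s (normc_ge0 _))) /(_ _) h.
set S := \sum_(c < Q | _) _.
have S0 : 0 <= S by apply: sumr_ge0 => c _; exact: F0.
have {}h : S ^+ s <= \prod_(j < s) G j.
  apply: le_trans (h _) _ => [c _|]; first by rewrite FE.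
  by apply: ler_prod => j _; rewrite factor andbT sumr_ge0 // => c _; rewrite exprn_ge0 // normc_ge0.
rewrite -(@ler_pXn2r _ s) ?nnegrE //; last by rewrite !mulr_ge0 ?addr_ge0 ?powR_ge0.
apply: le_trans h _.
have -> : \prod_(j < s) G j = ((c1 + c2) * E * Q%:R) ^+ s * U Ps `^ (s%:R - k%:R + eta) * X%:R `^ (- del).
  rewrite /G big_split /= big_split /= prodr_const card_ord; congr (_ * _ * _).
    by rewrite -prod_powR [RHS](big_nth 0%N) big_mkord sPs.
  by rewrite -big_mkcond big_pred1_eq.
have UX : U Ps <= X%:R ^+ s by rewrite -sPs; apply: prod_le => P /PsX/andP[].
have EX : E <= b%:R `^ eps * X%:R `^ (k%:R * eps) by apply: modulus_pw => //; exact: ltW.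
have U_eta : U Ps `^ eta <= X%:R `^ (s%:R * eta).
  rewrite powRrM npow_nat; apply: ge0_ler_powR; rewrite ?nnegrE ?exprn_ge0 //; exact: ltW.
have U_del : X%:R `^ (- (del / 2)) <= U Ps `^ (- (del / (2 * s%:R))).
  rewrite !powRN lef_pV2 ?posrE ?powR_gt0 ?ltr0n //.
  have -> : X%:R `^ (del / 2) = (X%:R ^+ s) `^ (del / (2 * s%:R)) :> R.
    by rewrite -npow_nat -powRrM; congr (_ `^ _); field; rewrite gt_eqF.
  apply: ge0_ler_powR; rewrite ?nnegrE ?exprn_ge0 //; last exact: ltW.
  by rewrite divr_ge0 ?mulr_ge0 // ltW.
have powU (x y : R) : U Ps `^ (x + y) = U Ps `^ x * U Ps `^ y.
  by rewrite powRD //; apply/implyP => _; rewrite gt_eqF.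
have Ec : ((c1 + c2) * E * Q%:R) ^+ s <= ((c1 + c2) * b%:R `^ eps * Q%:R) ^+ s * X%:R `^ (del / 4).
  have -> : X%:R `^ (del / 4) = (X%:R `^ (k%:R * eps)) ^+ s :> R.
    by rewrite npowX; congr (_ `^ _); rewrite /eps; field; rewrite !gt_eqF.
  rewrite -exprMn; apply: lerXn2r; rewrite ?nnegrE ?mulr_ge0 ?addr_ge0 ?powR_ge0 //.
  rewrite mulrAC [leRHS](_ : _ = (c1 + c2) * Q%:R * (b%:R `^ eps * X%:R `^ (k%:R * eps))); last by ring.
  by apply: ler_wpM2l; rewrite ?mulr_ge0 ?addr_ge0.
rewrite powU.
apply: (@le_trans _ _ (((c1 + c2) * b%:R `^ eps * Q%:R) ^+ s * X%:R `^ (del / 4) * (U Ps `^ (s%:R - k%:R) * X%:R `^ (s%:R * eta)) * X%:R `^ (- del))).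
  apply: ler_wpM2r; first exact: powR_ge0.
  apply: ler_pM; rewrite ?mulr_ge0 ?exprn_ge0 ?mulr_ge0 ?addr_ge0 ?powR_ge0 //.
  by apply: ler_wpM2l; first exact: powR_ge0.
rewrite [leLHS](_ : _ = ((c1 + c2) * b%:R `^ eps * Q%:R) ^+ s * (U Ps `^ (s%:R - k%:R) * (X%:R `^ (del / 4) * X%:R `^ (s%:R * eta) * X%:R `^ (- del)))); last by ring.
rewrite [leRHS]exprMn; apply: ler_wpM2l; first by rewrite exprn_ge0 // !mulr_ge0 ?addr_ge0 ?powR_ge0.
rewrite -powR_mulrn ?powR_ge0 // -powRrM.
have -> : (1 - k%:R / s%:R - del / (2 * s%:R * s%:R)) * s%:R = s%:R - k%:R + - (del / (2 * s%:R)) :> R by field; rewrite gt_eqF.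
rewrite (powU (s%:R - k%:R)); apply: ler_wpM2l; first exact: powR_ge0.
apply: le_trans U_del; rewrite -!npowD // le_eqVlt; apply/orP; left; apply/eqP; congr (_ `^ _).
by rewrite /eta; field; rewrite gt_eqF.
Qed.

(** Orthogonality; N and all the values are below Q, so congruence is equality. *)
Lemma generating_count N Ps Q : (1 < Q)%N -> (N < Q)%N -> {in power_sums k Ps, forall v, (v < Q)%N} ->
  \sum_(c < Q) generating k N Ps (c%:R / Q%:R) = Q%:R * (count_mem N (power_sums k Ps))%:R :> C.
Proof.
move=> Q1 NQ vQ.
have -> : \sum_(c < Q) generating k N Ps (c%:R / Q%:R) = \sum_(v <- power_sums k Ps) \sum_(c < Q) expi (c%:R / Q%:R * (v%:R - N%:R) : R).
  by rewrite exchange_big; apply: eq_bigr => c _; rewrite generating_sum.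
have -> : Q%:R * (count_mem N (power_sums k Ps))%:R = \sum_(v <- power_sums k Ps) (if v == N then Q%:R else 0) :> C.
  rewrite -big_mkcond -sum1_count natr_sum mulr_sumr; apply: eq_bigr => v _; by rewrite mulr1.
rewrite big_seq [RHS]big_seq; apply: eq_bigr => v vP.
have -> : (if v == N then Q%:R else 0) = (if (v%:R - N%:R : 'Z_Q) == 0 then Q%:R else 0) :> C.
  congr (if _ then _ else _); rewrite subr_eq0 -(inj_eq val_inj) /= !val_Zp_nat // !modn_small //; exact: vQ.
rewrite -(addchar_sum R _ Q1) -(@sum_Zp _ Q (fun c => expi (c%:R / Q%:R * (v%:R - N%:R) : R)) Q1); apply: eq_bigr => z _.
rewrite mulrBl addcharD // -addcharJ // -[z in RHS]natr_Zp -!natrM !addchar_nat // expiJ -expiD.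
by congr expi; rewrite !natrM; ring.
Qed.

(** A variable above N^(1/k) cannot occur in a solution. Truncating the ranges there secures X^k <=
    N. *)
Lemma power_sums_truncate N n0 Ps (Phi : nat -> R) : (forall x, (n0 < x)%N -> (N < x ^ k)%N) ->
  (forall v, 0 <= Phi v) -> (forall v, (N < v)%N -> Phi v = 0) ->
  \sum_(v <- power_sums k Ps) Phi v <= \sum_(v <- power_sums k (map (minn n0) Ps)) Phi v.
Proof.
move=> n0N; elim: Ps Phi => [|P Ps IH] Phi Phi0 PhiN; first exact: lexx.
rewrite [map _ _]/= !big_power_sums_cons.
apply: (@le_trans _ _ (\sum_(1 <= x < (minn n0 P).+1) \sum_(v <- power_sums k Ps) Phi (x ^ k + v)%N)).
  have [_|n0P] := leqP P n0; first exact: lexx.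
  rewrite (big_cat_nat (n := n0.+1)) //=; last by rewrite ltnS ltnW.
  rewrite -[leRHS]addr0 lerD2l big_nat big1 // => x /andP[x1 _].
  by rewrite big1 // => v _; apply: PhiN; apply: leq_trans (n0N _ x1) (leq_addr _ _).
apply: ler_sum => x _; apply: (IH (fun v => Phi (x ^ k + v)%N)) => [v|v vN]; first exact: Phi0.
by apply: PhiN; apply: leq_trans vN (leq_addl _ _).
Qed.

Lemma count_mem_sum N (vs : seq nat) : (count_mem N vs)%:R = \sum_(v <- vs) (v == N)%:R :> R.
Proof.
rewrite -sum1_count natr_sum big_mkcond; apply: eq_bigr => v _.
by rewrite /=; case: (v == N).
Qed.

Lemma size_power_sums Ps : (size (power_sums k Ps))%:R = U Ps.
Proof. by rewrite -[RHS]mulr1 -(sum_power_sums_const k) -sum1_size natr_sum; apply: eq_bigr. Qed.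

Lemma modulus_exists_for X : (0 < X)%N -> exists M, modulus M X.
Proof.
move=> X0; have L0 : (0 < (2 * p * X) ^ k)%N by rewrite expn_gt0 muln_gt0 X0 andbT muln_gt0 /= ltnW.
have [M [h1 h2]] := modulus_exists p_gt1 L0; exists M; split=> //.
by rewrite -mulnA -expnMn.
Qed.

Hypothesis p_ge8 : (8 <= p)%N.

Lemma count_power_sums_bound : exists2 delta : R, 0 < delta & exists2 c : R, 0 <= c & forall N Ps,
  (0 < N)%N -> size Ps = s -> {in Ps, forall P, (0 < P)%N} ->
  (count_mem N (power_sums k Ps))%:R <= c * (U Ps / N%:R + U Ps `^ (1 - k%:R / s%:R - delta)).
Proof.
have kR : 0 < k%:R :> R by rewrite ltr0n.
have k2R : 2 <= k%:R :> R by rewrite ler_nat.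
have ks2 : k%:R / s%:R < 2^-1 :> R.
  rewrite ltr_pdivrMr // mulrC ltr_pdivlMr // -natrM ltr_nat mulnC; exact: s_gt2k.
have kspos : 0 < k%:R / s%:R :> R by rewrite divr_gt0.
have h18 : 0 < (18%:R^-1 : R) /\ (18%:R^-1 : R) <= 1 by split; [rewrite invr_gt0 | rewrite invf_le1 // ler1n].
have [d1 d10 [c1 c10 H1]] := minor_count h18.1 h18.2.
(* A range below X^(1/2) gives U <= X^(s - 1/2), hence U^(k/s) <= X^(k - k/(2s)). Half of this
   margin pays for 2 tau2, the other half for s d3. *)
pose tau2 : R := k%:R / s%:R / 8.
have tau20 : 0 < tau2 by rewrite divr_gt0.
have tau21 : tau2 <= 1 by rewrite /tau2; lra.
have [d2 d20 [c2 c20 H2]] := minor_count tau20 tau21.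
have sav3 : power_saving k p s (3%:R^-1 : R).
  by apply: saving; [rewrite invr_gt0 | rewrite invf_le1 // ler1n].
have [c3 c30 H3] := singular_series k_gt1 p_gt1 p_ge8 (ltnW (leq_ltn_trans (leq_pmulr 2 k_gt0) s_gt2k)) sav3.
pose d3 : R := k%:R / s%:R / (4 * s%:R).
have d30 : 0 < d3 by apply: divr_gt0 => //; apply: mulr_gt0.
(* As k/s < 1/2, the bound 1/2 keeps 1 - k/s - d nonnegative, so that the right-hand side increases
   with U. *)
pose d := Num.min (Num.min d1 d2) (Num.min d3 2^-1).
have dd1 : d <= d1 by rewrite !ge_min lexx.
have dd2 : d <= d2 by rewrite !ge_min lexx orbT.
have dd3 : d <= d3 by rewrite !ge_min lexx !orbT.
have dd4 : d <= 2^-1 by rewrite !ge_min lexx !orbT.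
have d0 : 0 < d by (rewrite !lt_min d10 d20 d30 /=; lra).
exists d => //.
pose c4 := 36 * s%:R + c3 * (24 * s%:R ^+ 2 + 2) + 72 * s%:R * s%:R.
have c40 : 0 <= c4 by rewrite !addr_ge0 ?mulr_ge0 ?addr_ge0 ?mulr_ge0 ?exprn_ge0.
pose c := s%:R + c1 + c2 + c4 + 9.
have cc : s%:R <= c /\ c1 <= c /\ c2 + 9 <= c /\ c4 <= c by rewrite /c; move: (c4) c40 (ltW sR) => z z0 s0; split; [lra|split; [lra|split; lra]].
have c0 : 0 <= c by apply: le_trans (ltW sR) _; case: cc.
exists c => //.
have core N Ps : (0 < N)%N -> size Ps = s -> {in Ps, forall P, (0 < P)%N} -> {in Ps, forall P, (P ^ k <= N)%N} ->
    (count_mem N (power_sums k Ps))%:R <= c * (U Ps / N%:R + U Ps `^ (1 - k%:R / s%:R - d)).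
  move=> N0 sPs Ps0 PsN.
  have U1 : 1 <= U Ps by exact: prod_ge1.
  have U0 : 0 < U Ps by exact: lt_le_trans ltr01 U1.
  have NR : 0 < N%:R :> R by rewrite ltr0n.
  have rhs0 : 0 <= c * (U Ps / N%:R + U Ps `^ (1 - k%:R / s%:R - d)).
    apply: mulr_ge0 c0 _; apply: addr_ge0; last exact: powR_ge0.
    by apply: divr_ge0; exact: ltW.
  have [X XPs PsX] : exists2 X, X \in Ps & {in Ps, forall P, (P <= X)%N}.
    have : Ps != [::] by rewrite -size_eq0 sPs -lt0n.
    elim: (Ps) => [//|P Qs IH] _; case: (Qs =P [::]) => [->|/eqP/IH[X XQs QsX]].
      by exists P; rewrite ?inE // => P'; rewrite inE => /eqP ->.
    have [PX|XP] := leqP P X.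
      exists X; first by rewrite inE XQs orbT.
      by move=> P'; rewrite inE => /orP[/eqP ->|/QsX].
    exists P; first exact: mem_head.
    move=> P'; rewrite inE => /orP[/eqP -> //|/QsX h]; exact: leq_trans h (ltnW XP).
  have X0 : (0 < X)%N by exact: Ps0.
  have XN := PsN X XPs.
  have [NX|NX] := leqP N (s * X ^ k); last first.
    suff -> : count_mem N (power_sums k Ps) = 0%N by [].
    apply/count_memPn; apply/negP => /(power_sums_le k_gt0 PsX); rewrite sPs leqNgt NX //.
  (* For X = 1 the relevant N are at most s, and the first term of the bound suffices. *)
  have [X1|X1] := leqP X 1.
    have XE : X = 1%N by apply/eqP; rewrite eqn_leq X1 X0.
    apply: (@le_trans _ _ (U Ps)); first by rewrite -size_power_sums ler_nat count_size.
    apply: (@le_trans _ _ (c * (U Ps / N%:R))); last by rewrite ler_wpM2l // lerDl powR_ge0.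
    rewrite mulrCA ler_peMr ?(ltW U0) // ler_pdivlMr // mul1r.
    apply: (@le_trans _ _ s%:R); last by have [] := cc.
    by rewrite ler_nat; move: NX; rewrite XE exp1n muln1.
  have [M [QX Qb]] := modulus_exists_for X0.
  set Q := (p ^ M)%N in QX Qb.
  have QR : 0 < Q%:R :> R by rewrite ltr0n expn_gt0 ltnW.
  have XQ : (2 * (s * X ^ k) <= Q)%N.
    apply: leq_trans QX; rewrite expnMn mulnA leq_mul2r; apply/orP; right.
    apply: (@leq_trans (2 * p)); first by rewrite leq_mul2l s_le_p orbT.
    by rewrite -{1}(expn1 (2 * p)) leq_pexp2l // muln_gt0 (ltnW p_gt1).
  have XkQ : (X ^ k <= Q)%N by apply: leq_trans XQ; rewrite mulnA leq_pmull // muln_gt0.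
  have Xk0 : (0 < X ^ k)%N by rewrite expn_gt0 X0.
  have sX0 : (0 < s * X ^ k)%N by rewrite muln_gt0 s_gt0.
  have sXQ : (s * X ^ k < Q)%N by apply: leq_trans XQ; rewrite mul2n -addnn -[ltnLHS]add0n ltn_add2r.
  have Q1 : (1 < Q)%N by apply: leq_ltn_trans sXQ.
  have NQ : (N < Q)%N by exact: leq_ltn_trans NX sXQ.
  have vQ : {in power_sums k Ps, forall v, (v < Q)%N}.
    by move=> v /(power_sums_le k_gt0 PsX); rewrite sPs => h; exact: leq_ltn_trans h sXQ.
  have PsX' : {in Ps, forall P, (0 < P <= X)%N} by move=> P PPs; rewrite Ps0 // PsX.
  have cntE : Q%:R * (count_mem N (power_sums k Ps))%:R = nm (\sum_(c < Q) generating k N Ps (c%:R / Q%:R)).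
    by rewrite generating_count // Normc.normcM !normc_nat.
  have genE (t : R) : nm (generating k N Ps t) = \prod_(P <- Ps) nm (weyl k P t).
    by rewrite /generating Normc.normcM normc_expi mulr1 normc_prod.
  have gsum tau' : \sum_(c < Q | ~~ major k tau' X (c%:R / Q%:R : R)) nm (generating k N Ps (c%:R / Q%:R)) =
      \sum_(c < Q | ~~ major k tau' X (c%:R / Q%:R : R)) \prod_(P <- Ps) nm (weyl k P (c%:R / Q%:R)).
    by apply: eq_bigr => z _; exact: genE.
  rewrite -(ler_pM2l QR) cntE.
  pose Ue := U Ps `^ (1 - k%:R / s%:R - d).
  have Ule e : d <= e -> U Ps `^ (1 - k%:R / s%:R - e) <= Ue by move=> h; apply: ler_powR => //; lra.
  have Ue0 : 0 <= Ue by exact: powR_ge0.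
  have UN0 : 0 <= U Ps / N%:R by rewrite divr_ge0 // ltW.
  case: (boolP (all (fun P => (X <= P * P)%N) Ps)) => [/allP bal|/allPn[P PPs PX]].
    have := @major_contribution R k s M p N X Ps c3 k_gt1 s_gt0 sPs X1 PsX bal XN NX XQ H3.
    move/le_trans; apply.
    have := H1 M X Ps sPs XPs PsX' (conj QX Qb); rewrite -/Q -gsum => h.
    apply: le_trans (lerD h (lexx _)) _; rewrite -/c4 mulrCA mulrDr mulrDr addrC -/Q; apply: lerD.
      by apply: ler_wpM2l; [exact: ltW | apply: ler_wpM2r => //; case: cc => _ [_ []]].
    rewrite -mulrA mulrCA; apply: ler_wpM2l; first exact: ltW.
    by apply: ler_pM; rewrite ?powR_ge0 //; [case: cc => _ [] | exact: Ule].
  have Xk : X%:R ^+ k = X%:R `^ k%:R :> R by rewrite npow_nat.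
  have UX : U Ps <= X%:R `^ (s%:R - 2^-1).
    rewrite (perm_big _ (perm_to_rem PPs)) big_cons /=.
    have h1 : P%:R <= X%:R `^ 2^-1 :> R.
      rewrite -(@ler_pXn2r _ 2) ?nnegrE ?powR_ge0 // npowX mulVf ?pnatr_eq0 // powRr1 //.
      by rewrite -natrX ler_nat -mulnn; apply: ltnW; rewrite ltnNge.
    have h2 : U (rem P Ps) <= X%:R ^+ (s - 1).
      rewrite subn1 -sPs -(size_rem PPs); apply: prod_le => P' /mem_rem; exact: PsX.
    apply: le_trans (ler_pM (ler0n R P) _ h1 h2) _; first by apply: prodr_ge0.
    by rewrite -npow_nat -npowD //; apply: ler_npow => //; rewrite natrB //; lra.
  apply: le_trans (le_normc_sum _ _ _) _.
  rewrite (bigID (fun c : 'I_Q => major k tau2 X (c%:R / Q%:R : R))) /= addrC.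
  have := H2 M X Ps sPs XPs PsX' (conj QX Qb); rewrite -/Q -gsum => h.
  have major_le : \sum_(c < Q | major k tau2 X (c%:R / Q%:R : R)) nm (generating k N Ps (c%:R / Q%:R)) <= 9 * (Q%:R * Ue).
    apply: (@le_trans _ _ (\sum_(c < Q | major k tau2 X (c%:R / Q%:R : R)) U Ps * 1)).
      by apply: ler_sum => z _; rewrite mulr1; exact: normc_generating_le.
    rewrite -mulr_sumr.
    have tk : tau2 <= k%:R by lra.
    apply: le_trans (ler_wpM2l (ltW U0) (major_card k_gt1 (ltW tau20) tk X0 XkQ)) _.
    rewrite [leLHS](_ : _ = 9 * (Q%:R * (U Ps * X%:R `^ (2 * tau2 - k%:R)))); last by ring.
    apply: ler_wpM2l => //; apply: ler_wpM2l; first exact: ltW.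
    apply: le_trans (Ule d3 dd3).
    have powU (x y : R) : U Ps `^ (x + y) = U Ps `^ x * U Ps `^ y.
      by rewrite powRD //; apply/implyP => _; rewrite gt_eqF.
    have -> : 1 - k%:R / s%:R - d3 = 1 + - (k%:R / s%:R + d3) by ring.
    rewrite powU powRr1 ?(ltW U0) //; apply: ler_wpM2l; first exact: ltW.
    rewrite -[2 * tau2 - _]opprB !powRN lef_pV2 ?posrE ?powR_gt0 ?ltr0n //.
    apply: (@le_trans _ _ ((X%:R `^ (s%:R - 2^-1)) `^ (k%:R / s%:R + d3))).
      by apply: ge0_ler_powR; rewrite ?nnegrE ?powR_ge0 ?(ltW U0) // addr_ge0 // ltW.
    rewrite -powRrM; apply: ler_npow => //.
    have e1 : s%:R * (k%:R / s%:R) = k%:R :> R by rewrite mulrC divfK // gt_eqF.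
    have e2 : s%:R * d3 = k%:R / s%:R / 4 by rewrite /d3; field; rewrite gt_eqF.
    have -> : (s%:R - 2^-1) * (k%:R / s%:R + d3) = s%:R * (k%:R / s%:R) + s%:R * d3 - (k%:R / s%:R) / 2 - d3 / 2 by field; rewrite gt_eqF.
    by rewrite e1 e2 /tau2; lra.
  apply: le_trans (lerD h major_le) _.
  have fin : c * (Q%:R * Ue) <= Q%:R * (c * (U Ps / N%:R + Ue)).
    by rewrite [leRHS]mulrCA; apply: ler_wpM2l => //; apply: ler_wpM2l; [exact: ltW | rewrite lerDr].
  apply: le_trans _ fin.
  apply: (@le_trans _ _ ((c2 + 9) * (Q%:R * Ue))); last by apply: ler_wpM2r; [rewrite mulr_ge0 // ltW | case: cc => _ [_ []]].
  rewrite [leRHS]mulrDl lerD2r -mulrA; apply: ler_wpM2l => //; apply: ler_wpM2l; [exact: ltW | exact: Ule].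
move=> N Ps N0 sPs Ps0.
have exn : exists n, (n ^ k <= N)%N by exists 0%N; rewrite exp0n.
have bnd n : (n ^ k <= N)%N -> (n <= N)%N.
  by move=> h; apply: leq_trans h; case: n => // n; rewrite -{1}(expn1 n.+1) leq_pexp2l.
case: (ex_maxnP exn bnd) => n0 n0N n0max.
have n00 : (0 < n0)%N by apply: n0max; rewrite exp1n.
pose Ps' := map (minn n0) Ps.
have n0lt x : (n0 < x)%N -> (N < x ^ k)%N by move=> h; rewrite ltnNge; apply/negP => /n0max; rewrite leqNgt h.
have cle : (count_mem N (power_sums k Ps))%:R <= (count_mem N (power_sums k Ps'))%:R :> R.
  rewrite !count_mem_sum; apply: (power_sums_truncate _ n0lt) => [v|v vN]; first exact: ler0n.
  by rewrite gtn_eqF.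
apply: le_trans cle _; apply: le_trans (core N Ps' N0 _ _ _) _.
- by rewrite size_map.
- by move=> _ /mapP[P PPs ->]; rewrite leq_min n00 Ps0.
- by move=> _ /mapP[P PPs ->]; apply: leq_trans n0N; rewrite leq_exp2r // geq_minl.
have UU : U Ps' <= U Ps.
  rewrite /Ps' big_map; elim: (Ps) => [|P Qs IH]; first by rewrite !big_nil.
  by rewrite !big_cons; apply: ler_pM => //; rewrite ?prodr_ge0 // ler_nat geq_minr.
apply: ler_wpM2l => //; apply: lerD; first by apply: ler_wpM2r; rewrite // invr_ge0.
apply: ge0_ler_powR; rewrite ?nnegrE ?prodr_ge0 //; lra.
Qed.

End CountBound.

(** * Choice of the parameters and passage to the standard real numbers *)

Import Rstruct Rstruct_topology.
Local Open Scope ring_scope.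

Lemma Nat_powE m n : PeanoNat.Nat.pow m n = (m ^ n)%N.
Proof. by elim: n => [|n IH] //=; rewrite expnS IH. Qed.

Lemma Nat_lebE m n : PeanoNat.Nat.leb m n = (m <= n)%N.
Proof. by apply/idP/idP => [/PeanoNat.Nat.leb_le/ssrnat.leP | /ssrnat.leP/PeanoNat.Nat.leb_le]. Qed.

Lemma Nat_eqbE m n : PeanoNat.Nat.eqb m n = (m == n).
Proof. by apply/idP/eqP => /PeanoNat.Nat.eqb_eq. Qed.

Lemma Nat_sqrt_itv n : (PeanoNat.Nat.sqrt n * PeanoNat.Nat.sqrt n <= n < (PeanoNat.Nat.sqrt n).+1 * (PeanoNat.Nat.sqrt n).+1)%N.
Proof.
by have [h1 h2] := PeanoNat.Nat.sqrt_spec n (PeanoNat.Nat.le_0_l n); apply/andP; split; apply/ssrnat.leP.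
Qed.

Lemma root_countE k Ps N : Defs.root_count k Ps N = count_mem N (power_sums k Ps).
Proof.
elim: Ps N => [|P Ps IH] N; first by rewrite /= Nat_eqbE eq_sym addn0; case: eqP.
rewrite [power_sums _ _]/= count_flatten -map_comp.
rewrite [LHS](_ : _ = sumn [seq (if PeanoNat.Nat.leb (PeanoNat.Nat.pow x k) N then
  Defs.root_count k Ps (N - PeanoNat.Nat.pow x k) else 0)%N | x <- iota 1 P]) //.
congr sumn; apply: eq_map => x; rewrite Nat_powE Nat_lebE IH /= count_map.
have [xN|Nx] := leqP (x ^ k) N.
  by apply: eq_count => v /=; rewrite -[in RHS](subnKC xN) eqn_add2l.
rewrite (@eq_count _ _ pred0) ?count_pred0 // => v /=.
by rewrite gtn_eqF // (leq_trans Nx) // leq_addr.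
Qed.

Lemma prodPE (R : realType) Ps : (Defs.prodP Ps)%:R = \prod_(P <- Ps) P%:R :> R.
Proof. by elim: Ps => [|P Ps IH]; rewrite ?big_nil // big_cons -IH -natrM. Qed.

(* With [D = k + 1 - r], the interpolation needs [s > k^2 - k - 3 + D + (2k+2)/D], which is optimized at [D] close to [sqrt (2k+2)]. *)
Lemma s_bound_parameters k s : (1 < k)%N -> (Defs.s_bound k <= s)%N -> exists2 r, (0 < r <= k)%N &
  [/\ ((k.+1 - r) * (2 * tri k) < (k.+1 - r) * s + (2 * tri k - 2 * tri r))%N,
      (4 * tri k < 3 * s)%N & (2 * k < s)%N].
Proof.
move=> k1; have /andP[] := Nat_sqrt_itv (2 * k + 2).
rewrite /Defs.s_bound /Defs.theta !Nat_lebE; move: (PeanoNat.Nat.sqrt _) => rho h1 h2 hs.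
have tE n : (2 * tri n = n * n.+1)%N by rewrite tri_double mulnC.
have [D [D0 Dk key lin]] : exists D, [/\ (0 < D)%N, (D <= k)%N,
    (D * (k * k) + D * D + 2 * k + 2 < D * s + D * k + 3 * D)%N & (2 * k * k + 2 * k < 3 * s)%N].
  have [k4|k5] := leqP k 4.
    rewrite k4 Nat_powE in hs.
    have : [|| k == 2, k == 3 | k == 4] by lia.
    case/or3P => /eqP kE; subst k; [exists 2|exists 3|exists 3]; split=> //; move: hs => /=; lia.
  rewrite (leqNgt k) k5 /= in hs.
  (* The function D + (2k+2)/D is smaller at rho than at rho + 1, or equal, exactly when 2k + 2 <=
     rho (rho + 1); this is the case distinction of [theta]. *)
  have [le|lt] := leqP (2 * k + 2) (rho * rho + rho); [exists rho|exists rho.+1]; split=> //.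
  - clear -h2 k5; nia.
  - clear -h1 k5; nia.
  - move: hs; rewrite le => hs; clear -hs h2 k5; nia.
  - move: hs; rewrite le => hs; clear -hs h2 k5; nia.
  - clear -h1 k5; nia.
  - move: hs; rewrite (leqNgt (2 * k + 2)) lt /= => hs; clear -hs h2 k5; nia.
  - move: hs; rewrite (leqNgt (2 * k + 2)) lt /= => hs; clear -hs h2 k5; nia.
exists (k.+1 - D)%N; first by clear -D0 Dk; lia.
have -> : (4 * tri k = 2 * (k * k.+1))%N by rewrite -tE mulnA.
rewrite !tE subKn ?(leqW Dk) //; split.
- have [r rE] : exists r, (k = r + D)%N by exists (k - D)%N; rewrite subnK.
  have -> : (k.+1 - D = r.+1)%N by clear -rE D0; lia.
  have -> : (k * k.+1 - r.+1 * r.+2 = (r + D) * (r + D).+1 - r.+1 * r.+2)%N by rewrite rE.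
  have rk : (r.+1 * r.+2 <= k * k.+1)%N by apply: leq_mul; clear -rE D0; lia.
  rewrite -rE; clear -key rk rE; nia.
- clear -lin; lia.
clear -lin k1; nia.
Qed.

Lemma root_count_bound (R : realType) k s : (1 < k)%N -> (Defs.s_bound k <= s)%N ->
  exists2 delta : R, 0 < delta & exists2 c : R, 0 <= c & forall N Ps,
  (0 < N)%N -> size Ps = s -> {in Ps, forall P, (0 < P)%N} ->
  (Defs.root_count k Ps N)%:R <= c * ((\prod_(P <- Ps) P%:R : R) / N%:R + (\prod_(P <- Ps) P%:R : R) `^ (1 - k%:R / s%:R - delta)).
Proof.
move=> k1 hs; have [r r_bnd [hs1 hs2 hs3]] := s_bound_parameters k1 hs.
(* p > k makes the integers up to k units, p > tri k keeps the degrees in the sieve below the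
   modulus, p >= s puts 2 s X^k below it, and p >= 8 serves the recursion on multiples of p and the
   grid of the singular series. *)
have [p hp p_prime] := prime_above (8 + k + tri k + s).
have [p8 kp tp sp] : [/\ (8 <= p)%N, (k < p)%N, (tri k < p)%N & (s <= p)%N] by clear -hp; split; lia.
have saving := fun tau => @minor_power_mean R k k1 p r s p_prime kp tp p8 r_bnd hs1 hs2 tau.
have full := fun eta eps => @full_power_mean R k k1 p r s p_prime kp tp p8 r_bnd hs1 hs2 eta eps.
have [delta d0 [c c0 H]] := count_power_sums_bound k1 p_prime hs3 sp saving full p8.
exists delta => //; exists c => // N Ps N0 sPs Ps0.
by rewrite root_countE; exact: H.
Qed.

Lemma Rpower_powR (x y : Rdefinitions.R) : 0 < x -> Rpower.Rpower x y = x `^ y.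
Proof. by move=> x0; rewrite /Rpower.Rpower RexpE RlnE /powR gt_eqF. Qed.

Section Stdlib_reals.
Import Rdefinitions.
Local Delimit Scope R_scope with coqR.

Lemma root_count_bound_R (k s : nat) : (2 <= k)%coq_nat -> (Defs.s_bound k <= s)%coq_nat ->
  exists delta : Rdefinitions.R, (0 < delta)%coqR /\
  exists C : Rdefinitions.R, (0 < C)%coqR /\
  forall (N : nat) (Ps : list nat),
    (1 <= N)%coq_nat -> length Ps = s -> List.Forall (fun P => (1 <= P)%coq_nat) Ps ->
    (Raxioms.INR (Defs.root_count k Ps N) <=
      C * (Raxioms.INR (Defs.prodP Ps) / Raxioms.INR N
           + Rpower.Rpower (Raxioms.INR (Defs.prodP Ps)) (1 - Raxioms.INR k / Raxioms.INR s - delta)))%coqR.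
Proof.
move=> /ssrnat.leP k1 /ssrnat.leP hs.
have [delta d0 [c c0 H]] := root_count_bound Rdefinitions.R k1 hs.
exists delta; split; first exact/RltP.
(* c may be 0, while a positive constant is required. *)
exists (c + 1); split; first by apply/RltP; rewrite ltr_wpDl.
move=> N Ps /ssrnat.leP N0 sPs /List.Forall_forall Ps0.
have {}Ps0 : {in Ps, forall P, (0 < P)%nat}.
  move=> P PPs; apply/ssrnat.leP; apply: Ps0.
  elim: Ps PPs {sPs} => [//|P' Ps IH]; rewrite inE => /orP[/eqP ->|/IH]; [by left | by right].
have U1 : 1 <= (Defs.prodP Ps)%:R :> Rdefinitions.R by rewrite prodPE; exact: prod_ge1.
apply/RleP; rewrite !INRE Rpower_powR; last exact: lt_le_trans ltr01 U1.
rewrite !RealsE prodPE; apply: le_trans (H N Ps N0 sPs Ps0) _.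
apply: ler_wpM2r; last by rewrite lerDl.
by rewrite addr_ge0 ?powR_ge0 // divr_ge0 // prodr_ge0.
Qed.

End Stdlib_reals.

End Waring.

Theorem theorem1p1 (k s : nat) :
  (2 <= k)%nat -> (s_bound k <= s)%nat ->
  exists delta : R, 0 < delta /\
  exists C : R, 0 < C /\
  forall (N : nat) (Ps : list nat),
    (1 <= N)%nat -> length Ps = s -> Forall (fun P => (1 <= P)%nat) Ps ->
    INR (root_count k Ps N) <=
      C * (INR (prodP Ps) / INR N
           + Rpower (INR (prodP Ps)) (1 - INR k / INR s - delta)).
Proof. exact (@Waring.root_count_bound_R k s). Qed.
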